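(* For $n\ge2$ let $(\tau_1^n,\dots,\tau_{n-1}^n)$ be a uniformly random decreasing factorisation of size $n$, and let $(L^n_{\lfloor nt\rfloor})_{0\le t\le1}$ be its lamination process. Then the convergence $$(L^n_{\lfloor nt\rfloor})_{0\le t\le1}\xrightarrow[n\to\infty]{}(L_t(\mathbb e))_{0\le t\le1}$$ holds in distribution in the space $\mathbb D([0,1],\mathbb L)$ of càdlàg functions from $[0,1]$ to $(\mathbb L,d_H)$ equipped with Skorokhod's J1 topology, where $(L_t(\mathbb e))_{0\le t\le 1}$ is the linear Brownian lamination process.
   Context: Factorisations: a minimal factorisation of size $n\ge2$ is a tuple $(\tau_1,\dots,\tau_{n-1})$ of transpositions of $\{1,\dots,n\}$ with $\tau_{n-1}\circ\dots\circ\tau_1=(1\ 2\ \dots\ n)$ ($\tau_1$ applied first). Writing $\tau_i=(a_i\ b_i)$ with $a_i<b_i$, it is decreasing if $a_1\ge a_2\ge\dots\ge a_{n-1}$. Uniformly random means uniform on the finite set of decreasing factorisations of size $n$. Write $\tau_i^n=(a_i^n\ b_i^n)$ with $a_i^n<b_i^n$. Cords and laminations: let $D=\{z\in\mathbb C:|z|\le1\}$. For $0\le u\le v\le1$ the cord $[[u,v]]$ is the segment $\{s e^{-2i\pi u}+(1-s)e^{-2i\pi v}:s\in[0,1]\}\subset D$. Two cords are non-crossing if they do not intersect in the interior of $D$. A lamination is a non-empty compact subset of $D$ that can be written as a union of (pairwise non-crossing distinct) cords. $\mathbb L$ is the set of laminations, endowed with the Hausdorff distance $d_H(A,B)=\min\{\varepsilon\ge0:A\subset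 B^\varepsilon,\ B\subset A^\varepsilon\}$, where $U^\varepsilon$ is the set of points at distance at most $\varepsilon$ from $U$. Discrete lamination process: $L_k^n:=\bigcup_{i\le k}[[a_i^n/n,\,b_i^n/n]]$ for $1\le k\le n-1$, $L_0^n:=[[0,0]]$ (the single point $1\in\mathbb C$), and $L_n^n:=L_{n-1}^n$. Limit process: for a continuous function $g:[0,1]\to[0,\infty)$ with $g(0)=g(1)=0$ and $g>0$ on $(0,1)$, a cord $[[u,v]]$ (with $u\le v$) is called a cord of $g$ if $g(u)=g(v)=\min_{[u,v]}g$. For $t\in[0,1]$, $L_t(g)$ is the union of all cords $[[u,v]]$ of $g$ with $u\ge1-t$. $\mathbb e$ is the normalised Brownian excursion on $[0,1]$ (standard Brownian motion conditioned to be positive on $(0,1)$ and to return to $0$ at time $1$); $(L_t(\mathbb e))_{0\le t\le1}$ is the linear Brownian lamination process. The J1 topology is induced by the Skorokhod distance $d_S(f,h)=\inf_{\varphi\in\Lambda}\max\{\sup_{[0,1]}|\varphi-\mathrm{Id}|,\ \sup_{[0,1]}d_H(f,h\circ\varphi)\}$, where $\Lambda$ is the set of continuous strictly increasing bijections of $[0,1]$. *)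

(* Defs.v *)
From HB Require Import structures.
From mathcomp Require Import all_boot all_order all_algebra all_fingroup.
From mathcomp Require Import complex.
From mathcomp Require Import all_classical all_reals all_analysis.

Set Implicit Arguments.
Unset Strict Implicit.
Unset Printing Implicit Defensive.

Import Order.TTheory GRing.Theory Num.Theory.
Import numFieldNormedType.Exports.

Local Open Scope classical_set_scope.
Local Open Scope ring_scope.
Local Open Scope complex_scope.

(* The transposition (a b) with a < b is encoded by the pair (a, b), and the
   label j in {1, ..., n} by the element j - 1 of 'I_n.  The product of
   permutations applies its leftmost factor first, so the product below is
   tau_(n-1) o ... o tau_1; the permutation of [ordS_inj] is i |-> i + 1 mod n,
   i.e. the cycle (1 2 ... n). *)
Definition minimal_factorisation (n : nat) :
    pred ((n.-1).-tuple ('I_n * 'I_n)) :=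
  fun tau => all (fun c : 'I_n * 'I_n => (c.1 < c.2)%N) tau &&
    ((\prod_(c <- tau) tperm c.1 c.2)%g == perm (@ordS_inj n)).

Definition decreasing_factorisation (n : nat) :
    pred ((n.-1).-tuple ('I_n * 'I_n)) :=
  fun tau => minimal_factorisation tau &&
    sorted geq [seq nat_of_ord c.1 | c <- tau].

Definition uniform_on (d : measure_display) (T : measurableType d)
    (R : realType) (P : probability T R) (U : finType) (A : pred U)
    (X : T -> U) : Prop :=
  forall x : U, measurable (X @^-1` [set x]) /\
    P (X @^-1` [set x]) = ((A x)%:R / #|A|%:R)%:E.

Section Laminations.
Variable R : realType.
Implicit Types (u v t eps : R) (A B : set R[i]).

Definition unit_disk : set R[i] := [set z | `|z| <= 1].

(* exp (- 2 i pi u) *)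
Definition circle_point u : R[i] := cos (2 * pi * u) -i* sin (2 * pi * u).

Definition cord u v : set R[i] :=
  [set z | exists2 s : R, 0 <= s <= 1 &
     z = s%:C * circle_point u + (1 - s)%:C * circle_point v].

Definition is_cord A : Prop :=
  exists u v, [/\ 0 <= u, u <= v, v <= 1 & A = cord u v].

(* Cords are compared as subsets of the disk: [trivIset] requires any two
   cords of the family that are distinct as sets not to meet in the interior. *)
Definition is_lamination A : Prop :=
  [/\ A !=set0, compact (A : set (R[i])^o), A `<=` unit_disk &
      exists C : set (set R[i]),
        [/\ forall c, C c -> is_cord c,
            trivIset C (fun c => c `&` (unit_disk : set (R[i])^o)°) &
            A = \bigcup_(c in C) c]].

Definition thickening eps A : set R[i] :=
  [set z | exists2 w, A w & `|z - w| <= eps%:C].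

Definition hausdorff_dist A B : R :=
  inf [set eps | [/\ 0 <= eps, A `<=` thickening eps B &
                     B `<=` thickening eps A]].

(* Paths indexed by [0, 1] are encoded as functions on R whose values outside
   [0, 1] are ignored. *)
Definition is_cadlag (f : R -> set R[i]) : Prop :=
  [/\ forall t, 0 <= t <= 1 -> is_lamination (f t),
      forall t, 0 <= t < 1 -> hausdorff_dist (f s) (f t) @[s --> t^'+] --> 0 &
      forall t, 0 < t <= 1 -> exists2 A, is_lamination A &
        hausdorff_dist (f s) A @[s --> t^'-] --> 0].

Definition time_change (phi : R -> R) : Prop :=
  [/\ {within `[0, 1], continuous phi},
      {in `[0, 1] &, {homo phi : s t / s < t}} &
      set_bij `[0, 1] `[0, 1] phi].

Definition skorokhod_dist (f h : R -> set R[i]) : R :=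
  inf [set Num.max
         (sup [set `|phi t - t| | t in `[0, 1]])
         (sup [set hausdorff_dist (f t) (h (phi t)) | t in `[0, 1]])
      | phi in time_change].

Definition factorisation_lamination (n : nat)
    (tau : (n.-1).-tuple ('I_n * 'I_n)) (k : nat) : set R[i] :=
  if k is 0%N then cord 0 0 else
  \bigcup_(i in [set i : 'I_n.-1 | (i < k)%N])
    cord ((tnth tau i).1.+1%:R / n%:R) ((tnth tau i).2.+1%:R / n%:R).

Definition factorisation_process (n : nat)
    (tau : (n.-1).-tuple ('I_n * 'I_n)) (t : R) : set R[i] :=
  factorisation_lamination tau (Num.truncn (n%:R * t)).

Definition cord_of (g : R -> R) u v : Prop :=
  [/\ 0 <= u, u <= v, v <= 1, g u = g v & forall s, u <= s <= v -> g u <= g s].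

Definition lamination_of (g : R -> R) (t : R) : set R[i] :=
  \bigcup_(p in [set p : R * R | cord_of g p.1 p.2 /\ 1 - t <= p.1])
    cord p.1 p.2.

End Laminations.

Section ConvergenceInDistribution.
Variables (R : realType) (U : Type) (S : set U) (dist : U -> U -> R).

Definition metric_open (V : set U) : Prop :=
  V `<=` S /\ forall x, V x -> exists2 delta, 0 < delta &
    forall y, S y -> dist x y < delta -> V y.

Definition bounded_continuous (F : U -> R) : Prop :=
  (exists M, forall x, S x -> `|F x| <= M) /\
  forall x, S x -> forall eps, 0 < eps -> exists2 delta, 0 < delta &
    forall y, S y -> dist x y < delta -> `|F x - F y| < eps.

Definition random_element (d : measure_display) (T : measurableType d)
    (X : T -> U) : Prop :=
  (forall w, S (X w)) /\
  forall V, <<s S, metric_open >> V -> measurable (X @^-1` V).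

Definition ae_version (d : measure_display) (T : measurableType d)
    (P : probability T R) (X Y : T -> U) : Prop :=
  random_element Y /\ {ae P, forall w, X w = Y w}.

(* X_ n and X are only required to be almost surely equal to random elements
   of S; this includes that they take their values in S almost surely. *)
Definition cvg_in_distribution
    (d_ : nat -> measure_display) (T_ : forall n, measurableType (d_ n))
    (P_ : forall n, probability (T_ n) R) (X_ : forall n, T_ n -> U)
    (d : measure_display) (T : measurableType d)
    (P : probability T R) (X : T -> U) : Prop :=
  exists (Y_ : forall n, T_ n -> U) (Y : T -> U),
    [/\ forall n, ae_version (P_ n) (X_ n) (Y_ n), ae_version P X Y &
        forall F, bounded_continuous F ->
          ('E_(P_ n)[F \o Y_ n] @[n --> \oo] --> 'E_P[F \o Y])%E].

End ConvergenceInDistribution.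

Section BrownianExcursion.
Variable R : realType.

(* Independent centred Gaussian increments: the product formula gives both the
   independence and the law of the increments ([normal_prob] takes the mean and
   the standard deviation). *)
Definition standard_brownian_motion (d : measure_display)
    (T : measurableType d) (P : probability T R) (W : T -> R -> R) : Prop :=
  [/\ forall t, 0 <= t -> measurable_fun setT (W ^~ t),
      forall w, W w 0 = 0,
      forall w, {within `[0, +oo[, continuous (W w)} &
      forall (k : nat) (t : nat -> R) (A : nat -> set R),
        0 <= t 0%N -> (forall i, (i < k)%N -> t i < t i.+1) ->
        (forall i, measurable (A i)) ->
        P (\bigcap_(i in [set i | (i < k)%N])
             [set w | A i (W w (t i.+1) - W w (t i))]) =
        (\prod_(i < k)
           fine (normal_prob 0 (Num.sqrt (t i.+1 - t i)) (A i)))%:E].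

Definition continuous_path : set (R -> R) :=
  [set g : R -> R | {within `[0, 1], continuous g}].

Definition uniform_dist (g h : R -> R) : R :=
  sup [set `|g t - h t| | t in `[0, 1]].

Definition excursion_path : set (R -> R) :=
  [set g : R -> R | [/\ continuous_path g, g 0 = 0, g 1 = 0 &
               forall t, 0 < t < 1 -> 0 < g t]].

(* "Standard Brownian motion conditioned to be positive on (0, 1) and to return
   to 0 at time 1": the conditioning event being null, the law of e is the weak
   limit on C([0, 1]), as eps -> 0+, of the law of W given that W > - eps on
   (0, 1) and |W_1| < eps (Durrett, Iglehart and Miller, 1977). *)
Definition brownian_excursion (d : measure_display)
    (T : measurableType d) (P : probability T R) (e : T -> R -> R) : Prop :=
  [/\ forall w, excursion_path (e w),
      forall t, 0 <= t <= 1 -> measurable_fun setT (e ^~ t) &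
      exists (d' : measure_display) (T' : measurableType d')
        (Q : probability T' R) (W : T' -> R -> R),
        standard_brownian_motion Q W /\
        let A (eps : R) := [set w | (forall t, 0 < t < 1 -> - eps < W w t) /\
                                    `|W w 1| < eps] in
        forall F, bounded_continuous continuous_path uniform_dist F ->
          (\int[Q]_(w in A eps) F (W w)) / fine (Q (A eps)) @[eps --> 0^'+]
            --> fine ('E_P[F \o e])%E].

End BrownianExcursion.

(* Main.v *)
(** Reading a Dyck word of length 2N from right to left with a stack of labels
    gives a bijection with the decreasing factorisations of size N + 1: the
    transposition emitted at an up step joins the labels of the two ends of the
    first-return excursion above that step, and its rank is the number of up
    steps after it.  The discrete process is thus built from a uniform Dyck path
    in the way L(e) is built from e, up to a small error.

    The Brownian excursion e is only known as a limit of conditioned Brownian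
    motions.  By Donsker's theorem these are limits of conditioned walks, which
    stochastically dominate, and after cutting off two short ends are dominated
    by, the Dyck path; hence E F(Dyck) -> E F(e) for increasing Lipschitz F.  Sums
    and products of increasing functionals approximate from below every Lipschitz
    G >= 0 on continuous paths, so that liminf E G(Dyck) >= E G(e) without any
    tightness argument.

    The map g |-> L(g) is continuous for J1 at every excursion path g whose local
    minima have distinct values: the laminations jump only when a cord [u, v] with
    an interior minimum of the same height appears, and distinct minima make the
    times of such jumps match.  Counting the Dyck words with two almost equal
    minima shows that e has this property almost surely. *)

Require Import Defs.
From HB Require Import structures.
From mathcomp Require Import all_boot all_order all_algebra all_fingroup.
From mathcomp Require Import complex.
From mathcomp Require Import all_classical all_reals all_analysis.
From mathcomp Require Import measurable_realfun.
From mathcomp Require Import zify ring lra.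

Set Implicit Arguments.
Unset Strict Implicit.
Unset Printing Implicit Defensive.

Import Order.TTheory GRing.Theory Num.Theory.
Import numFieldNormedType.Exports.

Local Open Scope classical_set_scope.
Local Open Scope ring_scope.

(** Among all words of length [2N] the Dyck words have mass of order [N^(-3/2)], so a central limit
    theorem with additive errors says nothing about them. This is why the transfer uses stochastic
    domination, an inequality between ratios, and why estimates on Dyck words carry the mass of the
    Dyck words as a factor. The conditioning of the walk, by contrast, takes place at a fixed level
    [r > 0] and has a positive limiting probability. Only lower bounds on limits are proved for the
    Dyck path; applied to a functional and to its negative, both rescaled, they give convergence.
    The lamination depends continuously on the path at good paths only, so the lower bound is
    applied to a Lipschitz minorant built from the discrete laminations themselves. The predicate
    [adapted] isolates what is used of a timed family of cords: one matching argument then serves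
    both for the continuity of [lamination_of] and for the closeness of the discrete process to the
    continuous one. *)

Ltac drop_irrelevant := repeat match goal with
  | H : forall _, _ |- _ => clear H
  | H : is_true (leq _ _) |- _ => clear H
  | H : @eq nat _ _ |- _ => clear H
  | x := _ |- _ => clearbody x
  end.
Ltac rlra := first [drop_irrelevant; lra | lra].

(** * Words and walks *)

Section Words.

Fixpoint words (l : nat) : seq (seq bool) :=
  if l is k.+1 then map (cons true) (words k) ++ map (cons false) (words k)
  else [:: [::]].

Definition step (b : bool) : int := if b then 1 else -1.

Fixpoint height (w : seq bool) : int :=
  if w is b :: v then step b + height v else 0.

Lemma heightE w : height w = (count id w)%:Z - (count negb w)%:Z.
Proof. by elim: w => // b w /= ->; rewrite /step; case: b => /=; lia. Qed.

Lemma height_nil : height [::] = 0.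
Proof. by []. Qed.

Lemma height_cat v w : height (v ++ w) = height v + height w.
Proof. by rewrite !heightE !count_cat; lia. Qed.

Lemma size_words l w : (w \in words l) = (size w == l).
Proof.
elim: l w => [|l IHl] [|b w] //=; rewrite mem_cat.
  by apply/negbTE/negP => /orP[]/mapP[].
rewrite eqSS -IHl; apply/orP/idP => [[]/mapP[v vl [_ ->]]//|wl].
by case: b; [left|right]; exact: map_f.
Qed.

Lemma size_size_words l : size (words l) = (2 ^ l)%N.
Proof. by elim: l => //= l IHl; rewrite size_cat !size_map IHl expnS; lia. Qed.

Lemma uniq_words l : uniq (words l).
Proof.
elim: l => //= l IHl; rewrite cat_uniq !map_inj_uniq ?IHl ?andbT//=;
  try by move=> x y [].
by apply/hasPn => _ /mapP[v _ ->]; apply/negP => /mapP[].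
Qed.

Lemma height_bound w : `|height w| <= (size w)%:Z.
Proof. by rewrite heightE -(count_predC id w); have := @eq_count _ negb (predC id) (fun=> erefl) w; lia. Qed.

Definition nonneg_from (x : int) (w : seq bool) : bool :=
  all (fun j => 0 <= x + height (take j w)) (iota 0 (size w).+1).

(** Beyond the end of the word [take] returns the whole word, so [j] needs no bound. *)
Lemma nonneg_fromP (x : int) (w : seq bool) :
  reflect (forall j, 0 <= x + height (take j w)) (nonneg_from x w).
Proof.
apply: (iffP allP) => [h j|h j _]; last exact: h.
have [jw|jw] := leqP j (size w); first by apply: h; rewrite mem_iota; lia.
by have := h (size w); rewrite take_size take_oversize ?(ltnW jw)//;
  apply; rewrite mem_iota; lia.
Qed.

Lemma nonneg_from_nil x : nonneg_from x [::] = (0 <= x).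
Proof. by rewrite /nonneg_from /= andbT addr0. Qed.

Lemma nonneg_from_cons x b w :
  nonneg_from x (b :: w) = (0 <= x) && nonneg_from (x + step b) w.
Proof.
apply/nonneg_fromP/andP => [h|[x0 /nonneg_fromP h] [|j]] /=.
- split; first by have := h 0%N; rewrite addr0.
  by apply/nonneg_fromP => j; have := h j.+1; rewrite /= addrA.
- by rewrite addr0.
- by rewrite addrA.
Qed.

Lemma nonneg_from_cat x v w :
  nonneg_from x (v ++ w) = nonneg_from x v && nonneg_from (x + height v) w.
Proof.
elim: v x => [|b v IHv] x /=.
  rewrite addr0 nonneg_from_nil; case: w => [|b w].
    by rewrite nonneg_from_nil andbb.
  by rewrite nonneg_from_cons andbA andbb.
by rewrite !nonneg_from_cons IHv -andbA addrA.
Qed.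

Lemma nonneg_from_ge0 x w : nonneg_from x w -> 0 <= x.
Proof. by move/nonneg_fromP/(_ 0%N); rewrite take0 addr0. Qed.

Lemma nonneg_from_end x w : nonneg_from x w -> 0 <= x + height w.
Proof. by move/nonneg_fromP/(_ (size w)); rewrite take_size. Qed.

End Words.

(** * Expectations for the simple random walk and moments of the height *)

Section SumWords.
Variable R : realType.
Implicit Types (F G : seq bool -> R).

(** The expectation for [l] fair steps, as a finite sum over a list: independence of consecutive
    pieces is then the identity [mean_cat]. *)
Definition mean l F : R := (\sum_(w <- words l) F w) / 2 ^+ l.

Lemma sum_wordsS l F : \sum_(w <- words l.+1) F w =
  \sum_(w <- words l) F (true :: w) + \sum_(w <- words l) F (false :: w).
Proof. by rewrite big_cat !big_map. Qed.

Lemma sum_words_cat k l F : \sum_(w <- words (k + l)) F w =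
  \sum_(v <- words k) \sum_(w <- words l) F (v ++ w).
Proof.
elim: k F => [|k IHk] F; first by rewrite big_seq1.
by rewrite addSn !sum_wordsS !IHk.
Qed.

Lemma mean_cat k l F : mean (k + l) F = mean k (fun v => mean l (fun w => F (v ++ w))).
Proof.
by rewrite /mean sum_words_cat exprD -mulr_suml invfM [_^-1 * _]mulrC mulrA.
Qed.

Lemma eq_mean l F G : (forall w, size w = l -> F w = G w) -> mean l F = mean l G.
Proof.
by move=> FG; rewrite /mean; congr (_ / _); apply: eq_big_seq => w; rewrite size_words => /eqP/FG.
Qed.

Lemma le_mean l F G : (forall w, size w = l -> F w <= G w) -> mean l F <= mean l G.
Proof.
move=> FG; rewrite /mean ler_wpM2r ?invr_ge0 ?exprn_ge0//.
rewrite big_seq [leRHS]big_seq; apply: ler_sum => w.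
by rewrite size_words => /eqP/FG.
Qed.

Lemma meanD l F G : mean l (fun w => F w + G w) = mean l F + mean l G.
Proof. by rewrite /mean big_split mulrDl. Qed.

Lemma meanZ l c F : mean l (fun w => c * F w) = c * mean l F.
Proof. by rewrite /mean -mulr_sumr mulrA. Qed.

Lemma mean_cst l c : mean l (fun=> c) = c.
Proof.
rewrite /mean big_const_seq count_predT size_size_words iter_addr_0.
by rewrite -(mulr_natr c) natrX mulfK// expf_neq0.
Qed.

Lemma mean_sum l (I : Type) (r : seq I) (P : pred I) (F : I -> seq bool -> R) :
  mean l (fun w => \sum_(i <- r | P i) F i w) = \sum_(i <- r | P i) mean l (F i).
Proof. by rewrite /mean exchange_big mulr_suml. Qed.

Lemma mean_ge0 l F : (forall w, size w = l -> 0 <= F w) -> 0 <= mean l F.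
Proof. by move=> F0; rewrite -(mean_cst l 0); exact: le_mean. Qed.

Lemma meanS l F : mean l.+1 F =
  (mean l (F \o cons true) + mean l (F \o cons false)) / 2.
Proof. by rewrite /mean sum_wordsS exprS invfM /comp -mulrDl [2^-1 * _]mulrC mulrA. Qed.

Lemma mean_height2 l : mean l (fun w => (height w)%:~R ^+ 2) = l%:R.
Proof.
elim: l => [|l IHl]; first by rewrite /mean big_seq1 height_nil expr0 divr1 expr0n.
rewrite meanS -meanD.
rewrite (eq_mean (G := fun w => 2 * (height w)%:~R ^+ 2 + 2)) => [|w _ /=].
  by rewrite meanD meanZ mean_cst IHl -natr1; field.
by rewrite !intrD /step /=; ring.
Qed.

Lemma mean_height4 l : mean l (fun w => (height w)%:~R ^+ 4) <= 3 * l%:R ^+ 2.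
Proof.
(* The induction on the first step closes on the exact fourth moment, not on the bound. *)
suff -> : mean l (fun w => (height w)%:~R ^+ 4) = 3 * l%:R ^+ 2 - 2 * l%:R.
  by rewrite lerBlDr lerDl mulr_ge0.
elim: l => [|l IHl]; first by rewrite /mean big_seq1 expr0 divr1; ring.
rewrite meanS -meanD.
rewrite (eq_mean (G := fun w => 2 * (height w)%:~R ^+ 4 +
  (12 * (height w)%:~R ^+ 2 + 2))) => [|w _ /=].
  by rewrite !meanD !meanZ mean_cst IHl mean_height2 -natr1; field.
by rewrite !intrD /step /=; ring.
Qed.

End SumWords.

(** * Reflection principle, ballot estimates and the mass of Dyck words *)

Section Reflection.
Variable R : realType.

Definition flip := map negb.

Lemma height_flip w : height (flip w) = - height w.
Proof. by elim: w => //= b w ->; rewrite /step; case: b => /=; lia. Qed.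

Lemma mean_flip l (F : seq bool -> R) : mean l (F \o flip) = mean l F.
Proof.
elim: l F => [|l IHl] F; first by rewrite /mean !big_seq1.
by rewrite !meanS addrC -(IHl (F \o cons true)) -(IHl (F \o cons false)).
Qed.

Definition local_prob l (d : int) : R := mean l (fun w => (height w == d)%:R).

Lemma local_prob_ge0 l d : 0 <= local_prob l d.
Proof. by apply: mean_ge0. Qed.

Lemma local_prob0 d : local_prob 0 d = (d == 0)%:R.
Proof. by rewrite /local_prob /mean big_seq1 divr1 eq_sym. Qed.

Lemma local_probS l d :
  local_prob l.+1 d = (local_prob l (d - 1) + local_prob l (d + 1)) / 2.
Proof.
rewrite /local_prob meanS; congr ((_ + _) / _); apply: eq_mean => w _ /=;
  by congr ((nat_of_bool _)%:R); rewrite /step; lia.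
Qed.

Lemma local_probN l d : local_prob l (- d) = local_prob l d.
Proof.
rewrite /local_prob -mean_flip; apply: eq_mean => w _ /=.
by rewrite height_flip eqr_opp.
Qed.

(** The ratio of consecutive binomial coefficients in the height coordinate. Cleared of denominators
    it also covers vanishing probabilities; the local estimates below all come from it. *)
Lemma local_prob_ratio l (d : int) :
  (l%:R + d%:~R + 2) * local_prob l (d + 2) = (l%:R - d%:~R) * local_prob l d.
Proof.
elim: l d => [|l IHl] d.
  rewrite !local_prob0; have [d2|d2] := eqVneq (d + 2) 0.
    have -> : d = - 2 by lia.
    by rewrite (_ : (-2 == 0 :> int) = false)//=; ring.
  by have [->|d0] := eqVneq d 0; rewrite /= ?mulr0 ?mulr0z; ring.
rewrite !local_probS -natr1.
have := IHl (d - 1); have := IHl (d + 1).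
rewrite (_ : d + 1 + 2 = d + 2 + 1); last by lia.
rewrite (_ : d - 1 + 2 = d + 1); last by lia.
rewrite (_ : d + 2 - 1 = d + 1); last by lia.
rewrite !intrD mulrN1z /= => h1 h2.
move: (local_prob _ _) (local_prob _ _) (local_prob _ _) h1 h2 => a b c h1 h2.
lra.
Qed.

Lemma local_prob_decr l (d : int) : -1 <= d -> local_prob l (d + 2) <= local_prob l d.
Proof.
move=> d1; have d1' : -1 <= d%:~R :> R by rewrite -(ler_int R) in d1.
have l0 : 0 <= l%:R :> R by [].
have := local_prob_ratio l d; have := local_prob_ge0 l d.
move: (local_prob l d) (local_prob l (d + 2)) => a b a0 h.
rewrite -subr_le0 -(@pmulr_rle0 _ (l%:R + d%:~R + 2)); last by lra.
have -> : (l%:R + d%:~R + 2) * (b - a) = - ((2 * d%:~R + 2) * a) by lra.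
by rewrite oppr_le0 mulr_ge0//; lra.
Qed.

Lemma central_probS n : local_prob (n.+1).*2 0 =
  local_prob n.*2 0 * ((2 * n%:R + 1) / (2 * n%:R + 2)) :> R.
Proof.
have n0 : 0 <= n%:R :> R by [].
rewrite doubleS !local_probS.
have [-> -> -> ->] : [/\ 0 - 1 - 1 = - 2 :> int, 0 - 1 + 1 = 0 :> int,
  0 + 1 - 1 = 0 :> int & 0 + 1 + 1 = 2 :> int] by split; lia.
have -> : local_prob n.*2 (-2) = local_prob n.*2 2 by rewrite -local_probN.
have := local_prob_ratio n.*2 0; rewrite add0r -muln2 natrM.
move: (local_prob _ 2) (local_prob _ 0) => a b; rewrite mulr0z => h.
have -> : a = b * (n%:R * 2) / (n%:R * 2 + 2).
  by apply: (@mulIf _ (n%:R * 2 + 2)); [lra|rewrite divfK; lra].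
by field; lra.
Qed.

Lemma central_prob_gt0 n : 0 < local_prob n.*2 0 :> R.
Proof.
elim: n => [|n IHn]; first by rewrite local_prob0.
by rewrite central_probS mulr_gt0// divr_gt0// ltr_wpDl// mulr_ge0.
Qed.

(** The left side is nonincreasing in [n] because [(2n + 1)(2n + 3) <= (2n + 2)^2], and it equals 1
    at [n = 0]: a Wallis bound in place of Stirling's formula. *)
Lemma central_prob_ub n : (local_prob n.*2 0 : R) ^+ 2 * (2 * n%:R + 1) <= 1.
Proof.
elim: n => [|n IHn]; first by rewrite local_prob0 /=; lra.
rewrite central_probS; apply: le_trans IHn.
have n0 : 0 <= n%:R :> R by [].
move: (local_prob _ _) => p.
rewrite exprMn -mulrA ler_wpM2l ?sqr_ge0// -natr1 expr_div_n mulrAC.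
by rewrite ler_pdivrMr; nra.
Qed.

(** The right side is nondecreasing because [(2n + 1)^2 >= 4n(n + 1)], and it equals 1 at
    [n = 1]. *)
Lemma central_prob_lb n : (0 < n)%N -> 1 <= (local_prob n.*2 0 : R) ^+ 2 * (4 * n%:R).
Proof.
elim: n => // -[_ _|n /(_ isT) IHn _].
  by rewrite central_probS local_prob0 /= mul1r mulr0 !add0r mulr1 expr_div_n expr1n; lra.
rewrite central_probS; apply: le_trans IHn _.
have n0 : 0 <= n.+1%:R :> R by [].
move: (local_prob _ _) => p.
rewrite exprMn -(mulrA (p ^+ 2)) ler_wpM2l ?sqr_ge0// -[n.+2%:R]natr1 expr_div_n mulrAC.
by rewrite ler_pdivlMr; nra.
Qed.

Lemma local_prob_odd n (k : int) : local_prob n.*2 (k * 2 + 1) = 0 :> R.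
Proof.
rewrite /local_prob -[RHS](mean_cst n.*2 0); apply: eq_mean => w sw.
have := heightE w; have := count_predC id w.
have := @eq_count _ negb (predC id) (fun=> erefl) w => h0 h1 h2.
by rewrite (_ : _ == _ = false)//; apply/eqP; lia.
Qed.

Lemma local_prob_even_ub n d : local_prob n.*2 d <= local_prob n.*2 0 :> R.
Proof.
wlog d0 : d / 0 <= d => [hw|].
  have [/hw//|/ltW d0] := leP 0 d.
  by rewrite -local_probN; apply: hw; rewrite oppr_ge0.
case: d d0 => // d _.
have [k dk] : exists k, d = k.*2 \/ d = k.*2.+1.
  by exists (d./2); have := odd_double_half d; case: odd; lia.
case: dk => ->.
  elim: k => [//|k IHk]; apply: le_trans IHk.
  rewrite (_ : (k.+1.*2)%:Z = (k.*2)%:Z + 2); last by lia.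
  by apply: local_prob_decr; lia.
rewrite (_ : (k.*2.+1)%:Z = k%:Z * 2 + 1); last by lia.
by rewrite local_prob_odd ltW// central_prob_gt0.
Qed.

Lemma local_prob_ub l d : local_prob l d ^+ 2 * l%:R <= 1 :> R.
Proof.
have [n ln] : exists n, l = n.*2 \/ l = n.*2.+1.
  by exists (l./2); have := odd_double_half l; case: odd; lia.
have n0 : 0 <= n%:R :> R by [].
have := central_prob_ub n => h.
have : local_prob l d <= local_prob n.*2 0 :> R.
  case: ln => ->; first exact: local_prob_even_ub.
  rewrite local_probS ler_pdivrMr// mulr_natr mulr2n.
  by apply: lerD; exact: local_prob_even_ub.
have := local_prob_ge0 l d; have := central_prob_gt0 n.
move: (local_prob _ _) (local_prob _ _) h => a b h a0 b0 ba.
have ba2 : a ^+ 2 <= b ^+ 2 by nra.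
have : l%:R <= 2 * n%:R + 1 :> R.
  by case: ln => ->; rewrite -?natr1 -muln2 natrM; lra.
by move=> ?; apply: le_trans h; nra.
Qed.

Lemma sqr_le_local_prob_ub (s : R) l d : 0 < s -> s ^+ 2 = l%:R -> local_prob l d <= s^-1.
Proof.
move=> s0 sl; have := local_prob_ub l d; rewrite -sl.
have := local_prob_ge0 l d; move: (local_prob _ _) => p p0 h.
rewrite -[leRHS]mul1r ler_pdivlMr//.
have : (p * s) ^+ 2 <= 1 by rewrite exprMn.
by rewrite expr_le1// mulr_ge0// ltW.
Qed.

Definition ballot_prob l (x y : int) : R :=
  mean l (fun w => (nonneg_from x w && (x + height w == y))%:R).

Lemma ballot_probE l (x y : int) : -1 <= x -> 0 <= y ->
  ballot_prob l x y = local_prob l (y - x) - local_prob l (y + x + 2).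
Proof.
move=> + y0; elim: l x => [|l IHl] x x1.
  rewrite /ballot_prob !local_prob0 /mean big_seq1 nonneg_from_nil addr0 divr1 subr_eq0.
  rewrite (_ : (y + x + 2 == 0) = false); last by apply/eqP; lia.
  by rewrite subr0 [y == x]eq_sym; have [->|] := eqVneq x y; rewrite ?y0 ?andbF//.
have [x0|x0] := leP 0 x; last first.
  have -> : x = -1 by lia.
  have [-> ->] : y - -1 = y + 1 /\ y - 1 + 2 = y + 1 by split; lia.
  rewrite subrr /ballot_prob -[RHS](mean_cst l.+1 0); apply: eq_mean => -[|b w]// _; rewrite nonneg_from_cons.
have -> : ballot_prob l.+1 x y = (ballot_prob l (x + 1) y + ballot_prob l (x - 1) y) / 2.
  rewrite /ballot_prob meanS; congr ((_ + _) / _); apply: eq_mean => w _ /=;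
  by rewrite nonneg_from_cons x0 /= /step addrA.
rewrite !IHl; [|lia..].
rewrite !local_probS.
rewrite (_ : y - (x + 1) = y - x - 1); last by lia.
rewrite (_ : y - (x - 1) = y - x + 1); last by lia.
rewrite (_ : y + (x + 1) + 2 = y + x + 2 + 1); last by lia.
rewrite (_ : y + (x - 1) + 2 = y + x + 2 - 1); last by lia.
by field.
Qed.

Lemma ballot_prob_sym l x y : 0 <= x -> 0 <= y -> ballot_prob l x y = ballot_prob l y x.
Proof.
move=> x0 y0; rewrite !ballot_probE; [|lia..].
by rewrite -local_probN opprB [y + x]addrC.
Qed.

(** By reflection the probability is [p - q] with [p], [q] the local probabilities at [x] and
    [x + 2]. The ratio identity turns this into [2 (x + 1) p / (l + x + 2)], and [p <= 1 / s]. *)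
Lemma ballot_prob_ub (s : R) l (x : int) : 0 < s -> s ^+ 2 = l%:R -> 0 <= x ->
  ballot_prob l 0 x <= 2 * (x%:~R + 1) / s ^+ 3.
Proof.
move=> s0 sl x0; have -> : ballot_prob l 0 x = local_prob l x - local_prob l (x + 2).
  by rewrite ballot_probE//; congr (local_prob _ _ - local_prob _ _); lia.
have xR : 0 <= x%:~R :> R by rewrite -(ler_int R) in x0.
have ub := sqr_le_local_prob_ub x s0 sl.
have := local_prob_ratio l x; rewrite -sl.
have := local_prob_ge0 l x.
move: (local_prob l x) (local_prob l (x + 2)) ub => p q ub p0 h.
have s20 : 0 < s ^+ 2 by rewrite exprn_gt0.
have h2 : (p - q) * (s ^+ 2 + x%:~R + 2) = 2 * (x%:~R + 1) * p by lra.
have pq0 : 0 <= p - q.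
  by rewrite -(@pmulr_lge0 _ (s ^+ 2 + x%:~R + 2)) ?h2; [nra|lra].
have h3 : (p - q) * s ^+ 2 <= 2 * (x%:~R + 1) * p by rewrite -h2; nra.
rewrite ler_pdivlMr ?exprn_gt0// exprSr mulrA.
apply: (@le_trans _ _ (2 * (x%:~R + 1) * p * s)); first by rewrite ler_wpM2r// ltW.
rewrite -mulrA ger_pMr; last by lra.
by rewrite -ler_pdivlMr// div1r.
Qed.

(** Summed over the end point, the ballot formula telescopes to a window of heights. The identity is
    proved directly by induction on the first step, with [x = -1], where the window is empty, as
    boundary value. *)
Lemma mean_nonneg_from l (x : int) : -1 <= x ->
  mean l (fun w => (nonneg_from x w)%:R) =
  mean l (fun w => (- x <= height w <= x + 1)%R%:R) :> R.
Proof.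
elim: l x => [|l IHl] x x1.
  rewrite /mean !big_seq1 nonneg_from_nil /=; congr ((nat_of_bool _)%:R / _); lia.
have [x0|x0] := leP 0 x; last first.
  apply: eq_mean => -[|b w]// _; rewrite nonneg_from_cons.
  by congr ((nat_of_bool _)%:R); lia.
rewrite !meanS.
have -> : mean l ((fun w => (nonneg_from x w)%:R) \o cons true) =
  mean l (fun w => (nonneg_from (x + 1) w)%:R) :> R.
  by apply: eq_mean => w _ /=; rewrite nonneg_from_cons x0.
have -> : mean l ((fun w => (nonneg_from x w)%:R) \o cons false) =
  mean l (fun w => (nonneg_from (x - 1) w)%:R) :> R.
  by apply: eq_mean => w _ /=; rewrite nonneg_from_cons x0.
rewrite !IHl; [|lia..]; congr (_ / _); rewrite -!meanD; apply: eq_mean => w _ /=.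
rewrite -!natrD; congr _%:R; rewrite /step.
case: (boolP (- (x + 1) <= _ <= _)); case: (boolP (- (x - 1) <= _ <= _));
case: (boolP (- x <= 1 + _ <= _)); case: (boolP (- x <= -1 + _ <= _)) => /=; lia.
Qed.

Lemma mean_nonneg_from0_ub (s : R) l : 0 < s -> s ^+ 2 = l%:R ->
  mean l (fun w => (nonneg_from 0 w)%:R) <= 2 / s.
Proof.
move=> s0 sl; rewrite mean_nonneg_from//.
rewrite (eq_mean (G := fun w => (height w == 0)%:R + (height w == 1)%:R)).
  rewrite meanD mulr_natl mulr2n.
  by apply: lerD; exact: sqr_le_local_prob_ub.
move=> w _; rewrite -natrD; congr _%:R.
by case: (eqVneq (height w) 0); case: (eqVneq (height w) 1); lia.
Qed.

Definition stays_within (a : R) (w : seq bool) : bool :=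
  all (fun j => `|(height (take j w))%:~R| <= a) (iota 0 (size w).+1).

Lemma stays_withinP a w :
  reflect (forall j, `|(height (take j w))%:~R| <= a) (stays_within a w).
Proof.
apply: (iffP allP) => [h j|h j _]; last exact: h.
have [jw|jw] := leqP j (size w); first by apply: h; rewrite mem_iota; lia.
by have := h (size w); rewrite take_size take_oversize ?(ltnW jw)//;
  apply; rewrite mem_iota; lia.
Qed.

(** By [mean_nonneg_from] the exit on one side has the probability that the final height leaves a
    window, which Markov's inequality for the fourth moment bounds; [flip] gives the other side. The
    fourth power is needed when such bounds are summed over many blocks. *)
Lemma mean_stays_within l (a : R) : 1 < a ->
  mean l (fun w => (~~ stays_within a w)%:R) <= 6 * l%:R ^+ 2 / (a - 1) ^+ 4.
Proof.
move=> a1; have a0 : 0 < a - 1 by lra.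
pose x : int := Num.floor a.
have xa : x%:~R <= a by rewrite /x ge_floor.
have ax : a < x%:~R + 1 by rewrite -[1]/(1%:~R) -intrD floorD1_gt.
have x0 : 0 <= x by rewrite -(ler_int R); apply: ltW; lra.
have h1 : mean l (fun w => (~~ nonneg_from x w)%:R) <= 3 * l%:R ^+ 2 / (a - 1) ^+ 4 :> R.
  have -> : mean l (fun w => (~~ nonneg_from x w)%:R) =
     mean l (fun w => (~~ (- x <= height w <= x + 1)%R)%:R) :> R.
    have e (b : bool) : (~~ b)%:R = 1 + (-1) * b%:R :> R by case: b => /=; lra.
    under eq_mean do rewrite e.
    under [RHS]eq_mean do rewrite e.
    by rewrite !meanD !meanZ mean_nonneg_from//; lia.
  rewrite ler_pdivlMr ?exprn_gt0//; apply: le_trans (mean_height4 R l).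
  rewrite mulrC -meanZ; apply: le_mean => w _.
  case: (boolP (- x <= _ <= _)) => [_|h]; rewrite ?mulr1 ?mulr0.
    by rewrite exprn_even_ge0.
  have h' : x <= `|height w| by lia.
  have : (a - 1) <= `|(height w)%:~R|.
    by move: h'; rewrite -(ler_int R) intr_norm => ?; lra.
  move=> h2; have h3 : (a - 1) ^+ 2 <= (height w)%:~R ^+ 2.
    by rewrite -(real_normK (num_real (height w)%:~R)); nra.
  by rewrite !(exprM _ 2 2); move: (sqr_ge0 (a - 1)) h3; nra.
rewrite [leRHS](_ : _ = 3 * l%:R ^+ 2 / (a - 1) ^+ 4 + 3 * l%:R ^+ 2 / (a - 1) ^+ 4); last first.
  by field; lra.
apply: (@le_trans _ _ (mean l (fun w => (~~ nonneg_from x w)%:R) +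
   mean l (fun w => (~~ nonneg_from x w)%:R))); last exact: lerD.
rewrite -[X in _ <= _ + X]mean_flip -meanD; apply: le_mean => w _ /=.
case: (boolP (nonneg_from x w)) => /= [/nonneg_fromP n1|_]; last first.
  by apply: (@le_trans _ _ 1); [case: stays_within|rewrite lerDl].
case: (boolP (nonneg_from x (flip w))) => /= [/nonneg_fromP n2|_]; last first.
  by rewrite add0r; case: stays_within.
suff -> : stays_within a w by rewrite addr0.
apply/stays_withinP => j; rewrite -intr_norm; apply: le_trans xa; rewrite ler_int.
by have := n1 j; have := n2 j; rewrite -map_take height_flip; lia.
Qed.

(** The Catalan number [binom(2n, n) / (n + 1)], divided by [4^n]. *)
Lemma mean_dyck n : mean n.*2 (fun w => (nonneg_from 0 w && (height w == 0))%:R) =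
  local_prob n.*2 0 / (n%:R + 1).
Proof.
have n0 : 0 <= n%:R :> R by [].
have := @ballot_probE n.*2 0 0 isT isT; rewrite /ballot_prob.
under eq_mean do rewrite add0r.
rewrite subr0 add0r => ->.
have := local_prob_ratio n.*2 0; rewrite add0r -muln2 natrM.
move: (local_prob _ 2) (local_prob _ 0) => a b; rewrite mulr0z => h.
by apply: (@mulIf _ (n%:R + 1)); [lra|rewrite divfK; lra].
Qed.

Lemma mean_dyck_lb (s : R) n : (0 < n)%N -> 0 < s -> s ^+ 2 = n.*2%:R ->
  s ^- 3 / 2 <= mean n.*2 (fun w => (nonneg_from 0 w && (height w == 0))%:R).
Proof.
move=> n0 s0 sn; rewrite mean_dyck.
have n1 : 1 <= n%:R :> R by rewrite ler1n.
have := central_prob_lb n0; have := central_prob_gt0 n.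
move: (local_prob _ _) => p p0 h.
have sn2 : s ^+ 2 = n%:R * 2 by rewrite sn -muln2 natrM.
have ps : s^-1 / 2 <= p.
  rewrite -invfM -div1r ler_pdivrMr ?mulr_gt0//.
  have : 1 <= (p * (s * 2)) ^+ 2 by rewrite !exprMn sn2; nra.
  by rewrite expr_ge1// !mulr_ge0// ltW.
rewrite ler_pdivlMr; last by lra.
apply: le_trans ps.
rewrite exprS invfM -!mulrA ler_pM2l ?invr_gt0//.
rewrite ler_pdivrMl ?exprn_gt0// sn2.
by lra.
Qed.

End Reflection.

Arguments local_prob {R}.
Arguments ballot_prob {R}.

(** * Stochastic domination of nonnegative walks *)

Section Domination.
Variable R : realType.
Implicit Types (F : seq bool -> R) (phi : int -> R).

(** The law of the nonnegative walk from [x], reweighted by [phi] at its end point and not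
    normalised. The weight [phi] stands for a pinned end, for a window of ends, or for the
    probability of a continuation. *)
Definition weight l (x : int) phi F : R :=
  \sum_(w <- words l) (nonneg_from x w)%:R * phi (x + height w) * F w.

Lemma weight0 x phi F : weight 0 x phi F = (0 <= x)%R%:R * phi x * F [::].
Proof. by rewrite /weight big_seq1 nonneg_from_nil addr0. Qed.

Lemma weightS l x phi F : weight l.+1 x phi F = (0 <= x)%R%:R *
  (weight l (x + 1) phi (F \o cons true) + weight l (x - 1) phi (F \o cons false)).
Proof.
rewrite /weight sum_wordsS mulrDr !mulr_sumr.
by congr (_ + _); apply: eq_bigr => w _ /=; rewrite nonneg_from_cons !mulrA /step addrA;
  case: (0 <= x); rewrite ?mul0r ?mul1r.
Qed.

Lemma weight_ge0 l x phi F : (forall y, 0 <= phi y) -> (forall w, 0 <= F w) ->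
  0 <= weight l x phi F.
Proof. by move=> p0 F0; apply: sumr_ge0 => w _; rewrite !mulr_ge0. Qed.

Lemma weight_eq0 l x phi F : (forall y, 0 <= phi y) ->
  weight l x phi (fun=> 1) = 0 -> weight l x phi F = 0.
Proof.
move=> p0 /eqP; rewrite /weight psumr_eq0 => [/allP h|w _]; last by rewrite !mulr_ge0.
rewrite big_seq big1// => w /h /=; rewrite mulr1 => /eqP ->.
by rewrite mul0r.
Qed.

(** Says that [phi' / phi] is nondecreasing along heights of the same parity, cross-multiplied so as
    to allow zeros. *)
Definition lik_ratio_le phi phi' := forall (y : int) (k : nat),
  phi (y + k.*2%:Z) * phi' y <= phi y * phi' (y + k.*2%:Z).

(** The step kernel of the walk killed below 0 is totally positive of order 2 on a parity class,
    hence it preserves monotone likelihood ratios. *)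
Lemma lik_ratio_le_weight l phi phi' : (forall y, 0 <= phi y) -> (forall y, 0 <= phi' y) ->
  lik_ratio_le phi phi' ->
  lik_ratio_le (fun x => weight l x phi (fun=> 1)) (fun x => weight l x phi' (fun=> 1)).
Proof.
move=> p0 p'0 pp; elim: l => [|l IHl] y k.
  rewrite !weight0; case: (leP 0 y) => [y0|_]; last by rewrite !mul0r mulr0.
  rewrite (_ : 0 <= y + _); last by lia.
  by rewrite !mul1r !mulr1.
rewrite !weightS; case: (leP 0 y) => [y0|_]; last by rewrite !mul0r mulr0.
rewrite (_ : 0 <= y + _); last by lia.
rewrite !mul1r; case: k => [|k]; first by rewrite addr0.
have := IHl (y + 1) k.+1; have := IHl (y - 1) k.+1.
have := IHl (y - 1) k.+2; have := IHl (y + 1) k.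
have -> : y + 1 + k.*2%:Z = y + k.+1.*2%:Z - 1 by lia.
have -> : y + 1 + k.+1.*2%:Z = y + k.+1.*2%:Z + 1 by lia.
have -> : y - 1 + k.+1.*2%:Z = y + k.+1.*2%:Z - 1 by lia.
have -> : y - 1 + k.+2.*2%:Z = y + k.+1.*2%:Z + 1 by lia.
rewrite /comp.
move: (weight _ (y + 1) phi _) (weight _ (y - 1) phi _) (weight _ (y + 1) phi' _)
  (weight _ (y - 1) phi' _) (weight _ (y + k.+1.*2%:Z + 1) phi _)
  (weight _ (y + k.+1.*2%:Z - 1) phi _) (weight _ (y + k.+1.*2%:Z + 1) phi' _)
  (weight _ (y + k.+1.*2%:Z - 1) phi' _) => a b a' b' c d c' d'.
by lra.
Qed.

(** Index 1 is a step up and index 2 a step down; [z], [y] are total weights and [a], [b] weighted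
    functionals. Conditional means are comparable except [a1 / z1] with [b2 / y2]; the missing
    comparison is made up for by [z1 * y2 <= z2 * y1], which says that the second mixture favours
    the step up. *)
Lemma cross_mul_mixture (a1 a2 b1 b2 z1 z2 y1 y2 : R) :
  0 <= z1 -> 0 <= z2 -> 0 <= y1 -> 0 <= y2 ->
  (z1 = 0 -> a1 = 0) -> (y2 = 0 -> b2 = 0) -> z1 * y2 <= z2 * y1 ->
  a1 * y1 <= b1 * z1 -> a2 * y2 <= b2 * z2 -> a2 * y1 <= b1 * z2 ->
  (a1 + a2) * (y1 + y2) <= (b1 + b2) * (z1 + z2).
Proof.
move=> z10 z20 y10 y20 za yb tp h11 h22 h21.
suff h : a1 * y2 + a2 * y1 <= b1 * z2 + b2 * z1 by lra.
have [z1E|z1N] := eqVneq z1 0; first by rewrite z1E (za z1E); lra.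
have [y2E|y2N] := eqVneq y2 0; first by rewrite y2E (yb y2E); lra.
have z1p : 0 < z1 by rewrite lt_def z1N.
have y2p : 0 < y2 by rewrite lt_def y2N.
have zy : 0 < z2 * y1 by apply: lt_le_trans tp; rewrite mulr_gt0.
have z2p : 0 < z2 by rewrite lt_def z20 andbT; apply: contraTneq zy => ->; rewrite mul0r ltxx.
have y1p : 0 < y1 by rewrite lt_def y10 andbT; apply: contraTneq zy => ->; rewrite mulr0 ltxx.
have e1 : a1 / z1 <= b1 / y1 by rewrite ler_pdivrMr// mulrAC ler_pdivlMr.
have e2 : a2 / z2 <= b2 / y2 by rewrite ler_pdivrMr// mulrAC ler_pdivlMr.
have e3 : a2 / z2 <= b1 / y1 by rewrite ler_pdivrMr// mulrAC ler_pdivlMr.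
rewrite -(divfK (lt0r_neq0 z1p) a1) -(divfK (lt0r_neq0 z2p) a2).
rewrite -(divfK (lt0r_neq0 y1p) b1) -(divfK (lt0r_neq0 y2p) b2).
move: (a1 / z1) (a2 / z2) (b1 / y1) (b2 / y2) e1 e2 e3 => p q r s e1 e2 e3.
have := ler_wpM2r (ltW (mulr_gt0 z1p y2p)) e1.
have := ler_wpM2r (ltW (mulr_gt0 z1p y2p)) e2.
have h' : 0 <= z2 * y1 - z1 * y2 by lra.
have := ler_wpM2r h' e3.
by lra.
Qed.

(* Stochastic domination of nonnegative walks, with the normalising
   denominators cleared.  Two walks started at points of the same parity cannot
   cross without meeting, so the only delicate case of the induction is [x = x'],
   where monotonicity of the likelihood ratio orders the first steps. *)
Lemma weight_domination l (x : int) (k : nat) phi phi' F F' :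
  (forall y, 0 <= phi y) -> (forall y, 0 <= phi' y) -> lik_ratio_le phi phi' ->
  (forall w w', size w = l -> size w' = l ->
     (forall j, x + height (take j w) <= x + k.*2%:Z + height (take j w')) ->
     F w <= F' w') ->
  weight l x phi F * weight l (x + k.*2%:Z) phi' (fun=> 1) <=
  weight l (x + k.*2%:Z) phi' F' * weight l x phi (fun=> 1).
Proof.
move=> p0 p'0 pp; elim: l x k F F' => [|l IHl] x k F F' FF'.
  rewrite !weight0 !mulr1 mulrAC [leRHS]mulrAC; set a := _ * phi x; set b := _ * phi' _.
  have ab : 0 <= a * b by rewrite !mulr_ge0.
  have := ler_wpM2l ab (FF' [::] [::] erefl erefl _); rewrite [b * a]mulrC; apply.
  by move=> j; rewrite /= !addr0; lia.
rewrite !weightS; case: (leP 0 x) => [x0|_]; last by rewrite !mul0r mulr0.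
rewrite (_ : 0 <= x + _); last by lia.
rewrite !mul1r /comp.
have IH s s' m : x + k.*2%:Z + step s' = x + step s + m.*2%:Z ->
    weight l (x + step s) phi (fun w => F (s :: w)) *
    weight l (x + k.*2%:Z + step s') phi' (fun=> 1) <=
    weight l (x + k.*2%:Z + step s') phi' (fun w => F' (s' :: w)) *
    weight l (x + step s) phi (fun=> 1).
  move=> E; rewrite E; apply: IHl => w w' sw sw' le.
  apply: FF'; rewrite /= ?sw ?sw'// => -[|j] /=; first by rewrite !addr0; lia.
  by rewrite [leRHS]addrA E addrA.
case: k FF' IH => [|k] FF' IH.
  have h11 := IH true true 0%N; have h22 := IH false false 0%N.
  have h21 := IH false true 1%N.
  have tp := @lik_ratio_le_weight l phi phi' p0 p'0 pp (x - 1) 1.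
  move: h11 h22 h21 tp; rewrite /step /= !addr0 => /(_ erefl) h11 /(_ erefl) h22.
  rewrite (_ : x - 1 + 2 = x + 1); last by lia.
  move=> /(_ erefl) h21 tp.
  apply: cross_mul_mixture => //; do ?by apply: weight_ge0.
  - exact: weight_eq0.
  - exact: weight_eq0.
have h11 := IH true true k.+1; have h22 := IH false false k.+1.
have h21 := IH false true k.+2; have h12 := IH true false k.
move: h11 h22 h21 h12; rewrite /step /=.
move=> /(_ ltac:(lia)) h11 /(_ ltac:(lia)) h22 /(_ ltac:(lia)) h21 /(_ ltac:(lia)) h12.
by lra.
Qed.

Lemma mean_weight l x phi F :
  mean l (fun w => (nonneg_from x w)%:R * phi (x + height w) * F w) =
  weight l x phi F / 2 ^+ l.
Proof. by []. Qed.

End Domination.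

(** * Local and central limit theorems *)

Section RealProbability.
Context (d : measure_display) (T : measurableType d) (R : realType)
  (P : probability T R).
Implicit Types A B : set T.

Definition pr A : R := fine (P A).

Lemma prE A : measurable A -> P A = (pr A)%:E.
Proof. by move=> mA; rewrite fineK// fin_num_measure. Qed.

Lemma pr_ge0 A : 0 <= pr A.
Proof. by rewrite fine_ge0. Qed.

Lemma pr_setT : pr setT = 1.
Proof. by rewrite /pr probability_setT. Qed.

Lemma le_pr A B : measurable A -> measurable B -> A `<=` B -> pr A <= pr B.
Proof. by move=> mA mB AB; rewrite -lee_fin -!prE// le_measure ?inE. Qed.

Lemma pr_le1 A : measurable A -> pr A <= 1.
Proof. by move=> mA; rewrite -pr_setT le_pr. Qed.

Lemma prU A B : measurable A -> measurable B -> A `&` B = set0 ->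
  pr (A `|` B) = pr A + pr B.
Proof.
move=> mA mB AB; apply: EFin_inj; rewrite EFinD -!prE//; last exact: measurableU.
by rewrite measureU.
Qed.

End RealProbability.

(** * The normal distribution function and its lattice cells *)

Section NormalCells.
Variables (R : realType) (sigma : R).
Hypothesis sigma0 : 0 < sigma.

Definition normal_cdf (x : R) : R := pr (normal_prob 0 sigma) `]-oo, x].

Lemma normal_cdfB (x y : R) : x <= y ->
  pr (normal_prob 0 sigma) `]x, y] = normal_cdf y - normal_cdf x.
Proof.
move=> xy; rewrite /normal_cdf.
have -> : `]-oo, y]%classic = `]-oo, x] `|` `]x, y] :> set R.
  by rewrite -itv_bndbnd_setU.
rewrite prU//; first by rewrite addrAC subrr add0r.
by apply/seteqP; split => z //=; rewrite !in_itv/= => -[? /andP[]]; lra.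
Qed.

Lemma normal_cdf_homo : {homo normal_cdf : x y / x <= y}.
Proof. by move=> x y xy; rewrite -subr_ge0 -normal_cdfB// pr_ge0. Qed.

Lemma normal_cdf_le1 x : normal_cdf x <= 1.
Proof. exact: pr_le1. Qed.

Lemma normal_cdf_ge0 x : 0 <= normal_cdf x.
Proof. exact: pr_ge0. Qed.

Lemma normal_cell (x y c1 c2 : R) : x <= y -> 0 <= c1 ->
  (forall z, x <= z <= y -> c1 <= normal_pdf 0 sigma z <= c2) ->
  c1 * (y - x) <= normal_cdf y - normal_cdf x <= c2 * (y - x).
Proof.
move=> xy c10 h; rewrite -normal_cdfB//.
have mI : measurable `]x, y] by [].
have muI : (lebesgue_measure `]x, y]%classic = (y - x)%:E :> \bar R)%E.
  rewrite lebesgue_measure_itv /= lte_fin; case: ltP => // yx.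
  by rewrite (_ : y = x) ?subrr//; lra.
have sub z : `]x, y]%classic z -> x <= z <= y.
  by rewrite /= in_itv/= => /andP[xz zy]; rewrite (ltW xz).
have c0 : 0 <= c2 by have := h x; rewrite lexx => /(_ xy)/andP[]; lra.
rewrite -!lee_fin -!prE// /normal_prob /=.
rewrite !EFinM -muI -!integral_cst//; apply/andP; split.
  apply: ge0_le_integral => //=.
    by apply/measurable_EFinP; apply: measurable_funTS; exact: measurable_normal_pdf.
  by move=> z zI; rewrite lee_fin; have /andP[] := h _ (sub _ zI).
apply: ge0_le_integral => //=.
- by move=> z zI; rewrite lee_fin normal_pdf_ge0.
- by apply/measurable_EFinP; apply: measurable_funTS; exact: measurable_normal_pdf.
- by move=> z zI; rewrite lee_fin; have /andP[] := h _ (sub _ zI).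
Qed.

Definition peak : R := normal_peak sigma.

Lemma peak_gt0 : 0 < peak.
Proof. by rewrite normal_peak_gt0// lt0r_neq0. Qed.

Lemma normal_cdf_lip (x y : R) : x <= y -> normal_cdf y - normal_cdf x <= peak * (y - x).
Proof.
move=> xy; have := @normal_cell x y 0 peak xy (lexx _).
case/(_ _)/andP => // z _; rewrite normal_pdf_ge0 normal_pdf_ub//.
by rewrite lt0r_neq0.
Qed.

Lemma normal_pdf_expR x :
  normal_pdf 0 sigma x = peak * expR (- x ^+ 2 / (2 * sigma ^+ 2)).
Proof.
rewrite normal_pdfE ?lt0r_neq0// /peak /normal_fun subr0.
by rewrite -mulr_natl.
Qed.

(* The lattice cell of index [j], for the mesh [h] with [h^2 = 2 sigma^2 / n]. *)
Lemma normal_lattice_cell (n h : R) (j : int) : 0 < n -> 0 < h ->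
  h ^+ 2 * n = 2 * sigma ^+ 2 ->
  peak * h * expR (- j%:~R ^+ 2 / n - (2 * `|j%:~R| + 1) / n) <=
  normal_cdf ((j + 1)%:~R * h) - normal_cdf (j%:~R * h) <=
  peak * h * expR (- j%:~R ^+ 2 / n + (2 * `|j%:~R| + 1) / n).
Proof.
move=> n0 h0 hn; rewrite intrD; set x : R := j%:~R.
have s20 : 0 < 2 * sigma ^+ 2 by rewrite mulr_gt0// exprn_gt0.
have := @normal_cell (x * h) ((x + 1) * h)
  (peak * expR (- x ^+ 2 / n - (2 * `|x| + 1) / n))
  (peak * expR (- x ^+ 2 / n + (2 * `|x| + 1) / n)).
have -> : (x + 1) * h - x * h = h by ring.
rewrite ![_ * expR _ * h]mulrAC; apply.
- by rewrite ler_pM2r// lerDl.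
- by rewrite mulr_ge0 ?expR_ge0// ltW// peak_gt0.
move=> z zx; rewrite normal_pdf_expR.
have [t zt] : exists t, z = t * h by exists (z / h); rewrite divfK ?lt0r_neq0.
move: zx; rewrite zt !ler_pM2r// => /andP[xt tx].
have -> : - (t * h) ^+ 2 / (2 * sigma ^+ 2) = - t ^+ 2 / n.
  by rewrite -hn; field; rewrite !lt0r_neq0.
rewrite !ler_pM2l ?peak_gt0// !ler_expR -mulrBl -mulrDl !ler_pM2r ?invr_gt0//.
by have [x0|x0] := ger0P x; apply/andP; split; nra.
Qed.

End NormalCells.

(** * Local limit theorem with explicit errors *)

Section LocalLimit.
Variable R : realType.

Lemma local_prob_even_step n (j : nat) :
  (n%:R + j%:R + 1) * local_prob n.*2 j.+1.*2 = (n%:R - j%:R) * local_prob n.*2 j.*2 :> R.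
Proof.
have := @local_prob_ratio R n.*2 j.*2.
rewrite (_ : j.*2%:Z + 2 = j.+1.*2); last by lia.
rewrite -!muln2 !natrM /= -!pmulrn !natrM.
by move: (local_prob _ _) (local_prob _ _) => a b; lra.
Qed.

(** Induction on [j] through the exact ratio [(n - j) / (n + j + 1)]; the bound [j <= n / 2] keeps
    the numerator away from 0. *)
Lemma local_prob_even_bounds n (j : nat) : (0 < n)%N -> (j.*2 <= n)%N ->
  (local_prob n.*2 0 : R) * expR (- j%:R ^+ 2 / n%:R - 4 * j%:R ^+ 3 / n%:R ^+ 2) <=
  (local_prob n.*2 j.*2 : R) <=
  local_prob n.*2 0 * expR (- j%:R ^+ 2 / n%:R + 4 * j%:R ^+ 3 / n%:R ^+ 2).
Proof.
move=> n0 jn; set p0 := local_prob _ 0; have n1 : 0 < n%:R :> R by rewrite ltr0n.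
have p00 : 0 < p0 by exact: central_prob_gt0.
elim: j jn => [|j IHj] jn.
  by rewrite !expr0n/= !(mulr0, mul0r, oppr0, addr0) expR0 mulr1 lexx.
have /andP[lo up] := IHj ltac:(lia).
have step := local_prob_even_step n j.
move: lo up step; set p := local_prob _ j.*2; set q := local_prob _ j.+1.*2 => lo up step.
have j0 : 0 <= j%:R :> R by [].
have jn' : 2 * j%:R + 2 <= n%:R :> R by rewrite -!natrM -natrD ler_nat; lia.
pose x : R := n%:R; pose y : R := j%:R.
rewrite -/x -/y -[j.+1%:R]natr1 -/y in lo up step n1 jn' j0 *.
have qE : q = p * ((x - y) / (x + y + 1)).
  by apply: (@mulfI _ (x + y + 1)); [lra|rewrite step; field; lra].
have p1 : 0 < p by apply: lt_le_trans lo; rewrite mulr_gt0// expR_gt0.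
have r0 : 0 < (x - y) / (x + y + 1) by rewrite divr_gt0; lra.
have x2 : 0 < x ^+ 2 by rewrite exprn_gt0.
(* Here [2y + 1] is the increment of [y^2], and [12 y^2 + 12 y + 4 = 4 ((y + 1)^3 - y^3)] that of
   the cubic error term. *)
have rup : (x - y) / (x + y + 1) <=
    expR (- (2 * y + 1) / x + (12 * y ^+ 2 + 12 * y + 4) / x ^+ 2).
  apply: (@le_trans _ _ (expR (- ((2 * y + 1) / (x + y + 1))))).
    apply: le_trans (expR_ge1Dx _).
    by rewrite le_eqVlt; apply/orP; left; apply/eqP; field; lra.
  rewrite ler_expR -subr_ge0.
  have -> : - (2 * y + 1) / x + (12 * y ^+ 2 + 12 * y + 4) / x ^+ 2 -
     - ((2 * y + 1) / (x + y + 1)) =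
     ((12 * y ^+ 2 + 12 * y + 4) * (x + y + 1) - (2 * y + 1) * (y + 1) * x)
      / (x ^+ 2 * (x + y + 1)) by field; lra.
  by rewrite divr_ge0//; nra.
have rlo : expR (- (2 * y + 1) / x - (12 * y ^+ 2 + 12 * y + 4) / x ^+ 2) <=
    (x - y) / (x + y + 1).
  apply: (@le_trans _ _ (expR (- ((2 * y + 1) / (x - y))))).
    rewrite ler_expR -subr_ge0.
    have -> : - ((2 * y + 1) / (x - y)) -
       (- (2 * y + 1) / x - (12 * y ^+ 2 + 12 * y + 4) / x ^+ 2) =
      ((12 * y ^+ 2 + 12 * y + 4) * (x - y) - (2 * y + 1) * y * x)
      / (x ^+ 2 * (x - y)) by field; lra.
    by rewrite divr_ge0//; nra.
  rewrite expRN -[leRHS]invrK lef_pV2 ?posrE ?invr_gt0// ?expR_gt0//.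
  apply: le_trans (expR_ge1Dx _).
  by rewrite le_eqVlt; apply/orP; left; apply/eqP; field; lra.
have e1 : - (y + 1) ^+ 2 / x - 4 * (y + 1) ^+ 3 / x ^+ 2 =
  (- y ^+ 2 / x - 4 * y ^+ 3 / x ^+ 2) +
  (- (2 * y + 1) / x - (12 * y ^+ 2 + 12 * y + 4) / x ^+ 2) by field; lra.
have e2 : - (y + 1) ^+ 2 / x + 4 * (y + 1) ^+ 3 / x ^+ 2 =
  (- y ^+ 2 / x + 4 * y ^+ 3 / x ^+ 2) +
  (- (2 * y + 1) / x + (12 * y ^+ 2 + 12 * y + 4) / x ^+ 2) by field; lra.
rewrite e1 e2 (expRD (- y ^+ 2 / x - _)) (expRD (- y ^+ 2 / x + _)) !(mulrA p0) qE; apply/andP; split.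
  have p0e u : 0 <= p0 * expR u by rewrite mulr_ge0 ?expR_ge0 ?ltW.
  by apply: ler_pM => //; exact: expR_ge0.
by apply: ler_pM => //; exact: ltW.
Qed.

End LocalLimit.

Lemma height_even n w : size w = n.*2 -> exists j : int, height w = j * 2.
Proof.
move=> sw; exists ((count id w)%:Z - n%:Z); rewrite heightE.
by have := count_predC id w; rewrite sw -[count (predC id) w]/(count negb w); lia.
Qed.

(** [kappa] is the unknown ratio between the central probability and the Gaussian density at 0. It
    is bounded below only through the total mass, by [1 - q <= kappa * expR theta] with [q] a tail
    probability, so that Stirling's constant is never computed. [D] is the wanted Gaussian mass, [C]
    that of the lattice cells inside, [p] what is lost at the ends. *)
Lemma lattice_estimate (R : realType) (kappa theta p q D C X : R) :
  0 <= kappa -> 0 <= theta -> 0 <= p -> 0 <= q -> D <= 1 -> 0 <= C -> D - p <= C ->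
  1 - q <= kappa * expR theta -> theta <= X ->
  D - (p + 2 * X) - q <= kappa * expR (- theta) * C.
Proof.
move=> k0 t0 p0 q0 D1 C0 DC kq tX.
have ke0 : 0 <= kappa * expR (- theta) by rewrite mulr_ge0 ?expR_ge0.
have [Dp|Dp] := leP (D - p) 0.
  by apply: (@le_trans _ _ 0); [rlra|rewrite mulr_ge0].
have kap2 : 1 - q - 2 * theta <= kappa * expR (- theta).
  have e2 : 1 - 2 * theta <= expR (- (2 * theta)) by exact: expR_ge1Dx.
  have -> : kappa * expR (- theta) = kappa * expR theta * expR (- (2 * theta)).
    by rewrite -mulrA -expRD; congr (kappa * expR _); ring.
  have [t1|t1] := leP (1 - 2 * theta) 0.
    by apply: (@le_trans _ _ 0); [rlra|rewrite !mulr_ge0 ?expR_ge0].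
  have [q1|q1] := leP (1 - q) 0.
    by apply: (@le_trans _ _ 0); [rlra|rewrite !mulr_ge0 ?expR_ge0].
  apply: (@le_trans _ _ ((1 - q) * (1 - 2 * theta))); first by nra.
  by apply: ler_pM => //; rlra.
apply: (@le_trans _ _ ((1 - q - 2 * theta) * (D - p))); first by nra.
apply: (@le_trans _ _ (kappa * expR (- theta) * (D - p))); first by rewrite ler_pM2r.
by rewrite ler_wpM2l.
Qed.

(** * De Moivre-Laplace theorem with an explicit error *)

Section DeMoivreLaplace.
Variables (R : realType) (sigma : R).
Hypothesis sigma0 : 0 < sigma.
Local Notation cdf := (normal_cdf sigma).
Local Notation peak := (peak sigma).

(** The first term is the error of the local limit theorem, the second the variation of the exponent
    of the Gaussian density across one cell. *)
Definition lattice_error (n J : R) : R := 4 * J ^+ 3 / n ^+ 2 + (2 * J + 1) / n.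

Lemma local_prob_cell n (J : nat) (j : int) (h : R) : (0 < n)%N -> (J.*2 <= n)%N ->
  0 < h -> h ^+ 2 * n%:R = 2 * sigma ^+ 2 -> `|j| <= J%:Z ->
  let kappa := local_prob n.*2 0 / (peak * h) in
  let cell := cdf ((j + 1)%:~R * h) - cdf (j%:~R * h) in
  let theta := lattice_error n%:R J%:R in
  kappa * expR (- theta) * cell <= local_prob n.*2 (j * 2) /\
  local_prob n.*2 (j * 2) <= kappa * expR theta * cell.
Proof.
move=> n0 Jn h0 hn jJ kappa cell theta.
have n1 : 0 < n%:R :> R by rewrite ltr0n.
pose k := `|j|%N; have kJ : (k <= J)%N by rewrite /k; lia.
have kE : `|j%:~R| = k%:R :> R by rewrite -intr_norm -abszE.
have k2E : j%:~R ^+ 2 = k%:R ^+ 2 :> R by rewrite -kE real_normK// num_real.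
have pE : local_prob n.*2 (j * 2) = local_prob n.*2 k.*2 :> R.
  have [j0|j0] := leP 0 j; first by congr local_prob; rewrite /k; lia.
  by rewrite -local_probN; congr local_prob; rewrite /k; lia.
have /andP[lo up] := @local_prob_even_bounds R n k n0 ltac:(lia).
have := normal_lattice_cell sigma0 j n1 h0 hn; rewrite kE k2E -/cell => /andP[clo cup].
rewrite pE; set p := local_prob _ k.*2 in lo up *; pose p0 : R := local_prob n.*2 0.
rewrite -/p0 in lo up; have kapE : kappa = p0 / (peak * h) by [].
have p00 : 0 < p0 by exact: central_prob_gt0.
have ph0 : 0 < peak * h by rewrite mulr_gt0// peak_gt0.
have kR : k%:R <= J%:R :> R by rewrite ler_nat.
have k0 : 0 <= k%:R :> R by [].
pose th := 4 * k%:R ^+ 3 / n%:R ^+ 2 + (2 * k%:R + 1) / n%:R : R.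
have tth : th <= theta.
  rewrite /th /theta /lattice_error; apply: lerD.
    by rewrite ler_pM2r ?invr_gt0 ?exprn_gt0// ler_pM2l// lerXn2r// nnegrE (le_trans k0).
  by rewrite ler_pM2r ?invr_gt0//; rlra.
set e := - k%:R ^+ 2 / n%:R in lo up clo cup.
set u := 4 * _ / _ in lo up th tth *; set v := (2 * k%:R + 1) / _ in clo cup th tth *.
have kap0 : 0 < kappa by rewrite kapE divr_gt0.
have cell0 : 0 <= cell by apply: le_trans clo; rewrite mulr_ge0 ?expR_ge0// ltW.
split.
  apply: (@le_trans _ _ (kappa * expR (- th) * (peak * h * expR (e + v)))).
    apply: ler_pM => //; first by rewrite mulr_ge0 ?expR_ge0// ltW.
    by rewrite ler_pM2l// ler_expR lerN2.
  apply: le_trans lo.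
  have -> : kappa * expR (- th) * (peak * h * expR (e + v)) =
    kappa * (peak * h) * (expR (- th) * expR (e + v)) by ring.
  rewrite -expRD kapE divfK ?lt0r_neq0// ler_pM2l// ler_expR /th; rlra.
apply: le_trans up _.
apply: (@le_trans _ _ (kappa * expR th * (peak * h * expR (e - v)))).
  have -> : kappa * expR th * (peak * h * expR (e - v)) =
    kappa * (peak * h) * (expR th * expR (e - v)) by ring.
  rewrite -expRD kapE divfK ?lt0r_neq0// ler_pM2l// ler_expR /th; rlra.
apply: ler_pM clo.
- exact: mulr_ge0 (ltW kap0) (expR_ge0 _).
- exact: mulr_ge0 (ltW ph0) (expR_ge0 _).
- by rewrite ler_pM2l// ler_expR.
Qed.

Lemma natr_le_intr_norm (m : nat) (z : int) : ~~ (`|z| <= m%:Z) -> m%:R <= `|z%:~R| :> R.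
Proof.
by rewrite -ltNge => /ltW h; rewrite -intr_norm (_ : m%:R = m%:Z%:~R)// ler_int.
Qed.

Lemma error_term_ge0 (B s : R) : 1 <= B -> 0 < s -> 0 <= (256 * B ^+ 3 + 20 * B) / s.
Proof.
move=> B1 s0; have B0 : 0 <= B by rlra.
exact: divr_ge0 (addr_ge0 (mulr_ge0 (ler0n _ _) (exprn_ge0 _ B0)) (mulr_ge0 (ler0n _ _) B0)) (ltW s0).
Qed.

Lemma sum_local_prob n (j : int) (m : nat) (A : pred int) :
  (forall i, (i < m)%N -> A (j + i%:Z)) ->
  \sum_(i < m) local_prob n.*2 ((j + i%:Z) * 2) <=
  mean n.*2 (fun w => (A (height w %/ 2)%Z)%:R) :> R.
Proof.
move=> Am; rewrite /local_prob -mean_sum; apply: le_mean => w _.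
have [/existsP[i /eqP E]|/existsPn h] := boolP [exists i : 'I_m, height w == (j + (i : nat)%:Z) * 2].
  rewrite (bigD1 i)//= E eqxx big1 ?addr0 => [|k ki].
    by rewrite mulzK// Am.
  rewrite (_ : _ == _ = false)//; apply/eqP => E'.
  by move/eqP: ki; apply; apply: val_inj => /=; lia.
by rewrite big1 => // i _; rewrite (negbTE (h i)).
Qed.

Lemma le_sum_local_prob n (J : nat) :
  mean n.*2 (fun w => (`|height w| <= J.*2%:Z)%R%:R) <=
  \sum_(i < J.*2.+1) local_prob n.*2 ((- J%:Z + i%:Z) * 2) :> R.
Proof.
rewrite /local_prob -mean_sum; apply: le_mean => w sw.
have [j hj] := height_even sw; rewrite hj.
case: (boolP (`|j * 2| <= J.*2%:Z)) => hJ; last by apply: sumr_ge0.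
have ij : (absz (j + J%:Z)%R < J.*2.+1)%N by lia.
rewrite (bigD1 (Ordinal ij))//= (_ : _ == _) ?lerDl ?sumr_ge0//.
by apply/eqP; lia.
Qed.

Lemma sum_cells (j : int) (m : nat) (h : R) :
  \sum_(i < m) (cdf ((j + i%:Z + 1)%:~R * h) - cdf ((j + i%:Z)%:~R * h)) =
  cdf ((j + m%:Z)%:~R * h) - cdf (j%:~R * h).
Proof.
elim: m => [|m IHm]; first by rewrite big_ord0 addr0 subrr.
by rewrite big_ord_recr/= IHm (_ : j + m.+1%:Z = j + m%:Z + 1); [ring|lia].
Qed.

(** Lattice probabilities are compared with Gaussian cells of index at most [J], about [B * s]. The
    term [2 * sigma * peak / s] is one cell lost at the ends, the other terms over [s] bound twice
    the lattice error, and [(4 * B ^+ 2)^-1] is Chebyshev's bound for heights above [2J]. *)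
Lemma de_moivre_laplace_bound (n : nat) (a b B s : R) : a <= b ->
  0 < s -> s ^+ 2 = n.*2%:R -> 1 <= B ->
  `|a| <= 2 * sigma * (B - 1) -> `|b| <= 2 * sigma * (B - 1) -> 8 * B <= s ->
  cdf b - cdf a - (2 * sigma * peak + 256 * B ^+ 3 + 20 * B) / s - (4 * B ^+ 2)^-1 <=
  mean n.*2 (fun w => (a < sigma * (height w)%:~R / s <= b)%R%:R).
Proof.
move=> ab s0 sn B1 aB bB Bs.
have n20 : n%:R * 2 = s ^+ 2 by rewrite sn -muln2 natrM.
have n1 : 0 < n%:R :> R by have := exprn_gt0 2 s0; rlra.
have n0 : (0 < n)%N by rewrite -(ltr0n R).
(* An even height [2j] is rescaled to [j * h]. *)
pose h := 2 * sigma / s; have h0 : 0 < h by rewrite divr_gt0// mulr_gt0.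
have hn : h ^+ 2 * n%:R = 2 * sigma ^+ 2.
  have -> : n%:R = s ^+ 2 / 2 by rlra.
  by rewrite /h; field; rewrite lt0r_neq0.
have [J JE] : exists J, J = (Num.truncn (B * s)).+1 by eexists.
have Bs0 : 0 <= B * s by rewrite mulr_ge0; rlra.
have /andP[Jlo Jup] := truncn_itv Bs0.
have JB : J%:R <= B * s + 1 by rewrite JE -natr1; rlra.
rewrite -JE in Jup.
have J2n : (J.*2 <= n)%N.
  rewrite -(ler_nat R) -muln2 natrM.
  have : 4 * (B * s + 1) <= s ^+ 2 by nra.
  by rlra.
have [] : exists theta : R, theta = lattice_error n%:R J%:R by exists (lattice_error n%:R J%:R).
move=> theta thetaE.
have theta0 : 0 <= theta.
  have J0 : 0 <= J%:R :> R by [].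
  by rewrite thetaE /lattice_error addr_ge0// divr_ge0// ?mulr_ge0 ?exprn_ge0//; rlra.
have theta_ub : theta <= (128 * B ^+ 3 + 10 * B) / s.
  rewrite thetaE /lattice_error [leRHS]mulrDl; apply: lerD.
    have -> : n%:R = s ^+ 2 / 2 by rlra.
    have -> : 4 * J%:R ^+ 3 / (s ^+ 2 / 2) ^+ 2 = 16 * J%:R ^+ 3 / s ^+ 4 by field; rewrite lt0r_neq0.
    rewrite ler_pdivrMr ?exprn_gt0//.
    have -> : 128 * B ^+ 3 / s * s ^+ 4 = 16 * (2 * (B * s)) ^+ 3 by field; rewrite lt0r_neq0.
    by rewrite ler_pM2l// lerXn2r ?nnegrE//; nra.
  rewrite ler_pdivrMr// (_ : n%:R = s ^+ 2 / 2); last by rlra.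
  have -> : 10 * B / s * (s ^+ 2 / 2) = 5 * (B * s) by field; rewrite lt0r_neq0.
  by nra.
pose kappa := local_prob n.*2 0 / (peak * h).
have kap0 : 0 <= kappa.
  by rewrite divr_ge0 ?local_prob_ge0// ltW// mulr_gt0// peak_gt0.
have lp (j : int) : `|j| <= J%:Z -> _ := @local_prob_cell n J j h n0 J2n h0 hn.
rewrite /= -/kappa -thetaE in lp; clearbody kappa.
(* The upper cell bounds, summed over the central window and compared with Chebyshev's inequality,
   bound [kappa] from below. *)
have kap1 : 1 - (4 * B ^+ 2)^-1 <= kappa * expR theta.
  apply: (@le_trans _ _ (mean n.*2 (fun w => (`|height w| <= J.*2%:Z)%R%:R))).
    rewrite lerBlDr -[leLHS](mean_cst n.*2).
    have -> : (4 * B ^+ 2)^-1 = (4 * B ^+ 2 * s ^+ 2)^-1 *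
        mean n.*2 (fun w => (height w)%:~R ^+ 2).
      by rewrite mean_height2 -sn; field; rewrite !lt0r_neq0// (lt_le_trans ltr01).
    rewrite -meanZ -meanD; apply: le_mean => w _.
    case: (boolP (`|height w| <= J.*2%:Z)) => hJ; first by rewrite /= lerDl mulr_ge0 ?sqr_ge0// invr_ge0 mulr_ge0 ?sqr_ge0// mulr_ge0 ?sqr_ge0.
    have B0 : 0 < B by rewrite (lt_le_trans ltr01).
    rewrite add0r mulrC ler_pdivlMr ?mul1r ?mulr_gt0 ?exprn_gt0//.
    have := natr_le_intr_norm hJ.
    rewrite -muln2 natrM -(@real_normK _ (height w)%:~R) ?num_real// => hh.
    have : 2 * (B * s) <= `|(height w)%:~R| by rlra.
    by move: Bs0 => /[swap]; nra.
  apply: le_trans (le_sum_local_prob _ _) _.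
  apply: (@le_trans _ _ (kappa * expR theta * \sum_(i < J.*2.+1)
     (cdf ((- J%:Z + i%:Z + 1)%:~R * h) - cdf ((- J%:Z + i%:Z)%:~R * h)))).
    by rewrite mulr_sumr; apply: ler_sum => i _; apply: (lp _ _).2; move: (ltn_ord i); clear; lia.
  rewrite sum_cells ler_piMr// ?mulr_ge0 ?expR_ge0//.
  by rewrite lerBlDr (le_trans (normal_cdf_le1 _ _))// lerDl normal_cdf_ge0.
(* The first and the last index of a lattice point in []a, b]]. *)
pose j1 : int := Num.floor (a / h) + 1; pose j2 : int := Num.floor (b / h).
have j1lo : (j1 - 1)%:~R <= a / h by rewrite /j1 addrK ge_floor.
have j1up : a / h < j1%:~R by rewrite /j1 floorD1_gt.
have j2lo : j2%:~R <= b / h by rewrite ge_floor.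
have j2up : b / h < (j2 + 1)%:~R by rewrite floorD1_gt.
(* Without a lattice point in []a, b]] the interval is no longer than the mesh, and the claimed
   lower bound is nonpositive. *)
have [ba|ab1] := leP (j2 + 1) j1.
  have ba2 : b - a <= h.
    have : (j2 + 1)%:~R <= j1%:~R :> R by rewrite ler_int.
    rewrite intrB in j1lo => ?.
    have : b / h <= a / h + 1 by rlra.
    by rewrite ler_pdivrMr// mulrDl divfK ?lt0r_neq0//; rlra.
  apply: (@le_trans _ _ 0); last by apply: mean_ge0.
  have := normal_cdf_lip sigma0 ab; have pk := peak_gt0 sigma0.
  have : peak * (b - a) <= peak * h by rewrite ler_pM2l.
  have -> : (2 * sigma * peak + 256 * B ^+ 3 + 20 * B) / s =
    peak * h + (256 * B ^+ 3 + 20 * B) / s by rewrite /h; field; rewrite lt0r_neq0.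
  have B0 : 0 <= (256 * B ^+ 3 + 20 * B) / s.
    exact: error_term_ge0.
  have : 0 <= (4 * B ^+ 2)^-1 by rewrite invr_ge0 mulr_ge0 ?sqr_ge0.
  by rlra.
pose m : nat := absz (j2 - j1 + 1)%R.
have mE : m%:Z = j2 - j1 + 1 by move: ab1; rewrite /m; clear; lia.
have hE x : x / h = x * s / (2 * sigma) by rewrite /h; field; rewrite !lt0r_neq0.
have small (x : R) : `|x| <= 2 * sigma * (B - 1) -> `|x / h| <= J%:R - s.
  move=> xB; rewrite hE normf_div normrM (gtr0_norm s0) (@gtr0_norm _ (2 * sigma)) ?mulr_gt0//.
  rewrite ler_pdivrMr ?mulr_gt0//.
  apply: (@le_trans _ _ ((2 * sigma) * (B - 1) * s)); first by rewrite ler_pM2r.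
  by rewrite -mulrA mulrC ler_pM2r ?mulr_gt0//; rlra.
have s1 : 1 <= s by rlra.
have j1J : `|j1| <= J%:Z.
  have := small _ aB; rewrite intrB in j1lo.
  rewrite -(ler_int R) intr_norm => /ler_normlP[h1 h2]; clearbody h; rewrite ler_norml; clear -h1 h2 s1 j1lo j1up; apply/andP; split; rlra.
have j2J : `|j2| <= J%:Z.
  have := small _ bB; rewrite intrD in j2up.
  rewrite -(ler_int R) intr_norm => /ler_normlP[h1 h2]; clearbody h; rewrite ler_norml; clear -h1 h2 s1 j2lo j2up; apply/andP; split; rlra.
pose A (j : int) := a < j%:~R * h <= b.
apply: (@le_trans _ _ (mean n.*2 (fun w => (A (height w %/ 2)%Z)%:R))); last first.
  apply: le_mean => w sw; have [j hj] := height_even sw.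
  rewrite hj mulzK// /A (_ : sigma * _ / s = j%:~R * h)// /h intrM.
  by rewrite mulr2n; field; rewrite lt0r_neq0.
apply: le_trans (@sum_local_prob n j1 m A _); last first.
  move=> i im; rewrite /A -ltr_pdivrMr// -ler_pdivlMr//; apply/andP; split.
    by apply: lt_le_trans j1up _; rewrite ler_int; clear; lia.
  by apply: le_trans _ j2lo; rewrite ler_int; move: im mE; clear; lia.
apply: (@le_trans _ _ (kappa * expR (- theta) * \sum_(i < m)
     (cdf ((j1 + i%:Z + 1)%:~R * h) - cdf ((j1 + i%:Z)%:~R * h)))); last first.
  by rewrite mulr_sumr; apply: ler_sum => i _; apply: (lp _ _).1; move: (ltn_ord i) mE j1J j2J; clear; lia.
rewrite sum_cells (_ : j1 + m%:Z = j2 + 1); last by rewrite mE; clear; lia.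
set D := cdf b - cdf a.
have D1 : D <= 1 by rewrite lerBlDr (le_trans (normal_cdf_le1 _ _))// lerDl normal_cdf_ge0.
have Dlo : D - peak * h <= cdf ((j2 + 1)%:~R * h) - cdf (j1%:~R * h).
  have : cdf b <= cdf ((j2 + 1)%:~R * h).
    by apply: normal_cdf_homo; rewrite -ler_pdivrMr// ltW.
  have : cdf (j1%:~R * h) <= cdf (a + h).
    apply: normal_cdf_homo; rewrite intrB in j1lo.
    by rewrite -ler_pdivlMr// mulrDl divff ?lt0r_neq0//; rlra.
  have := @normal_cdf_lip _ _ sigma0 a (a + h) ltac:(rlra).
  have -> : a + h - a = h by ring.
  by rewrite /D; clearbody h; clear; rlra.
have pk : 0 <= peak * h by rewrite ltW// mulr_gt0// peak_gt0.
have -> : (2 * sigma * peak + 256 * B ^+ 3 + 20 * B) / s =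
    peak * h + 2 * ((128 * B ^+ 3 + 10 * B) / s) by rewrite /h; field; rewrite lt0r_neq0.
have B40 : 0 <= (4 * B ^+ 2)^-1 by rewrite invr_ge0 mulr_ge0 ?sqr_ge0.
have cells0 : 0 <= cdf ((j2 + 1)%:~R * h) - cdf (j1%:~R * h).
  by rewrite subr_ge0; apply: normal_cdf_homo; rewrite ler_pM2r// ler_int; move: ab1; clear; lia.
exact: lattice_estimate.
Qed.

End DeMoivreLaplace.

(** * Donsker's theorem for Lipschitz functionals *)

Section BoundedExpectation.
Context (d : measure_display) (T : measurableType d) (R : realType)
  (P : probability T R).
Implicit Types X Y : T -> R.

Definition bounded_measurable X :=
  measurable_fun setT X /\ exists M, forall w, `|X w| <= M.

Definition ex X : R := \int[P]_w X w.

Lemma bounded_measurable_integrable X : bounded_measurable X ->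
  P.-integrable setT (EFin \o X).
Proof.
move=> [mX [M XM]]; apply: measurable_bounded_integrable => //.
  by rewrite -ge0_fin_numE// fin_num_measure.
exists M; split; first exact: num_real.
by move=> x Mx w _ /=; rewrite (le_trans (XM w))// ltW.
Qed.

Lemma exE X : bounded_measurable X -> (\int[P]_w (X w)%:E)%E = (ex X)%:E.
Proof.
move=> bX; rewrite /ex /Rintegral fineK//.
exact: integrable_fin_num (bounded_measurable_integrable bX).
Qed.

Lemma bm_cst c : bounded_measurable (fun=> c).
Proof. by split => //; exists `|c|. Qed.

Lemma bmD X Y : bounded_measurable X -> bounded_measurable Y ->
  bounded_measurable (fun w => X w + Y w).
Proof.
move=> [mX [M XM]] [mY [N YN]]; split; first exact: measurable_funD.
by exists (M + N) => w; rewrite (le_trans (ler_normD _ _))// lerD.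
Qed.

Lemma bmM X Y : bounded_measurable X -> bounded_measurable Y ->
  bounded_measurable (fun w => X w * Y w).
Proof.
move=> [mX [M XM]] [mY [N YN]]; split; first exact: measurable_funM.
by exists (M * N) => w; rewrite normrM ler_pM.
Qed.

Lemma bmZ c X : bounded_measurable X -> bounded_measurable (fun w => c * X w).
Proof. by apply: bmM; exact: bm_cst. Qed.

Lemma bmB X Y : bounded_measurable X -> bounded_measurable Y ->
  bounded_measurable (fun w => X w - Y w).
Proof.
move=> bX bY; rewrite (_ : (fun w => _) = fun w => X w + (-1) * Y w); last first.
  by apply/funext => w; rewrite mulN1r.
by apply: bmD => //; exact: bmZ.
Qed.

Lemma bm_indic (A : set T) : measurable A -> bounded_measurable (\1_A : T -> R).
Proof.
move=> mA; split; first exact: measurable_indic.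
by exists 1 => w; rewrite indicE; case: (_ \in _); rewrite ?normr1 ?normr0.
Qed.

Lemma bm_sum (I : Type) (r : seq I) (X : I -> T -> R) :
  (forall i, bounded_measurable (X i)) ->
  bounded_measurable (fun w => \sum_(i <- r) X i w).
Proof.
move=> bX; elim: r => [|i r IHr].
  by under eq_fun do rewrite big_nil; exact: bm_cst.
by under eq_fun do rewrite big_cons; exact: bmD.
Qed.

Lemma ex_cst c : ex (fun=> c) = c.
Proof. by rewrite /ex Rintegral_cst// -/(pr P setT) pr_setT mulr1. Qed.

Lemma exD X Y : bounded_measurable X -> bounded_measurable Y ->
  ex (fun w => X w + Y w) = ex X + ex Y.
Proof. by move=> bX bY; rewrite /ex RintegralD//; exact: bounded_measurable_integrable. Qed.

Lemma exZ c X : bounded_measurable X -> ex (fun w => c * X w) = c * ex X.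
Proof. by move=> bX; rewrite /ex RintegralZl//; exact: bounded_measurable_integrable. Qed.

Lemma exB X Y : bounded_measurable X -> bounded_measurable Y ->
  ex (fun w => X w - Y w) = ex X - ex Y.
Proof. by move=> bX bY; rewrite /ex RintegralB//; exact: bounded_measurable_integrable. Qed.

Lemma le_ex X Y : bounded_measurable X -> bounded_measurable Y ->
  (forall w, X w <= Y w) -> ex X <= ex Y.
Proof.
by move=> bX bY XY; apply: le_Rintegral => //; exact: bounded_measurable_integrable.
Qed.

Lemma ex_ge0 X : (forall w, 0 <= X w) -> 0 <= ex X.
Proof. by move=> X0; apply: Rintegral_ge0. Qed.

Lemma ex_indic A : measurable A -> ex (\1_A) = pr P A.
Proof. by move=> mA; rewrite /ex /Rintegral integral_indic// setIT. Qed.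

Lemma ex_sum (I : Type) (r : seq I) (X : I -> T -> R) :
  (forall i, bounded_measurable (X i)) ->
  ex (fun w => \sum_(i <- r) X i w) = \sum_(i <- r) ex (X i).
Proof.
move=> bX; elim: r => [|i r IHr].
  by under eq_fun do rewrite big_nil; rewrite big_nil ex_cst.
under eq_fun do rewrite big_cons.
by rewrite exD// ?IHr ?big_cons//; exact: bm_sum.
Qed.

Lemma ex_cvg (X_ : nat -> T -> R) X (M : R) :
  (forall n, measurable_fun setT (X_ n)) ->
  (forall w, (X_ ^~ w) @ \oo --> X w) ->
  (forall n w, `|X_ n w| <= M) ->
  bounded_measurable X /\ (fun n => ex (X_ n)) @ \oo --> ex X.
Proof.
move=> mX cX XM.
have mXl : measurable_fun setT X.
  by apply: (@measurable_fun_cvg _ _ _ _ X_) => // w _; exact: cX.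
have bX : bounded_measurable X.
  split => //; exists M => w.
  have cn : (fun n => `|X_ n w|) @ \oo --> `|X w| by apply: cvg_norm; exact: cX.
  rewrite -(cvg_lim _ cn)//; apply: limr_le; first exact: cvgP cn.
  by apply: nearW.
split => //.
have iM : P.-integrable setT (EFin \o cst M).
  exact: bounded_measurable_integrable (bm_cst M).
have [|||||_ _ h] := @dominated_convergence _ T R P setT measurableT
   (fun n => EFin \o X_ n) (EFin \o X) (EFin \o cst M).
- by move=> n; exact/measurable_EFinP.
- exact/measurable_EFinP.
- apply: aeW => w _; apply: cvg_EFin; last exact: cX.
  exact: nearW.
- exact: iM.
- by apply: aeW => w n _ /=; rewrite lee_fin.
apply: fine_cvg.
rewrite -[in X in _ --> X]exE//.
Qed.

Lemma ex_cvg0 (X_ : nat -> T -> R) (M : R) :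
  (forall n, measurable_fun setT (X_ n)) ->
  (forall w (eps : R), 0 < eps -> exists N, forall n, (N <= n)%N -> `|X_ n w| <= eps) ->
  (forall n w, `|X_ n w| <= M) ->
  forall eps, 0 < eps -> exists N, forall n, (N <= n)%N -> `|ex (X_ n)| <= eps.
Proof.
move=> mX X0 XM eps e0.
have [|_] := @ex_cvg X_ (fun=> 0) M mX _ XM.
  move=> w; apply/cvgrPdist_le => e /(X0 w)[N hN].
  by exists N => // n /hN; rewrite /= sub0r normrN.
rewrite ex_cst => /cvgrPdist_le/(_ _ e0)[N _ hN].
by exists N => n /hN; rewrite /= sub0r normrN.
Qed.

End BoundedExpectation.

(** * Lipschitz functionals of paths on the unit interval *)

Section UnitInterval.
Variable R : realType.
Implicit Types (f g : R -> R) (H : (R -> R) -> R).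

Definition sup_close f g (c : R) := forall t : R, 0 <= t <= 1 -> `|f t - g t| <= c.

(** Stated through [sup_close] and not through [uniform_dist]: functionals are applied to arbitrary
    functions, for which a supremum may be infinite and then takes its default value 0. *)
Definition lip (L : R) H := forall f g c, sup_close f g c -> `|H f - H g| <= L * c.

Definition unit_valued H := forall f, 0 <= H f <= 1.

Definition cont01 g := forall x : R, 0 <= x <= 1 -> forall eps : R, 0 < eps ->
  exists2 delta : R, 0 < delta &
    forall y : R, 0 <= y <= 1 -> `|x - y| <= delta -> `|g x - g y| <= eps.

Lemma within_cont01 g : {within `[0, 1], continuous g} -> cont01 g.
Proof.
move=> cg x x01 eps e0.
have xI : (`[0, 1]%classic : set R) x by rewrite /= in_itv.
have := (subspace_continuousP _ _).1 cg x xI => /cvgrPdist_le/(_ _ e0)/nbhs_ballP[d /= d0 hd].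
exists (d / 2) => [|y y01 xy]; first by rewrite divr_gt0.
apply: hd; last by rewrite /= in_itv.
by rewrite /ball /= (le_lt_trans xy)// ltr_pdivrMr// ltr_pMr// ltr1n.
Qed.

Lemma subseq01 (u : nat -> R) : (forall n, 0 <= u n <= 1) ->
  exists phi : nat -> nat, exists2 l : R, 0 <= l <= 1 &
    (forall n, (n <= phi n)%N) /\
    forall eps : R, 0 < eps -> exists N, forall n, (N <= n)%N -> `|u (phi n) - l| <= eps.
Proof.
move=> u01; have [|phi iphi cu] := @bolzano_weierstrass R u.
  exists 1; split; first exact: num_real.
  by move=> M M1 n _ /=; have /andP[u0 u1] := u01 n; rewrite ger0_norm// (le_trans u1)// ltW.
exists phi; exists (limn (u \o phi)).
  apply/andP; split.
    by apply: limr_ge => //; apply: nearW => n /=; have /andP[] := u01 (phi n).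
  by apply: limr_le => //; apply: nearW => n /=; have /andP[] := u01 (phi n).
split.
  elim=> // n IHn; apply: leq_ltn_trans IHn _.
  by have /leqW_mono h := iphi; have := h n n.+1; rewrite ltnSn.
move=> eps e0; move/cvgrPdistC_le : cu => /(_ _ e0)[N _ hN].
by exists N => n /hN.
Qed.

Lemma natSinv_le (eps : R) : 0 < eps -> exists N : nat, forall n, (N <= n)%N -> n.+1%:R^-1 <= eps.
Proof.
move=> e0; exists (Num.truncn eps^-1) => n Nn.
rewrite -[eps]invrK lef_pV2 ?posrE ?invr_gt0//.
apply: (@le_trans _ _ (Num.truncn eps^-1).+1%:R); first by rewrite ltW// truncnS_gt.
by rewrite ler_nat.
Qed.

Lemma cont01_unif g : cont01 g -> forall eps : R, 0 < eps ->
  exists2 delta : R, 0 < delta & forall x y : R, 0 <= x <= 1 -> 0 <= y <= 1 ->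
    `|x - y| <= delta -> `|g x - g y| <= eps.
Proof.
move=> cg eps e0; apply: contrapT => h.
have {h} h (n : nat) : exists p : R * R, [/\ 0 <= p.1 <= 1, 0 <= p.2 <= 1,
    `|p.1 - p.2| <= n.+1%:R^-1 & eps < `|g p.1 - g p.2|].
  apply: contrapT => hn; apply: h; exists n.+1%:R^-1; first by rewrite invr_gt0.
  move=> x y x01 y01 xy; rewrite leNgt; apply/negP => gxy.
  by apply: hn; exists (x, y).
have [p hp] := choice h.
have [phi [l l01 [phin cphi]]] := @subseq01 (fun n => (p n).1) (fun n => let: And4 a _ _ _ := hp n in a).
have [d d0 hd] := cg l l01 (eps / 2) ltac:(by rewrite divr_gt0).
have [N hN] := cphi (d / 2) ltac:(by rewrite divr_gt0).
have [M hM] := @natSinv_le (d / 2) ltac:(by rewrite divr_gt0).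
pose n := maxn N M.
have [a1 a2 a3 a4] := hp (phi n).
have h1 := hN n (leq_maxl _ _).
have h2 := hM (phi n) (leq_trans (leq_maxr _ _) (phin n)).
have h3 : `|g l - g (p (phi n)).1| <= eps / 2.
  by apply: hd => //; rewrite distrC (le_trans h1)// ler_pdivrMr// ler_pMr// ler1n.
have h4 : `|g l - g (p (phi n)).2| <= eps / 2.
  apply: hd => //.
  have -> : l - (p (phi n)).2 = (l - (p (phi n)).1) + ((p (phi n)).1 - (p (phi n)).2) by ring.
  rewrite (le_trans (ler_normD _ _))// (splitr d) lerD//; first by rewrite distrC.
  exact: le_trans a3 h2.
move: a4; rewrite ltNge => /negP; apply.
have -> : g (p (phi n)).1 - g (p (phi n)).2 =
  (g l - g (p (phi n)).2) - (g l - g (p (phi n)).1) by ring.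
by rewrite (le_trans (ler_normB _ _))// (splitr eps) lerD.
Qed.

Lemma le_sup_image (I : Type) (D : set I) (a b : I -> R) (c : R) :
  D !=set0 -> (forall i, D i -> b i <= 1) -> (forall i, D i -> a i <= b i + c) ->
  sup [set a i | i in D] <= sup [set b i | i in D] + c.
Proof.
move=> [i0 D0] b1 ab; apply: ge_sup; first by exists (a i0); exists i0.
move=> _ [i Di <-]; apply: le_trans (ab _ Di) _; rewrite lerD2r.
apply: ub_le_sup; last by exists i.
by exists 1 => _ [j Dj <-]; exact: b1.
Qed.

Lemma sup_image_ub (I : Type) (D : set I) (a : I -> R) (i : I) :
  D i -> (forall i, D i -> a i <= 1) -> a i <= sup [set a i | i in D].
Proof.
move=> Di a1; apply: ub_le_sup; last by exists i.
by exists 1 => _ [j Dj <-]; exact: a1.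
Qed.

Lemma sup_image_le (I : Type) (D : set I) (a : I -> R) (c : R) :
  D !=set0 -> (forall i, D i -> a i <= c) -> sup [set a i | i in D] <= c.
Proof.
move=> [i0 D0] ac; apply: ge_sup; first by exists (a i0); exists i0.
by move=> _ [i Di <-]; exact: ac.
Qed.

Lemma lip_ge0 L H : lip L H -> 0 <= L.
Proof.
move=> LH; have := LH (fun=> 0) (fun=> 0) 1; rewrite subrr normr0 mulr1; apply.
by move=> t _; rewrite subrr normr0.
Qed.

Lemma trunc_grid (K : nat) (t : R) : 0 <= t <= 1 ->
  let i := Num.truncn (K.+1%:R * t) in
  [/\ (i <= K.+1)%N, 0 <= (i%:R / K.+1%:R : R) <= 1 & 0 <= t - i%:R / K.+1%:R <= K.+1%:R^-1].
Proof.
move=> /andP[t0 t1] i; have Kt0 : 0 <= K.+1%:R * t by rewrite mulr_ge0.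
have /andP[h1 h2] := truncn_itv Kt0; rewrite -/i in h1 h2.
have iK : (i <= K.+1)%N.
  by rewrite -(ler_nat R) (le_trans h1)// -[leRHS]mulr1 ler_pM2l.
split => //; first by rewrite divr_ge0//= ler_pdivrMr// mul1r ler_nat.
rewrite subr_ge0 ler_pdivrMr// mulrC h1/=.
have : t <= (i%:R + 1) / K.+1%:R by rewrite ler_pdivlMr// mulrC natr1 ltW.
by rewrite mulrDl div1r lerBlDl.
Qed.

Definition near_pairs (K : nat) : set (R * R) :=
  [set p | [/\ 0 <= p.1 <= 1, 0 <= p.2 <= 1 & `|p.1 - p.2| <= K%:R^-1]].

(** The modulus of continuity at scale [1 / K]. The cap at 1 keeps the supremum finite for every
    function and provides the domination when [K] tends to infinity. *)
Definition osc (K : nat) g : R :=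
  sup [set Num.min 1 `|g p.1 - g p.2| | p in near_pairs K].

Lemma near_pairs0 K : near_pairs K !=set0.
Proof. by exists (0, 0); split; rewrite /= ?lexx ?ler01// subrr normr0 invr_ge0. Qed.

Lemma osc_le1 K g : osc K g <= 1.
Proof. by apply: sup_image_le => [|p _]; [exact: near_pairs0|rewrite ge_min lexx]. Qed.

Lemma osc_ub K g p : near_pairs K p -> Num.min 1 `|g p.1 - g p.2| <= osc K g.
Proof. by move=> Kp; apply: (@sup_image_ub _ _ (fun p => Num.min 1 `|g p.1 - g p.2|)) => // q _; rewrite ge_min lexx. Qed.

Lemma osc_ge0 K g : 0 <= osc K g.
Proof.
have [p Kp] := near_pairs0 K; apply: le_trans (osc_ub g Kp).
by rewrite le_min ler01 normr_ge0.
Qed.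

Lemma osc_lip K : lip 2 (osc K).
Proof.
move=> f g c fg; have aux f' g' : sup_close f' g' c -> osc K f' <= osc K g' + 2 * c.
  move=> fg'; apply: le_sup_image; [exact: near_pairs0|by move=> p _; rewrite ge_min lexx|].
  move=> p [p1 p2 _]; have h1 := fg' _ p1; have h2 := fg' _ p2.
  have c0 : 0 <= c by exact: le_trans h1.
  have h : `|f' p.1 - f' p.2| <= `|g' p.1 - g' p.2| + 2 * c.
    have -> : f' p.1 - f' p.2 = (g' p.1 - g' p.2) + ((f' p.1 - g' p.1) - (f' p.2 - g' p.2)) by ring.
    rewrite (le_trans (ler_normD _ _))// lerD2l (le_trans (ler_normB _ _))//.
    by rewrite mulr_natl mulr2n lerD.
  by rewrite addr_minl le_min !ge_min; apply/andP; split; apply/orP; [left|right]; lra.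
have gf : sup_close g f c by move=> t t01; rewrite distrC fg.
by have h1 := aux _ _ fg; have h2 := aux _ _ gf; rewrite ler_norml; apply/andP; split; lra.
Qed.

Lemma osc_cvg0 g : cont01 g -> forall eps : R, 0 < eps ->
  exists N, forall K, (N <= K)%N -> osc K g <= eps.
Proof.
move=> cg eps e0; have [d d0 hd] := cont01_unif cg e0.
have [N hN] := natSinv_le d0; exists N.+1 => -[//|K] NK.
apply: sup_image_le; first exact: near_pairs0.
move=> p [p1 p2 p12]; rewrite ge_min; apply/orP; right.
by apply: hd => //; rewrite (le_trans p12)// hN.
Qed.

End UnitInterval.

(** * Measurability of Lipschitz functionals of a continuous process *)

Section MeasurableFunctional.
Context (d : measure_display) (T : measurableType d) (R : realType).
Variables (X : T -> R -> R) (L : R) (H : (R -> R) -> R).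
Hypothesis mX : forall t : R, 0 <= t <= 1 -> measurable_fun setT (X ^~ t).
Hypothesis cX : forall w, cont01 (X w).
Hypothesis LH : lip L H.

Let grid (K : nat) (z : {ffun 'I_K.+2 -> int}) (t : R) : R :=
  (z (inord (Num.truncn (K.+1%:R * t))))%:~R / K.+1%:R.

Let digits (K : nat) (w : T) : {ffun 'I_K.+2 -> int} :=
  [ffun i : 'I_K.+2 => Num.floor (K.+1%:R * X w (i%:R / K.+1%:R))].

Let measurable_digits K (A : set {ffun 'I_K.+2 -> int}) :
  measurable [set w | A (digits K w)].
Proof.
have -> : [set w | A (digits K w)] = \bigcup_(z in A)
    \bigcap_(i in [set: 'I_K.+2]) [set w | digits K w i = z i].
  apply/seteqP; split => w /=; first by move=> Aw; exists (digits K w).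
  by move=> [z Az h]; rewrite (_ : digits K w = z)//; apply/ffunP => i; exact: h.
rewrite bigcup_mkcond; apply: countable_bigcupT_measurable => // z.
case: ifPn => // _; apply: fin_bigcap_measurable => // i _.
have i01 : 0 <= (i%:R / K.+1%:R : R) <= 1.
  by rewrite divr_ge0//= ler_pdivrMr// mul1r ler_nat -ltnS.
rewrite (_ : [set w | _] = (X ^~ (i%:R / K.+1%:R)) @^-1`
   `[(z i)%:~R / K.+1%:R, ((z i) + 1)%:~R / K.+1%:R[).
  by rewrite -[X in measurable X]setTI; apply: (mX i01).
apply/seteqP; split => w /=; rewrite ffunE in_itv/= ler_pdivrMr// ltr_pdivlMr// mulrC.
  by move=> <-; rewrite ge_floor// floorD1_gt.
by move=> h; apply/eqP; rewrite floor_eq// h.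
Qed.

(** Times and values are rounded to multiples of [1 / (K + 1)]. The rounded path takes countably
    many values, so that [H] of it is measurable, and it converges uniformly to the path by
    continuity. *)
Lemma measurable_functional : measurable_fun setT (fun w => H (X w)).
Proof.
apply: (@measurable_fun_cvg _ _ _ _ (fun K w => H (grid (digits K w)))).
  move=> K _ Y mY; rewrite setTI.
  exact: (@measurable_digits K [set z | Y (H (grid z))]).
move=> w _; apply/cvgrPdist_le => eps e0.
have L0 := lip_ge0 LH; have L1 : 0 < L + 1 by lra.
pose e1 : R := eps / (2 * (L + 1)); have e10 : 0 < e1 by rewrite divr_gt0// mulr_gt0.
have [d0 d00 hd] := cont01_unif (@cX w) e10.
have d10 : 0 < Num.min d0 e1 by rewrite lt_min d00.
have [N hN] := natSinv_le d10.
exists N => // K /= /hN; rewrite le_min => /andP[Kd Ke].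
have : sup_close (X w) (grid (digits K w)) (2 * e1).
  move=> t t01; have [iK i01 ti] := trunc_grid K t01; set i := Num.truncn _ in iK i01 ti.
  rewrite /grid /digits ffunE -/i inordK ?ltnS//.
  set x := X w (i%:R / K.+1%:R).
  have h1 : `|X w t - x| <= e1.
    by apply: hd => //; rewrite ger0_norm; case/andP: ti => // ti0 ti1; rewrite (le_trans ti1).
  have h2 : `|x - (Num.floor (K.+1%:R * x))%:~R / K.+1%:R| <= e1.
    apply: le_trans Ke.
    have -> : x - (Num.floor (K.+1%:R * x))%:~R / K.+1%:R =
       (K.+1%:R * x - (Num.floor (K.+1%:R * x))%:~R) / K.+1%:R by field.
    rewrite normrM [X in _ * X]ger0_norm ?invr_ge0// ler_piMl ?invr_ge0//.
    have h3 := ge_floor (K.+1%:R * x); have h4 := floorD1_gt (K.+1%:R * x).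
    by rewrite intrD in h4; rewrite ger0_norm; lra.
  apply: le_trans (ler_distD x _ _) _; apply: le_trans (lerD h1 h2) _.
  by rewrite -mulr2n mulr_natl.
move=> /LH h; apply: le_trans h _.
rewrite /e1 (_ : L * _ = eps * (L / (L + 1))); last by field; lra.
have h1 : L / (L + 1) <= 1 by rewrite ler_pdivrMr//; lra.
by rewrite ler_piMr// ltW.
Qed.

End MeasurableFunctional.

(** * Independent blocks of a walk *)

Section Blocks.
Variable R : realType.

Lemma size_take_leq (A : Type) n (s : seq A) : (size (take n s) <= size s)%N.
Proof. by rewrite size_take_min geq_minr. Qed.

Lemma size_take_leqn (A : Type) n (s : seq A) : (size (take n s) <= n)%N.
Proof. by rewrite size_take_min geq_minl. Qed.

Lemma prod_ge_sum_error (I : Type) (r : seq I) (x y : I -> R) (eta : R) : 0 <= eta ->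
  (forall i, 0 <= x i <= 1) -> (forall i, 0 <= y i <= 1) -> (forall i, y i - eta <= x i) ->
  \prod_(i <- r) y i - (size r)%:R * eta <= \prod_(i <- r) x i.
Proof.
move=> eta0 x01 y01 xy; elim: r => [|i r IHr]; first by rewrite !big_nil mul0r subr0.
rewrite !big_cons /= -natr1.
have /andP[x0 x1] := x01 i; have /andP[y0 y1] := y01 i; have h := xy i.
have X0 : 0 <= \prod_(j <- r) x j by apply: prodr_ge0 => j _; have /andP[] := x01 j.
have Y0 : 0 <= \prod_(j <- r) y j by apply: prodr_ge0 => j _; have /andP[] := y01 j.
have Y1 : \prod_(j <- r) y j <= 1 by apply: prodr_ile1 => j _; exact: y01.
move: X0 Y0 Y1 IHr; set X := \prod_(j <- r) x j; set Y := \prod_(j <- r) y j => X0 Y0 Y1 IHr.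
have s0 : 0 <= (size r)%:R * eta by rewrite mulr_ge0.
apply: (@le_trans _ _ (y i * (Y - (size r)%:R * eta) - eta)); first by nra.
have [c|c] := leP (Y - (size r)%:R * eta) 0.
  by apply: (@le_trans _ _ 0); [nra|rewrite mulr_ge0].
apply: (@le_trans _ _ (x i * (Y - (size r)%:R * eta))); first by nra.
by rewrite ler_wpM2l.
Qed.

Definition block (L i : nat) (w : seq bool) : seq bool := take L (drop (i * L) w).

Lemma mean_blocks K L r (f : nat -> seq bool -> R) :
  mean (K * L + r) (fun w => \prod_(i < K) f i (block L i w)) = \prod_(i < K) mean L (f i).
Proof.
elim: K f => [|K IHK] f.
  by under eq_mean do rewrite big_ord0; rewrite mean_cst big_ord0.
rewrite mulSn -addnA mean_cat big_ord_recl /= -(IHK (fun i => f i.+1)).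
rewrite mulrC -meanZ; apply: eq_mean => v sv.
rewrite mulrC -meanZ; apply: eq_mean => w _.
rewrite big_ord_recl /block mul0n drop0 take_size_cat//; congr (_ * _).
by apply: eq_bigr => i _; rewrite lift0 mulSn addnC -drop_drop drop_size_cat.
Qed.

Lemma mean_block K L r (f : seq bool -> R) (i : 'I_K) :
  mean (K * L + r) (fun w => f (block L i w)) = mean L f.
Proof.
transitivity (\prod_(j < K) mean L (fun w => if (j : nat) == i then f w else 1)).
  rewrite -(@mean_blocks K L r (fun j w => if j == i then f w else 1)).
  apply: eq_mean => w _; rewrite (bigD1 i)//= eqxx big1 ?mulr1// => j ji.
  by case: eqP => // E; move/eqP: ji; case; exact: val_inj.
rewrite (bigD1 i)//= big1 ?mulr1 => [|j ji].
  by apply: eq_mean => w _; rewrite eqxx.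
rewrite -[RHS](mean_cst L 1); apply: eq_mean => w _.
by case: eqP => // E; move/eqP: ji; case; exact: val_inj.
Qed.

Lemma height_blocks K L r w i : size w = (K * L + r)%N -> (i <= K)%N ->
  height (take (i * L) w) = \sum_(j < i) height (block L j w).
Proof.
move=> sw; elim: i => [|i IHi] iK; first by rewrite mul0n take0 big_ord0.
rewrite big_ord_recr /= -IHi ?(ltnW iK)// mulSn addnC takeD height_cat.
by [].
Qed.

(** The rescaled walk, kept as a step function: [lip] makes sense for discontinuous paths, so no
    interpolation is made. *)
Definition wpath (w : seq bool) (t : R) : R :=
  (height (take (Num.truncn ((size w)%:R * t)) w))%:~R / Num.sqrt (size w)%:R.

Definition step_path (K : nat) (x : nat -> R) (t : R) : R :=
  \sum_(j < Num.truncn (K%:R * t)) x j.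

(** The error [a] is the oscillation within a block; one [2 * K] pays for the [r] letters left over,
    another for the normalisation by the square root of [K * L] instead of that of the length. *)
Lemma block_approximation K L r w (a : R) : (0 < K)%N -> (0 < L)%N -> (r <= K.*2)%N ->
  size w = (K * L + r)%N ->
  (forall i, (i < K)%N -> stays_within a (block L i w)) ->
  sup_close (wpath w)
    (step_path K (fun i => (height (block L i w))%:~R / Num.sqrt (K * L)%:R))
    ((a + 4 * K%:R) / Num.sqrt (size w)%:R).
Proof.
move=> K0 L0 rK sw wa t /andP[t0 t1].
have KR : 0 < K%:R :> R by rewrite ltr0n.
have LR : 0 < L%:R :> R by rewrite ltr0n.
have rR : r%:R <= 2 * K%:R :> R by rewrite -natrM ler_nat mul2n.
have r0 : 0 <= r%:R :> R by [].
have mE : (size w)%:R = K%:R * L%:R + r%:R :> R by rewrite sw natrD natrM.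
have KL0 : 0 < K%:R * L%:R :> R by rewrite mulr_gt0.
have m0 : 0 < (size w)%:R :> R by rewrite mE; lra.
rewrite /wpath /step_path; set p := Num.truncn _; set i := Num.truncn (K%:R * t).
have p0 : 0 <= (size w)%:R * t by rewrite mulr_ge0// ltW.
have i0 : 0 <= K%:R * t by rewrite mulr_ge0// ltW.
have /andP[p1 p2] := truncn_itv p0; have /andP[i1 i2] := truncn_itv i0.
rewrite -/p -/i in p1 p2 i1 i2.
have iK : (i <= K)%N.
  by rewrite -(ler_nat R) (le_trans i1)// -[leRHS]mulr1 ler_pM2l.
have iLp : (i * L <= p)%N.
  rewrite -ltnS -(ltr_nat R) (le_lt_trans _ p2)// natrM mE mulrDl.
  have : 0 <= r%:R * t by rewrite mulr_ge0.
  have : i%:R * L%:R <= K%:R * t * L%:R by rewrite ler_pM2r.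
  by move: p0 i1; clear; lra.
have pm : (p <= size w)%N.
  by rewrite -(ler_nat R) (le_trans p1)// -[leRHS]mulr1 ler_pM2l.
have piL : (p < i.+1 * L + r)%N.
  rewrite -(ltr_nat R) (le_lt_trans p1)// natrD natrM mE mulrDl.
  have : r%:R * t <= r%:R by rewrite ler_piMr.
  have : K%:R * t * L%:R < i.+1%:R * L%:R by rewrite ltr_pM2r.
  by clear; lra.
have a0 : 0 <= a by have /stays_withinP/(_ 0%N) := wa 0%N K0; rewrite take0 normr0.
have local : `|(height (take p w))%:~R - (height (take (i * L) w))%:~R| <= a + 2 * K%:R :> R.
  rewrite -(subnKC iLp) takeD height_cat intrD addrAC subrr add0r.
  have hb (v : seq bool) : `|(height v)%:~R| <= (size v)%:R :> R.
    rewrite -intr_norm (_ : (size v)%:R = (size v)%:Z%:~R)// ler_int.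
    exact: height_bound.
  have [iKlt|Ki] := ltnP i K; last first.
    apply: le_trans (hb _) _; apply: (@le_trans _ _ r%:R); last by move: a0 rR r0; clear; lra.
    have iE : i = K by apply/eqP; rewrite eqn_leq iK Ki.
    by rewrite ler_nat (leq_trans (size_take_leq _ _))// size_drop sw iE addKn.
  have [pL|Lp] := leqP (p - i * L) L.
    have /stays_withinP/(_ (p - i * L)%N) := wa i iKlt.
    by rewrite /block -take_min (minn_idPl pL); move: KR; clear; lra.
  rewrite -(subnKC (ltnW Lp)) takeD height_cat intrD.
  apply: le_trans (ler_normD _ _) _; apply: lerD.
    have /stays_withinP/(_ L) := wa i iKlt.
    by rewrite /block -take_min minnn.
  apply: le_trans (hb _) _; apply: (@le_trans _ _ r%:R) => //.
  rewrite ler_nat (leq_trans (size_take_leqn _ _))//.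
  by move: piL; rewrite mulSn; clear; lia.
rewrite -mulr_suml.
have hbE : \sum_(j < i) (height (block L j w))%:~R = (height (take (i * L) w))%:~R :> R.
  by rewrite (height_blocks sw iK) (big_morph (fun x : int => x%:~R : R) (@intrD R) (erefl _)).
rewrite hbE {hbE}.
set s := Num.sqrt (size w)%:R; set s' := Num.sqrt (K * L)%:R.
have s0 : 0 < s by rewrite sqrtr_gt0.
have s'0 : 0 < s' by rewrite sqrtr_gt0 natrM.
have s2 : s ^+ 2 = K%:R * L%:R + r%:R by rewrite sqr_sqrtr ?ltW// mE.
have s'2 : s' ^+ 2 = K%:R * L%:R by rewrite sqr_sqrtr ?natrM// ltW.
have s's : s' <= s by rewrite ler_wsqrtr// mE natrM; lra.
have hi : `|(height (take (i * L) w))%:~R| <= s' ^+ 2.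
  rewrite s'2 -natrM -intr_norm (_ : (K * L)%:R = (K * L)%N%:Z%:~R)// ler_int.
  apply: le_trans (height_bound _) _.
  by rewrite lez_nat (leq_trans (size_take_leqn _ _))// leq_mul2r iK orbT.
move: local hi; set x := (height (take p w))%:~R; set y := (height (take (i * L) w))%:~R.
move=> local hi; apply: le_trans (ler_distD (y / s) _ _) _.
have -> : (a + 4 * K%:R) / s = (a + 2 * K%:R) / s + 2 * K%:R / s by rewrite -mulrDl; congr (_ / _); ring.
have si : 0 < s^-1 by rewrite invr_gt0.
have ssi : 0 < (s * s')^-1 by rewrite invr_gt0 mulr_gt0.
have ss : 0 <= s - s' by rewrite subr_ge0.
apply: lerD; first by rewrite -mulrBl normrM (gtr0_norm si) ler_pM2r.
have -> : y / s - y / s' = - (y * (s - s') / (s * s')) by field; rewrite !lt0r_neq0.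
rewrite normrN normrM (gtr0_norm ssi) normrM (ger0_norm ss).
rewrite ler_pdivrMr ?mulr_gt0// mulrA divfK ?lt0r_neq0//.
apply: (@le_trans _ _ (s' ^+ 2 * (s - s'))); first by rewrite ler_wpM2r.
by rewrite expr2 -mulrA mulrC ler_pM2r//; move: s0 s'0 s2 s'2 s's rR; clear; nra.
Qed.

End Blocks.

(** * Discretisation of the increments *)

Section Boxes.
Variables (R : realType) (K J : nat) (delta : R).
Hypotheses (K0 : (0 < K)%N) (delta0 : 0 < delta).

Definition cell_left (j : nat) : R := (j%:R - J%:R) * delta.

Definition in_cell (j : nat) (x : R) : bool := cell_left j < x <= cell_left j + delta.

Definition box_path (b : {ffun 'I_K -> 'I_(J.*2)}) : R -> R :=
  step_path K (fun i => if insub i is Some k then cell_left (b k) else 0).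

(** The boxes are disjoint, so at most one term survives: this is [H] at the corner of the box
    containing the increments [x], and 0 if some increment lies outside all cells. As a finite
    combination of products of indicators it can be averaged factor by factor. *)
Definition box_sum (H : (R -> R) -> R) (x : nat -> R) : R :=
  \sum_(b : {ffun 'I_K -> 'I_(J.*2)}) H (box_path b) * \prod_(i < K) (in_cell (b i) (x i))%:R.

Lemma in_cell_inj (j k : nat) (x : R) : in_cell j x -> in_cell k x -> j = k.
Proof.
rewrite /in_cell /cell_left => /andP[h1 h2] /andP[h3 h4].
have : (j%:R - k%:R - 1) * delta < 0 by lra.
have : (k%:R - j%:R - 1) * delta < 0 by lra.
rewrite !pmulr_llt0// => h5 h6.
have : j%:R < k.+1%:R :> R by rewrite -natr1; lra.
have : k%:R < j.+1%:R :> R by rewrite -natr1; lra.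
by rewrite !ltr_nat; lia.
Qed.

Lemma box_path_close (b : {ffun 'I_K -> 'I_(J.*2)}) (x : nat -> R) :
  (forall i, in_cell (b i) (x i)) ->
  sup_close (box_path b) (step_path K x) (K%:R * delta).
Proof.
move=> bx t /andP[t0 t1].
have KR : 0 < K%:R :> R by rewrite ltr0n.
have i0 : 0 <= K%:R * t by rewrite mulr_ge0// ltW.
rewrite /box_path /step_path; set i := Num.truncn _.
have iK : (i <= K)%N.
  have /andP[i1 _] := truncn_itv i0.
  by rewrite -(ler_nat R) (le_trans i1)// -[leRHS]mulr1 ler_pM2l.
rewrite -sumrB; apply: le_trans (ler_norm_sum _ _ _) _.
apply: (@le_trans _ _ (\sum_(j < i) delta)).
  apply: ler_sum => j _; case: insubP => [k _ kj|]; last by rewrite (leq_trans (ltn_ord j) iK).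
  have := bx k; rewrite /in_cell kj => /andP[h1 h2].
  by rewrite ler0_norm; lra.
by rewrite sumr_const card_ord -[_ *+ _]mulr_natl ler_pM2r// ler_nat.
Qed.

Lemma box_sum_cases H (x : nat -> R) :
  (exists2 b : {ffun 'I_K -> 'I_(J.*2)}, (forall i, in_cell (b i) (x i)) &
     box_sum H x = H (box_path b)) \/ box_sum H x = 0.
Proof.
have [[b hb]|h] := pselect (exists b : {ffun 'I_K -> 'I_(J.*2)}, forall i, in_cell (b i) (x i)).
  left; exists b => //; rewrite /box_sum (bigD1 b)//= [X in _ + X]big1 ?addr0 => [|b' b'b]; last first.
    have [i hi] : exists i, b' i != b i.
      by apply/existsP; rewrite -negb_forall; apply: contraNN b'b => /forallP h; apply/eqP/ffunP => i; exact/eqP.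
    rewrite (bigD1 i)//= (_ : in_cell _ _ = false) ?mul0r ?mulr0//.
    apply/negP => h; move/eqP: hi; apply; apply: val_inj.
    exact: in_cell_inj h (hb i).
  by rewrite big1 ?mulr1// => i _; rewrite hb.
right; rewrite /box_sum big1// => b _.
have [i hi] : exists i, ~~ in_cell (b i) (x i).
  by apply/existsP; rewrite -negb_forall; apply/negP => /forallP hb; apply: h; exists b.
by rewrite (bigD1 i)//= (negbTE hi) mul0r mulr0.
Qed.

Lemma box_sum_le1 H (x : nat -> R) : unit_valued H -> box_sum H x <= 1.
Proof.
by move=> uH; have [[b _ ->]| ->//] := box_sum_cases H x; have /andP[] := uH (box_path b).
Qed.

Lemma box_sum_ub H L (x : nat -> R) (g : R -> R) (c : R) : lip L H -> unit_valued H ->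
  sup_close g (step_path K x) c -> box_sum H x <= H g + L * (c + K%:R * delta).
Proof.
move=> LH uH gx; have L0 := lip_ge0 LH.
have c0 : 0 <= c.
  by have := gx 0; rewrite lexx ler01 => /(_ isT); apply: le_trans.
have /andP[Hg0 _] := uH g.
have Kd0 : 0 <= K%:R * delta by rewrite mulr_ge0// ltW.
have err0 : 0 <= L * (c + K%:R * delta) by rewrite mulr_ge0// addr_ge0.
have [[b hb ->]|->] := box_sum_cases H x; last by rewrite addr_ge0.
have : sup_close (box_path b) g (c + K%:R * delta).
  move=> t t01; apply: le_trans (ler_distD (step_path K x t) _ _) _.
  by rewrite addrC lerD//; [rewrite distrC gx|exact: box_path_close].
by move/LH; rewrite ler_norml => /andP[]; lra.
Qed.

Lemma box_sum_ge0 H (x : nat -> R) : unit_valued H -> 0 <= box_sum H x.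
Proof.
move=> uH; apply: sumr_ge0 => b _; rewrite mulr_ge0 ?prodr_ge0//.
by have /andP[] := uH (box_path b).
Qed.

Lemma box_sum_lb H L (x : nat -> R) (g : R -> R) (c : R) : lip L H -> unit_valued H ->
  (forall i, (i < K)%N -> `|x i| < J%:R * delta) ->
  sup_close g (step_path K x) c -> H g - L * (c + K%:R * delta) <= box_sum H x.
Proof.
move=> LH uH xJ gx.
have hx (i : 'I_K) : exists j : 'I_(J.*2), in_cell j (x i).
  have := xJ i (ltn_ord i); rewrite ltr_norml => /andP[h1 h2].
  pose y := x i / delta + J%:R.
  have y0 : 0 < y by rewrite /y -ltrBlDr sub0r ltr_pdivlMr// mulNr.
  have y1 : y < J.*2%:R.
    by rewrite /y -ltrBrDr ltr_pdivrMr// -addnn natrD addrK.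
  have c0 : 0 < Num.ceil y by rewrite ceil_gt_int.
  have /andP[] := ceil_itv y; case: (Num.ceil y) c0 => [[//|k] _|//].
  rewrite (_ : Posz k.+1 - 1 = k); last by lia.
  rewrite -!pmulrn => ky yk.
  have kJ : (k < J.*2)%N by rewrite -(ltr_nat R) (lt_trans ky).
  exists (Ordinal kJ); rewrite /in_cell /cell_left /=.
  have -> : x i = (y - J%:R) * delta by rewrite /y addrK divfK ?lt0r_neq0.
  rewrite ltr_pM2r// ltrD2r ky /= -lerBlDl -mulrBl -[leRHS]mul1r ler_pM2r//.
  by move: yk; rewrite -natr1; clear; lra.
have [b hb] := choice hx.
pose b' := [ffun i => b i].
have hb' i : in_cell (b' i) (x i) by rewrite ffunE.
rewrite /box_sum (bigD1 b')//= big1 => [|i _]; last by rewrite hb'.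
have : sup_close (box_path b') g (c + K%:R * delta).
  move=> t t01; apply: le_trans (ler_distD (step_path K x t) _ _) _.
  by rewrite addrC lerD//; [rewrite distrC gx|exact: box_path_close].
move/LH; rewrite mulr1 ler_norml => /andP[h1 h2].
have : 0 <= \sum_(i | i != b') H (box_path i) * \prod_(j < K) (in_cell (i j) (x j))%:R.
  by apply: sumr_ge0 => b1 _; rewrite mulr_ge0 ?prodr_ge0//; have /andP[] := uH (box_path b1).
by lra.
Qed.

End Boxes.

(** * Central limit theorem *)

Section CentralLimit.
Variable R : realType.

Lemma large_nat (x : R) : exists N : nat, forall n, (N <= n)%N -> x <= n%:R.
Proof.
exists (Num.truncn x).+1 => n Nn; apply: (@le_trans _ _ (Num.truncn x).+1%:R).
  by rewrite ltW// truncnS_gt.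
by rewrite ler_nat.
Qed.

Lemma large_sqrt (x : R) : exists N : nat, forall n, (N <= n)%N -> x <= Num.sqrt n%:R.
Proof.
have [N hN] := large_nat (x ^+ 2); exists N => n /hN h.
have [x0|x0] := leP x 0; first by rewrite (le_trans x0)// sqrtr_ge0.
by apply: le_trans (ler_wsqrtr h); rewrite sqrtr_sqr ger0_norm// ltW.
Qed.

Lemma central_limit (sigma a b eta : R) : 0 < sigma -> a <= b -> 0 < eta ->
  exists N : nat, forall n, (N <= n)%N ->
    normal_cdf sigma b - normal_cdf sigma a - eta <=
    mean n.*2 (fun w => (a < sigma * (height w)%:~R / Num.sqrt n.*2%:R <= b)%R%:R).
Proof.
move=> s0 ab e0.
have [B [B1 Be Ba Bb]] : exists B : R, [/\ 1 <= B, (4 * B ^+ 2)^-1 <= eta / 2,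
   `|a| <= 2 * sigma * (B - 1) & `|b| <= 2 * sigma * (B - 1)].
  pose B := 1 + (eta / 2)^-1 + `|a| / (2 * sigma) + `|b| / (2 * sigma).
  have h1 : 0 < (eta / 2)^-1 by rewrite invr_gt0 divr_gt0.
  have h2 : 0 <= `|a| / (2 * sigma) by rewrite divr_ge0// mulr_ge0// ltW.
  have h3 : 0 <= `|b| / (2 * sigma) by rewrite divr_ge0// mulr_ge0// ltW.
  have s20 : 0 < 2 * sigma by rewrite mulr_gt0.
  exists B; split.
  - by rewrite /B; lra.
  - rewrite -[leRHS]invrK lef_pV2 ?posrE//.
      have : (eta / 2)^-1 <= B by rewrite /B; lra.
      have : 1 <= B by rewrite /B; lra.
      by move: (B) ((eta / 2)^-1) h1; clear; move=> x y; nra.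
    by rewrite mulr_gt0// exprn_gt0//; rewrite /B; lra.
  - by rewrite mulrC -ler_pdivrMr//; rewrite /B; lra.
  - by rewrite mulrC -ler_pdivrMr//; rewrite /B; lra.
pose C := 2 * sigma * peak sigma + 256 * B ^+ 3 + 20 * B.
have [N hN] := large_sqrt (Num.max (8 * B) (Num.max 1 (C / (eta / 2)))).
exists N => n Nn; have /hN : (N <= n.*2)%N by rewrite (leq_trans Nn)// -addnn leq_addr.
rewrite !ge_max => /and3P[sB s1 sC].
have sq0 : 0 < Num.sqrt n.*2%:R :> R by apply: lt_le_trans s1.
have := @de_moivre_laplace_bound R sigma s0 n a b B (Num.sqrt n.*2%:R) ab sq0.
rewrite sqr_sqrtr// => /(_ erefl B1 Ba Bb sB); apply: le_trans.
rewrite -/C; have : C / Num.sqrt n.*2%:R <= eta / 2.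
  by rewrite ler_pdivrMr// mulrC -ler_pdivrMr// divr_gt0.
by move: Be; clear; lra.
Qed.

End CentralLimit.

Lemma mean_blocks_ord (R : realType) K L r (f : 'I_K -> seq bool -> R) :
  mean (K * L + r) (fun w => \prod_(i < K) f i (block L i w)) = \prod_(i < K) mean L (f i).
Proof.
have := @mean_blocks R K L r (fun j => if insub j is Some i then f i else fun=> 0).
rewrite (eq_mean (G := fun w => \prod_(i < K) f i (block L i w))) => [->|w _];
  by apply: eq_bigr => i _; rewrite valK.
Qed.

(** * Comparison of Brownian motion with the walk *)

Section Donsker.
Context (d : measure_display) (T : measurableType d) (R : realType)
  (Q : probability T R) (W : T -> R -> R).
Hypothesis BM : standard_brownian_motion Q W.

Lemma brownian_measurable (t : R) : 0 <= t -> measurable_fun setT (W ^~ t).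
Proof. by have [h _ _ _] := BM; exact: h. Qed.

Lemma brownian_cont01 w : cont01 (W w).
Proof.
have [_ _ h _] := BM; apply: within_cont01.
apply: continuous_subspaceW (h w) => t /=; rewrite !in_itv/= => /andP[->]//.
Qed.

Lemma brownian0 w : W w 0 = 0.
Proof. by have [_ h _ _] := BM. Qed.

Definition increment (K i : nat) (w : T) : R := W w (i.+1%:R / K%:R) - W w (i%:R / K%:R).

Lemma measurable_increment K i : measurable_fun setT (increment K i).
Proof. by apply: measurable_funB; apply: brownian_measurable; rewrite divr_ge0. Qed.

Lemma measurable_in_cell (J : nat) (delta : R) (K i j : nat) :
  measurable [set w | in_cell J delta j (increment K i w)].
Proof.
rewrite (_ : [set w | _] = increment K i @^-1`
   `]cell_left J delta j, cell_left J delta j + delta]%classic); last first.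
  by apply/seteqP; split => w; rewrite /= in_itv.
by rewrite -[X in measurable X]setTI; apply: measurable_increment.
Qed.

Lemma indic_prod_cells (J : nat) (delta : R) (K : nat) (b : 'I_K -> nat) :
  (fun w => \prod_(i < K) (in_cell J delta (b i) (increment K i w))%:R : R) =
  \1_(\bigcap_(i in [set: 'I_K]) [set w | in_cell J delta (b i) (increment K i w)]).
Proof.
apply/funext => w; rewrite indicE.
have [h|h] := pselect (forall i : 'I_K, in_cell J delta (b i) (increment K i w)).
  rewrite big1; first by rewrite mem_set// => i _; exact: h.
  by move=> i _; rewrite h.
rewrite memNset; last by move=> h'; apply: h => i; exact: h'.
have [i hi] : exists i : 'I_K, ~~ in_cell J delta (b i) (increment K i w).
  by apply: contrapT => h'; apply: h => i; apply: contrapT => /negP hi; apply: h'; exists i.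
by rewrite (bigD1 i)//= (negbTE hi) mul0r.
Qed.

Lemma bm_prod_cells (J : nat) (delta : R) (K : nat) (b : 'I_K -> nat) :
  bounded_measurable (fun w => \prod_(i < K) (in_cell J delta (b i) (increment K i w))%:R : R).
Proof.
rewrite indic_prod_cells; apply: bm_indic.
by apply: fin_bigcap_measurable => // i _; exact: measurable_in_cell.
Qed.

Lemma ex_prod_cells (J : nat) (delta : R) (K : nat) (b : 'I_K -> nat) : (0 < K)%N -> 0 <= delta ->
  ex Q (fun w => \prod_(i < K) (in_cell J delta (b i) (increment K i w))%:R) =
  \prod_(i < K) (normal_cdf (Num.sqrt K%:R^-1) (cell_left J delta (b i) + delta) -
                 normal_cdf (Num.sqrt K%:R^-1) (cell_left J delta (b i))).
Proof.
move=> K0 d0; rewrite indic_prod_cells ex_indic; last first.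
  by apply: fin_bigcap_measurable => // i _; exact: measurable_in_cell.
have [_ _ _ h] := BM.
pose A (i : nat) : set R := if insub i is Some k then
   `]cell_left J delta (b k), cell_left J delta (b k) + delta]%classic else setT.
have KR : 0 < K%:R :> R by rewrite ltr0n.
have := h K (fun i => i%:R / K%:R) A; rewrite mul0r lexx => /(_ isT) {}h.
rewrite /pr.
have -> : \bigcap_(i in [set: 'I_K]) [set w | in_cell J delta (b i) (increment K i w)] =
  \bigcap_(i in [set i | (i < K)%N])
     [set w | A i (W w (i.+1%:R / K%:R) - W w (i%:R / K%:R))].
  apply/seteqP; split => w /= hw.
    move=> i /= iK; rewrite /A insubT/= in_itv/=.
    exact: (hw (Ordinal iK)).
  move=> i _ /=; have := hw i (ltn_ord i); rewrite /A /=.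
  by rewrite valK /= in_itv.
rewrite h /=.
- apply: eq_bigr => i _; rewrite /A valK -mulrBl -natr1 addrAC subrr add0r mul1r.
  by rewrite -normal_cdfB ?lerDl.
- by move=> i _; rewrite ltr_pM2r ?invr_gt0// ltr_nat.
- by move=> i; rewrite /A; case: insub.
Qed.

Lemma brownian_step_path (K : nat) w : (0 < K)%N -> osc K (W w) < 1 ->
  sup_close (W w) (step_path K (fun i => increment K i w)) (osc K (W w)).
Proof.
case: K => // K _ o1 t t01; rewrite /step_path.
have [iK i01 ti] := trunc_grid K t01; set i := Num.truncn _ in iK i01 ti *.
have -> : \sum_(j < i) increment K.+1 j w = W w (i%:R / K.+1%:R).
  rewrite /increment -(big_mkord xpredT (fun j => W w (j.+1%:R / K.+1%:R) - W w (j%:R / K.+1%:R))).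
  by rewrite telescope_sumr// mul0r brownian0 subr0.
have : near_pairs K.+1 (t, i%:R / K.+1%:R).
  by split => //=; rewrite ger0_norm; case/andP: ti.
by move/(osc_ub (W w)) => /=; rewrite ge_min leNgt o1.
Qed.

Lemma measurable_lip (L : R) (H : (R -> R) -> R) : lip L H ->
  measurable_fun setT (fun w => H (W w)).
Proof.
move=> LH; apply: measurable_functional LH => [t /andP[t0 _]|w].
  exact: brownian_measurable.
exact: brownian_cont01.
Qed.

Lemma bm_lip (L : R) (H : (R -> R) -> R) : lip L H -> unit_valued H ->
  bounded_measurable (fun w => H (W w)).
Proof.
move=> LH uH; split; first exact: measurable_lip LH.
by exists 1 => w; have /andP[h0 h1] := uH (W w); rewrite ger0_norm.
Qed.

Lemma brownian_boxes (L : R) (H : (R -> R) -> R) (e : R) : lip L H -> unit_valued H -> 0 < e ->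
  exists K0 : nat, forall K, (K0 <= K)%N -> (0 < K)%N -> forall delta, 0 < delta ->
  exists J : nat, ex Q (fun w => H (W w)) <= ex Q (fun w => box_sum K J delta H (fun i => increment K i w))
       + L * (K%:R * delta) + (L + 1) * e + e.
Proof.
move=> LH uH e0.
have L0 := lip_ge0 LH.
have [K0 hK0] := @ex_cvg0 _ T R Q (fun K w => osc K (W w)) 1
  (fun K => measurable_lip (@osc_lip R K))
  (fun w eps e0 => let: ex_intro N hN := osc_cvg0 (brownian_cont01 w) e0 in
     ex_intro _ N (fun n Nn => eq_rect_r (fun x => x <= eps) (hN n Nn) (ger0_norm (osc_ge0 n (W w)))))
  (fun K w => eq_rect_r (fun x => x <= 1) (osc_le1 K (W w)) (ger0_norm (osc_ge0 K (W w)))) e e0.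
exists K0 => K KK0 K1 delta d0.
have {hK0} oe : ex Q (fun w => osc K (W w)) <= e.
  by have := hK0 K KK0; rewrite ger0_norm// ex_ge0// => w; exact: osc_ge0.
pose S w := \sum_(i < K) `|increment K i w|.
have S0 w : 0 <= S w by apply: sumr_ge0.
have mS : measurable_fun setT S.
  apply: measurable_sum => i; apply: measurableT_comp => //.
  exact: measurable_increment.
(* Equal to 1 as soon as an increment leaves the boxes, and tending to 0 with [J]: dominated
   convergence replaces a Gaussian tail estimate. *)
pose tail J w := Num.min 1 (S w / (J.+1%:R * delta)).
have tail0 J w : 0 <= tail J w.
  by rewrite /tail le_min ler01 divr_ge0// mulr_ge0// ltW.
have tail1 J w : `|tail J w| <= 1.
  by rewrite ger0_norm// /tail ge_min lexx.
have mtail J : measurable_fun setT (tail J).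
  by apply: measurable_minr => //; apply: measurable_funM.
have [J0 hJ0] : exists J0, forall J, (J0 <= J)%N -> `|ex Q (tail J)| <= e.
  apply: (@ex_cvg0 _ T R Q tail 1 mtail _ tail1 e e0) => w eps eps0.
  have [N hN] := large_nat (S w / (eps * delta)).
  exists N => n Nn; rewrite ger0_norm// /tail ge_min; apply/orP; right.
  have := hN n.+1 (leqW Nn).
  rewrite ler_pdivrMr ?mulr_gt0// => h.
  by rewrite ler_pdivrMr ?mulr_gt0//; apply: le_trans h _; rewrite mulrCA.
exists J0.+1.
have bH := bm_lip LH uH.
have bO : bounded_measurable (fun w => osc K (W w)).
  split; first exact: measurable_lip (@osc_lip R K).
  by exists 1 => w; rewrite ger0_norm ?osc_ge0 ?osc_le1.
have bT : bounded_measurable (tail J0) by split => //; exists 1 => w.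
have bB : bounded_measurable (fun w => box_sum K J0.+1 delta H (fun i => increment K i w)).
  by apply: bm_sum => b; apply: bmZ; exact: bm_prod_cells.
apply: (@le_trans _ _ (ex Q (fun w => (box_sum K J0.+1 delta H (fun i => increment K i w) +
   L * (K%:R * delta)) + ((L + 1) * osc K (W w) + tail J0 w)))).
  apply: le_ex => //.
    by do ?apply: bmD => //; [exact: bm_cst|exact: bmZ].
  move=> w; have /andP[_ H1] := uH (W w).
  have B0 := @box_sum_ge0 R K J0.+1 delta H (fun i => increment K i w) uH.
  have o0 := osc_ge0 K (W w); have t0 := tail0 J0 w.
  have Kd : 0 <= L * (K%:R * delta) by rewrite mulr_ge0// mulr_ge0// ltW.
  have Lo : 0 <= L * osc K (W w) by rewrite mulr_ge0.
  case: (leP 1 (osc K (W w))) => o1.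
    by move: B0 Kd H1 Lo o1 t0; clear; lra.
  have [h|h] := pselect (forall i, (i < K)%N -> `|increment K i w| < J0.+1%:R * delta).
    have := box_sum_lb K1 d0 LH uH h (brownian_step_path K1 o1).
    by move: o0 t0; clear; lra.
  have [i [iK hi]] : exists i, (i < K)%N /\ J0.+1%:R * delta <= `|increment K i w|.
    apply: contrapT => h'; apply: h => i iK; rewrite ltNge; apply/negP => hi.
    by apply: h'; exists i.
  have : 1 <= tail J0 w.
    rewrite /tail le_min lexx /= ler_pdivlMr ?mulr_gt0// mul1r (le_trans hi)//.
    by rewrite /S (bigD1 (Ordinal iK))//= lerDl sumr_ge0.
  by move: B0 Kd H1 Lo o0; clear; lra.
rewrite exD; last 2 first.
- by apply: bmD => //; exact: bm_cst.
- by apply: bmD => //; exact: bmZ.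
rewrite exD//; last exact: bm_cst.
rewrite exD//; last exact: bmZ.
rewrite ex_cst exZ//.
have h1 := hJ0 J0 (leqnn _); rewrite ger0_norm in h1; last exact: ex_ge0.
have : (L + 1) * ex Q (fun w => osc K (W w)) <= (L + 1) * e.
  by rewrite ler_wpM2l// addr_ge0.
by move: h1; clear; lra.
Qed.

(** For fixed [K], [J] and [delta] only finitely many instances of the central limit theorem are
    involved. Blocks have even length because that theorem is stated for even lengths. *)
Lemma walk_boxes (L : R) (H : (R -> R) -> R) (K J : nat) (delta e : R) :
  lip L H -> unit_valued H -> (0 < K)%N -> 0 < delta -> 0 < e ->
  exists N0 : nat, forall N, (N0 <= N)%N ->
    ex Q (fun w => box_sum K J delta H (fun i => increment K i w)) - e <=
    mean N.*2 (fun w => box_sum K J delta H (fun i =>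
       (height (block (N %/ K).*2 i w))%:~R / Num.sqrt (K * (N %/ K).*2)%:R)).
Proof.
move=> LH uH K0 d0 e0.
have KR : 0 < K%:R :> R by rewrite ltr0n.
pose sigma : R := Num.sqrt K%:R^-1.
have sigma0 : 0 < sigma by rewrite sqrtr_gt0 invr_gt0.
pose cell j := normal_cdf sigma (cell_left J delta j + delta) - normal_cdf sigma (cell_left J delta j).
have cell01 j : 0 <= cell j <= 1.
  apply/andP; split.
    by rewrite subr_ge0; apply: normal_cdf_homo => //; rewrite lerDl ltW.
  rewrite /cell lerBlDr.
  by rewrite (le_trans (normal_cdf_le1 _ _))// lerDl normal_cdf_ge0.
pose M := #|{ffun 'I_K -> 'I_(J.*2)}|.
(* Each of the [M] boxes costs [K * eta] by [prod_ge_sum_error]; the [+ 1] keeps the denominator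
   positive. *)
pose eta := e / (M%:R * K%:R + 1).
have eta0 : 0 < eta.
  by rewrite divr_gt0// ltr_wpDl// mulr_ge0.
have hcell (j : 'I_(J.*2)) : exists N, forall n, (N <= n)%N -> cell j - eta <=
    mean n.*2 (fun w => (cell_left J delta j < sigma * (height w)%:~R / Num.sqrt n.*2%:R
          <= cell_left J delta j + delta)%R%:R).
  by apply: central_limit => //; rewrite lerDl ltW.
have [N_ hN_] := choice hcell.
pose N1 := \max_(j < J.*2) N_ j.
exists (N1 * K)%N => N NN.
have N1l : (N1 <= N %/ K)%N by rewrite leq_divRL.
set l := (N %/ K)%N in N1l *.
have NE : N.*2 = (K * l.*2 + (N %% K).*2)%N.
  by rewrite {1}(divn_eq N K) -/l mulnC; lia.
rewrite /box_sum ex_sum; last by move=> b; apply: bmZ; exact: bm_prod_cells.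
rewrite mean_sum lerBlDr.
have -> : e = M%:R * K%:R * eta + eta.
  by rewrite /eta; field; rewrite gt_eqF// ltr_wpDl// mulr_ge0.
apply: (@le_trans _ _ (\sum_(b : {ffun 'I_K -> 'I_(J.*2)}) (mean N.*2 (fun w => H (box_path delta b) *
   \prod_(i < K) (in_cell J delta (b i) ((height (block l.*2 i w))%:~R / Num.sqrt (K * l.*2)%:R))%:R)
   + K%:R * eta))).
  apply: ler_sum => b _.
  rewrite exZ; last exact: bm_prod_cells.
  rewrite ex_prod_cells//; last exact: ltW.
  rewrite meanZ NE.
  rewrite (mean_blocks_ord l.*2 (N %% K).*2 (fun i v => (in_cell J delta (b i) ((height v)%:~R / Num.sqrt (K * l.*2)%:R))%:R)).
  pose P (i : 'I_K) : R := mean l.*2 (fun v => (in_cell J delta (b i) ((height v)%:~R / Num.sqrt (K * l.*2)%:R))%:R).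
  have P01 i : 0 <= P i <= 1.
    rewrite mean_ge0//= -[leRHS](mean_cst l.*2); apply: le_mean => w _.
    by case: in_cell.
  have cP i : cell (b i) - eta <= P i.
    have N_l : (N_ (b i) <= l)%N by apply: leq_trans N1l; exact: leq_bigmax.
    apply: le_trans (hN_ (b i) l N_l) _; rewrite le_eqVlt; apply/orP; left; apply/eqP.
    apply: eq_mean => w _; rewrite /in_cell.
    have -> // : sigma * (height w)%:~R / Num.sqrt l.*2%:R = (height w)%:~R / Num.sqrt (K * l.*2)%:R.
    by rewrite natrM sqrtrM// invfM /sigma sqrtrV// mulrA [_ * (height w)%:~R]mulrC.
  have := prod_ge_sum_error (index_enum 'I_K) (ltW eta0) P01 (fun i => cell01 (b i)) cP.
  have -> : size (index_enum 'I_K) = K by rewrite -[RHS]card_ord cardT enumT.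
  have /andP[H0 H1] := uH (box_path delta b).
  have X0 : 0 <= \prod_(i <- index_enum 'I_K) P i.
    by apply: prodr_ge0 => i _; have /andP[] := P01 i.
  have Ke : 0 <= K%:R * eta by rewrite mulr_ge0// ltW.
  move: (H _) H0 H1 X0 Ke => h h0 h1.
  set X := \prod_(i <- _) P i; set Y := \prod_(i <- _) cell _; set Z := K%:R * eta.
  move=> X0 Z0 YX; rewrite -lerBlDr; apply: (@le_trans _ _ (h * (Y - Z))).
    by rewrite mulrBr lerD2l lerN2 ler_piMl.
  by rewrite ler_wpM2l.
rewrite big_split /= lerD2l sumr_const -[leLHS]mulr_natl -/M mulrA lerDl.
exact: ltW.
Qed.

(** The fourth-moment bound makes the probability that one of the [K] blocks oscillates too much of
    order [1 / K]; a variance bound would only give order 1. *)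
Lemma walk_box_sum_ub (L : R) (H : (R -> R) -> R) (K J : nat) (delta lam e : R) :
  lip L H -> unit_valued H -> (0 < K)%N -> 0 < delta -> 0 < lam -> 0 < e ->
  96 / (lam ^+ 4 * K%:R) <= e ->
  exists N0 : nat, forall N, (N0 <= N)%N ->
    mean N.*2 (fun w => box_sum K J delta H (fun i =>
       (height (block (N %/ K).*2 i w))%:~R / Num.sqrt (K * (N %/ K).*2)%:R)) <=
    mean N.*2 (fun w => H (wpath w)) + L * (K%:R * delta) + L * (2 * lam) + e.
Proof.
move=> LH uH K0 d0 lam0 e0 Ke; have L0 := lip_ge0 LH.
have KR : 0 < K%:R :> R by rewrite ltr0n.
have [N1 hN1] := large_sqrt (Num.max (2 / lam) (4 * K%:R / lam)).
exists (maxn N1 K) => N; rewrite geq_max => /andP[N1N KN].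
set l := (N %/ K)%N.
have l0 : (0 < l)%N by rewrite divn_gt0.
have NE : N.*2 = (K * l.*2 + (N %% K).*2)%N.
  by rewrite {1}(divn_eq N K) -/l mulnC; lia.
have rK : ((N %% K).*2 <= K.*2)%N by rewrite leq_double ltnW// ltn_mod.
have NN2 : (N1 <= N.*2)%N by rewrite (leq_trans N1N)// -addnn leq_addr.
have := hN1 _ NN2; rewrite ge_max => /andP[].
set s := Num.sqrt N.*2%:R => s2 s4.
have s0 : 0 < s by apply: lt_le_trans s2; rewrite divr_gt0.
have sE : s ^+ 2 = N.*2%:R by rewrite sqr_sqrtr.
pose a := lam * s.
have a2 : 2 <= a by rewrite /a mulrC -ler_pdivrMr.
have a1 : 1 < a by rewrite (lt_le_trans _ a2)// ltr1n.
pose bad w : R := \sum_(i < K) (~~ stays_within a (block l.*2 i w))%:R.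
apply: (@le_trans _ _ (mean N.*2 (fun w => H (wpath w) + (L * (2 * lam + K%:R * delta) + bad w)))).
  apply: le_mean => w sw.
  have bad0 : 0 <= bad w by apply: sumr_ge0.
  have [h|h] := pselect (forall i, (i < K)%N -> stays_within a (block l.*2 i w)).
    have l20 : (0 < l.*2)%N by rewrite double_gt0.
    have swE : size w = (K * l.*2 + (N %% K).*2)%N by rewrite sw.
    have := @box_sum_ub R K J delta K0 d0 H L _ _ _ LH uH (block_approximation K0 l20 rK swE h).
    rewrite sw -/s => hb; apply: le_trans hb _; rewrite lerD2l.
    apply: (@le_trans _ _ (L * (2 * lam + K%:R * delta))); last by rewrite lerDl.
    rewrite ler_wpM2l// lerD2r ler_pdivrMr// /a.
    have : 4 * K%:R <= lam * s by rewrite [leRHS]mulrC -ler_pdivrMr.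
    by clear; lra.
  have [i [iK hi]] : exists i, (i < K)%N /\ ~~ stays_within a (block l.*2 i w).
    apply: contrapT => h'; apply: h => i iK; apply: contrapT => /negP hi.
    by apply: h'; exists i.
  have : 1 <= bad w.
    by rewrite /bad (bigD1 (Ordinal iK))//= hi lerDl sumr_ge0.
  have /andP[Hw0 _] := uH (wpath w).
  have : box_sum K J delta H (fun i => (height (block l.*2 i w))%:~R / Num.sqrt (K * l.*2)%:R) <= 1.
    exact: box_sum_le1.
  have : 0 <= L * (2 * lam + K%:R * delta).
    by rewrite mulr_ge0// addr_ge0// mulr_ge0// ltW.
  by move: Hw0; clear; lra.
rewrite meanD meanD mean_cst -!addrA lerD2l addrA [L * (_ * delta) + _]addrC -mulrDr lerD2l.
rewrite /bad mean_sum; apply: le_trans Ke.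
apply: (@le_trans _ _ (\sum_(i < K) (6 * l.*2%:R ^+ 2 / (a - 1) ^+ 4))).
  apply: ler_sum => i _.
  rewrite NE (mean_block l.*2 (N %% K).*2 (fun v => (~~ stays_within a v)%:R) i).
  exact: mean_stays_within.
rewrite sumr_const card_ord -[leLHS]mulr_natl.
have lR : 0 <= l.*2%:R :> R by [].
(* Halving [a] turns the constant 6 of [mean_stays_within] into [6 * 2^4 = 96]. *)
have a4 : (a / 2) ^+ 4 <= (a - 1) ^+ 4 by apply: lerXn2r; rewrite ?nnegrE; move: a2; clear; lra.
have a0 : 0 < a by move: a2; clear; lra.
apply: (@le_trans _ _ (K%:R * (6 * l.*2%:R ^+ 2 / (a / 2) ^+ 4))).
  rewrite ler_pM2l// ler_wpM2l ?mulr_ge0 ?sqr_ge0// lef_pV2// posrE exprn_gt0//; last by rewrite divr_gt0.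
  by move: a2; clear; lra.
have sKl : K%:R * l.*2%:R <= s ^+ 2 by rewrite sE NE natrD natrM lerDl.
have -> : K%:R * (6 * l.*2%:R ^+ 2 / (a / 2) ^+ 4) =
   96 / (lam ^+ 4 * K%:R) * ((K%:R * l.*2%:R) ^+ 2 / (s ^+ 2) ^+ 2).
  by rewrite /a; field; rewrite !lt0r_neq0.
rewrite ler_piMr//; first by rewrite divr_ge0// ltW// mulr_gt0// exprn_gt0.
rewrite ler_pdivrMr ?mul1r; last by rewrite !exprn_gt0.
have Kl0 : 0 <= K%:R * l.*2%:R :> R by exact: mulr_ge0 (ltW KR) lR.
by apply: lerXn2r => //; exact: sqr_ge0.
Qed.

(** Parameters are chosen in the order [K] (oscillation of Brownian motion and bad blocks), [delta]
    of order [1 / K], [J] (large increments), and finally [N]. The opposite bound follows by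
    applying this one to [1 - H]. *)
Theorem donsker_liminf (L : R) (H : (R -> R) -> R) (eps : R) :
  lip L H -> unit_valued H -> 0 < eps ->
  exists N0 : nat, forall N, (N0 <= N)%N ->
    ex Q (fun w => H (W w)) - eps <= mean N.*2 (fun w => H (wpath w)).
Proof.
move=> LH uH eps0; have L0 := lip_ge0 LH.
pose e := eps / 10; have e0 : 0 < e by rewrite divr_gt0.
pose e1 := e / (L + 1); have L1 : 0 < L + 1 by rewrite ltr_wpDl.
have e10 : 0 < e1 by rewrite divr_gt0.
have Le1 : (L + 1) * e1 = e by rewrite /e1 mulrC divfK// lt0r_neq0.
have Le1' : L * e1 <= e by rewrite -Le1 ler_pM2r// lerDl.
have [K1 hK1] := brownian_boxes LH uH e10.
have [K2 hK2] := large_nat (96 / (e1 ^+ 4 * e)).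
pose K := (maxn K1 K2).+1.
have K1K : (K1 <= K)%N by rewrite leqW// leq_maxl.
have K0 : (0 < K)%N by [].
have KR : 0 < K%:R :> R by [].
pose delta := e1 / K%:R; have d0 : 0 < delta by rewrite divr_gt0.
have Kd : K%:R * delta = e1 by rewrite /delta mulrC divfK// lt0r_neq0.
have [J hJ] := hK1 K K1K K0 delta d0.
have [N1 hN1] := @walk_boxes L H K J delta e LH uH K0 d0 e0.
have Ke : 96 / (e1 ^+ 4 * K%:R) <= e.
  have := hK2 K (leqW (leq_maxr _ _)).
  have e14 : 0 < e1 ^+ 4 by rewrite exprn_gt0.
  rewrite ler_pdivrMr; last exact: mulr_gt0.
  move=> h; rewrite ler_pdivrMr; last exact: mulr_gt0.
  by apply: le_trans h _; rewrite mulrCA [K%:R * e]mulrC mulrCA.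
have [N2 hN2] := @walk_box_sum_ub L H K J delta e1 e LH uH K0 d0 e10 e0 Ke.
exists (maxn N1 N2) => N; rewrite geq_max => /andP[/hN1 h1 /hN2 h2].
rewrite Kd in hJ h2; rewrite Le1 in hJ.
have e1e : e1 <= e by rewrite /e1 ler_pdivrMr// ler_pMr// lerDr.
have -> : eps = 10 * e by rewrite /e; field.
move: hJ h1 h2 Le1' e0 e1e; rewrite [L * (2 * e1)]mulrCA.
move: (ex Q _) (ex Q _) (mean _ _) (mean _ _) (L * e1) => x1 x2 x3 x4 x5.
by clear; lra.
Qed.

End Donsker.

(** * From conditioned walks to Dyck paths *)

Section LipFunctionals.
Variable R : realType.
Implicit Types (f g : R -> R) (H : (R -> R) -> R).

Lemma lipM L L' H H' : lip L H -> lip L' H' -> unit_valued H -> unit_valued H' ->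
  lip (L + L') (fun g => H g * H' g).
Proof.
move=> LH LH' uH uH' f g c fg.
have h1 := LH _ _ _ fg; have h2 := LH' _ _ _ fg.
have /andP[a0 a1] := uH f; have /andP[b0 b1] := uH' g.
have -> : H f * H' f - H g * H' g = H f * (H' f - H' g) + (H f - H g) * H' g by ring.
rewrite (le_trans (ler_normD _ _))// [leRHS]mulrDl [leLHS]addrC !normrM.
rewrite (ger0_norm a0) (ger0_norm b0) lerD//.
- by apply: le_trans h1; rewrite ler_piMr.
- by apply: le_trans h2; rewrite ler_piMl.
Qed.

Lemma unit_valuedM H H' : unit_valued H -> unit_valued H' -> unit_valued (fun g => H g * H' g).
Proof.
move=> uH uH' f; have /andP[a0 a1] := uH f; have /andP[b0 b1] := uH' f.
by rewrite mulr_ge0//= mulr_ile1.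
Qed.

Lemma lipC L H : lip L H -> lip L (fun g => 1 - H g).
Proof.
move=> LH f g c fg; have := LH _ _ _ fg; rewrite distrC.
by have -> : 1 - H f - (1 - H g) = H g - H f by ring.
Qed.

Lemma unit_valuedC H : unit_valued H -> unit_valued (fun g => 1 - H g).
Proof. by move=> uH f; have /andP[a0 a1] := uH f; rewrite subr_ge0 a1 lerBlDr lerDl. Qed.

Definition clamp (x : R) : R := Num.max 0 (Num.min 1 x).

Lemma clamp_ge0 x : 0 <= clamp x. Proof. by rewrite /clamp le_max lexx. Qed.
Lemma clamp_le1 x : clamp x <= 1. Proof. by rewrite /clamp ge_max ler01 ge_min lexx. Qed.
Lemma clamp1 x : 1 <= x -> clamp x = 1.
Proof. by move=> x1; rewrite /clamp min_l// max_r. Qed.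
Lemma clamp0 x : x <= 0 -> clamp x = 0.
Proof. by move=> x0; rewrite /clamp min_r ?max_l// (le_trans x0). Qed.
Lemma clamp_id x : 0 <= x <= 1 -> clamp x = x.
Proof. by move=> /andP[x0 x1]; rewrite /clamp min_r// max_r. Qed.

Lemma clamp_homo : {homo clamp : x y / x <= y}.
Proof.
move=> x y xy; rewrite /clamp ge_max !le_max lexx /= orbC.
by rewrite !le_min !ge_min lexx /= xy !orbT.
Qed.

Lemma clamp_lip x y : `|clamp x - clamp y| <= `|x - y|.
Proof.
wlog xy : x y / x <= y => [hw|].
  by have [/hw//|/ltW/hw] := leP x y; rewrite distrC [leRHS]distrC.
rewrite distrC [leRHS]distrC !ger0_norm ?subr_ge0//; last exact: clamp_homo.
have [x1|x1] := leP 1 x; first by rewrite (clamp1 x1) (clamp1 (le_trans x1 xy)) subrr subr_ge0.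
have [x0|x0] := leP x 0.
  rewrite (clamp0 x0) subr0 /clamp ge_max subr_ge0 xy /= ge_min.
  by apply/orP; right; rewrite lerDl oppr_ge0.
rewrite (@clamp_id x) ?(ltW x0) ?(ltW x1)// lerD2r /clamp ge_max ge_min lexx orbT andbT.
by rewrite (le_trans (ltW x0)).
Qed.

(* [lev g < r] is, for [0 < r <= 1], the conditioning event of
   [brownian_excursion] at level [r], as a sublevel set of a Lipschitz
   functional. *)
Definition lev g : R :=
  sup [set Num.min 1 (Num.max (- g t) `|g 1|) | t in `[0, 1]].

Lemma mem01 (t : R) : (`[0, 1]%classic : set R) t <-> 0 <= t <= 1.
Proof. by rewrite /= in_itv. Qed.

Lemma set01_neq0 : (`[0, 1]%classic : set R) !=set0.
Proof. by exists 0; rewrite mem01 lexx ler01. Qed.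

Lemma lev_ub g (t : R) : 0 <= t <= 1 -> Num.min 1 (Num.max (- g t) `|g 1|) <= lev g.
Proof.
move=> t01; apply: (@sup_image_ub _ _ _ (fun t => Num.min 1 (Num.max (- g t) `|g 1|))).
  exact/mem01.
by move=> ? _; rewrite ge_min lexx.
Qed.

Lemma lev_le g (c : R) : (forall t, 0 <= t <= 1 -> - g t <= c) -> `|g 1| <= c -> lev g <= c.
Proof.
move=> h1 h2; apply: sup_image_le; first exact: set01_neq0.
by move=> t /mem01 t01; rewrite ge_min ge_max h1// h2 orbT.
Qed.

Lemma lev_lip : lip 1 lev.
Proof.
move=> f g c fg; rewrite mul1r.
have aux f' g' : sup_close f' g' c -> lev f' <= lev g' + c.
  move=> fg'; apply: le_sup_image; [exact: set01_neq0|by move=> p _; rewrite ge_min lexx|].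
  move=> t /mem01 t01; have h1 := fg' _ t01.
  have h2 := fg' 1; rewrite ler01 lexx in h2; have {}h2 := h2 isT.
  have c0 : 0 <= c by exact: le_trans h1.
  rewrite addr_minl le_min !ge_min lerDl c0 /= ge_max addr_maxl !le_max.
  apply/orP; right; apply/andP; split; apply/orP; [left|right].
    by move: h1; rewrite ler_norml => /andP[]; rlra.
  by rewrite -lerBlDl (le_trans (lerB_dist _ _)).
have gf : sup_close g f c by move=> t t01; rewrite distrC fg.
by have h1 := aux _ _ fg; have h2 := aux _ _ gf; rewrite ler_norml; apply/andP; split; rlra.
Qed.

Definition cutoff (r r' : R) g : R := clamp ((r' - lev g) / (r' - r)).

Lemma cutoff_lip r r' : r < r' -> lip (r' - r)^-1 (cutoff r r').
Proof.
move=> rr f g c fg; apply: le_trans (clamp_lip _ _) _.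
have rr0 : 0 < (r' - r)^-1 by rewrite invr_gt0 subr_gt0.
rewrite -mulrBl normrM (gtr0_norm rr0) mulrC ler_pM2l//.
have -> : r' - lev f - (r' - lev g) = lev g - lev f by ring.
by rewrite distrC; have := lev_lip fg; rewrite mul1r.
Qed.

Lemma cutoff_unit r r' : unit_valued (cutoff r r').
Proof. by move=> g; rewrite clamp_ge0 clamp_le1. Qed.

Lemma cutoff1 r r' g : r < r' -> lev g <= r -> cutoff r r' g = 1.
Proof. by move=> rr lr; rewrite /cutoff clamp1// ler_pdivlMr ?subr_gt0// mul1r lerD2l lerN2. Qed.

Lemma cutoff0 r r' g : r < r' -> r' <= lev g -> cutoff r r' g = 0.
Proof.
move=> rr lr; rewrite /cutoff clamp0// mulr_le0_ge0 ?subr_le0//.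
by rewrite invr_ge0 subr_ge0 ltW.
Qed.

(** Otherwise [q] would grow by a factor [1 + alpha] on each of arbitrarily many subintervals;
    already the linear growth that this implies exceeds [q b]. It stands in for continuity of the
    law of [lev]. *)
Lemma geometric_pigeonhole (q : R -> R) (a b alpha : R) : a < b -> 0 < q a -> 0 < alpha ->
  {homo q : x y / x <= y} ->
  exists r r' : R, [/\ a <= r, r < r', r' <= b & q r' <= (1 + alpha) * q r].
Proof.
move=> ab qa al hq; apply: contrapT => h.
have [n hn] := large_nat (q b / (alpha * q a)).
have aq : 0 < alpha * q a by rewrite mulr_gt0.
pose x (i : nat) : R := a + i%:R * ((b - a) / n.+1%:R).
have st : 0 < (b - a) / n.+1%:R by rewrite divr_gt0// subr_gt0.
have hx (i : nat) : (i <= n.+1)%N -> q a + i%:R * (alpha * q a) <= q (x i).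
  elim: i => [_|i IHi iN]; first by rewrite mul0r addr0 /x mul0r addr0.
  have {IHi} IHi := IHi (ltnW iN).
  have xi : x i < x i.+1 by rewrite /x ltrD2l ltr_pM2r// ltr_nat.
  have axi : a <= x i by rewrite /x lerDl mulr_ge0// ltW.
  have xb : x i.+1 <= b.
    rewrite /x -lerBrDl mulrCA ger_pMr ?subr_gt0//.
    by rewrite ler_pdivrMr// mul1r ler_nat.
  have : (1 + alpha) * q (x i) < q (x i.+1).
    by rewrite ltNge; apply/negP => hc; apply: h; exists (x i), (x i.+1).
  have := hq _ _ axi; rewrite -natr1.
  have : 0 <= i%:R * (alpha * q a) by rewrite mulr_ge0// ltW.
  by move: IHi; clear -al; nra.
have := hx n.+1 (leqnn _).
have -> : x n.+1 = b by rewrite /x; field.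
have := hn n.+1 (leqnSn _); rewrite ler_pdivrMr// => h1 h2.
by move: h1 h2 qa; clear; rlra.
Qed.

End LipFunctionals.

(** * Walks conditioned as Brownian motion is *)

Section ConditionedWalk.
Context (d : measure_display) (T : measurableType d) (R : realType)
  (Q : probability T R) (W : T -> R -> R).
Hypothesis BM : standard_brownian_motion Q W.

Lemma donsker_limsup (L : R) (H : (R -> R) -> R) (eps : R) :
  lip L H -> unit_valued H -> 0 < eps ->
  exists N0 : nat, forall N, (N0 <= N)%N ->
    mean N.*2 (fun w => H (wpath w)) <= ex Q (fun w => H (W w)) + eps.
Proof.
move=> LH uH eps0.
have [N0 hN0] := donsker_liminf BM (lipC LH) (unit_valuedC uH) eps0.
exists N0 => N /hN0.
have bH := bm_lip BM LH uH.
rewrite exB//; last exact: bm_cst.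
rewrite ex_cst.
have -> : mean N.*2 (fun w => 1 - H (wpath w)) = 1 - mean N.*2 (fun w => H (wpath w)).
  have := meanD N.*2 (fun w => 1 - H (wpath w)) (fun w => H (wpath w)).
  under eq_mean do rewrite subrK.
  by rewrite mean_cst => h; apply/eqP; rewrite eq_sym subr_eq; apply/eqP.
by rlra.
Qed.

Definition level_set (r : R) : set T :=
  [set w | (forall t : R, 0 < t < 1 -> - r < W w t) /\ `|W w 1| < r].

Lemma level_setE (r : R) : 0 < r <= 1 -> level_set r = [set w | lev (W w) < r].
Proof.
move=> /andP[r0 r1]; apply/seteqP; split => w /=.
  move=> [h1 h2].
  (* The minimum is attained, so the supremum in [lev] stays strictly below [r]; the end points,
     which the event leaves out, are covered by [W w 0 = 0] and the bound on [W w 1]. *)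
  have [c c01 hc] : exists2 c, c \in `[0, 1] & forall t, t \in `[0, 1] -> W w c <= W w t.
    apply: EVT_min => //; have [_ _ h _] := BM.
    by apply: continuous_subspaceW (h w) => t /=; rewrite !in_itv/= => /andP[->].
  have hcr : - W w c < r.
    rewrite ltrNl; move: c01; rewrite in_itv/= => /andP[c0 c1].
    have [->|cn0] := eqVneq c 0; first by rewrite (brownian0 BM) oppr_lt0.
    have [->|cn1] := eqVneq c 1; first by move: h2; rewrite ltr_norml => /andP[].
    by apply: h1; rewrite !lt_def cn0 c0 eq_sym cn1.
  apply: (@le_lt_trans _ _ (Num.max (- W w c) `|W w 1|)); last by rewrite gt_max hcr.
  apply: lev_le => [t t01|]; rewrite le_max ?lexx ?orbT//.
  by rewrite lerN2 hc.
move=> h.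
have ub (t : R) : 0 <= t <= 1 -> Num.max (- W w t) `|W w 1| < r.
  move=> t01; have := le_lt_trans (lev_ub (W w) t01) h.
  by rewrite gt_min ltNge r1.
split => [t /andP[t0 t1]|].
  by have := ub t; rewrite !ltW// => /(_ isT); rewrite gt_max ltrNl => /andP[].
by have := ub 1; rewrite ler01 lexx => /(_ isT); rewrite gt_max => /andP[].
Qed.

Lemma measurable_level_set (r : R) : 0 < r <= 1 -> measurable (level_set r).
Proof.
move=> r01; rewrite level_setE//.
have -> : [set w | lev (W w) < r] = (fun w => lev (W w)) @^-1` `]-oo, r[%classic.
  by apply/seteqP; split => w; rewrite /= in_itv.
rewrite -[X in measurable X]setTI.
exact: (measurable_lip BM (@lev_lip R)).
Qed.

Lemma Rintegral_level_set (F : (R -> R) -> R) (r : R) : 0 < r <= 1 ->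
  \int[Q]_(w in level_set r) F (W w) = ex Q (fun w => F (W w) * \1_(level_set r) w).
Proof.
move=> r01; rewrite Rintegral_mkcond /ex; congr Rintegral; apply/funext => w.
by rewrite /restrict indicE; case: ifPn => _; rewrite ?mulr1 ?mulr0.
Qed.

(** The discrete counterpart of [level_set]; the bound [- k <= height w] at the end is part of
    [nonneg_from]. *)
Definition conditioned (k : nat) (w : seq bool) : bool :=
  nonneg_from k w && (height w <= k%:Z).

Lemma lev_wpath_le (k : nat) w : (0 < size w)%N -> conditioned k w ->
  lev (wpath w) <= k%:R / Num.sqrt (size w)%:R :> R.
Proof.
move=> w0 /andP[/nonneg_fromP h1 h2].
have s0 : 0 < Num.sqrt (size w)%:R :> R by rewrite sqrtr_gt0 ltr0n.
apply: lev_le => [t t01|].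
  rewrite /wpath -mulNr ler_pM2r ?invr_gt0//.
  have := h1 (Num.truncn ((size w)%:R * t)); rewrite -(ler_int R) intrD /=.
  by rewrite -pmulrn; rlra.
rewrite /wpath mulr1 natrK take_size normrM [X in _ * X]gtr0_norm ?invr_gt0//.
rewrite ler_pM2r ?invr_gt0// -intr_norm pmulrn ler_int.
by have := h1 (size w); rewrite take_size; lia.
Qed.

Lemma lev_wpath_gt (k : nat) (r : R) w : (0 < size w)%N -> r <= 1 ->
  r <= k.+1%:R / Num.sqrt (size w)%:R -> lev (wpath w) < r -> conditioned k w.
Proof.
move=> w0 r1 rk h.
have s0 : 0 < Num.sqrt (size w)%:R :> R by rewrite sqrtr_gt0 ltr0n.
have m0 : 0 < (size w)%:R :> R by rewrite ltr0n.
have ub (t : R) : 0 <= t <= 1 -> Num.max (- wpath w t) `|wpath w 1| < k.+1%:R / Num.sqrt (size w)%:R.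
  move=> t01; have := le_lt_trans (lev_ub (wpath w) t01) h.
  by rewrite gt_min ltNge r1 /= => /lt_le_trans; apply.
apply/andP; split.
  apply/nonneg_fromP => j.
  have [jw|jw] := leqP j (size w); last first.
    have := ub 1; rewrite ler01 lexx => /(_ isT); rewrite gt_max => /andP[+ _].
    rewrite /wpath mulr1 natrK take_size -mulNr ltr_pM2r ?invr_gt0//.
    by rewrite take_oversize ?(ltnW jw)// -intrN pmulrn ltr_int; lia.
  have := ub (j%:R / (size w)%:R).
  rewrite divr_ge0//= ler_pdivrMr// mul1r ler_nat jw => /(_ isT).
  have jE : Num.truncn ((size w)%:R * (j%:R / (size w)%:R) : R) = j.
    by rewrite mulrC divfK ?lt0r_neq0// natrK.
  rewrite gt_max => /andP[+ _]; rewrite /wpath jE.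
  by rewrite -mulNr ltr_pM2r ?invr_gt0// -intrN pmulrn ltr_int; lia.
have := ub 1; rewrite ler01 lexx => /(_ isT); rewrite gt_max => /andP[_].
rewrite /wpath mulr1 natrK take_size normrM [X in _ * X]gtr0_norm ?invr_gt0//.
by rewrite ltr_pM2r ?invr_gt0// -intr_norm pmulrn ltr_int; lia.
Qed.

Lemma conditioned_walk (L : R) (F : (R -> R) -> R) (ell eps rho0 : R) :
  lip L F -> unit_valued F -> 0 <= ell <= 1 -> 0 < eps <= 1 -> 0 < rho0 ->
  (forall alpha : R, 0 < alpha -> exists2 delta : R, 0 < delta & forall r, 0 < r < delta ->
     0 < pr Q (level_set r) /\
     `|(\int[Q]_(w in level_set r) F (W w)) / pr Q (level_set r) - ell| <= alpha) ->
  exists N0 : nat, forall N, (N0 <= N)%N -> exists k : nat,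
    let c w : R := (conditioned k.*2 w)%:R in
    [/\ k.*2%:R <= rho0 * Num.sqrt N.*2%:R, 0 < mean N.*2 c,
        mean N.*2 (fun w => c w * F (wpath w)) <= (ell + eps) * mean N.*2 c &
        (ell - eps) * mean N.*2 c <= mean N.*2 (fun w => c w * F (wpath w))].
Proof.
move=> LF uF /andP[ell0 ell1] /andP[e0 e1] rho00 hell.
pose alpha := eps / 8; have al0 : 0 < alpha by rewrite divr_gt0.
have [del del0 hdel] := hell alpha al0.
pose b := Num.min (del / 2) (Num.min (1 / 2) rho0).
have b0 : 0 < b by rewrite !lt_min !divr_gt0.
have bdel : b < del by rewrite /b gt_min ltr_pdivrMr// ltr_pMr// ltr1n.
have b1 : b <= 1.
  by rewrite /b ge_min; apply/orP; right; rewrite ge_min; apply/orP; left; rewrite ler_pdivrMr// mul1r ler1n.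
have brho : b <= rho0 by rewrite /b !ge_min lexx !orbT.
(* Forcing the level into [[b / 2, 1]] makes [q] monotone on the whole line, as
   [geometric_pigeonhole] asks. *)
pose q x := pr Q (level_set (Num.min 1 (Num.max (b / 2) x))).
have rng x : 0 < Num.min 1 (Num.max (b / 2) x) <= 1.
  by rewrite ge_min lexx /= andbT lt_min ltr01 /= lt_max divr_gt0.
have sub (x y : R) : 0 < x -> x <= y -> y <= 1 -> level_set x `<=` level_set y.
  move=> x0 xy y1; rewrite !level_setE ?x0 ?(le_trans xy)// ?(lt_le_trans x0 xy)//.
  by move=> w /= /lt_le_trans; apply.
have qE x : b / 2 <= x <= b -> q x = pr Q (level_set x).
  by move=> /andP[h1 h2]; rewrite /q max_r// min_r// (le_trans h2).
have [r [r3 [ar rr3 r3b qr]]] : exists r r' : R, [/\ b / 2 <= r, r < r', r' <= b & q r' <= (1 + alpha) * q r].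
  apply: geometric_pigeonhole => //.
  - by rewrite ltr_pdivrMr// ltr_pMr// ltr1n.
  - rewrite qE ?lexx/=; last by rewrite ler_pdivrMr// ler_peMr ?ler1n// ltW.
    apply: (hdel (b / 2) _).1; rewrite divr_gt0//= (lt_trans _ bdel)//.
    by rewrite ltr_pdivrMr// ltr_pMr// ltr1n.
  - move=> x y xy; apply: le_pr; [exact: measurable_level_set|exact: measurable_level_set|].
    apply: sub; [by have /andP[] := rng x| |by have /andP[] := rng y].
    by rewrite le_min ge_min lexx /= ge_min; apply/orP; right; rewrite ge_max le_max lexx /= le_max xy orbT.
have b20 : 0 < b / 2 by rewrite divr_gt0.
have r0 : 0 < r by apply: lt_le_trans ar.
have r30 : 0 < r3 by apply: lt_trans rr3.
have r31 : r3 <= 1 by apply: le_trans b1.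
have r1' : r <= 1 by rewrite ltW// (lt_le_trans rr3).
rewrite !qE ?ar ?r3b ?(ltW (lt_le_trans rr3 r3b)) ?(ltW (le_lt_trans ar rr3))// in qr.
have [qr0 hr] := hdel r ltac:(by rewrite r0 (lt_trans rr3)// (le_lt_trans r3b)).
have [qr30 hr3] := hdel r3 ltac:(by rewrite r30 (le_lt_trans r3b)).
set q0 := pr Q (level_set r) in qr qr0 hr; set q3 := pr Q (level_set r3) in qr qr30 hr3.
set I0 := \int[Q]_(w in level_set r) _ in hr; set I3 := \int[Q]_(w in level_set r3) _ in hr3.
(* Cutoffs between [r] and [r1] and between [r2] and [r3] enclose the discrete event at a level
   between [r1] and [r2]. All of them differ from the event at level [r] by a factor close to 1, by
   the choice of [r] and [r3]. *)
pose r1 := r + (r3 - r) / 3; pose r2 := r + 2 * (r3 - r) / 3.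
have rr1 : r < r1 by rewrite /r1 ltrDl divr_gt0// subr_gt0.
have rr12 : r1 < r2 by rewrite /r1 /r2; rlra.
have rr23 : r2 < r3 by rewrite /r2; rlra.
have mr : measurable (level_set r) by apply: measurable_level_set; rewrite r0.
have mr3 : measurable (level_set r3) by apply: measurable_level_set; rewrite r30.
have eta0 : 0 < alpha * q0 by rewrite mulr_gt0.
have lm := cutoff_lip rr1; have lp := cutoff_lip rr23.
have um := @cutoff_unit R r r1; have up := @cutoff_unit R r2 r3.
have bF := bm_lip BM LF uF.
have mF r' : measurable (level_set r') -> bounded_measurable (fun w => F (W w) * \1_(level_set r') w : R).
  by move=> m; apply: bmM => //; exact: bm_indic.
have [N1 hN1] := donsker_limsup (lipM LF lp uF up) (unit_valuedM uF up) eta0.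
have [N2 hN2] := donsker_liminf BM (lipM LF lm uF um) (unit_valuedM uF um) eta0.
have [N3 hN3] := donsker_limsup lp up eta0.
have [N4 hN4] := donsker_liminf BM lm um eta0.
have [N5 hN5] := large_sqrt (2 / (r2 - r1)).
have bp : bounded_measurable (fun w => F (W w) * cutoff r2 r3 (W w)) :=
  bm_lip BM (lipM LF lp uF up) (unit_valuedM uF up).
have bm : bounded_measurable (fun w => F (W w) * cutoff r r1 (W w)) :=
  bm_lip BM (lipM LF lm uF um) (unit_valuedM uF um).
have bp' := bm_lip BM lp up; have bm' := bm_lip BM lm um.
have E1 : ex Q (fun w => F (W w) * cutoff r2 r3 (W w)) <= I3.
  rewrite /I3 Rintegral_level_set ?r30//; apply: le_ex; [exact: bp|exact: mF|].
  move=> w; have /andP[F0 _] := uF (W w); rewrite ler_wpM2l// indicE.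
  have [h|h] := ltP (lev (W w)) r3; last by rewrite cutoff0.
  by rewrite level_setE ?r30// mem_set//; have /andP[] := up (W w).
have E2 : I0 <= ex Q (fun w => F (W w) * cutoff r r1 (W w)).
  rewrite /I0 Rintegral_level_set ?r0//; apply: le_ex; [exact: mF|exact: bm|].
  move=> w; have /andP[F0 _] := uF (W w); rewrite ler_wpM2l// indicE.
  rewrite level_setE ?r0//; have [h|h] := ltP (lev (W w)) r.
    by rewrite cutoff1 ?(ltW h)//; case: (_ \in _).
  by rewrite memNset ?clamp_ge0//=; apply/negP; rewrite -leNgt.
have E3 : ex Q (fun w => cutoff r2 r3 (W w)) <= q3.
  rewrite /q3 -ex_indic//; apply: le_ex; [exact: bp'|exact: bm_indic|].
  move=> w; rewrite indicE; have [h|h] := ltP (lev (W w)) r3; last by rewrite cutoff0.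
  by rewrite level_setE ?r30// mem_set//; have /andP[] := up (W w).
have E4 : q0 <= ex Q (fun w => cutoff r r1 (W w)).
  rewrite /q0 -ex_indic//; apply: le_ex; [exact: bm_indic|exact: bm'|].
  move=> w; rewrite indicE level_setE ?r0//; have [h|h] := ltP (lev (W w)) r.
    by rewrite cutoff1 ?(ltW h)//; case: (_ \in _).
  by rewrite memNset ?clamp_ge0//=; apply/negP; rewrite -leNgt.
exists (maxn 1 (maxn (maxn N1 N2) (maxn (maxn N3 N4) N5))) => N.
rewrite !geq_max => /and3P[N0 /andP[/hN1 h1 /hN2 h2] /andP[/andP[/hN3 h3 /hN4 h4] NN5]].
have NN52 : (N5 <= N.*2)%N by rewrite (leq_trans NN5)// -addnn leq_addr.
have := hN5 _ NN52; set s := Num.sqrt _ => hs.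
have s0 : 0 < s by rewrite sqrtr_gt0 ltr0n double_gt0.
have r20 : 0 <= r2 * s / 2 by rewrite divr_ge0// mulr_ge0 ?(ltW s0)// ltW// (lt_trans r0)// (lt_trans rr1).
(* The discrete level is the even number [k.*2], so that the walk started there has the parity of
   one started at 0. *)
exists (Num.truncn (r2 * s / 2)).
set k := Num.truncn _; have /andP[k1 k2] := truncn_itv r20; rewrite -/k in k1 k2.
have kle : k.*2%:R / s <= r2.
  by rewrite ler_pdivrMr// -muln2 natrM; move: k1; clear; rlra.
have kge : r1 <= k.*2.+1%:R / s.
  rewrite ler_pdivlMr// -natr1 -muln2 natrM.
  have : 2 <= (r2 - r1) * s by rewrite mulrC -ler_pdivrMr// subr_gt0.
  by move: k2; rewrite -[k.+1%:R]natr1; clear; rlra.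
move=> c.
have cup w : size w = N.*2 -> c w <= cutoff r2 r3 (wpath w).
  move=> sw; rewrite /c; case: (boolP (conditioned _ _)) => [hc|_]; last exact: clamp_ge0.
  rewrite cutoff1//; apply: le_trans kle; rewrite /s -sw; apply: lev_wpath_le => //.
  by rewrite sw double_gt0.
have clo w : size w = N.*2 -> cutoff r r1 (wpath w) <= c w.
  move=> sw; rewrite /c; have [h|h] := ltP (lev (wpath w)) r1; last by rewrite cutoff0.
  rewrite (@lev_wpath_gt k.*2 r1) ?clamp_le1//; first by rewrite sw double_gt0.
    by rewrite (le_trans (ltW rr12))// (le_trans (ltW rr23)).
  by rewrite sw.
have m1 : mean N.*2 (fun w => c w * F (wpath w)) <= I3 + alpha * q0.
  apply: le_trans (le_trans h1 _); last by rewrite lerD2r.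
  by apply: le_mean => w sw; rewrite mulrC; have /andP[F0 _] := uF (wpath w); rewrite ler_wpM2l// cup.
have m2 : I0 - alpha * q0 <= mean N.*2 (fun w => c w * F (wpath w)).
  apply: le_trans (le_trans _ h2) _; first by rewrite lerD2r.
  by apply: le_mean => w sw; rewrite [leRHS]mulrC; have /andP[F0 _] := uF (wpath w); rewrite ler_wpM2l// clo.
have m3 : mean N.*2 c <= q3 + alpha * q0.
  by apply: le_trans (le_trans h3 _); [apply: le_mean|rewrite lerD2r].
have m4 : q0 - alpha * q0 <= mean N.*2 c.
  by apply: le_trans (le_trans _ h4) _; [rewrite lerD2r|apply: le_mean].
have I0q : (ell - alpha) * q0 <= I0.
  by rewrite -ler_pdivlMr//; move: hr; rewrite ler_norml => /andP[]; clear; rlra.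
have I3q : I3 <= (ell + alpha) * q3.
  by rewrite -ler_pdivrMr//; move: hr3; rewrite ler_norml => /andP[_]; clear; rlra.
have ae : eps = 8 * alpha by rewrite /alpha; field.
have al1 : alpha <= 1 / 8 by rewrite ler_pM2r ?invr_gt0.
move: m1 m2 m3 m4; set X := mean _ _; set Y := mean _ _ => m1 m2 m3 m4.
have Y0 : 0 < Y by apply: lt_le_trans m4; move: qr0 al1; clear; nra.
split => //.
- apply: (@le_trans _ _ (r2 * s)); first by rewrite -ler_pdivrMr.
  by rewrite ler_pM2r// (le_trans (ltW rr23))// (le_trans r3b).
- rewrite ae; apply: le_trans m1 _; apply: (@le_trans _ _ ((ell + 8 * alpha) * (q0 - alpha * q0))).
    have : (ell + alpha) * q3 <= (ell + alpha) * ((1 + alpha) * q0).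
      by rewrite ler_wpM2l// addr_ge0// ltW.
    have : 0 <= alpha * q0 by exact: ltW.
    have : 0 <= ell * (alpha * q0) by rewrite mulr_ge0// ltW.
    have : ell * (alpha * q0) <= alpha * q0 by rewrite ler_piMl// ltW.
    have : alpha * (alpha * q0) <= (1 / 8) * (alpha * q0) by rewrite ler_wpM2r// ltW.
    by move: I3q; clear; rlra.
  by rewrite ler_wpM2l// addr_ge0// mulr_ge0// ltW.
- rewrite ae; have [c0|c0] := leP (ell - 8 * alpha) 0.
    apply: (@le_trans _ _ 0); first by rewrite mulr_le0_ge0// ltW.
    by apply: mean_ge0 => w _; rewrite mulr_ge0//; have /andP[] := uF (wpath w).
  apply: le_trans m2; apply: (@le_trans _ _ ((ell - 8 * alpha) * (q3 + alpha * q0))).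
    by rewrite ler_wpM2l// ltW.
  have : (ell - 8 * alpha) * q3 <= (ell - 8 * alpha) * ((1 + alpha) * q0) by rewrite ler_wpM2l// ltW.
  have : 0 <= alpha * q0 by exact: ltW.
  have : ell * (alpha * q0) <= alpha * q0 by rewrite ler_piMl// ltW.
  have : 0 <= alpha * (alpha * q0) by rewrite mulr_ge0// ltW.
  by move: I0q; clear; rlra.
Qed.

End ConditionedWalk.

(** * The excursion as a limit of conditioned Brownian motions *)

Section ExcursionLimit.
Variable R : realType.
Implicit Types (f g : R -> R) (F H : (R -> R) -> R).

Lemma cont01_bounded g : cont01 g -> exists M : R, forall t : R, 0 <= t <= 1 -> `|g t| <= M.
Proof.
move=> cg; have [del del0 hd] := cont01_unif cg ltr01.
have [K hK] := natSinv_le del0.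
exists (1 + \sum_(i < K.+2) `|g (i%:R / K.+1%:R)|) => t t01.
have [iK i01 /andP[ti0 ti1]] := trunc_grid K t01; set i := Num.truncn _ in iK i01 ti0 ti1.
have -> : g t = (g t - g (i%:R / K.+1%:R)) + g (i%:R / K.+1%:R) by rewrite subrK.
rewrite (le_trans (ler_normD _ _))// lerD//.
  by apply: hd => //; rewrite ger0_norm// (le_trans ti1)// hK.
have iK' : (i < K.+2)%N by [].
by rewrite (bigD1 (Ordinal iK'))//= lerDl sumr_ge0.
Qed.

Lemma uniform_dist_close f g : continuous_path f -> continuous_path g ->
  sup_close f g (uniform_dist f g).
Proof.
move=> /within_cont01/cont01_bounded[M hM] /within_cont01/cont01_bounded[M' hM'] t t01.
apply: ub_le_sup; last by exists t => //; exact/mem01.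
exists (M + M') => _ [u /mem01 u01 <-].
by rewrite (le_trans (ler_normB _ _))// lerD ?hM ?hM'.
Qed.

Lemma lip_bounded_continuous (L : R) F : lip L F -> unit_valued F ->
  bounded_continuous (@continuous_path R) (@uniform_dist R) F.
Proof.
move=> LF uF; split.
  by exists 1 => g _; have /andP[F0 F1] := uF g; rewrite ger0_norm.
move=> f cf eps e0; have L0 := lip_ge0 LF; have L1 : 0 < L + 1 by rlra.
exists (eps / (L + 1)) => [|g cg fg]; first by rewrite divr_gt0.
apply: le_lt_trans (LF _ _ _ (uniform_dist_close cf cg)) _.
have : 0 <= uniform_dist f g.
  by apply: le_trans (uniform_dist_close cf cg (t := 0) _); rewrite ?lexx ?ler01.
by move: fg; rewrite ltr_pdivlMr// => fg u0; apply: le_lt_trans fg; rewrite mulrC ler_wpM2l//; rlra.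
Qed.

(* Leaves room at both ends for the steps that bring a walk close to 0. *)
Definition squeeze (eta : R) g (t : R) : R :=
  if (eta <= t) && (t <= 1 - eta) then
    Num.sqrt (1 - 2 * eta) * g ((t - eta) / (1 - 2 * eta)) else 0.

Lemma squeeze_time (eta t : R) : 0 <= eta -> eta <= 1 / 4 -> eta <= t -> t <= 1 - eta ->
  0 <= (t - eta) / (1 - 2 * eta) <= 1.
Proof.
move=> e0 e1 t0 t1; have h : 0 < 1 - 2 * eta by rlra.
by rewrite divr_ge0//=; [rewrite ler_pdivrMr//; rlra|rlra|rlra].
Qed.

Lemma squeeze_close (eta : R) f g (c : R) : 0 <= eta -> eta <= 1 / 4 -> sup_close f g c ->
  sup_close (squeeze eta f) (squeeze eta g) c.
Proof.
move=> e0 e1 fg t t01; have c0 : 0 <= c by exact: le_trans (fg t t01).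
rewrite /squeeze; case: ifPn => [/andP[h1 h2]|_]; last by rewrite subrr normr0.
rewrite -mulrBr normrM ger0_norm ?sqrtr_ge0//.
apply: (@le_trans _ _ (1 * c)); last by rewrite mul1r.
apply: ler_pM => //; last by apply: fg; exact: squeeze_time.
by rewrite -[leRHS]sqrtr1 ler_sqrt//; rlra.
Qed.

Definition path_increasing F :=
  forall f g, (forall t : R, 0 <= t <= 1 -> f t <= g t) -> F f <= F g.

Lemma squeeze_lip (eta L : R) F : 0 <= eta -> eta <= 1 / 4 -> lip L F ->
  lip L (fun g => F (squeeze eta g)).
Proof. by move=> e0 e1 LF f g c fg; apply: LF; exact: squeeze_close. Qed.

Lemma squeeze_cvg g : cont01 g -> g 0 = 0 -> g 1 = 0 -> forall eps : R, 0 < eps ->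
  exists N, forall n, (N <= n)%N -> sup_close (squeeze (n.+4%:R^-1) g) g eps.
Proof.
move=> cg g0 g1 eps e0.
have e20 : 0 < eps / 2 by rewrite divr_gt0.
have [M hM] := cont01_bounded cg.
have M0 : 0 <= M by apply: le_trans (hM 0 _); rewrite ?lexx ?ler01.
have [del del0 hd] := cont01_unif cg e20.
pose b := Num.min (del / 2) (eps / (4 * (M + 1))).
have b0 : 0 < b by rewrite lt_min !divr_gt0// mulr_gt0//; rlra.
have [N hN] := natSinv_le b0; exists N => n Nn t t01.
set eta : R := n.+4%:R^-1.
have eta0 : 0 < eta by rewrite invr_gt0.
have eta4 : eta <= 1 / 4 by rewrite /eta -[1 / 4]mul1r mul1r div1r lef_pV2 ?posrE// ler_nat.
have : eta <= b.
  by apply: (le_trans _ (hN n Nn)); rewrite /eta lef_pV2 ?posrE// ler_nat; clear; lia.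
rewrite le_min => /andP[etad etaM].
have /andP[t0 t1] := t01.
rewrite /squeeze; case: ifPn => [/andP[h1 h2]|].
  have t'01 := squeeze_time (ltW eta0) eta4 h1 h2.
  set t' := _ / _ in t'01 *; set c := Num.sqrt _.
  have c1 : c <= 1 by rewrite -[leRHS]sqrtr1 ler_sqrt//; rlra.
  have c0 : 0 <= c by exact: sqrtr_ge0.
  have cc : c ^+ 2 = 1 - 2 * eta by rewrite sqr_sqrtr//; rlra.
  have cle : 1 - c <= 2 * eta.
    by move: cc c0 c1; clear -eta0; nra.
  have tt : `|t' - t| <= del.
    apply: (@le_trans _ _ (2 * eta)); last by rlra.
    have -> : t' - t = eta * ((2 * t - 1) / (1 - 2 * eta)).
      by rewrite /t'; field; apply: lt0r_neq0; rlra.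
    rewrite normrM (gtr0_norm eta0) mulrC ler_pM2r// normrM.
    have -> : `|(1 - 2 * eta)^-1| = (1 - 2 * eta)^-1 by rewrite gtr0_norm// invr_gt0; rlra.
    rewrite ler_pdivrMr; last rlra.
    by rewrite ler_norml; apply/andP; split; rlra.
  have -> : c * g t' - g t = (g t' - g t) - (1 - c) * g t' by ring.
  rewrite (le_trans (ler_normB _ _))// (splitr eps) lerD ?hd//.
  rewrite normrM (ger0_norm (x := 1 - c)); last by rlra.
  apply: (@le_trans _ _ (2 * eta * M)); first by apply: ler_pM => //; [rlra|exact: hM].
  move: etaM; rewrite ler_pdivlMr; last by rewrite mulr_gt0//; rlra.
  by move: eta0 M0; clear; nra.
rewrite negb_and -!ltNge sub0r normrN => /orP[h|h].
  have -> : g t = g t - g 0 by rewrite g0 subr0.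
  apply: (@le_trans _ _ (eps / 2)); last by rlra.
  by apply: hd; rewrite ?lexx ?ler01// subr0 ger0_norm//; rlra.
have -> : g t = g t - g 1 by rewrite g1 subr0.
apply: (@le_trans _ _ (eps / 2)); last by rlra.
by apply: hd; rewrite ?lexx ?ler01// distrC ger0_norm//; rlra.
Qed.

End ExcursionLimit.

Section ExcursionFunctionals.
Context (d : measure_display) (T : measurableType d) (R : realType)
  (P : probability T R) (e : T -> R -> R).
Hypothesis he : brownian_excursion P e.

Lemma excursion_cont01 w : cont01 (e w).
Proof. by have [h _ _] := he; have [c _ _ _] := h w; exact: within_cont01. Qed.

Lemma excursion_ends w : e w 0 = 0 /\ e w 1 = 0.
Proof. by have [h _ _] := he; have [_ ? ? _] := h w. Qed.

Lemma measurable_excursion (L : R) (F : (R -> R) -> R) : lip L F ->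
  measurable_fun setT (fun w => F (e w)).
Proof.
move=> LF; apply: (measurable_functional _ _ LF); last exact: excursion_cont01.
by have [_ h _] := he.
Qed.

Lemma bm_excursion (L : R) (F : (R -> R) -> R) : lip L F -> unit_valued F ->
  bounded_measurable (fun w => F (e w)).
Proof.
move=> LF uF; split; first exact: measurable_excursion LF.
by exists 1 => w; have /andP[F0 F1] := uF (e w); rewrite ger0_norm.
Qed.

Lemma ex_unit (L : R) (F : (R -> R) -> R) : lip L F -> unit_valued F ->
  0 <= ex P (fun w => F (e w)) <= 1.
Proof.
move=> LF uF; apply/andP; split; first by apply: ex_ge0 => w; have /andP[] := uF (e w).
rewrite -(ex_cst P (1 : R)); apply: le_ex; [exact: bm_excursion LF uF|exact: bm_cst|].
by move=> w; have /andP[] := uF (e w).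
Qed.

Lemma nbhs_right_ex (A : R -> Prop) : (\forall x \near 0^'+, A x) ->
  exists2 delta : R, 0 < delta & forall r, 0 < r < delta -> A r.
Proof.
move=> [del /= del0 h]; exists del => // r /andP[r0 rd]; apply: h => //=.
by rewrite sub0r normrN gtr0_norm.
Qed.

Lemma excursion_level_limit : exists (d' : measure_display) (T' : measurableType d')
    (Q : probability T' R) (W : T' -> R -> R), standard_brownian_motion Q W /\
  forall (L : R) (F : (R -> R) -> R), lip L F -> unit_valued F ->
  forall alpha : R, 0 < alpha -> exists2 delta : R, 0 < delta & forall r : R, 0 < r < delta ->
     0 < pr Q (level_set W r) /\
     `|(\int[Q]_(w in level_set W r) F (W w)) / pr Q (level_set W r) -
       ex P (fun w => F (e w))| <= alpha.
Proof.
have [_ _ [d' [T' [Q [W [BM lim]]]]]] := he; exists d', T', Q, W; split=> // L F LF uF alpha al0.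
(* For the constant functional 1 the quotient tends to 1, which forces the conditioning event to
   have positive probability at small levels: a quotient by 0 would be 0. *)
have l1 : lip 1 (fun=> 1 : R).
  move=> f g c fg; rewrite subrr normr0 mul1r; apply: le_trans (fg 0 _) => //.
  by rewrite lexx ler01.
have u1 : unit_valued (fun=> 1 : R) by move=> f; rewrite ler01 lexx.
have h1 := lim _ (lip_bounded_continuous l1 u1).
have h2 := lim _ (lip_bounded_continuous LF uF).
have e1 : fine 'E_P[(fun=> 1) \o e] = 1 :> R by rewrite unlock; exact: ex_cst.
have e2 : fine 'E_P[F \o e] = ex P (fun w => F (e w)) :> R by rewrite unlock.
rewrite e1 in h1; rewrite e2 in h2.
move/cvgrPdist_lt : h1 => /(_ _ ltr01)/nbhs_right_ex[del1 del10 hd1].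
move/cvgrPdist_le : h2 => /(_ _ al0)/nbhs_right_ex[del2 del20 hd2].
exists (Num.min 1 (Num.min del1 del2)); first by rewrite !lt_min ltr01 del10.
move=> r /andP[r0]; rewrite !lt_min => /and3P[r1 rd1 rd2].
split; last by rewrite distrC; apply: hd2; rewrite r0.
have mA : measurable (level_set W r) by apply: (measurable_level_set BM); rewrite r0 ltW.
rewrite lt_def pr_ge0 andbT; apply/eqP => p0.
have := hd1 r; rewrite r0 rd1 => /(_ isT).
rewrite -[fine (Q _)]/(pr Q (level_set W r)) p0 invr0 mulr0 subr0 normr1 ltxx.
by [].
Qed.

Lemma squeeze_limit (L : R) (F : (R -> R) -> R) (eps : R) : lip L F -> unit_valued F -> 0 < eps ->
  exists2 eta : R, 0 < eta <= 1 / 8 &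
    ex P (fun w => F (e w)) - eps <= ex P (fun w => F (squeeze eta (e w))).
Proof.
move=> LF uF e0.
have eta0 (n : nat) : 0 < (n.+4%:R^-1 : R) by rewrite invr_gt0.
have eta4 (n : nat) : n.+4%:R^-1 <= 1 / 4 :> R by rewrite div1r lef_pV2 ?posrE// ler_nat.
have uS n : unit_valued (fun g => F (squeeze (n.+4%:R^-1) g)) by move=> g; exact: uF.
have LS n := squeeze_lip (ltW (eta0 n)) (eta4 n) LF.
have bF := bm_excursion LF uF.
have bS n := bm_excursion (LS n) (uS n).
have [N hN] : exists N, forall n, (N <= n)%N ->
    `|ex P (fun w => F (e w) - F (squeeze (n.+4%:R^-1) (e w)))| <= eps.
  apply: (@ex_cvg0 _ _ _ _ _ 1) => //.
  - by move=> n; have [] := bmB bF (bS n).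
  - move=> w al al0; have L0 := lip_ge0 LF; have L1 : 0 < L + 1 by rlra.
    have [g0 g1] := excursion_ends w.
    have [N hN] := squeeze_cvg (excursion_cont01 w) g0 g1 (divr_gt0 al0 L1).
    exists N => n /hN h; rewrite distrC (le_trans (LF _ _ _ h))//.
    by rewrite mulrA ler_pdivrMr// mulrC ler_wpM2l ?(ltW al0)//; rlra.
  - move=> n w; have /andP[a0 a1] := uF (e w); have /andP[b0 b1] := uS n (e w).
    by rewrite ler_norml; apply/andP; split; rlra.
(* The index is at least 8, whence [eta <= 1 / 8]. *)
exists ((N + 4).+4%:R^-1).
  by rewrite eta0 div1r lef_pV2 ?posrE// ler_nat addn4.
have := hN (N + 4)%N (leq_addr _ _); rewrite exB//.
by rewrite ler_norml => /andP[_]; rlra.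
Qed.

End ExcursionFunctionals.

(** * Domination between Dyck walks and conditioned walks *)

Section Sandwich.
Variable R : realType.
Implicit Types (F H : (R -> R) -> R).

Definition dyck (w : seq bool) : bool := nonneg_from 0 w && (height w == 0).

(** Not divided by the mass of Dyck words, in keeping with the cross-multiplied form of
    [weight_domination]. *)
Definition dyck_mean (N : nat) (F : seq bool -> R) : R :=
  mean N.*2 (fun w => (dyck w)%:R * F w).

Lemma mean_domination l (x : int) (k : nat) (phi phi' : int -> R) (F F' : seq bool -> R) :
  (forall y, 0 <= phi y) -> (forall y, 0 <= phi' y) -> lik_ratio_le phi phi' ->
  (forall w w', size w = l -> size w' = l ->
    (forall j, x + height (take j w) <= x + k.*2%:Z + height (take j w')) -> F w <= F' w') ->
  mean l (fun w => (nonneg_from x w)%:R * phi (x + height w) * F w) *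
  mean l (fun w => (nonneg_from (x + k.*2%:Z) w)%:R * phi' (x + k.*2%:Z + height w)) <=
  mean l (fun w => (nonneg_from (x + k.*2%:Z) w)%:R * phi' (x + k.*2%:Z + height w) * F' w) *
  mean l (fun w => (nonneg_from x w)%:R * phi (x + height w)).
Proof.
move=> p0 p0' lr FF.
have h z (psi : int -> R) : mean l (fun w => (nonneg_from z w)%:R * psi (z + height w)) =
    weight l z psi (fun=> 1) / 2 ^+ l.
  by rewrite -mean_weight; apply: eq_mean => w _; rewrite mulr1.
rewrite !h !mean_weight !mulrA -![_ / _ * _]mulrA -![_^-1 * _]mulrC !mulrA.
by rewrite !ler_pM2r ?invr_gt0 ?exprn_gt0//; exact: weight_domination.
Qed.

Lemma dyck_lb (N : nat) (s : R) : (0 < N)%N -> 0 < s -> s ^+ 2 = N.*2%:R ->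
  s ^- 3 / 2 <= mean N.*2 (fun w => (dyck w)%:R).
Proof. exact: mean_dyck_lb. Qed.

(** Cut at time [l1], the word becomes two ballot paths meeting at a height below [K], each of
    probability at most [2 * K / s^3]; the sum over the height gives [K^3]. For [K] a small multiple
    of the root of the length this is small compared with the mass of Dyck words. *)
Lemma low_at_time l1 l2 (K : nat) (s1 s2 : R) : 0 < s1 -> 0 < s2 ->
  s1 ^+ 2 = l1%:R -> s2 ^+ 2 = l2%:R ->
  mean (l1 + l2) (fun w => (dyck w && (height (take l1 w) < K%:Z))%:R) <=
    4 * K%:R ^+ 3 / (s1 ^+ 3 * s2 ^+ 3).
Proof.
move=> s10 s20 s1l s2l.
have -> : mean (l1 + l2) (fun w => (dyck w && (height (take l1 w) < K%:Z))%:R) =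
    \sum_(y < K) ballot_prob l1 0 y * ballot_prob l2 y 0 :> R.
  rewrite mean_cat.
  have E u : size u = l1 ->
      mean l2 (fun v => (dyck (u ++ v) && (height (take l1 (u ++ v)) < K%:Z))%:R) =
      \sum_(y < K) ballot_prob l2 y 0 * (nonneg_from 0 u && (0 + height u == y%:Z))%:R :> R.
    move=> su; rewrite -(eq_mean (F := fun v => \sum_(y < K)
        (nonneg_from 0 u && (0 + height u == y%:Z))%:R * (nonneg_from y v && (y%:Z + height v == 0))%:R)); last first.
      move=> v _; rewrite take_size_cat// /dyck nonneg_from_cat height_cat add0r.
      case: (boolP (nonneg_from 0 u)) => [n0|_]; last by rewrite big1// => y _; rewrite mul0r.
      have := nonneg_from_end n0; rewrite add0r /=; case: (height u) => // m _.
      rewrite ltz_nat; have [mK|mK] := ltnP m K; last first.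
        rewrite andbF big1// => y _; rewrite eqz_nat (_ : (m == y) = false) ?mul0r//.
        by apply/negbTE; rewrite neq_ltn (leq_trans (ltn_ord y) mK) orbT.
      rewrite andbT (bigD1 (Ordinal mK))//= eqxx mul1r big1 ?addr0// => y /negbTE yn.
      rewrite eqz_nat (_ : (m == y) = false) ?mul0r//; apply/negbTE.
      by move/negbT: yn; apply: contraNneq => my; apply/eqP/val_inj.
    rewrite mean_sum; apply: eq_bigr => y _; rewrite meanZ mulrC; congr (_ * _).
  rewrite (eq_mean E) mean_sum; apply: eq_bigr => y _.
  by rewrite meanZ mulrC.
have s30 : 0 < s1 ^+ 3 * s2 ^+ 3 by rewrite mulr_gt0// exprn_gt0.
have h (y : 'I_K) : ballot_prob l1 0 y * ballot_prob l2 y 0 <= 4 * K%:R ^+ 2 / (s1 ^+ 3 * s2 ^+ 3).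
  have hb l (s : R) : 0 < s -> s ^+ 2 = l%:R -> ballot_prob l 0 y <= 2 * K%:R / s ^+ 3.
    move=> s0 sl; apply: le_trans (ballot_prob_ub s0 sl _) _ => //.
    rewrite ler_pM2r ?invr_gt0 ?exprn_gt0// ler_pM2l// -[(y%:Z)%:~R]/(y%:R) natr1 ler_nat.
    exact: ltn_ord.
  rewrite [X in _ * X]ballot_prob_sym//.
  apply: le_trans (ler_pM _ _ (hb _ _ s10 s1l) (hb _ _ s20 s2l)) _.
  - by apply: mean_ge0.
  - by apply: mean_ge0.
  rewrite le_eqVlt; apply/orP; left; apply/eqP; field.
  by rewrite !lt0r_neq0.
apply: le_trans (ler_sum _ (fun y _ => h y)) _.
rewrite sumr_const card_ord -[X in X <= _]mulr_natl 2!mulrA.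
by rewrite ler_pM2r ?invr_gt0// [K%:R * 4]mulrC -mulrA -exprS.
Qed.

Definition end_below (K : nat) (y : int) : R := ((0 <= y) && (y <= (K + K)%:Z))%:R.

Lemma conditionedE (K : nat) w :
  (nonneg_from K%:Z w)%:R * end_below K (K%:Z + height w) = (conditioned K w)%:R.
Proof.
rewrite /end_below /conditioned -natrM mulnb; congr (_%:R : R).
case: (boolP (nonneg_from _ w)) => // /nonneg_from_end -> /=.
by rewrite PoszD lerD2l.
Qed.

Lemma height_take_lip (w : seq bool) a b : (a <= b)%N ->
  `|height (take b w) - height (take a w)| <= (b - a)%:Z.
Proof.
move=> ab; rewrite -(subnKC ab) takeD height_cat addrC addKr (subnKC ab).
by rewrite (le_trans (height_bound _))// lez_nat size_take; case: ltnP.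
Qed.

(** The middle stretch [v] of a word of length [M] with [h] letters cut off at each end, drawn at
    the scale of the whole word, starting from height [x], and set to 0 near the ends of the time
    interval. *)
Definition midpath (eta : R) (M h : nat) (x : int) (v : seq bool) (t : R) : R :=
  if (eta <= t) && (t <= 1 - eta) then
    (x + height (take (Num.truncn (M%:R * t) - h) v))%:~R / Num.sqrt M%:R else 0.

(** The constant 9 is 5 for the discrepancy of the two truncated times plus 4 for that of the two
    normalisations. *)
Lemma midpath_close (eta : R) (M h K : nat) v : 0 < eta -> eta <= 1 / 8 -> (0 < M)%N ->
  h%:R <= eta * M%:R -> eta * M%:R <= h%:R + 2 -> (0 < size v)%N -> M = (h + (size v + h))%N ->
  sup_close (midpath eta M h K v) (squeeze eta (wpath v)) ((K%:R + 9) / Num.sqrt M%:R).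
Proof.
move=> e0 e8 M0 hl hu v0 ME t t01.
have s0 : 0 < Num.sqrt M%:R :> R by rewrite sqrtr_gt0 ltr0n.
rewrite /midpath /squeeze; case: ifPn => [/andP[h1 h2]|_]; last first.
  by rewrite subr0 normr0 divr_ge0// ltW.
have t'01 : 0 <= (t - eta) / (1 - 2 * eta) <= 1 by apply: squeeze_time => //; rlra.
rewrite /wpath; set t' := _ / (1 - _) in t'01 *; set m := (size v)%:R; set s := Num.sqrt M%:R in s0 *.
have m0 : 0 < m :> R by rewrite ltr0n.
set r := Num.sqrt m; have r0 : 0 < r by rewrite sqrtr_gt0.
set c := Num.sqrt _; have c0 : 0 <= c by exact: sqrtr_ge0.
have cc : c ^+ 2 = 1 - 2 * eta by rewrite sqr_sqrtr//; rlra.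
have rr : r ^+ 2 = m by rewrite sqr_sqrtr// ltW.
have ss : s ^+ 2 = M%:R by rewrite sqr_sqrtr.
have Mm : M%:R = m + 2 * h%:R :> R by rewrite ME !natrD -/m; ring.
have /andP[t'0 t'1] := t'01.
have mt'0 : 0 <= m * t' by rewrite mulr_ge0// ltW.
have Mt0 : 0 <= M%:R * t by rewrite mulr_ge0//; rlra.
have tE : t = (1 - 2 * eta) * t' + eta by rewrite /t'; field; apply: lt0r_neq0; rlra.
have /andP[a1 a2] := truncn_itv Mt0; have /andP[b1 b2] := truncn_itv mt'0.
set a := Num.truncn (M%:R * t) in a1 a2 *; set b := Num.truncn (m * t') in b1 b2 *.
rewrite -natr1 in a2; rewrite -natr1 in b2.
pose del : R := eta * M%:R - h%:R.
have del0 : 0 <= del by rewrite subr_ge0.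
have del2 : del <= 2 by rewrite /del; rlra.
have dE : m * t' = M%:R * t - h%:R - del + 2 * (del * t').
  by rewrite tE /del Mm; ring.
have dt0 : 0 <= del * t' by rewrite mulr_ge0.
have dt1 : del * t' <= del by rewrite ler_piMr.
have ha : (h <= a)%N.
  have : h%:R < a%:R + 1 :> R.
    apply: le_lt_trans a2; apply: (le_trans hl); rewrite mulrC ler_wpM2l//.
  by rewrite natr1 ltr_nat.
have hab : `|height (take (a - h) v) - height (take b v)| <= 5.
  have hn : (a - h <= b + 5)%N /\ (b <= a - h + 5)%N.
    have h3 : a%:R - h%:R <= b%:R + 5 :> R by rlra.
    have h4 : b%:R <= a%:R - h%:R + 5 :> R by rlra.
    by move: h3 h4; rewrite -(natrB _ ha) -!natrD !ler_nat.
  case: hn => h3 h4; case: (leqP (a - h) b) => ab.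
    by rewrite distrC (le_trans (height_take_lip _ ab))// lez_nat leq_subLR addnC [(5 + _)%N]addnC.
  by rewrite (le_trans (height_take_lip _ (ltnW ab)))// lez_nat leq_subLR.
set Ha := height _ in hab *; set Hb := height _ in hab *.
have hb : `|Hb%:~R| <= r ^+ 2.
  rewrite rr /m -intr_norm pmulrn ler_int (le_trans (height_bound _))// lez_nat size_take.
  by case: ltnP => // /ltnW.
have -> : (K%:Z + Ha)%:~R / s - c * (Hb%:~R / r) =
    K%:R / s + (Ha - Hb)%:~R / s + Hb%:~R * (r - c * s) / (s * r).
  by rewrite intrD intrB -pmulrn; field; rewrite !lt0r_neq0.
have hh1 : `|(Ha - Hb)%:~R / s| <= 5 / s.
  rewrite normrM [X in _ * X]gtr0_norm ?invr_gt0// ler_pM2r ?invr_gt0//.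
  by rewrite -intr_norm -[5]/(5%:~R) ler_int.
have hh2 : `|Hb%:~R * (r - c * s) / (s * r)| <= 4 / s.
  rewrite normrM [X in _ * X]gtr0_norm ?invr_gt0 ?mulr_gt0// normrM.
  rewrite ler_pdivrMr ?mulr_gt0// (_ : 4 / s * (s * r) = 4 * r); last by field; rewrite lt0r_neq0.
  apply: (@le_trans _ _ (r ^+ 2 * `|r - c * s|)); first by rewrite ler_wpM2r.
  rewrite expr2 -mulrA mulrC ler_pM2r//.
  apply: (@le_trans _ _ ((r + c * s) * `|r - c * s|)).
    by rewrite ler_wpM2r// lerDl mulr_ge0// ltW.
  have rcs : 0 <= r + c * s by rewrite addr_ge0// ?mulr_ge0// ltW.
  rewrite -[X in X * _](ger0_norm rcs) -normrM.
  have -> : (r + c * s) * (r - c * s) = 2 * del.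
    have -> : (r + c * s) * (r - c * s) = r ^+ 2 - c ^+ 2 * s ^+ 2 by ring.
    by rewrite rr cc ss /del Mm; ring.
  by rewrite ger0_norm; rlra.
apply: le_trans (ler_normD _ _) _; apply: le_trans (lerD (ler_normD _ _) (lexx _)) _.
rewrite (ger0_norm (x := K%:R / s)) ?divr_ge0 ?(ltW s0)//.
have -> : (K%:R + 9) / s = K%:R / s + 5 / s + 4 / s by field; rewrite lt0r_neq0.
by apply: lerD => //; apply: lerD.
Qed.

End Sandwich.

Section Sandwich2.
Context (d : measure_display) (T : measurableType d) (R : realType)
  (P : probability T R) (e : T -> R -> R).
Implicit Types (F H : (R -> R) -> R).
Hypothesis he : brownian_excursion P e.

(** An end pinned at 0 precedes every window of ends in likelihood ratio, so the Dyck walk lies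
    below the conditioned walk started at [k.*2]. Removing this shift from the conditioned path
    costs [L * rho], at most [eps / 2]. *)
Lemma sandwich_ub (L eps : R) F : lip L F -> unit_valued F -> path_increasing F -> 0 < eps ->
  exists N0 : nat, forall N, (N0 <= N)%N ->
    dyck_mean N (fun w => F (wpath w)) <=
    (ex P (fun w => F (e w)) + eps) * mean N.*2 (fun w => (dyck w)%:R).
Proof.
move=> LF uF iF e0.
wlog e1 : eps e0 / eps <= 1 => [hw|].
  have [N0 hN0] := hw (Num.min eps 1) ltac:(by rewrite lt_min e0 ltr01) ltac:(by rewrite ge_min lexx orbT).
  exists N0 => N /hN0 h; apply: le_trans h _; rewrite ler_wpM2r ?mean_ge0//.
  by rewrite lerD2l ge_min lexx.
have [d' [T' [Q [W [BM lim]]]]] := excursion_level_limit he.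
have L0 := lip_ge0 LF; have L1 : 0 < L + 1 by rlra.
pose rho := eps / (2 * (L + 1)).
have rho0 : 0 < rho by rewrite divr_gt0// mulr_gt0.
have Lrho : L * rho <= eps / 2.
  have -> : eps / 2 = (L + 1) * rho by rewrite /rho; field; rewrite lt0r_neq0.
  by rewrite ler_wpM2r ?(ltW rho0)//; rlra.
have e2 : 0 < eps / 2 <= 1 by rewrite divr_gt0//=; rlra.
have [N0 hN0] := conditioned_walk BM LF uF (ex_unit he LF uF) e2 rho0 (lim _ _ LF uF).
exists N0.+1 => N NN; have [k [kr c0 hub _]] := hN0 N (ltnW NN).
set c := fun w => _ in c0 hub.
pose phi (y : int) : R := (y == 0)%:R.
have N0' : (0 < N.*2)%N by rewrite double_gt0 (leq_trans _ NN).
have s0 : 0 < Num.sqrt N.*2%:R :> R by rewrite sqrtr_gt0 ltr0n.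
have phE w : (nonneg_from 0 w)%:R * phi (0 + height w) = (dyck w)%:R.
  by rewrite /phi /dyck -natrM mulnb add0r.
have h : dyck_mean N (fun w => F (wpath w)) * mean N.*2 c <=
    (mean N.*2 (fun w => c w * F (wpath w)) + eps / 2 * mean N.*2 c) * mean N.*2 (fun w => (dyck w)%:R).
  have -> : dyck_mean N (fun w => F (wpath w)) =
      mean N.*2 (fun w => (nonneg_from 0 w)%:R * phi (0 + height w) * F (wpath w)).
    by apply: eq_mean => w _; rewrite phE.
  have -> : mean N.*2 c = mean N.*2 (fun w => (nonneg_from (0 + k.*2%:Z) w)%:R * end_below R k.*2 (0 + k.*2%:Z + height w)).
    by apply: eq_mean => w _; rewrite add0r conditionedE.
  have -> : mean N.*2 (fun w => (dyck w)%:R) = mean N.*2 (fun w => (nonneg_from 0 w)%:R * phi (0 + height w)).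
    by apply: eq_mean => w _; rewrite phE.
  have -> : mean N.*2 (fun w => c w * F (wpath w)) + eps / 2 * mean N.*2 (fun w => (nonneg_from (0 + k.*2%:Z) w)%:R * end_below R k.*2 (0 + k.*2%:Z + height w)) =
      mean N.*2 (fun w => (nonneg_from (0 + k.*2%:Z) w)%:R * end_below R k.*2 (0 + k.*2%:Z + height w) * (F (wpath w) + eps / 2)).
    rewrite -meanZ -meanD; apply: eq_mean => w _.
    by rewrite add0r conditionedE mulrDr [X in _ + X]mulrC.
  apply: mean_domination => //.
    move=> y j; rewrite /phi /end_below -!natrM !mulnb ler_nat; case: j => [|j]; first by rewrite !addr0.
    case: (leP 0 y) => [y0|_]; last by rewrite andbF.
    by rewrite (_ : (y + _ == 0) = false)//; apply/negbTE; move: y0; clear; lia.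
  move=> w w' sw sw' hww.
  apply: (@le_trans _ _ (F (fun t => wpath w' t + k.*2%:R / Num.sqrt N.*2%:R))).
    apply: iF => t t01; rewrite /wpath sw sw' -mulrDl ler_pM2r ?invr_gt0//.
    have := hww (Num.truncn (N.*2%:R * t)); rewrite !add0r addrC -(ler_int R) intrD.
    by rewrite -pmulrn.
  have : sup_close (fun t => wpath w' t + k.*2%:R / Num.sqrt N.*2%:R) (wpath w') rho.
    move=> t _; rewrite addrC addKr ger0_norm ?divr_ge0 ?sqrtr_ge0//.
    by rewrite ler_pdivrMr.
  by move/LF; rewrite ler_norml => /andP[_]; move: Lrho; clear; rlra.
rewrite -(ler_pM2r c0); apply: le_trans h _; rewrite [leRHS]mulrAC ler_wpM2r ?mean_ge0//.
have -> : ex P (fun w => F (e w)) + eps = ex P (fun w => F (e w)) + eps / 2 + eps / 2 by rewrite -addrA -splitr.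
by rewrite [leRHS]mulrDl; exact: lerD hub (lexx _).
Qed.

End Sandwich2.

(** * Lower comparison, with the two ends cut off *)

Section SandwichLower.
Context (d : measure_display) (T : measurableType d) (R : realType)
  (P : probability T R) (e : T -> R -> R).
Implicit Types (F H : (R -> R) -> R).
Hypothesis he : brownian_excursion P e.

(** When the Dyck path is high at both cuts, its middle stretch dominates a conditioned walk, and
    what was cut off is nonnegative. The Dyck words that are low at a cut are a small fraction of
    all Dyck words by [low_at_time]. *)
Lemma sandwich_lb (L eps : R) F : lip L F -> unit_valued F -> path_increasing F -> 0 < eps ->
  exists N0 : nat, forall N, (N0 <= N)%N ->
    (ex P (fun w => F (e w)) - eps) * mean N.*2 (fun w => (dyck w)%:R) <=
    dyck_mean N (fun w => F (wpath w)).
Proof.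
move=> LF uF iF e0.
wlog e1 : eps e0 / eps <= 1 => [hw|].
  have [N0 hN0] := hw (Num.min eps 1) ltac:(by rewrite lt_min e0 ltr01) ltac:(by rewrite ge_min lexx orbT).
  exists N0 => N /hN0 h; apply: le_trans h; rewrite ler_wpM2r ?mean_ge0//.
  by rewrite lerD2l lerN2 ge_min lexx.
have [d' [T' [Q [W [BM lim]]]]] := excursion_level_limit he.
have L0 := lip_ge0 LF; have L1 : 0 < L + 1 by rlra.
have e4 : 0 < eps / 4 by rewrite divr_gt0.
have [eta /andP[eta0 eta8] hell] := squeeze_limit he LF uF e4.
have eta04 : eta <= 1 / 4 by rlra.
(* Chosen so that [a * s ^+ 2] is at most the product of the roots of the two lengths into which
   either cut divides the word. *)
pose a := Num.sqrt (eta / 4).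
have a0 : 0 < a by rewrite sqrtr_gt0 divr_gt0.
have a2 : a ^+ 2 = eta / 4 by rewrite sqr_sqrtr// ltW// divr_gt0.
(* With [x = rho / a] the low words have relative mass at most [64 * x ^+ 3], and
   [64 * eps / 512 = eps / 8]. *)
pose rho := Num.min (eps / (8 * (L + 1))) (a * (eps / 512)).
have kap0 : 0 < eps / 512 by rewrite divr_gt0 ?ltr0n.
have rho0 : 0 < rho.
  by rewrite lt_min (mulr_gt0 a0 kap0) andbT; apply: divr_gt0 => //; apply: mulr_gt0.
have Lrho : L * (2 * rho) <= eps / 4.
  have -> : eps / 4 = (L + 1) * (2 * (eps / (8 * (L + 1)))) by field; rewrite lt0r_neq0.
  by apply: ler_pM => //; [rewrite mulr_ge0// ltW|rlra|rewrite ler_pM2l// ge_min lexx].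
have rhoa : rho / a <= eps / 512 by rewrite ler_pdivrMr// mulrC ge_min lexx orbT.
have LS := squeeze_lip (ltW eta0) eta04 LF.
have uS : unit_valued (fun g => F (squeeze eta g)) by move=> g; exact: uF.
have e42 : 0 < eps / 4 <= 1 by rewrite e4; rlra.
have [N1 hN1] := conditioned_walk BM LS uS (ex_unit he LS uS) e42 rho0 (lim _ _ LS uS).
set ell := ex P (fun w => F (e w)) in hell *; set ell' := ex P _ in hell hN1.
have [N2 hN2] := large_nat (4 / eta).
have [N3 hN3] := large_sqrt (9 / rho).
exists (maxn 1 (maxn (N1.*2) (maxn N2 N3))) => N.
rewrite !geq_max => /and4P[N0 NN1 NN2 NN3].
pose M := N.*2.
have NM : (N <= M)%N by rewrite /M -addnn leq_addr.
have M0 : (0 < M)%N by rewrite double_gt0.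
have MR : M%:R = 2 * N%:R :> R by rewrite /M -mul2n natrM.
have etaN0 : 0 <= eta * N%:R by rewrite mulr_ge0// ltW.
pose h0 := Num.truncn (eta * N%:R).
have /andP[h01 h02] := truncn_itv etaN0; rewrite -/h0 -natr1 in h01 h02.
pose h := h0.*2.
have hR : h%:R = 2 * h0%:R :> R by rewrite /h -mul2n natrM.
have hl : h%:R <= eta * M%:R by rewrite hR MR; clear -h01 h02 etaN0; rlra.
have hu : eta * M%:R <= h%:R + 2 by rewrite hR MR; clear -h01 h02 etaN0; rlra.
have etaN4 : 4 <= eta * N%:R by rewrite mulrC -ler_pdivrMr// hN2.
have hge : eta * M%:R / 2 <= h%:R by rewrite hR MR; clear -h02 etaN4; rlra.
have h0N : (h0 * 8 <= N)%N.
  rewrite -(ler_nat R) natrM; apply: (@le_trans _ _ (eta * N%:R * 8)); first by rewrite ler_pM2r.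
  have : eta * N%:R <= 1 / 8 * N%:R by rewrite ler_wpM2r.
  by rlra.
pose N' := (N - h0.*2)%N.
have N'1 : (N1 <= N')%N by rewrite /N'; clear -NN1 h0N; lia.
have N'0 : (0 < N')%N by rewrite /N'; clear -N0 h0N; lia.
have ME : M = (h + (N'.*2 + h))%N by rewrite /M /h /N'; clear -h0N; lia.
have [k [kr c0 _ hlb]] := hN1 N' N'1.
set c := fun w => _ in c0 hlb.
pose K := k.*2.
pose s : R := Num.sqrt M%:R; have s0 : 0 < s by rewrite sqrtr_gt0 ltr0n.
have ss : s ^+ 2 = M%:R by rewrite sqr_sqrtr.
have Ks : K%:R <= rho * s.
  apply: le_trans kr _; rewrite ler_pM2l// ler_sqrt// ler_nat ME.
  by rewrite addnCA leq_addr.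
have s9 : 9 <= rho * s by rewrite mulrC -ler_pdivrMr// hN3// (leq_trans NN3).
pose F1 (x : int) (v : seq bool) := F (midpath eta M h x v).
pose B (y : int) := mean h (fun z => (nonneg_from y z && (y + height z == 0))%:R) : R.
(* [B] weighs an end of the middle stretch by its continuations to 0. As [high] charges only heights
   from [2 * K] on, where the window of [end_below] stops, the likelihood ratio is trivially
   monotone. *)
pose high (y : int) : R := ((K + K)%N%:Z <= y)%R%:R * B y.
have B0 y : 0 <= B y by apply: mean_ge0.
have high0 y : 0 <= high y by rewrite mulr_ge0.
have low1 : (ell - 3 / 4 * eps) * mean N'.*2 c <= mean N'.*2 (fun v => c v * F1 K%:Z v).
  have h1 : mean N'.*2 (fun v => c v * F (squeeze eta (wpath v))) - eps / 4 * mean N'.*2 c <=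
     mean N'.*2 (fun v => c v * F1 K%:Z v).
    rewrite lerBlDr -meanZ -meanD; apply: le_mean => v sv.
    rewrite [eps / 4 * _]mulrC -mulrDr ler_wpM2l//.
    have v0 : (0 < size v)%N by rewrite sv double_gt0.
    have MEv : M = (h + (size v + h))%N by rewrite sv.
    have := LF _ _ _ (midpath_close K eta0 eta8 M0 hl hu v0 MEv).
    have : L * ((K%:R + 9) / Num.sqrt M%:R) <= eps / 4.
      apply: le_trans Lrho; rewrite ler_wpM2l// ler_pdivrMr// -/s.
      by move: Ks s9; clear; rlra.
    rewrite -/(F1 K%:Z v) => h1; rewrite ler_norml => /andP[h2 _].
    by move: h1 h2; clear; rlra.
  apply: le_trans h1; apply: (le_trans _ (lerB hlb (lexx (eps / 4 * mean N'.*2 c)))).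
  by rewrite -mulrBl ler_pM2r//; move: hell; clear; rlra.
have step1 (u : seq bool) : size u = h -> nonneg_from 0 u -> (K%:Z <= height u) ->
    (ell - 3 / 4 * eps) * mean N'.*2 (fun v => (nonneg_from (height u) v)%:R * high (height u + height v)) <=
    mean N'.*2 (fun v => (nonneg_from (height u) v)%:R * high (height u + height v) * F1 (height u) v).
  move=> su nu Ku.
  (* [h] and [K] are even, so both starting heights have the same parity, as the domination
     requires. *)
  have [k' uE] : exists k' : nat, height u = K%:Z + k'.*2%:Z.
    have [j jE] := height_even su; exists (absz (height u - K%:Z)%R)./2.
    by move: Ku jE; rewrite /K; clear; lia.
  rewrite uE.
  have hd : mean N'.*2 (fun v => (nonneg_from K%:Z v)%:R * end_below R K (K%:Z + height v) * F1 K%:Z v) *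
    mean N'.*2 (fun v => (nonneg_from (K%:Z + k'.*2%:Z) v)%:R * high (K%:Z + k'.*2%:Z + height v)) <=
    mean N'.*2 (fun v => (nonneg_from (K%:Z + k'.*2%:Z) v)%:R * high (K%:Z + k'.*2%:Z + height v) * F1 (K%:Z + k'.*2%:Z) v) *
    mean N'.*2 (fun v => (nonneg_from K%:Z v)%:R * end_below R K (K%:Z + height v)).
    apply: mean_domination => //.
      move=> y j; rewrite /end_below /high.
      have [yK|yK] := leP (K + K)%N%:Z y; last by rewrite !mul0r mulr0 mulr_ge0// mulr_ge0.
      case: j => [|j]; first by rewrite !addr0 yK.
      rewrite (_ : (y + j.+1.*2%:Z <= (K + K)%N%:Z) = false); last by move: yK; clear; lia.
      by rewrite andbF mul0r mulr_ge0// mulr_ge0.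
    move=> v v' sv sv' vv; apply: iF => t t01; rewrite /midpath.
    by case: ifP => // _; rewrite ler_pM2r ?invr_gt0// ler_int.
  have E1 : mean N'.*2 (fun v => (nonneg_from K%:Z v)%:R * end_below R K (K%:Z + height v)) = mean N'.*2 c.
    by apply: eq_mean => v _; rewrite conditionedE.
  have E2 : mean N'.*2 (fun v => (nonneg_from K%:Z v)%:R * end_below R K (K%:Z + height v) * F1 K%:Z v) =
      mean N'.*2 (fun v => c v * F1 K%:Z v).
    by apply: eq_mean => v _; rewrite conditionedE.
  rewrite E1 E2 in hd; rewrite -(ler_pM2r c0); apply: le_trans hd.
  rewrite mulrAC ler_wpM2r//; first by apply: mean_ge0 => v _; rewrite mulr_ge0.
pose good (u v : seq bool) : R := (nonneg_from 0 u && (K%:Z <= height u)%R)%:R *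
  ((nonneg_from (height u) v)%:R * high (height u + height v)).
pose G := mean h (fun u => mean N'.*2 (good u)).
have low2 : (ell - 3 / 4 * eps) * G <= dyck_mean N (fun w => F (wpath w)).
  apply: (@le_trans _ _ (mean h (fun u => mean N'.*2 (fun v => good u v * F1 (height u) v)))).
    rewrite /G -meanZ; apply: le_mean => u su; rewrite /good.
    case: (boolP (_ && _)) => [/andP[nu Ku]|_]; last first.
      by under eq_mean do rewrite mul0r; under [leRHS]eq_mean do rewrite !mul0r; rewrite !mean_cst mulr0.
    under eq_mean do rewrite mul1r; under [leRHS]eq_mean do rewrite mul1r.
    exact: step1.
  rewrite /dyck_mean -/M ME mean_cat; apply: le_mean => u su.
  rewrite mean_cat; apply: le_mean => v sv.
  have -> : good u v * F1 (height u) v = mean h (fun z =>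
      ((nonneg_from 0 u && (K%:Z <= height u)%R)%:R * (nonneg_from (height u) v)%:R *
       ((K + K)%N%:Z <= height u + height v)%R%:R * F1 (height u) v) *
      (nonneg_from (height u + height v) z && (height u + height v + height z == 0))%:R).
    by rewrite meanZ /good /high -/(B _); ring.
  apply: le_mean => z sz.
  rewrite /dyck !nonneg_from_cat !height_cat !add0r addrA.
  case: (boolP (nonneg_from 0 u)) => nu; last by rewrite !(mul0r, mulr0).
  case: (boolP (nonneg_from (height u) v)) => nv; last by rewrite !(mul0r, mulr0).
  case: (boolP (nonneg_from (height u + height v) z)) => nz; last by rewrite !(mul0r, mulr0).
  case: eqP => hz; last by rewrite !(mul0r, mulr0).
  (* On the middle stretch the two paths agree; elsewhere [midpath] is 0 and the Dyck path
     nonnegative. *)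
  have FF : F1 (height u) v <= F (wpath (u ++ v ++ z)).
    apply: iF => t /andP[t0 t1]; rewrite /midpath /wpath.
    have sM : size (u ++ v ++ z) = M by rewrite !size_cat su sv sz ME.
    rewrite sM; set q := Num.truncn _.
    have nw : nonneg_from 0 (u ++ v ++ z) by rewrite !nonneg_from_cat !add0r nu nv nz.
    case: ifPn => [/andP[h1 h2]|_]; last first.
      by rewrite divr_ge0// ?sqrtr_ge0// ler0z; have /nonneg_fromP/(_ q) := nw; rewrite add0r.
    rewrite ler_pM2r ?invr_gt0// ler_int.
    have Mt0 : 0 <= M%:R * t by rewrite mulr_ge0.
    have /andP[q1 q2] := truncn_itv Mt0; rewrite -/q -natr1 in q1 q2.
    have hq : (h <= q)%N.
      have : h%:R < q%:R + 1 :> R.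
        by apply: le_lt_trans q2; apply: (le_trans hl); rewrite mulrC ler_wpM2l.
      by rewrite natr1 ltr_nat.
    have qh : (q - h <= size v)%N.
      have : M%:R * t <= M%:R * (1 - eta) by rewrite ler_wpM2l.
      have : q%:R + h%:R <= M%:R * t + eta * M%:R by rewrite lerD.
      rewrite sv => h3 h4.
      have : (q + h <= M)%N by rewrite -(ler_nat R) natrD; move: h3 h4; clear; rlra.
      by rewrite ME; clear; lia.
    by rewrite take_cat su ltnNge hq /= height_cat takel_cat.
  have /andP[F10 _] : 0 <= F1 (height u) v <= 1 by exact: uF.
  have /andP[f0 _] := uF (wpath (u ++ v ++ z)).
  by case: (K%:Z <= height u); case: (_ <= height u + height v);
    rewrite /= !(mul1r, mul0r, mulr1, mulr0).
set D := mean N.*2 (fun w => (dyck w)%:R).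
have good_dyck u v : mean h (fun z => (dyck (u ++ v ++ z))%:R) =
    (nonneg_from 0 u)%:R * ((nonneg_from (height u) v)%:R * B (height u + height v)).
  rewrite /B -!meanZ; apply: eq_mean => z _.
  by rewrite /dyck !nonneg_from_cat !height_cat !add0r addrA -!natrM !mulnb !andbA.
have GD : G <= D.
  rewrite /G /D -/M ME mean_cat; apply: le_mean => u su; rewrite mean_cat; apply: le_mean => v sv.
  rewrite good_dyck /good /high; have := B0 (height u + height v); set b := B _ => b0.
  by case: (nonneg_from 0 u); case: (nonneg_from (height u) v); case: (K%:Z <= height u);
    case: (_ <= height u + height v); rewrite /= !(mul1r, mul0r, mulr1, mulr0).
have Dlb : s ^- 3 / 2 <= D by apply: dyck_lb.
pose bad1 := mean M (fun w => (dyck w && (height (take h w) < (K + K)%N%:Z))%:R) : R.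
pose bad2 := mean M (fun w => (dyck w && (height (take (h + N'.*2) w) < (K + K)%N%:Z))%:R) : R.
have DG : D - G <= bad1 + bad2.
  rewrite lerBlDr /D -/M /bad1 /bad2 /G {1 2 3}ME !mean_cat -!meanD.
  apply: le_mean => u su; rewrite !mean_cat -!meanD; apply: le_mean => v sv.
  have -> : mean h (fun z => (dyck (u ++ v ++ z) && (height (take h (u ++ v ++ z)) < (K + K)%N%:Z))%:R) =
      (height u < (K + K)%N%:Z)%R%:R * mean h (fun z => (dyck (u ++ v ++ z))%:R) :> R.
    by rewrite -meanZ; apply: eq_mean => z _; rewrite take_size_cat// -natrM mulnb andbC.
  have -> : mean h (fun z => (dyck (u ++ v ++ z) && (height (take (h + N'.*2) (u ++ v ++ z)) < (K + K)%N%:Z))%:R) =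
      (height u + height v < (K + K)%N%:Z)%R%:R * mean h (fun z => (dyck (u ++ v ++ z))%:R) :> R.
    rewrite -meanZ; apply: eq_mean => z _; rewrite catA take_size_cat ?size_cat ?su ?sv//.
    by rewrite height_cat -natrM mulnb andbC.
  rewrite good_dyck /good /high; have := B0 (height u + height v); set b := B _ => b0.
  case: (nonneg_from 0 u); case: (nonneg_from (height u) v);
    rewrite /= !(mul1r, mul0r, mulr1, mulr0) ?addr0//.
  have [h1|h1] := leP (K + K)%N%:Z (height u); last first.
    by rewrite mul1r -addrA lerDl addr_ge0// mulr_ge0// mulr_ge0.
  rewrite (_ : (K%:Z <= height u) = true); last by move: h1; clear; lia.
  by have [h2|h2] := leP (K + K)%N%:Z (height u + height v); rewrite !(mul1r, mul0r, add0r, addr0).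
have bad_ub l1 l2 : M = (l1 + l2)%N -> eta * M%:R / 2 <= l1%:R -> eta * M%:R / 2 <= l2%:R ->
    mean M (fun w => (dyck w && (height (take l1 w) < (K + K)%N%:Z))%:R) <= eps / 8 * D.
  move=> Ml hl1 hl2; set q := eta * M%:R / 2 in hl1 hl2.
  have MR0 : 0 < M%:R :> R by rewrite ltr0n.
  have q0 : 0 < q by rewrite divr_gt0// mulr_gt0.
  have l10 : 0 < l1%:R :> R by apply: lt_le_trans hl1.
  have l20 : 0 < l2%:R :> R by apply: lt_le_trans hl2.
  have s10 : 0 < Num.sqrt l1%:R :> R by rewrite sqrtr_gt0.
  have s20 : 0 < Num.sqrt l2%:R :> R by rewrite sqrtr_gt0.
  rewrite {1}Ml; apply: le_trans (low_at_time (K + K) s10 s20 (sqr_sqrtr (ltW l10)) (sqr_sqrtr (ltW l20))) _.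
  rewrite -exprMn; set s12 := _ * Num.sqrt l2%:R.
  have s12E : s12 ^+ 2 = l1%:R * l2%:R by rewrite exprMn !sqr_sqrtr// ltW.
  have s12lb : a * s ^+ 2 <= s12.
    rewrite -(ler_pXn2r (n := 2))// ?nnegrE ?mulr_ge0 ?exprn_ge0 ?(ltW a0) ?(ltW s0) ?(ltW s10) ?(ltW s20)//.
    rewrite s12E exprMn a2 ss.
    have Mll : M%:R = l1%:R + l2%:R :> R by rewrite Ml natrD.
    have : 0 <= (l1%:R - q) * (l2%:R - q) by rewrite mulr_ge0// subr_ge0.
    have -> : eta / 4 * M%:R ^+ 2 = q * M%:R / 2 by rewrite /q; field.
    have : q * q <= q * (M%:R / 2).
      rewrite ler_pM2l// /q ler_pM2r// ger_pMl//.
      by apply: (le_trans eta8); rewrite ler_pdivrMr// mul1r ler1n.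
    by rewrite Mll; clear; rlra.
  have as0 : 0 < a * s ^+ 2 by rewrite mulr_gt0// exprn_gt0.
  have s120 : 0 < s12 by apply: lt_le_trans s12lb.
  pose x := rho / a; have x0 : 0 < x by rewrite divr_gt0.
  have x1 : x <= eps / 512 by [].
  have KK : (K + K)%:R <= 2 * (rho * s) :> R by rewrite natrD; move: Ks; clear; rlra.
  apply: (@le_trans _ _ (4 * (2 * (rho * s)) ^+ 3 / (a * s ^+ 2) ^+ 3)).
    have i0 : 0 <= 4 * (K + K)%:R ^+ 3 :> R by rewrite mulr_ge0 ?exprn_ge0.
    have i1 : 0 <= (s12 ^+ 3)^-1 by rewrite invr_ge0 exprn_ge0// ltW.
    apply: ler_pM i0 i1 _ _.
      rewrite ler_pM2l//; apply: lerXn2r KK; rewrite nnegrE// mulr_ge0// mulr_ge0// ltW//.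
    rewrite lef_pV2 ?posrE ?exprn_gt0//; apply: lerXn2r s12lb; by rewrite nnegrE ltW.
  have -> : 4 * (2 * (rho * s)) ^+ 3 / (a * s ^+ 2) ^+ 3 = 64 * x ^+ 3 * (s ^- 3 / 2).
    by rewrite /x; field; rewrite !lt0r_neq0.
  have i0 : 0 <= 64 * x ^+ 3 by rewrite mulr_ge0 ?exprn_ge0 ?(ltW x0).
  have i1 : 0 <= s ^- 3 / 2 by rewrite divr_ge0 ?invr_ge0 ?exprn_ge0 ?(ltW s0).
  apply: ler_pM i0 i1 _ Dlb.
  have x3 : x ^+ 3 <= x.
    rewrite exprS ger_pMr// exprn_ile1 ?(ltW x0)//; apply: (le_trans x1).
    by rewrite ler_pdivrMr ?ltr0n// mul1r (le_trans e1)// ler1n.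
  by move: x1 x3 e0; set y := x ^+ 3; clear; rlra.
have E1 : bad1 <= eps / 8 * D.
  apply: (bad_ub h (N'.*2 + h)%N) => //.
  apply: (le_trans hge); rewrite ler_nat leq_addl//.
have E2 : bad2 <= eps / 8 * D.
  apply: (bad_ub (h + N'.*2)%N h) => //; first by rewrite -addnA.
  apply: (le_trans hge); rewrite ler_nat leq_addr//.
have ell01 := ex_unit he LF uF; rewrite -/ell in ell01; case/andP: ell01 => ell0 ell1.
apply: le_trans low2.
have D0 : 0 <= D by apply: mean_ge0.
have DG' : D - G <= eps / 4 * D by move: E1 E2 DG; clear; rlra.
have [q0|q0] := leP 0 (ell - 3 / 4 * eps).
  have : (ell - 3 / 4 * eps) * (D - G) <= 1 * (eps / 4 * D).
    by apply: ler_pM => //; [rewrite subr_ge0|move: e0 ell1; clear; rlra].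
  by clear; rlra.
have : (ell - 3 / 4 * eps) * D <= (ell - 3 / 4 * eps) * G by rewrite ler_wnM2l// ltW.
have : 0 <= eps * D by rewrite mulr_ge0// ltW.
by clear; rlra.
Qed.

End SandwichLower.

(** * Lipschitz functionals of the Dyck path *)

Section MonotoneAlgebra.
Variable R : realType.
Implicit Types (F G H : (R -> R) -> R) (g : R -> R).

Definition mono F := [/\ exists L, lip L F, unit_valued F & path_increasing F].

Lemma monoM F G : mono F -> mono G -> mono (fun g => F g * G g).
Proof.
move=> [[L LF] uF iF] [[L' LG] uG iG]; split.
- by exists (L + L'); exact: lipM.
- exact: unit_valuedM.
- move=> f g fg; have /andP[a0 _] := uF f; have /andP[b0 _] := uG f.
  by apply: ler_pM => //; [exact: iF|exact: iG].
Qed.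

(** Linear combinations of [mono] functionals. They form an algebra because products of nonnegative
    increasing functionals are increasing, which is where the lower bound in [unit_valued]
    enters. *)
Inductive mono_span : ((R -> R) -> R) -> Prop :=
| mono_span0 : mono_span (fun=> 0)
| mono_spanS c F G : mono F -> mono_span G -> mono_span (fun g => c * F g + G g).

Lemma mono_span_ext F G : (forall g, F g = G g) -> mono_span F -> mono_span G.
Proof. by move=> /funext ->. Qed.

Lemma mono_spanD F G : mono_span F -> mono_span G -> mono_span (fun g => F g + G g).
Proof.
move=> sF sG; elim: sF => [|c F' G' mF' _ IH].
  by apply: mono_span_ext sG => g; rewrite add0r.
by apply: mono_span_ext (mono_spanS c mF' IH) => g; rewrite addrA.
Qed.

Lemma mono_spanZ a F : mono_span F -> mono_span (fun g => a * F g).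
Proof.
move=> sF; elim: sF => [|c F' G' mF' _ IH].
  by apply: mono_span_ext mono_span0 => g; rewrite mulr0.
by apply: mono_span_ext (mono_spanS (a * c) mF' IH) => g; rewrite mulrDr mulrA.
Qed.

Lemma mono_span_mono F : mono F -> mono_span F.
Proof.
move=> mF; apply: mono_span_ext (mono_spanS 1 mF mono_span0) => g.
by rewrite mul1r addr0.
Qed.

Lemma mono_spanB F G : mono_span F -> mono_span G -> mono_span (fun g => F g - G g).
Proof.
move=> sF sG; apply: mono_span_ext (mono_spanD sF (mono_spanZ (-1) sG)) => g.
by rewrite mulN1r.
Qed.

Lemma mono_spanM F G : mono_span F -> mono_span G -> mono_span (fun g => F g * G g).
Proof.
move=> sF sG; elim: sF => [|c F' G' mF' _ IH].
  by apply: mono_span_ext mono_span0 => g; rewrite mul0r.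
have h : mono_span (fun g => F' g * G g).
  elim: sG => [|c' F2 G2 mF2 _ IH2].
    by apply: mono_span_ext mono_span0 => g; rewrite mulr0.
  apply: mono_span_ext (mono_spanS c' (monoM mF' mF2) IH2) => g.
  by rewrite mulrDr mulrCA.
by apply: mono_span_ext (mono_spanD (mono_spanZ c h) IH) => g; rewrite mulrDl mulrA.
Qed.

Lemma mono_span_sum (I : Type) (r : seq I) (Q : pred I) (c : I -> R) (F : I -> (R -> R) -> R) :
  (forall i, mono_span (F i)) -> mono_span (fun g => \sum_(i <- r | Q i) c i * F i g).
Proof.
move=> h; elim: r => [|i r IHr].
  by apply: mono_span_ext mono_span0 => g; rewrite big_nil.
case Qi: (Q i).
  by apply: mono_span_ext (mono_spanD (mono_spanZ (c i) (h i)) IHr) => g; rewrite big_cons Qi.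
by apply: mono_span_ext IHr => g; rewrite big_cons Qi.
Qed.

Lemma mono_span_prod (I : Type) (r : seq I) (F : I -> (R -> R) -> R) :
  (forall i, mono_span (F i)) -> mono_span (fun g => \prod_(i <- r) F i g).
Proof.
move=> h; elim: r => [|i r IHr].
  apply: (@mono_span_ext (fun=> 1)); first by move=> g; rewrite big_nil.
  apply: mono_span_mono; split.
  - exists 1 => f g c fg; rewrite subrr normr0 mul1r.
    by apply: le_trans (fg 0 _) => //; rewrite lexx ler01.
  - by move=> g; rewrite ler01 lexx.
  - by move=> f g _.
by apply: mono_span_ext (mono_spanM (h i) IHr) => g; rewrite big_cons.
Qed.

Definition window (K i : nat) : set R :=
  [set t | 0 <= t <= 1 /\ i%:R / K.+1%:R <= t <= i.+1%:R / K.+1%:R].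

(** Differences of consecutive ramps are tents of width [2 / q] around [j / q]: a partition of unity
    on nonnegative values, made from increasing functions. *)
Definition ramp (q : R) (j : nat) (x : R) : R := clamp (q * x + 1 - j%:R).

Definition sup_ramp K i q j g : R := sup [set ramp q j (g t) | t in window K i].
Definition inf_ramp K i q j g : R := 1 - sup [set 1 - ramp q j (g t) | t in window K i].

Lemma window_neq0 K i : (i <= K)%N -> window K i !=set0.
Proof.
move=> iK; exists (i%:R / K.+1%:R); rewrite /window /= lexx ler_pM2r ?invr_gt0// ler_nat leqnSn.
by rewrite divr_ge0// ler_pdivrMr// mul1r ler_nat; split => //; exact: leqW.
Qed.

Lemma window_dist K i (t u : R) : window K i t -> window K i u -> `|t - u| <= K.+1%:R^-1.
Proof.
move=> [_ wt] [_ wu].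
have E : i.+1%:R / K.+1%:R = i%:R / K.+1%:R + K.+1%:R^-1 :> R by rewrite -natr1 mulrDl mul1r.
have h (x y : R) : x <= t <= x + y -> x <= u <= x + y -> `|t - u| <= y.
  by rewrite ler_norml => /andP[w1 w2] /andP[w3 w4]; apply/andP; split; lra.
by apply: (h (i%:R / K.+1%:R)); rewrite -E.
Qed.

Lemma ramp01 q j x : 0 <= ramp q j x <= 1.
Proof. by rewrite clamp_ge0 clamp_le1. Qed.

Lemma ramp_homo q j x y : 0 <= q -> x <= y -> ramp q j x <= ramp q j y.
Proof. by move=> q0 xy; apply: clamp_homo; rewrite !lerD2r ler_wpM2l. Qed.

Lemma ramp_lip q j x y : 0 <= q -> `|ramp q j x - ramp q j y| <= q * `|x - y|.
Proof.
move=> q0; apply: le_trans (clamp_lip _ _) _.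
have -> : q * x + 1 - j%:R - (q * y + 1 - j%:R) = q * (x - y) by ring.
by rewrite normrM ger0_norm.
Qed.

Lemma ramp_step q j x : ramp q j.+1 x <= ramp q j x.
Proof. by apply: clamp_homo; rewrite lerD2l lerN2 ler_nat. Qed.

Section Window.
Variables (K i : nat) (q : R).
Hypotheses (iK : (i <= K)%N) (q0 : 0 <= q).

Let ub1 j g t : window K i t -> ramp q j (g t) <= 1.
Proof. by move=> _; have /andP[] := ramp01 q j (g t). Qed.
Let ub2 j g t : window K i t -> 1 - ramp q j (g t) <= 1.
Proof. by move=> _; have /andP[h _] := ramp01 q j (g t); rewrite lerBlDr lerDl. Qed.

Lemma sup_ramp_ge j g t : window K i t -> ramp q j (g t) <= sup_ramp K i q j g.
Proof. by move=> wt; apply: (@sup_image_ub _ _ _ (fun t => ramp q j (g t))) => // u; exact: ub1. Qed.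

Lemma inf_ramp_le j g t : window K i t -> inf_ramp K i q j g <= ramp q j (g t).
Proof.
move=> wt; rewrite /inf_ramp lerBlDr -lerBlDl.
by apply: (@sup_image_ub _ _ _ (fun t => 1 - ramp q j (g t))) => // u; exact: ub2.
Qed.

Lemma sup_ramp_le j g c : (forall t, window K i t -> ramp q j (g t) <= c) -> sup_ramp K i q j g <= c.
Proof. by move=> h; apply: sup_image_le => //; exact: window_neq0. Qed.

Lemma inf_ramp_ge j g c : (forall t, window K i t -> c <= ramp q j (g t)) -> c <= inf_ramp K i q j g.
Proof.
move=> h; rewrite /inf_ramp lerBrDr -lerBrDl; apply: sup_image_le; first exact: window_neq0.
by move=> t /h; lra.
Qed.

Lemma mono_sup_ramp j : mono (sup_ramp K i q j).
Proof.
have [t0 wt0] := window_neq0 iK.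
split.
- have aux f g c : sup_close f g c -> sup_ramp K i q j f <= sup_ramp K i q j g + q * c.
    move=> fg; apply: le_sup_image => [||t [t01 _]]; [exact: window_neq0|exact: ub1|].
    have := ramp_lip j (f t) (g t) q0; have : q * `|f t - g t| <= q * c by rewrite ler_wpM2l// fg.
    by rewrite ler_norml => h /andP[_]; lra.
  exists q => f g c fg; have gf : sup_close g f c by move=> t t01; rewrite distrC fg.
  have := aux _ _ _ fg; have := aux _ _ _ gf; rewrite ler_norml => h1 h2.
  by apply/andP; split; lra.
- move=> g; apply/andP; split; last by apply: sup_ramp_le => t; exact: ub1.
  by apply: le_trans (sup_ramp_ge j g wt0); have /andP[] := ramp01 q j (g t0).
- move=> f g fg; apply: sup_ramp_le => t wt; apply: le_trans (sup_ramp_ge j g wt).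
  by apply: ramp_homo => //; apply: fg; case: wt.
Qed.

Lemma mono_inf_ramp j : mono (inf_ramp K i q j).
Proof.
have [t0 wt0] := window_neq0 iK.
split.
- have aux f g c : sup_close f g c -> inf_ramp K i q j f <= inf_ramp K i q j g + q * c.
    move=> fg; rewrite -lerBlDr; apply: inf_ramp_ge => t wt; have [t01 _] := wt.
    have := inf_ramp_le j f wt.
    have := ramp_lip j (f t) (g t) q0; have : q * `|f t - g t| <= q * c by rewrite ler_wpM2l// fg.
    by rewrite ler_norml => h /andP[_]; lra.
  exists q => f g c fg; have gf : sup_close g f c by move=> t t01; rewrite distrC fg.
  have := aux _ _ _ fg; have := aux _ _ _ gf; rewrite ler_norml => h1 h2.
  by apply/andP; split; lra.
- move=> g; apply/andP; split; first by apply: inf_ramp_ge => t _; have /andP[] := ramp01 q j (g t).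
  by apply: le_trans (inf_ramp_le j g wt0) _; have /andP[] := ramp01 q j (g t0).
- move=> f g fg; apply: inf_ramp_ge => t wt; apply: le_trans (inf_ramp_le j f wt) _.
  by apply: ramp_homo => //; apply: fg; case: wt.
Qed.

Lemma sup_ramp_step j g : sup_ramp K i q j.+1 g <= sup_ramp K i q j g.
Proof. by apply: sup_ramp_le => t wt; apply: le_trans (ramp_step _ _ _) (sup_ramp_ge j g wt). Qed.

Lemma inf_ramp_step j g : inf_ramp K i q j.+1 g <= inf_ramp K i q j g.
Proof. by apply: inf_ramp_ge => t wt; apply: le_trans (inf_ramp_le j.+1 g wt) (ramp_step _ _ _). Qed.

End Window.

(** Localises [q] times the infimum of [g] on the window near [c.1], and [q] times its supremum near
    [c.2]. Infima and suprema over windows are increasing in the path, and together they determine a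
    continuous path up to a small error. *)
Definition cell_weight K i q (c : nat * nat) g : R :=
  (inf_ramp K i q c.1 g - inf_ramp K i q c.1.+1 g) *
  (sup_ramp K i q c.2 g - sup_ramp K i q c.2.+1 g).

Lemma cell_weight_ge0 K i q c g : (i <= K)%N -> 0 <= cell_weight K i q c g.
Proof. by move=> iK; rewrite mulr_ge0// subr_ge0 ?inf_ramp_step ?sup_ramp_step. Qed.

Lemma cell_weight_span K i q c : (i <= K)%N -> 0 <= q -> mono_span (cell_weight K i q c).
Proof.
move=> iK q0; apply: mono_spanM; apply: mono_spanB; apply: mono_span_mono.
- exact: mono_inf_ramp. - exact: mono_inf_ramp. - exact: mono_sup_ramp. - exact: mono_sup_ramp.
Qed.

Lemma cell_weight_sum K i q J g :
  \sum_(j < J) \sum_(k < J) cell_weight K i q (nat_of_ord j, nat_of_ord k) g =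
  (inf_ramp K i q 0 g - inf_ramp K i q J g) * (sup_ramp K i q 0 g - sup_ramp K i q J g).
Proof.
have tel (a : nat -> R) : \sum_(j < J) (a j - a j.+1) = a 0 - a J.
  elim: J => [|n IHn]; first by rewrite big_ord0 subrr.
  by rewrite big_ord_recr IHn /=; ring.
rewrite -(tel (fun j => inf_ramp K i q j g)) -(tel (fun j => sup_ramp K i q j g)).
by rewrite mulr_suml; apply: eq_bigr => j _; rewrite mulr_sumr.
Qed.

Lemma cell_weight_neq0 K i q (c : nat * nat) g : (i <= K)%N -> cell_weight K i q c g != 0 ->
  [/\ forall t, window K i t -> c.1%:R - 1 <= q * g t <= c.2%:R + 1,
      exists2 t, window K i t & q * g t <= c.1%:R + 1 &
      exists2 t, window K i t & c.2%:R - 1 <= q * g t].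
Proof.
move=> iK h; split.
- move=> t wt; apply/andP; split; rewrite leNgt; apply/negP => hc; move: h.
    have : inf_ramp K i q c.1 g <= 0.
      by apply: le_trans (inf_ramp_le q c.1 g wt) _; rewrite /ramp clamp0//; lra.
    have : 0 <= inf_ramp K i q c.1.+1 g by apply: inf_ramp_ge => // u _; have /andP[] := ramp01 q c.1.+1 (g u).
    have := inf_ramp_step q iK c.1 g => h1 h2 h3.
    by rewrite /cell_weight (_ : _ - _ = 0) ?mul0r ?eqxx//; lra.
  have : 1 <= sup_ramp K i q c.2.+1 g.
    by apply: le_trans (sup_ramp_ge q c.2.+1 g wt); rewrite /ramp clamp1// -natr1; lra.
  have : sup_ramp K i q c.2 g <= 1 by apply: sup_ramp_le => // u _; have /andP[] := ramp01 q c.2 (g u).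
  have := sup_ramp_step q iK c.2 g => h1 h2 h3.
  by rewrite /cell_weight [X in _ * X](_ : _ - _ = 0) ?mulr0 ?eqxx//; lra.
- apply: contrapT => hn; move: h.
  have : 1 <= inf_ramp K i q c.1.+1 g.
    apply: inf_ramp_ge => // t wt; rewrite /ramp clamp1// -natr1.
    have : ~ q * g t <= c.1%:R + 1 by move=> ht; apply: hn; exists t.
    by move/negP; rewrite -ltNge; lra.
  have [t0 wt0] := window_neq0 iK.
  have : inf_ramp K i q c.1 g <= 1.
    by apply: le_trans (inf_ramp_le q c.1 g wt0) _; have /andP[] := ramp01 q c.1 (g t0).
  have := inf_ramp_step q iK c.1 g => h1 h2 h3.
  by rewrite /cell_weight (_ : _ - _ = 0) ?mul0r ?eqxx//; lra.
- apply: contrapT => hn; move: h.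
  have : sup_ramp K i q c.2 g <= 0.
    apply: sup_ramp_le => // t wt; rewrite /ramp clamp0//.
    have : ~ c.2%:R - 1 <= q * g t by move=> ht; apply: hn; exists t.
    by move/negP; rewrite -ltNge; lra.
  have [t0 wt0] := window_neq0 iK.
  have : 0 <= sup_ramp K i q c.2.+1 g.
    by apply: le_trans (sup_ramp_ge q c.2.+1 g wt0); have /andP[] := ramp01 q c.2.+1 (g t0).
  have := sup_ramp_step q iK c.2 g => h1 h2 h3.
  by rewrite /cell_weight [X in _ * X](_ : _ - _ = 0) ?mulr0 ?eqxx//; lra.
Qed.

(** The minimum with [K] puts [t = 1] into the last window. *)
Definition window_of (K : nat) (t : R) : 'I_K.+1 := inord (minn (Num.truncn (K.+1%:R * t)) K).

Lemma window_ofP K t : 0 <= t <= 1 -> window K (window_of K t) t.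
Proof.
move=> t01; split => //; have /andP[t0 t1] := t01.
have Kt : 0 <= K.+1%:R * t by rewrite mulr_ge0.
have /andP[a1 a2] := truncn_itv Kt.
rewrite /window_of inordK ?ltnS ?geq_minr//; set a := Num.truncn _ in a1 a2 *.
rewrite ler_pdivrMr// ler_pdivlMr// [t * _]mulrC; apply/andP; split.
  by apply: le_trans a1; rewrite ler_nat geq_minl.
have [aK|aK] := leqP a K; first by rewrite (ltW a2).
by rewrite ler_piMr.
Qed.

Definition cell_path K J q (f : {ffun 'I_K.+1 -> 'I_J * 'I_J}) (t : R) : R :=
  (nat_of_ord (f (window_of K t)).1)%:R / q.

Definition cell_good K J (f : {ffun 'I_K.+1 -> 'I_J * 'I_J}) : bool :=
  [forall i, (f i).2 <= (f i).1 + 2]%N.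

(** On a good cell [g] is within [3 / q] of [cell_path], so [G g] is at least the coefficient. Cells
    on which the path oscillates too much are dropped, which keeps a minorant since [G >= 0]; this
    works for every function [g], continuous or not. *)
Definition lower_span K J q L G g : R :=
  \sum_(f : {ffun 'I_K.+1 -> 'I_J * 'I_J} | cell_good f)
    Num.max 0 (G (cell_path q f) - 3 * L / q) *
    \prod_(i < K.+1) cell_weight K i q (nat_of_ord (f i).1, nat_of_ord (f i).2) g.

Lemma lower_span_span K J (q L : R) G : 0 <= q -> mono_span (lower_span K J q L G).
Proof.
move=> q0; apply: (mono_span_sum _ _ (fun f => _)) => f.
by apply: mono_span_prod => i; apply: cell_weight_span; rewrite // -ltnS.
Qed.

Lemma prod_weight_ge0 K J q (f : {ffun 'I_K.+1 -> 'I_J * 'I_J}) g :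
  0 <= \prod_(i < K.+1) cell_weight K i q (nat_of_ord (f i).1, nat_of_ord (f i).2) g.
Proof. by apply: prodr_ge0 => i _; apply: cell_weight_ge0; rewrite -ltnS. Qed.

Lemma prod_weight_sum K J q g :
  \sum_(f : {ffun 'I_K.+1 -> 'I_J * 'I_J})
    \prod_(i < K.+1) cell_weight K i q (nat_of_ord (f i).1, nat_of_ord (f i).2) g =
  \prod_(i < K.+1) ((inf_ramp K i q 0 g - inf_ramp K i q J g) * (sup_ramp K i q 0 g - sup_ramp K i q J g)).
Proof.
rewrite -(bigA_distr_bigA (fun (i : 'I_K.+1) (c : 'I_J * 'I_J) =>
  cell_weight K i q (nat_of_ord c.1, nat_of_ord c.2) g)).
by apply: eq_bigr => i _; rewrite -cell_weight_sum pair_bigA.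
Qed.

Lemma prod_weight_close K J (q : R) g (f : {ffun 'I_K.+1 -> 'I_J * 'I_J}) : 0 < q -> cell_good f ->
  \prod_(i < K.+1) cell_weight K i q (nat_of_ord (f i).1, nat_of_ord (f i).2) g != 0 ->
  sup_close g (cell_path q f) (3 / q).
Proof.
move=> q0 /forallP gf /prodf_neq0 nz t t01.
have wt := window_ofP K t01; have iK : (window_of K t <= K)%N by rewrite -ltnS.
have [h _ _] := cell_weight_neq0 iK (nz (window_of K t) isT).
have := h _ wt; have := gf (window_of K t); rewrite /cell_path /=.
rewrite -(ler_nat R) natrD; move: (f _) => -[j k] /= jk /andP[h1 h2].
have -> : g t - j%:R / q = (q * g t - j%:R) / q by field; rewrite lt0r_neq0.
rewrite normrM [X in _ * X]gtr0_norm ?invr_gt0// ler_pM2r ?invr_gt0// ler_norml.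
by apply/andP; split; lra.
Qed.

Lemma lower_span_le K J (q L : R) G g : 0 < q -> lip L G -> unit_valued G ->
  lower_span K J q L G g <= G g.
Proof.
move=> q0 LG uG; have /andP[G0 _] := uG g.
apply: (@le_trans _ _ (G g * \sum_(f : {ffun 'I_K.+1 -> 'I_J * 'I_J})
    \prod_(i < K.+1) cell_weight K i q (nat_of_ord (f i).1, nat_of_ord (f i).2) g)).
  rewrite mulr_sumr [leRHS](bigID (@cell_good K J))/= -[leLHS]addr0 lerD//; last first.
    by apply: sumr_ge0 => f _; rewrite mulr_ge0// prod_weight_ge0.
  apply: ler_sum => f gf; set p := \prod_(i < _) _.
  have p0 : 0 <= p by exact: prod_weight_ge0.
  have [->|pn] := eqVneq p 0; first by rewrite !mulr0.
  rewrite ler_wpM2r// ge_max G0/=.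
  have := LG _ _ _ (prod_weight_close q0 gf pn); rewrite ler_norml mulrCA mulrA => /andP[+ _].
  lra.
rewrite ler_piMr// prod_weight_sum prodr_ile1// => i _.
have iK : (i <= K)%N by rewrite -ltnS.
have [_ u0 _] := mono_inf_ramp iK (ltW q0) 0; have [_ u1 _] := mono_inf_ramp iK (ltW q0) J.
have [_ v0 _] := mono_sup_ramp iK (ltW q0) 0; have [_ v1 _] := mono_sup_ramp iK (ltW q0) J.
have a n : inf_ramp K i q n g <= inf_ramp K i q 0 g.
  by elim: n => // n IHn; apply: le_trans (inf_ramp_step q iK n g) IHn.
have b n : sup_ramp K i q n g <= sup_ramp K i q 0 g.
  by elim: n => // n IHn; apply: le_trans (sup_ramp_step q iK n g) IHn.
have /andP[a0 a1] := u0 g; have /andP[a2 a3] := u1 g; have /andP[b0 b1] := v0 g; have /andP[b2 b3] := v1 g.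
have := a J; have := b J => aJ bJ.
by rewrite mulr_ge0 ?subr_ge0//= mulr_ile1 ?subr_ge0//; lra.
Qed.

Lemma lower_span_ge K J (q L : R) G g : 0 < q -> lip L G -> unit_valued G ->
  (forall t : R, 0 <= t <= 1 -> 0 <= q * g t <= J%:R - 1) ->
  (forall t u : R, 0 <= t <= 1 -> 0 <= u <= 1 -> `|t - u| <= K.+1%:R^-1 -> q * `|g t - g u| < 1) ->
  G g - 6 * L / q <= lower_span K J q L G g.
Proof.
move=> q0 LG uG gJ gosc.
have iK (i : 'I_K.+1) : (i <= K)%N by rewrite -ltnS.
have one : \sum_(f : {ffun 'I_K.+1 -> 'I_J * 'I_J})
    \prod_(i < K.+1) cell_weight K i q (nat_of_ord (f i).1, nat_of_ord (f i).2) g = 1.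
  rewrite prod_weight_sum big1// => i _.
  have [t0 wt0] := window_neq0 (iK i).
  have h0 n t : window K i t -> n = 0 -> ramp q n (g t) = 1.
    by move=> [t01 _] ->; have /andP[h _] := gJ _ t01; rewrite /ramp clamp1//; lra.
  have hJ t : window K i t -> ramp q J (g t) = 0.
    by move=> [t01 _]; have /andP[_ h] := gJ _ t01; rewrite /ramp clamp0//; lra.
  have [_ u0 _] := mono_inf_ramp (iK i) (ltW q0) 0; have [_ u1 _] := mono_inf_ramp (iK i) (ltW q0) J.
  have [_ v0 _] := mono_sup_ramp (iK i) (ltW q0) 0; have [_ v1 _] := mono_sup_ramp (iK i) (ltW q0) J.
  have /andP[a0 a1] := u0 g; have /andP[a2 a3] := u1 g; have /andP[b0 b1] := v0 g; have /andP[b2 b3] := v1 g.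
  have e1 : inf_ramp K i q 0 g = 1.
    by apply/eqP; rewrite eq_le a1 inf_ramp_ge// => t wt; rewrite (h0 0).
  have e2 : inf_ramp K i q J g = 0.
    by apply/eqP; rewrite eq_le a2 andbT (le_trans (inf_ramp_le q J g wt0))// hJ.
  have e3 : sup_ramp K i q 0 g = 1.
    by apply/eqP; rewrite eq_le b1 /= -(h0 0 t0)// sup_ramp_ge.
  have e4 : sup_ramp K i q J g = 0.
    by apply/eqP; rewrite eq_le b2 andbT sup_ramp_le// => t wt; rewrite hJ.
  by rewrite e1 e2 e3 e4 subr0 mulr1.
(* Indices of supremum and infimum that differ by 3 or more would mean an oscillation of at least
   [1 / q] on one window. *)
have bad (f : {ffun 'I_K.+1 -> 'I_J * 'I_J}) : ~~ cell_good f ->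
    \prod_(i < K.+1) cell_weight K i q (nat_of_ord (f i).1, nat_of_ord (f i).2) g = 0.
  move=> nf; apply/eqP; apply: contraT => /prodf_neq0 nz'; case/negP: nf.
  apply/forallP => i; rewrite leqNgt; apply/negP => fi; have nz := nz' i isT.
  have [_ [t [t01 wt] h1] [u [u01 wu] h2]] := cell_weight_neq0 (iK i) nz.
  have : `|t - u| <= K.+1%:R^-1.
    exact: window_dist (conj t01 wt) (conj u01 wu).
  move=> /(gosc _ _ t01 u01) h.
  have : q * (g u - g t) < 1.
    by apply: le_lt_trans h; rewrite ler_pM2l// distrC ler_norm.
  have fi' : (f i).1%:R + 3 <= (f i).2%:R :> R by rewrite -natrD ler_nat addnS.
  by move: h1 h2; rewrite mulrBr /=; move: fi'; clear; lra.
have -> : G g - 6 * L / q = \sum_(f : {ffun 'I_K.+1 -> 'I_J * 'I_J} | cell_good f) (G g - 6 * L / q) *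
    \prod_(i < K.+1) cell_weight K i q (nat_of_ord (f i).1, nat_of_ord (f i).2) g.
  rewrite -[LHS]mulr1 -[X in _ * X = _]one mulr_sumr (bigID (@cell_good K J))/=.
  by rewrite [X in _ + X]big1 ?addr0// => f nf; rewrite bad ?mulr0.
apply: ler_sum => f gf; set p := \prod_(i < _) _.
have p0 : 0 <= p by exact: prod_weight_ge0.
have [->|pn] := eqVneq p 0; first by rewrite !mulr0.
rewrite ler_wpM2r// le_max; apply/orP; right.
have := LG _ _ _ (prod_weight_close q0 gf pn); rewrite ler_norml mulrCA mulrA => /andP[_].
lra.
Qed.

End MonotoneAlgebra.

(** * Lower limits of Lipschitz functionals of the Dyck path *)

Section ExcursionLiminf.
Context (d : measure_display) (T : measurableType d) (R : realType)
  (P : probability T R) (e : T -> R -> R).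
Implicit Types (F G : (R -> R) -> R).
Hypothesis he : brownian_excursion P e.

Let m N : R := mean N.*2 (fun w => (dyck w)%:R).

Let m_ge0 N : 0 <= m N. Proof. exact: mean_ge0. Qed.

Lemma mono_span_bm F : mono_span F -> bounded_measurable (fun w => F (e w)).
Proof.
elim=> [|c F' G' [[L LF] uF _] _ IH]; first exact: bm_cst.
by apply: bmD => //; apply: bmZ; exact: (bm_excursion he LF uF).
Qed.

Lemma mono_span_cvg F : mono_span F -> forall eps : R, 0 < eps ->
  exists N0 : nat, forall N, (N0 <= N)%N ->
    `|dyck_mean N (fun w => F (wpath w)) - ex P (fun w => F (e w)) * m N| <= eps * m N.
Proof.
elim=> [eps e0|c F' G' [[L LF] uF iF] sG IH eps e0].
  exists 0 => N _; rewrite ex_cst mul0r subr0 /dyck_mean.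
  by under eq_mean do rewrite mulr0; rewrite mean_cst normr0 mulr_ge0// ltW.
have c1 : 0 < `|c| + 1 by rewrite ltr_wpDl.
pose e1 := eps / (2 * (`|c| + 1)).
have e10 : 0 < e1 by rewrite divr_gt0// mulr_gt0.
have ce1 : `|c| * e1 <= eps / 2.
  have -> : eps / 2 = (`|c| + 1) * e1 by rewrite /e1; field; rewrite lt0r_neq0.
  by rewrite ler_wpM2r ?(ltW e10)// lerDl.
have [N1 h1] := sandwich_ub he LF uF iF e10.
have [N2 h2] := sandwich_lb he LF uF iF e10.
have [N3 h3] := IH (eps / 2) ltac:(by rewrite divr_gt0).
exists (maxn N1 (maxn N2 N3)) => N; rewrite !geq_max => /and3P[/h1 {}h1 /h2 {}h2 /h3 {}h3].
have bF := bm_excursion he LF uF; have bG := mono_span_bm sG.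
rewrite exD//; last exact: bmZ.
rewrite exZ//.
have -> : dyck_mean N (fun w => c * F' (wpath w) + G' (wpath w)) =
    c * dyck_mean N (fun w => F' (wpath w)) + dyck_mean N (fun w => G' (wpath w)).
  by rewrite /dyck_mean -meanZ -meanD; apply: eq_mean => w _; rewrite mulrDr mulrCA.
have h : `|dyck_mean N (fun w => F' (wpath w)) - ex P (fun w => F' (e w)) * m N| <= e1 * m N.
  rewrite ler_norml lerBlDr lerBrDl -mulrBl addrC -mulrDl [e1 + _]addrC.
  by rewrite [- e1 + _]addrC; apply/andP; split.
move: h h3; set a := dyck_mean N _; set b := dyck_mean N _; set x := ex P _; set y := ex P _ => h h3.
have -> : c * a + b - (c * x + y) * m N = c * (a - x * m N) + (b - y * m N) by ring.
rewrite (le_trans (ler_normD _ _))// (splitr eps) [leRHS]mulrDl lerD// normrM.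
apply: (@le_trans _ _ (`|c| * (e1 * m N))); first by rewrite ler_wpM2l.
by rewrite mulrA ler_wpM2r.
Qed.

(** For words only [low K <= G] is used, which holds for every function. The converse approximation
    concerns the continuous paths [e w] alone, and dominated convergence makes its error small in
    mean. *)
Lemma excursion_liminf (L eps : R) G : lip L G -> unit_valued G -> 0 < eps ->
  exists N0 : nat, forall N, (N0 <= N)%N ->
    (ex P (fun w => G (e w)) - eps) * m N <= dyck_mean N (fun w => G (wpath w)).
Proof.
move=> LG uG e0; have L0 := lip_ge0 LG.
have e3 : 0 < eps / 3 by rewrite divr_gt0.
pose q := 18 * (L + 1) / eps; have q0 : 0 < q by rewrite divr_gt0// mulr_gt0//; lra.
have qL : 6 * L / q <= eps / 3.
  rewrite ler_pdivrMr// (_ : eps / 3 * q = 6 * (L + 1)); last by rewrite /q; field; rewrite lt0r_neq0.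
  by lra.
pose low K := lower_span K K q L G.
have slow K : mono_span (low K) by apply: lower_span_span; rewrite ltW.
have blow K := mono_span_bm (slow K).
have bG := bm_excursion he LG uG.
have low0 K g : 0 <= low K g.
  by apply: sumr_ge0 => f _; rewrite mulr_ge0 ?prod_weight_ge0// le_max lexx.
have low1 K g : low K g <= G g by exact: lower_span_le.
pose X K w := Num.max 0 (G (e w) - low K (e w) - eps / 3).
have X01 K w : 0 <= X K w <= 1.
  rewrite /X le_max lexx /= ge_max ler01 /=.
  by have := low0 K (e w); have /andP[_ g1] := uG (e w); lra.
have mX K : measurable_fun setT (X K).
  apply: measurable_maxr => //; apply: measurable_funB => //.
  by have [] := bmB bG (blow K).
have bX K : bounded_measurable (X K).
  by split => //; exists 1 => w; have /andP[x0 x1] := X01 K w; rewrite ger0_norm.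
have [K hK] : exists N, forall n, (N <= n)%N -> `|ex P (X n)| <= eps / 3.
  apply: (@ex_cvg0 _ _ _ _ _ 1) => //; last first.
    by move=> n w; have /andP[x0 x1] := X01 n w; rewrite ger0_norm.
  move=> w al al0.
  have cw := excursion_cont01 he w.
  have [M hM] := cont01_bounded cw.
  have [K1 hK1] := large_nat (q * M + 1).
  have qi : 0 < (2 * q)^-1 by rewrite invr_gt0 mulr_gt0.
  have [del del0 hd] := cont01_unif cw qi.
  have [K2 hK2] := natSinv_le del0.
  exists (maxn K1 K2) => K; rewrite geq_max => /andP[/hK1 h1 /hK2 h2].
  have h : G (e w) - 6 * L / q <= low K (e w).
    apply: lower_span_ge => //.
      move=> t t01; apply/andP; split.
        rewrite mulr_ge0 ?(ltW q0)//; have [g0 g1] := excursion_ends he w.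
        have [hx _ _] := he; have [_ _ _ hp] := hx w.
        have /andP[t0 t1] := t01.
        have [->|tn0] := eqVneq t 0; first by rewrite g0.
        have [->|tn1] := eqVneq t 1; first by rewrite g1.
        by apply/ltW/hp; rewrite !lt_def tn0 t0 eq_sym tn1.
      have : q * e w t <= q * M by rewrite ler_pM2l// (le_trans (ler_norm _))// hM.
      by lra.
    move=> t u t01 u01 tu; rewrite mulrC -ltr_pdivlMr// mul1r.
    have : `|e w t - e w u| <= (2 * q)^-1 by apply: hd => //; apply: le_trans h2.
    have q2 : q < 2 * q by lra.
    by move/le_lt_trans; apply; rewrite ltf_pV2// posrE mulr_gt0.
  rewrite (_ : X K w = 0) ?normr0 ?(ltW al0)//.
  by rewrite /X max_l//; lra.
have [N0 hN0] := mono_span_cvg (slow K) e3.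
exists N0 => N /hN0 hN.
have E : ex P (fun w => G (e w)) <= ex P (fun w => low K (e w)) + 2 * (eps / 3).
  have h1 : ex P (fun w => G (e w)) <= ex P (fun w => low K (e w) + (eps / 3 + X K w)).
    apply: le_ex => //; first by apply: bmD => //; apply: bmD => //; exact: bm_cst.
    move=> w; have : G (e w) - low K (e w) - eps / 3 <= X K w by rewrite /X le_max lexx orbT.
    by lra.
  rewrite exD// in h1; last by apply: bmD => //; exact: bm_cst.
  rewrite exD// ?ex_cst in h1; last exact: bm_cst.
  have := hK K (leqnn _); rewrite ler_norml => /andP[_]; lra.
have h2 : dyck_mean N (fun w => low K (wpath w)) <= dyck_mean N (fun w => G (wpath w)).
  by apply: le_mean => w _; rewrite ler_wpM2l.
apply: le_trans h2; move: hN; rewrite ler_norml => /andP[+ _].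
have : (ex P (fun w => G (e w)) - eps) * m N <= (ex P (fun w => low K (e w)) - eps / 3) * m N.
  by rewrite ler_wpM2r//; lra.
set a := ex P _; set b := ex P _; set c := dyck_mean _ _ => h3 h4.
by move: h3 h4; rewrite mulrBl; lra.
Qed.

End ExcursionLiminf.

(** * Cords of a path and of its approximations *)

Section Chords.
Variable R : realType.
Implicit Types (g h : R -> R) (u v w x eps delta : R) (Lam : R -> R -> R -> Prop).

(** Local minima may be non-strict here, so a path that is constant on some interval is excluded
    too. *)
Definition distinct_minima g : Prop := forall a b r : R,
  0 < r -> 0 < a - r -> a + r < b - r -> b + r < 1 ->
  (forall w, `|w - a| <= r -> g a <= g w) -> (forall w, `|w - b| <= r -> g b <= g w) ->
  g a <> g b.

Definition excursion g : Prop :=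
  [/\ cont01 g, g 0 = 0, g 1 = 0 & forall t : R, 0 < t < 1 -> 0 < g t].

Definition good_path g : Prop := excursion g /\ distinct_minima g.

Definition near_cord g delta u v : Prop :=
  [/\ 0 <= u, u <= v, v <= 1, `|g u - g v| <= delta &
      forall w, u <= w <= v -> g u - delta <= g w].

Definition box (u v : R) eps (a b : R) : Prop := `|a - u| <= eps /\ `|b - v| <= eps.

(* A timed family of cords that approximates the cords of [g], the cord [u, v]
   appearing near time [1 - u].  The family [cords h] of a path [h] close to [g]
   and the cords of a Dyck word whose path is close to [g] are of this kind. *)
Definition adapted g delta Lam : Prop :=
  [/\ forall u v s, Lam u v s -> [/\ 0 <= s, s <= 1, `|s - (1 - u)| <= delta & near_cord g delta u v],
      forall m c : R, 0 <= m <= 1 -> delta < c -> c < g m - delta ->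
        exists u v s, [/\ Lam u v s, u - delta <= m, m <= v + delta & `|g u - c| <= delta],
      forall x, 0 <= x <= 1 -> exists u v s, Lam u v s /\ box x x delta u v,
      forall x y eps u v s, Lam u v s -> box x y eps u v -> exists u' v' s',
        [/\ Lam u' v' s', box x y eps u' v' &
            forall u v s, Lam u v s -> box x y eps u v -> s' <= s] &
      Lam 1 1 0].

Lemma adaptedW g delta delta' Lam : delta <= delta' -> adapted g delta Lam -> adapted g delta' Lam.
Proof.
move=> dd [h1 h2 h3 h4 h5]; split => //.
- move=> u v s /h1[s0 s1 su [u0 uv v1 guv gw]]; split => //; first exact: le_trans dd.
  split => //; first exact: le_trans dd.
  by move=> w /gw; rlra.
- move=> m c m01 c0 c1; have [||u [v [s [Ls um mv gu]]]] := h2 m c m01; [rlra|rlra|].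
  by exists u, v, s; split => //; rlra.
- move=> x /h3[u [v [s [Ls [b1 b2]]]]]; exists u, v, s; split => //.
  by split; exact: le_trans dd.
Qed.

Lemma cont01_min g (a b : R) : cont01 g -> [&& 0 <= a, a <= b & b <= 1] ->
  exists2 x, a <= x <= b & forall y, a <= y <= b -> g x <= g y.
Proof.
move=> cg /and3P[a0 ab b1].
have [|x xI hx] := @EVT_min R g a b ab; last first.
  by exists x; [move: xI; rewrite in_itv|move=> y yI; apply: hx; rewrite in_itv].
apply/subspace_continuousP => x; rewrite /= in_itv/= => /andP[ax xb].
apply/cvgrPdist_le => eps e0.
have [|del del0 hd] := cg x _ eps e0; first by rewrite (le_trans a0)//= (le_trans xb).
rewrite near_withinE; near=> y => /=; rewrite in_itv/= => /andP[ay yb].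
apply: hd; first by rewrite (le_trans a0)//= (le_trans yb).
near: y; exact: (@cvgr_dist_le _ _ _ _ _ id x).
Unshelve. all: by end_near. Qed.

(** Bolzano-Weierstrass together with the continuity of [g]; it supplies the limiting cord in the
    arguments by contradiction below. *)
Lemma near_cord_cluster g (u v : nat -> R) : cont01 g ->
  (forall n, near_cord g n.+1%:R^-1 (u n) (v n)) ->
  exists a b, cord_of g a b /\
    forall eps, 0 < eps -> forall N, exists2 n, (N <= n)%N & box a b eps (u n) (v n).
Proof.
move=> cg huv.
have [phi [a a01 [phin ua]]] := @subseq01 R u (fun n => ltac:(by have [h1 h2 h3 _ _] := huv n; rewrite h1 (le_trans h2))).
have [psi [b b01 [psin vb]]] := @subseq01 R (v \o phi) (fun n => ltac:(by have [h1 h2 h3 _ _] := huv (phi n); rewrite /= h3 (le_trans h1))).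
have cl eps : 0 < eps -> forall N, exists2 n, (N <= n)%N & box a b eps (u n) (v n).
  move=> e0 N; have [N1 h1] := ua _ e0; have [N2 h2] := vb _ e0.
  pose k := maxn N (maxn N1 N2).
  have kk : (k <= psi k)%N by exact: psin.
  exists (phi (psi k)).
    by rewrite (leq_trans _ (phin _))// (leq_trans _ kk)// leq_max leqnn.
  split; last by apply: h2; rewrite !leq_max leqnn !orbT.
  by apply: h1; rewrite (leq_trans _ kk)// !leq_max leqnn !orbT.
have lim (Q : Prop) (eta : R) : 0 < eta ->
   (forall n, n.+1%:R^-1 <= eta -> box a b eta (u n) (v n) -> Q) -> Q.
  move=> eta0 hQ; have [N hN] := natSinv_le eta0.
  by have [n /hN hn bx] := cl _ eta0 N; exact: hQ hn bx.
exists a, b; split => //.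
have g01 x y : 0 <= x <= 1 -> 0 <= y <= 1 -> (forall eps, 0 < eps -> exists x' y',
    [/\ 0 <= x' <= 1, 0 <= y' <= 1, `|x - x'| <= eps, `|y - y'| <= eps & g x' - eps <= g y']) -> g x <= g y.
  move=> x01 y01 h; apply/ler_addgt0Pr => al al0.
  have al3 : 0 < al / 3 by rewrite divr_gt0.
  have [del del0 hd] := cont01_unif cg al3.
  have m0 : 0 < Num.min del (al / 3) by rewrite lt_min del0.
  have [x' [y' [x'01 y'01]]] := h _ m0.
  rewrite !le_min => /andP[xx _] /andP[yy _] gxy.
  have := hd _ _ x01 x'01 xx; have := hd _ _ y01 y'01 yy.
  have : Num.min del (al / 3) <= al / 3 by rewrite ge_min lexx orbT.
  by rewrite !ler_norml => m3 /andP[h1 h2] /andP[h3 h4]; move: gxy m3 h1 h2 h3 h4; clear; rlra.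
have u01 n : 0 <= u n <= 1 by have [h1 h2 h3 _ _] := huv n; rewrite h1 (le_trans h2).
have v01 n : 0 <= v n <= 1 by have [h1 h2 h3 _ _] := huv n; rewrite h3 (le_trans h1).
have ab : a <= b.
  apply/ler_addgt0Pr => al al0; apply: (lim _ (al / 2)); first by rewrite divr_gt0.
  move=> n _ [h1 h2]; have [_ h3 _ _ _] := huv n.
  by move: h1 h2 h3; rewrite !ler_norml => /andP[? ?] /andP[? ?] ?; rlra.
have gab : g a <= g b.
  apply: g01 => // eps e0; apply: (lim _ eps) => // n hn [h1 h2]; exists (u n), (v n).
  rewrite ![`|_ - u n|]distrC ![`|_ - v n|]distrC; split => //.
  have [_ h3 _ _ h4] := huv n; have := h4 (v n); rewrite h3 lexx => /(_ isT).
  by apply: le_trans; rewrite lerD2l lerN2.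
have gba : g b <= g a.
  apply: g01 => // eps e0; apply: (lim _ eps) => // n hn [h1 h2]; exists (v n), (u n).
  rewrite ![`|_ - u n|]distrC ![`|_ - v n|]distrC; split => //.
  have [_ _ _ h4 _] := huv n; move: h4; rewrite ler_norml => /andP[h4 _].
  have : - eps <= - n.+1%:R^-1 by rewrite lerN2.
  by move/le_trans/(_ h4); clear; rlra.
split => //; [by case/andP: a01|by case/andP: b01|by apply/eqP; rewrite eq_le gab|].
move=> w /andP[aw wb].
have w01 : 0 <= w <= 1 by case/andP: a01 => ? _; case/andP: b01 => _ ?; apply/andP; split; rlra.
apply: g01 => // eps e0; apply: (lim _ eps) => // n hn [h1 h2].
have [u0 uv v1 _ h4] := huv n.
exists (u n), (Num.max (u n) (Num.min (v n) w)).
have wn : u n <= Num.max (u n) (Num.min (v n) w) <= v n.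
  by rewrite le_max lexx /= ge_max uv ge_min lexx.
have wc : `|w - Num.max (u n) (Num.min (v n) w)| <= eps.
  move: h1 h2; rewrite !ler_norml => /andP[p1 p2] /andP[p3 p4].
  case: (leP (v n) w) => vw; first by rewrite max_r//; apply/andP; split; rlra.
  by case: (leP (u n) w) => uw; apply/andP; split; rlra.
split => //; [|by rewrite distrC|].
  by case/andP: wn => ? ?; apply/andP; split; rlra.
by apply: le_trans (h4 _ wn); rewrite lerD2l lerN2.
Qed.

Lemma cord_near g delta u v : 0 <= delta -> cord_of g u v -> near_cord g delta u v.
Proof.
move=> d0 [u0 uv v1 guv gw]; split => //; first by rewrite guv subrr normr0.
by move=> w /gw; rlra.
Qed.

Definition outer g u v : Prop := cord_of g u v /\ exists2 m, u < m < v & g m = g u.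

Lemma excursion_ge0 g t : excursion g -> 0 <= t <= 1 -> 0 <= g t.
Proof.
move=> [_ g0 g1 gp] /andP[t0 t1].
have [->|tn0] := eqVneq t 0; first by rewrite g0.
have [->|tn1] := eqVneq t 1; first by rewrite g1.
by apply/ltW/gp; rewrite !lt_def tn0 t0 eq_sym tn1.
Qed.

Lemma interior_min g u v m : cord_of g u v -> u < m < v -> g m = g u ->
  exists2 r, 0 < r & forall r', 0 < r' <= r -> [/\ u < m - r', m + r' < v & forall w, `|w - m| <= r' -> g m <= g w].
Proof.
move=> [u0 uv v1 guv gw] /andP[um mv] gm.
exists (Num.min ((m - u) / 2) ((v - m) / 2)); first by rewrite lt_min !divr_gt0// subr_gt0.
move=> r' /andP[r0]; rewrite le_min => /andP[r1 r2]; split; [rlra|rlra|].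
by move=> w; rewrite ler_norml gm => /andP[h1 h2]; apply: gw; apply/andP; split; rlra.
Qed.

(* Two points in the interior of cords at the same height are local minima of equal value. *)
Lemma interior_min_unique g u v m u' v' m' : good_path g ->
  cord_of g u v -> u < m < v -> g m = g u -> cord_of g u' v' -> u' < m' < v' -> g m' = g u' ->
  g u = g u' -> ~ m < m'.
Proof.
move=> [_ dm] c1 m1 gm1 c2 m2 gm2 guu mm.
have [u0 _ _ _ _] := c1; have [_ _ v1 _ _] := c2.
have [r r0 hr] := interior_min c1 m1 gm1; have [r' r'0 hr'] := interior_min c2 m2 gm2.
pose s := Num.min (Num.min r r') ((m' - m) / 4).
have s0 : 0 < s by rewrite !lt_min r0 r'0 divr_gt0// subr_gt0.
have [h1 h2 h3] := hr s ltac:(by rewrite s0 !ge_min lexx).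
have [h4 h5 h6] := hr' s ltac:(by rewrite s0 !ge_min lexx !orbT).
have s4 : s <= (m' - m) / 4 by rewrite ge_min lexx orbT.
by apply: (dm m m' s) => //; [rlra|rlra|rlra|rewrite gm1 gm2].
Qed.

Lemma outer_unique g u v v' : good_path g -> outer g u v -> outer g u v' -> v = v'.
Proof.
move=> gg; wlog vv : v v' / v <= v' => [hw|].
  by case: (leP v v') => [/hw//|/ltW h o1 o2]; rewrite (hw _ _ h o2 o1).
move=> [c1 [m /andP[um mv] gm]] [c2 _]; apply/eqP; rewrite eq_le vv /= leNgt; apply/negP => lt.
have [_ _ _ guv _] := c1.
apply: (@interior_min_unique g u v' m u v' v gg c2) => //.
- by rewrite um (lt_trans mv).
- by rewrite lt (lt_trans um).
Qed.

Definition realised g eps u v : Prop :=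
  exists2 delta : R, 0 < delta & forall Lam, adapted g delta Lam ->
    exists a b s, Lam a b s /\ box u v eps a b.

(** Away from the ends [g] exceeds [g u] by a positive gap. A cord of the family around the midpoint
    at height [g u + gap / 2] is squeezed in just inside [[u, v]], hence starts strictly after
    [u]. *)
Lemma simple_realised g eps u v : excursion g -> cord_of g u v -> u < v -> ~ outer g u v -> 0 < eps ->
  exists2 delta : R, 0 < delta & forall Lam, adapted g delta Lam ->
    exists a b s, [/\ Lam a b s, u < a & box u v eps a b].
Proof.
move=> eg c uv no; have [cg _ _ _] := eg.
wlog : eps / eps <= (v - u) / 8 => [hw e0|e8 e0].
  have [||del del0 hd] := hw (Num.min eps ((v - u) / 8)); first by rewrite ge_min lexx orbT.
    by rewrite lt_min e0 divr_gt0// subr_gt0.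
  exists del => // Lam /hd[a [b [s [Ls ua [b1 b2]]]]]; exists a, b, s; split => //.
  by split; [apply: le_trans b1 _|apply: le_trans b2 _]; rewrite ge_min lexx.
have [u0 _ v1 guv gw] := c.
have mid w : u + eps <= w <= v - eps -> g u < g w.
  move=> /andP[h1 h2]; rewrite lt_def gw ?andbT; last by apply/andP; split; rlra.
  apply/eqP => gwu; apply: no; split=> //; exists w => //; apply/andP; split; rlra.
have [|x0 x01 hx0] := @cont01_min g (u + eps) (v - eps) cg; first by apply/and3P; split; rlra.
have gap0 := mid _ x01; set gap := g x0 - g u.
have gap1 : 0 < gap by rewrite subr_gt0.
have gu0 : 0 <= g u by apply: excursion_ge0 => //; apply/andP; split; rlra.
exists (Num.min (gap / 8) eps) => [|Lam [h1 h2 _ _ _]]; first by rewrite lt_min divr_gt0.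
set del := Num.min _ _ in h1 h2.
have dg : del <= gap / 8 by rewrite ge_min lexx.
have de : del <= eps by rewrite ge_min lexx orbT.
pose m := (u + v) / 2.
have gm : g x0 <= g m by apply: hx0; apply/andP; split; rewrite /m; rlra.
have [||a [b [s [Ls am mb gac]]]] := h2 m (g u + gap / 2) ltac:(by apply/andP; split; rewrite /m; rlra).
- by rlra.
- by rewrite /gap in dg *; rlra.
have [_ _ _ [a0 ab b1 gab gnear]] := h1 _ _ _ Ls.
move: gac gab; rewrite !ler_norml => /andP[ga1 ga2] /andP[gb1 gb2].
have ua : u < a.
  rewrite ltNge; apply/negP => au.
  have := gnear u; rewrite au /= (_ : u <= b) => [/(_ isT)|]; last by rewrite /m in mb; rlra.
  by rewrite /gap in ga1 dg *; rlra.
have bv : b < v.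
  rewrite ltNge; apply/negP => vb.
  have := gnear v; rewrite vb /= andbT (_ : a <= v) => [/(_ isT)|]; last by rewrite /m in am; rlra.
  by rewrite -guv /gap in ga1 dg *; rlra.
have ae : a < u + eps.
  rewrite ltNge; apply/negP => h.
  have := hx0 a; rewrite h /= (_ : a <= v - eps) => [/(_ isT)|]; last by rewrite /m in am; rlra.
  by rewrite /gap in ga2 dg *; rlra.
have be : v - eps < b.
  rewrite ltNge; apply/negP => h.
  have := hx0 b; rewrite h andbT (_ : u + eps <= b) => [/(_ isT)|]; last by rewrite /m in mb; rlra.
  by rewrite /gap in ga2 dg *; rlra.
by exists a, b, s; split => //; split; rewrite ler_norml; clear -e0 ua ae bv be; apply/andP; split; rlra.
Qed.

(** The inner point [m] is a local minimum of height [g u], so neither [u] nor [v] can be one: [g]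
    falls below [g u] just before [u] and just after [v]. A cord around [m] slightly below that
    height is caught just outside [[u, v]]. *)
Lemma outer_realised g eps u v : good_path g -> outer g u v -> 0 < eps -> realised g eps u v.
Proof.
move=> gg [c [m /andP[um mv] gm]]; have [eg dm] := gg; have [cg g0 g1 gp] := eg.
have [u0 uv v1 guv gw] := c.
have cm : 0 < g u by rewrite -gm; apply: gp; apply/andP; split; rlra.
have u0' : 0 < u by rewrite lt_def u0 andbT; apply/eqP => uE; move: cm; rewrite uE g0 ltxx.
have v1' : v < 1 by rewrite lt_def v1 andbT; apply/eqP => vE; move: cm; rewrite guv -vE g1 ltxx.
wlog : eps / [/\ eps <= u / 2, eps <= (1 - v) / 2, eps <= (m - u) / 4 & eps <= (v - m) / 4].
  move=> hw e0; pose eps' := Num.min eps (Num.min (Num.min (u / 2) ((1 - v) / 2)) (Num.min ((m - u) / 4) ((v - m) / 4))).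
  have [||del del0 hd] := hw eps'.
  - by rewrite /eps' !ge_min !lexx !orbT.
  - by rewrite /eps' !lt_min e0 !divr_gt0// subr_gt0.
  exists del => // Lam /hd[a [b [s [Ls [b1 b2]]]]]; exists a, b, s; split => //.
  by split; [apply: le_trans b1 _|apply: le_trans b2 _]; rewrite ge_min lexx.
move=> [e1 e2 e3 e4] e0.
have minm (r : R) : 0 < r -> r <= eps -> forall w, `|w - m| <= r -> g m <= g w.
  by move=> r0 re w; rewrite gm ler_norml => /andP[? ?]; apply: gw; apply/andP; split; rlra.
have [u1 /andP[uu1 u1u] gu1] : exists2 u1, u - eps <= u1 < u & g u1 < g u.
  apply: contrapT => hn; apply: (dm u m (eps / 2)) => //; [clear -e0 e1 e2 e3 e4 u0' v1' um mv; rlra|clear -e0 e1 e2 e3 e4 u0' v1' um mv; rlra|clear -e0 e1 e2 e3 e4 u0' v1' um mv; rlra|clear -e0 e1 e2 e3 e4 u0' v1' um mv; rlra| |by apply: minm; rlra].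
  move=> w; rewrite ler_norml => /andP[w1 w2]; have [uw|wu] := leP u w.
    by apply: gw; apply/andP; split; rlra.
  by rewrite leNgt; apply/negP => gwu; apply: hn; exists w => //; apply/andP; split; rlra.
have [v2 /andP[vv2 v2v] gv2] : exists2 v2, v < v2 <= v + eps & g v2 < g u.
  apply: contrapT => hn; apply: (dm m v (eps / 2)); rewrite ?gm//; [clear -e0 e1 e2 e3 e4 u0' v1' um mv; rlra|clear -e0 e1 e2 e3 e4 u0' v1' um mv; rlra|clear -e0 e1 e2 e3 e4 u0' v1' um mv; rlra|clear -e0 e1 e2 e3 e4 u0' v1' um mv; rlra|by rewrite -gm; apply: minm; rlra|].
  move=> w; rewrite ler_norml => /andP[w1 w2]; have [wv|vw] := leP w v.
    by rewrite -guv; apply: gw; apply/andP; split; rlra.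
  by rewrite -guv leNgt; apply/negP => gwu; apply: hn; exists w => //; apply/andP; split; rlra.
pose top := Num.max (g u1) (g v2); pose gap := g u - top.
have gap0 : 0 < gap by rewrite subr_gt0 gt_max gu1.
have t1 : g u1 <= top by rewrite le_max lexx.
have t2 : g v2 <= top by rewrite le_max lexx orbT.
have top0 : 0 <= top by apply: le_trans t1; apply: excursion_ge0 => //; apply/andP; split; rlra.
exists (Num.min (gap / 8) eps) => [|Lam [h1 h2 _ _ _]]; first by rewrite lt_min divr_gt0.
set del := Num.min _ _ in h1 h2.
have dg : del <= gap / 8 by rewrite ge_min lexx.
have de : del <= eps by rewrite ge_min lexx orbT.
have [||a [b [s [Ls am mb gac]]]] := h2 m (g u - gap / 2) ltac:(by apply/andP; split; rlra).
- by rewrite /gap in dg gap0 *; rlra.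
- by rewrite gm /gap in dg gap0 *; rlra.
have [_ _ _ [a0 ab b1 gab gnear]] := h1 _ _ _ Ls.
move: gac gab; rewrite !ler_norml => /andP[ga1 ga2] /andP[gb1 gb2].
have ua : u1 < a.
  rewrite ltNge; apply/negP => au.
  have := gnear u1; rewrite au /= (_ : u1 <= b) => [/(_ isT)|]; last by clear -u1u mb de e3 um; rlra.
  by rewrite /gap in ga1 dg gap0 *; clear -ga1 gb1 gb2 dg gap0 t1 t2; rlra.
have bv : b < v2.
  rewrite ltNge; apply/negP => vb.
  have := gnear v2; rewrite vb andbT (_ : a <= v2) => [/(_ isT)|]; last by clear -am de e4 mv vv2; rlra.
  by rewrite /gap in ga1 dg gap0 *; clear -ga1 gb1 gb2 dg gap0 t1 t2; rlra.
have ae : a < u.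
  rewrite ltNge; apply/negP => h.
  have := gw a; rewrite h /= (_ : a <= v) => [/(_ isT)|]; last by clear -am de e4 mv; rlra.
  by rewrite /gap in ga2 dg gap0 *; clear -ga2 gb1 gb2 dg gap0 t1 t2; rlra.
have be : v < b.
  rewrite ltNge; apply/negP => h.
  have := gw b; rewrite h andbT (_ : u <= b) => [/(_ isT)|]; last by clear -mb de e3 um; rlra.
  by rewrite /gap in ga2 dg gap0 *; clear -ga2 gb1 gb2 dg gap0 t1 t2; rlra.
by exists a, b, s; split => //; split; rewrite ler_norml; clear -e0 uu1 ua ae vv2 v2v bv be; apply/andP; split; rlra.
Qed.

Lemma cord_realised g eps u v : good_path g -> cord_of g u v -> 0 < eps -> realised g eps u v.
Proof.
move=> gg c e0; case: (pselect (outer g u v)) => [ho|no]; first exact: outer_realised.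
have [u0 uv v1 guv gw] := c.
have [uv'|] := ltP u v.
  have [del del0 hd] := simple_realised gg.1 c uv' no e0.
  by exists del => // Lam /hd[a [b [s [Ls _ bx]]]]; exists a, b, s.
move=> vu; have -> : v = u by apply/eqP; rewrite eq_le vu.
exists eps => // Lam [_ _ h _ _]; have [|a [b [s [Ls bx]]]] := h u.
  by apply/andP; split; rlra.
by exists a, b, s.
Qed.

End Chords.

(** * Matching the jump times *)

Section TimeMatching.
Variable R : realType.
Implicit Types (g h : R -> R) (u v w x eps delta : R) (Lam : R -> R -> R -> Prop).

Lemma last_below g (c m : R) : cont01 g -> 0 <= m <= 1 -> g 0 <= c -> c < g m ->
  exists u, [/\ 0 <= u, u <= m, g u = c & forall w, u <= w <= m -> c <= g w].
Proof.
move=> cg /andP[m0 m1] g0 gm.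
pose S := [set w : R | 0 <= w <= m /\ g w <= c].
have S0 : S 0 by split; rewrite ?lexx.
have ubS : ubound S m by move=> w [/andP[]].
have supS : has_sup S by split; [exists 0|exists m].
pose u := sup S.
have u0 : 0 <= u by apply: ub_le_sup => //; exists m.
have um : u <= m by apply: ge_sup => //; exists 0.
have gw w : u < w -> w <= m -> c < g w.
  move=> uw wm; rewrite ltNge; apply/negP => gwc; have : w <= u.
    apply: ub_le_sup; first by exists m.
    by split => //; rewrite wm andbT ltW// (le_lt_trans u0).
  by rewrite leNgt uw.
have u01 : 0 <= u <= 1 by rewrite u0 (le_trans um).
have guc : g u <= c.
  apply/ler_addgt0Pr => al al0; have [del del0 hd] := cg u u01 al al0.
  have [w [/andP[w0 wm] gwc] uw] := sup_adherent del0 supS.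
  have wu : w <= u by apply: ub_le_sup; [exists m|split => //; rewrite w0].
  have := hd w; rewrite w0 (le_trans wm)//= => /(_ isT).
  rewrite ger0_norm ?subr_ge0// => hh; have : u - w <= del by move: uw; rewrite -/u; clear; rlra.
  by move/hh; rewrite ler_norml => /andP[_]; move: gwc; clear; rlra.
have ult : u < m by rewrite lt_def um andbT; apply/eqP => E; move: guc; rewrite -E leNgt gm.
have cgu : c <= g u.
  apply/ler_addgt0Pr => al al0; have [del del0 hd] := cg u u01 al al0.
  pose w := Num.min (u + del) m.
  have uw : u < w by rewrite lt_min ult andbT ltrDl.
  have wm : w <= m by rewrite ge_min lexx orbT.
  have wd : w <= u + del by rewrite ge_min lexx.
  have := hd w; rewrite (le_trans u0 (ltW uw)) (le_trans wm)//= => /(_ isT).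
  rewrite distrC ger0_norm ?subr_ge0 ?(ltW uw)// => hh.
  have : w - u <= del by move: wd; clear; rlra.
  by move/hh; rewrite distrC ler_norml => /andP[]; have := gw w uw wm; clear; rlra.
exists u; split => //; first by apply/eqP; rewrite eq_le guc.
move=> w /andP[uw wm]; have [<-//|uw'] := eqVneq u w.
by apply/ltW/gw; rewrite // lt_def eq_sym uw'.
Qed.

Lemma excursion_rev g : excursion g -> excursion (fun t => g (1 - t)).
Proof.
move=> [cg g0 g1 gp]; split; rewrite ?subr0 ?subrr//; last first.
  by move=> t /andP[t0 t1]; apply: gp; apply/andP; split; rlra.
move=> x /andP[x0 x1] eps e0; have [|del del0 hd] := cg (1 - x) _ eps e0.
  by apply/andP; split; rlra.
exists del => // y /andP[y0 y1] xy; apply: hd; first by apply/andP; split; rlra.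
by rewrite (_ : 1 - x - (1 - y) = y - x) 1?distrC//; ring.
Qed.

Lemma cord_around g (c m : R) : excursion g -> 0 <= m <= 1 -> 0 <= c -> c < g m ->
  exists u v, [/\ cord_of g u v, u <= m, m <= v & g u = c].
Proof.
move=> eg m01 c0 cm; have [cg g0 g1 gp] := eg; have /andP[m0 m1] := m01.
have [|u [u0 um gu hu]] := last_below cg m01 _ cm; first by rewrite g0.
have [cg' _ _ _] := excursion_rev eg.
have [|||v' [v0 vm gv hv]] := @last_below _ c (1 - m) cg'.
- by apply/andP; split; rlra.
- by rewrite subr0 g1.
- by rewrite (_ : 1 - (1 - m) = m)//; ring.
exists u, (1 - v'); split => //; [|rlra].
split; [by []|rlra|rlra|by rewrite gu gv|].
move=> w /andP[uw wv]; rewrite gu; have [wm|mw] := leP w m; first by apply: hu; rewrite uw.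
have -> : w = 1 - (1 - w) by ring.
by apply: hv; apply/andP; split; rlra.
Qed.

Lemma box_max g (x y eps : R) : cont01 g -> 0 < eps -> (exists u v, cord_of g u v /\ box x y eps u v) ->
  exists a b, [/\ cord_of g a b, box x y eps a b & forall u v, cord_of g u v -> box x y eps u v -> u <= a].
Proof.
move=> cg e0 [u1 [v1 [c1 b1]]].
pose S := [set u : R | exists v, cord_of g u v /\ box x y eps u v].
have supS : has_sup S.
  split; first by exists u1, v1.
  by exists 1 => u [v [[_ uv v1' _ _] _]]; exact: le_trans v1'.
have /choice[f hf] : forall n : nat, exists p : R * R, [/\ cord_of g p.1 p.2, box x y eps p.1 p.2 & sup S - n.+1%:R^-1 < p.1].
  move=> n; have [|u [v [cu bu]] su] := @sup_adherent _ S (n.+1%:R^-1) _ supS; first by rewrite invr_gt0.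
  by exists (u, v).
have [|a [b [cab cl]]] := @near_cord_cluster _ g (fun n => (f n).1) (fun n => (f n).2) cg.
  by move=> n; have [h _ _] := hf n; apply: cord_near => //; rewrite invr_ge0.
exists a, b; split => //.
  split; apply/ler_addgt0Pr => al al0; have [n _ [h1 h2]] := cl al al0 0%N; have [_ [h3 h4] _] := hf n.
    have -> : a - x = - ((f n).1 - a) + ((f n).1 - x) by ring.
    by rewrite (le_trans (ler_normD _ _))// normrN addrC lerD.
  have -> : b - y = - ((f n).2 - b) + ((f n).2 - y) by ring.
  by rewrite (le_trans (ler_normD _ _))// normrN addrC lerD.
move=> u v cu bu; apply/ler_addgt0Pr => al al0.
have al2 : 0 < al / 2 by rewrite divr_gt0.
have [N hN] := natSinv_le al2; have [n /hN hn [h1 _]] := cl _ al2 N.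
have [_ _ h3] := hf n.
have : u <= sup S by apply: ub_le_sup; [case: supS|exists v].
have : - n.+1%:R^-1 >= - (al / 2) by rewrite lerN2.
by move: h1 h3; rewrite ler_norml => /andP[? ?]; move: (n.+1%:R^-1) => z; rlra.
Qed.

Definition cords g (u v s : R) : Prop := cord_of g u v /\ s = 1 - u.

Lemma adapted_close g h delta : excursion g -> excursion h -> 0 < delta -> sup_close g h (delta / 2) ->
  adapted g delta (cords h).
Proof.
move=> eg eh d0 gh; have [ch h0 h1 hp] := eh.
have close u v : 0 <= u -> u <= v -> v <= 1 -> cord_of h u v -> near_cord g delta u v.
  move=> u0 uv v1 [_ _ _ huv hw]; split => //.
    have -> : g u - g v = (g u - h u) - (g v - h v) by rewrite huv; ring.
    by rewrite (le_trans (ler_normB _ _))// (splitr delta) lerD// gh//; apply/andP; split; rlra.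
  move=> w /andP[uw wv]; have := hw w; rewrite uw wv => /(_ isT).
  have := gh u; have := gh w; rewrite !ler_norml u0 (le_trans u0)//= (le_trans wv)// (le_trans uv)//.
  by move=> /(_ isT)/andP[? ?] /(_ isT)/andP[? ?]; rlra.
split.
- move=> u v s [c ->]; have [u0 uv v1 _ _] := c; split; [rlra|rlra| |exact: close].
  by rewrite subrr normr0 ltW.
- move=> m c m01 c0 cm; have := gh m m01; rewrite ler_norml => /andP[q1 q2].
  have [||u [v [cuv um mv hu]]] := @cord_around h c m eh m01; [rlra|rlra|].
  have [u0 uv v1 _ _] := cuv.
  exists u, v, (1 - u); split => //; [rlra|rlra|].
  by rewrite -hu (le_trans (gh u _))//; [apply/andP; split; rlra|rlra].
- move=> x x01; exists x, x, (1 - x); split; last by split; rewrite subrr normr0 ltW.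
  split => //; have /andP[x0 x1] := x01; split => // w /andP[xw wx].
  by rewrite (_ : w = x)//; apply/eqP; rewrite eq_le wx.
- move=> x y eps u v s [c _] bx.
  have [e0|e0] := ltP 0 eps; last first.
    have e00 : eps = 0.
      by apply/eqP; rewrite eq_le e0 (le_trans _ bx.1).
    exists u, v, (1 - u); split => // u' v' s' [c' ->] [+ _]; case: bx => + _.
    by rewrite e00 !normr_le0 !subr_eq0 => /eqP -> /eqP ->.
  have [|a [b [cab bab hmax]]] := box_max ch e0 (x := x) (y := y); first by exists u, v.
  by exists a, b, (1 - a); split => // u' v' s' [c' ->] /(hmax _ _ c'); rlra.
- by split; [split => //; rewrite ?ler01// => w /andP[w1 w2]; rewrite (_ : w = 1)//; apply/eqP; rewrite eq_le w2|rewrite subrr].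
Qed.

Lemma adapted_cords g delta : excursion g -> 0 < delta -> adapted g delta (cords g).
Proof.
move=> eg d0; apply: adapted_close => // t _; rewrite subrr normr0 divr_ge0// ltW//.
Qed.

(** This is why only outer cords cause jumps: any other cord is already approximated by cords that
    appear strictly before time [1 - u]. *)
Lemma cord_approx_after g eps u v : good_path g -> cord_of g u v -> ~ outer g u v -> u < 1 -> 0 < eps ->
  exists a b, [/\ cord_of g a b, u < a & box u v eps a b].
Proof.
move=> [eg _] c no u1 e0; have [u0 uv v1 guv gw] := c.
have [uv'|vu] := ltP u v.
  have [del del0 hd] := simple_realised eg c uv' no e0.
  by have [a [b [s [[cab _] ua bx]]]] := hd _ (adapted_cords eg del0); exists a, b.
have vE : v = u by apply/eqP; rewrite eq_le vu.
pose a := u + Num.min eps (1 - u).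
have m0 : 0 < Num.min eps (1 - u) by rewrite lt_min e0 subr_gt0.
have m1 : Num.min eps (1 - u) <= 1 - u by rewrite ge_min lexx orbT.
have au : `|a - u| <= eps by rewrite /a addrC addKr gtr0_norm// ge_min lexx.
exists a, a; split; [|by rewrite /a ltrDl|by rewrite vE].
split => //; [by rewrite /a; rlra|by rewrite /a; rlra|].
by move=> w /andP[aw wa]; rewrite (_ : w = a)//; apply/eqP; rewrite eq_le wa.
Qed.

Lemma box_trans (u v a b p q e1 e2 : R) : box u v e1 a b -> box a b e2 p q -> box u v (e1 + e2) p q.
Proof.
move=> [h1 h2] [h3 h4]; split.
  have -> : p - u = (a - u) + (p - a) by ring.
  by rewrite (le_trans (ler_normD _ _))// lerD.
have -> : q - v = (b - v) + (q - b) by ring.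
by rewrite (le_trans (ler_normD _ _))// lerD.
Qed.

Lemma box_sym (u v a b e : R) : box u v e a b -> box a b e u v.
Proof. by move=> [h1 h2]; split; rewrite distrC. Qed.

Lemma boxW (u v a b e e' : R) : e <= e' -> box u v e a b -> box u v e' a b.
Proof. by move=> ee [h1 h2]; split; exact: le_trans ee. Qed.

(** Compactness makes the lead [rho] uniform over all cords present at time [1 - x]; only those
    close to the outer cord starting at [x] cannot be anticipated. *)
Lemma cords_realised_from g x eps : good_path g -> 0 <= x < 1 -> 0 < eps ->
  exists2 rho : R, 0 < rho & forall Lam, adapted g rho Lam -> forall u v, cord_of g u v -> x <= u ->
    (exists a b s, [/\ Lam a b s, box u v eps a b & s <= 1 - x - rho]) \/
    (exists v0, outer g x v0 /\ box x v0 eps u v).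
Proof.
move=> gg /andP[x0 x1] e0; apply: contrapT => hn; have [eg _] := gg; have [cg _ _ _] := eg.
have /choice[f hf] : forall n : nat, exists p : R * R, [/\ cord_of g p.1 p.2, x <= p.1,
    exists2 Lam, adapted g n.+1%:R^-1 Lam & ~ (exists a b s, [/\ Lam a b s, box p.1 p.2 eps a b & s <= 1 - x - n.+1%:R^-1]) &
    ~ (exists v0, outer g x v0 /\ box x v0 eps p.1 p.2)].
  move=> n; apply: contrapT => hp; apply: hn; exists n.+1%:R^-1; first by rewrite invr_gt0.
  move=> Lam aL u v c xu; apply: contrapT => /not_orP[q1 q2]; apply: hp; exists (u, v); split => //.
  by exists Lam.
have [|a [b [cab cl]]] := @near_cord_cluster _ g (fun n => (f n).1) (fun n => (f n).2) cg.
  by move=> n; have [h _ _ _] := hf n; apply: cord_near => //; rewrite invr_ge0.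
have xa : x <= a.
  apply/ler_addgt0Pr => al al0; have [n _ [h1 _]] := cl al al0 0%N.
  by have [_ h2 _ _] := hf n; move: h1; rewrite ler_norml => /andP[_]; rlra.
have e3 : 0 < eps / 3 by rewrite divr_gt0.
case: (pselect (outer g a b /\ a = x)) => [ [ho ax]|no].
  have [n _ bx] := cl eps e0 0%N; have [_ _ _ hno] := hf n.
  by apply: hno; exists b; rewrite -ax.
have [a' [b' [cab' xa' bx']]] : exists a' b', [/\ cord_of g a' b', x < a' & box a b (eps / 3) a' b'].
  have [ax|nax] := eqVneq a x; last first.
    exists a, b; split => //; first by rewrite lt_def nax.
    by split; rewrite subrr normr0 ltW.
  have [||a' [b' [c' h b'']]] := cord_approx_after gg cab _ _ e3.
  - by move=> ho; apply: no.
  - by rewrite ax.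
  by exists a', b'; rewrite -ax.
pose r := Num.min (eps / 3) ((a' - x) / 4).
have r0 : 0 < r by rewrite lt_min e3 divr_gt0// subr_gt0.
have [del del0 hd] := cord_realised gg cab' r0.
have m0 : 0 < Num.min del r by rewrite lt_min del0.
have [N hN] := natSinv_le m0; have [n /hN hn' bx] := cl _ e3 N.
have [cn xn [Lam aL hno] _] := hf n; apply: hno.
have nd : n.+1%:R^-1 <= del by apply: le_trans hn' _; rewrite ge_min lexx.
have [p [q [s [Ls bpq]]]] := hd Lam (adaptedW nd aL).
exists p, q, s; split => //.
  have -> : eps = eps / 3 + (eps / 3 + eps / 3) by field.
  apply: box_trans (box_sym bx) (box_trans bx' _).
  by apply: boxW bpq; rewrite ge_min lexx.
have [/(_ _ _ _ Ls)[_ _ su _] _ _ _ _] := aL.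
have [h1 _] := bpq.
have rr : r <= (a' - x) / 4 by rewrite ge_min lexx orbT.
have nr : n.+1%:R^-1 <= r by apply: le_trans hn' _; rewrite ge_min lexx orbT.
move: su h1 nr; rewrite !ler_norml; set z := n.+1%:R^-1 => /andP[? ?] /andP[? ?] ?; rlra.
Qed.

(** The converse comparison: a near cord that starts up to [delta] before [x] still resembles a cord
    starting strictly after [x], unless it is close to the outer cord at [x]. *)
Lemma near_cords_after g x eps eta : good_path g -> 0 <= x < 1 -> 0 < eps -> 0 < eta ->
  exists2 delta : R, 0 < delta & forall u v, near_cord g delta u v -> x - delta <= u ->
    (exists a b, [/\ cord_of g a b, x < a & box u v eps a b]) \/
    (exists v0, outer g x v0 /\ box x v0 eta u v).
Proof.
move=> gg /andP[x0 x1] e0 eta0; apply: contrapT => hn; have [eg _] := gg; have [cg _ _ _] := eg.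
have /choice[f hf] : forall n : nat, exists p : R * R, [/\ near_cord g n.+1%:R^-1 p.1 p.2, x - n.+1%:R^-1 <= p.1,
    ~ (exists a b, [/\ cord_of g a b, x < a & box p.1 p.2 eps a b]) &
    ~ (exists v0, outer g x v0 /\ box x v0 eta p.1 p.2)].
  move=> n; apply: contrapT => hp; apply: hn; exists n.+1%:R^-1; first by rewrite invr_gt0.
  by move=> u v c xu; apply: contrapT => /not_orP[q1 q2]; apply: hp; exists (u, v).
have [|a [b [cab cl]]] := @near_cord_cluster _ g (fun n => (f n).1) (fun n => (f n).2) cg.
  by move=> n; have [h _ _ _] := hf n.
have xa : x <= a.
  apply/ler_addgt0Pr => al al0; have al2 : 0 < al / 2 by rewrite divr_gt0.
  have [N hN] := natSinv_le al2; have [n /hN hn' [h1 _]] := cl _ al2 N.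
  have [_ h2 _ _] := hf n; move: h1 h2 hn'; rewrite ler_norml => /andP[_].
  by move: (n.+1%:R^-1) => z; rlra.
have e2 : 0 < eps / 2 by rewrite divr_gt0.
case: (pselect (outer g a b /\ a = x)) => [ [ho ax]|no].
  have [n _ bx] := cl eta eta0 0%N; have [_ _ _ hno] := hf n.
  by apply: hno; exists b; rewrite -ax.
have [a' [b' [cab' xa' bx']]] : exists a' b', [/\ cord_of g a' b', x < a' & box a b (eps / 2) a' b'].
  have [ax|nax] := eqVneq a x; last first.
    exists a, b; split => //; first by rewrite lt_def nax.
    by split; rewrite subrr normr0 ltW.
  have [||a' [b' [c' h b'']]] := cord_approx_after gg cab _ _ e2.
  - by move=> ho; apply: no.
  - by rewrite ax.
  by exists a', b'; rewrite -ax.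
have [n _ bx] := cl _ e2 0%N; have [_ _ hno _] := hf n; apply: hno.
exists a', b'; split => //; rewrite (splitr eps).
exact: box_trans (box_sym bx) bx'.
Qed.

(** [t'] plays for the family the part of the time [1 - x]: at [t'] it has all that [g] has at
    [1 - x], and before [t'] no more than the left limit. At [x = 0], the end of the time interval,
    the last clause covers the whole family. *)
Definition time_match g eps Lam (x t' : R) : Prop :=
  [/\ 0 <= t' <= 1, `|t' - (1 - x)| <= eps, (x = 0 -> t' = 1) /\ (x = 1 -> t' = 0),
      forall u v, cord_of g u v -> x <= u -> exists a b s, [/\ Lam a b s, box u v eps a b & s <= t'] &
      forall a b s, Lam a b s -> s < t' \/ x = 0 -> exists u v, [/\ cord_of g u v, x < u & box u v eps a b]].

Lemma time_match_exists g x eps : good_path g -> 0 <= x <= 1 -> 0 < eps ->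
  exists2 delta : R, 0 < delta & forall Lam, adapted g delta Lam -> exists t', time_match g eps Lam x t'.
Proof.
move=> gg /andP[x0]; rewrite le_eqVlt => /predU1P[-> e0|x1 e0].
  exists 1 => // Lam aL; have [h1 _ _ _ L1] := aL; exists 0; split.
  - by rewrite lexx ler01.
  - by rewrite subrr subr0 normr0 ltW.
  - by split => // /eqP; rewrite oner_eq0.
  - move=> u v [u0 uv v1 _ _] u1; have -> : u = 1 by apply/eqP; rewrite eq_le u1 (le_trans uv).
    have -> : v = 1 by apply/eqP; rewrite eq_le v1 (le_trans u1).
    by exists 1, 1, 0; split => //; split; rewrite subrr normr0 ltW.
  - move=> a b s /h1[s0 _ _ _]; rewrite ltNge s0 => -[//|/eqP]; by rewrite oner_eq0.
have [eg _] := gg; have x01 : 0 <= x < 1 by rewrite x0.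
have e2 : 0 < eps / 2 by rewrite divr_gt0.
have [rho rho0 hrho] := cords_realised_from gg x01 e2.
pose eta := Num.min (eps / 2) (rho / 4).
have eta0 : 0 < eta by rewrite lt_min e2 divr_gt0.
have eta1 : eta <= eps / 2 by rewrite ge_min lexx.
have eta2 : eta <= rho / 4 by rewrite ge_min lexx orbT.
clearbody eta.
have [d2 d20 hd2] := near_cords_after gg x01 e0 eta0.
(* Without an outer cord at [x] nothing jumps there, and [t' = 1 - x] works. *)
case: (pselect (exists v0, outer g x v0)) => [[v0 ho]|no]; last first.
  exists (Num.min rho d2) => [|Lam aL]; first by rewrite lt_min rho0.
  have dr : Num.min rho d2 <= rho by rewrite ge_min lexx.
  have dd : Num.min rho d2 <= d2 by rewrite ge_min lexx orbT.
  exists (1 - x); split.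
  - by apply/andP; split; rlra.
  - by rewrite subrr normr0 ltW.
  - by split => [->|xE]; [rewrite subr0|move: x1; rewrite xE ltxx].
  - move=> u v c xu; have [[a [b [s [Ls bx sr]]]]|[v0  [ho _]]] := hrho Lam (adaptedW dr aL) u v c xu.
      by exists a, b, s; split => //; [apply: boxW bx; rlra|rlra].
    by case: no; exists v0.
  - move=> a b s Ls hs; have [/(_ _ _ _ Ls)[s0 s1 su nc] _ _ _ _] := adaptedW dd aL.
    have [|[u [v [c xu bx]]]|[v0 [ho _]]] := hd2 a b nc.
    + have [a0 _ _ _ _] := nc; move: su; rewrite ler_norml => /andP[? ?].
      by case: hs => [?|->]; rlra.
    + by exists u, v; split => //; exact: box_sym.
    + by case: no; exists v0.
pose r := Num.min eta (d2 / 4).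
have r0 : 0 < r by rewrite lt_min eta0 divr_gt0.
have [d3 d30 hd3] := outer_realised gg ho r0.
pose del := Num.min (Num.min rho d3) (Num.min eta (d2 / 4)).
have del0 : 0 < del by rewrite lt_min [X in X && _]lt_min [X in _ && X]lt_min rho0 d30 eta0 divr_gt0.
exists del => // Lam aL.
have D1 : del <= rho by rewrite /del !ge_min lexx.
have D3 : del <= d3 by rewrite /del !ge_min lexx orbT.
have De : del <= eta by rewrite /del !ge_min lexx !orbT.
have D2 : del <= d2 / 4 by rewrite /del !ge_min lexx !orbT.
have [p [q [s0 [Ls0 bpq]]]] := hd3 Lam (adaptedW D3 aL).
have [h1 _ _ h4 _] := aL.
have bpq' : box x v0 eta p q by apply: boxW bpq; rewrite ge_min lexx.
(* [t'] is the first time at which a cord close to the outer one appears; it exists by the fourth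
   clause of [adapted]. *)
have [p1 [q1 [t' [Lt bt tmin]]]] := h4 _ _ _ _ _ _ Ls0 bpq'.
have t's0 : t' <= s0 by apply: tmin Ls0 bpq'.
have [t'0 t'1 tp1 _] := h1 _ _ _ Lt; have [_ _ sp _] := h1 _ _ _ Ls0.
have rd : r <= d2 / 4 by rewrite ge_min lexx orbT.
have t'lb : 1 - x - rho / 2 <= t' /\ 1 - x - eps <= t'.
  by case: bt => + _; move: tp1; rewrite !ler_norml => /andP[? ?] /andP[? ?]; split; rlra.
have t'ub : t' <= 1 - x + d2 / 2 /\ t' <= 1 - x + eps.
  have re : r <= eta by rewrite ge_min lexx.
  by case: bpq => + _; move: sp; rewrite !ler_norml => /andP[? ?] /andP[? ?]; split; rlra.
have xn0 : x <> 0.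
  move=> xE; have [[_ _ v1 gv gw] [m /andP[um mv] gm]] := ho; have [_ g0 _ gp] := eg.
  have := gp m; rewrite gm xE g0 ltxx -xE um (lt_le_trans mv)// => /(_ isT).
  by [].
exists t'; split.
- by rewrite t'0.
- by rewrite ler_norml; apply/andP; split; rlra.
- by split => // xE; move: x1; rewrite xE ltxx.
- move=> u v c xu; have [[a [b [s [Ls bx sr]]]]|[v0' [ho' bx]]] := hrho Lam (adaptedW D1 aL) u v c xu.
    by exists a, b, s; split => //; [apply: boxW bx; rlra|rlra].
  have E := outer_unique gg ho ho'; subst v0'.
  exists p1, q1, t'; split => //; rewrite (splitr eps).
  by apply: box_trans (box_sym bx) (boxW eta1 bt).
- move=> a b s Ls [hs|//]; have [||[u [v [c xu bx]]]|[v0' [ho' bx]]] := hd2 a b.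
  + have d22 : del <= d2 by rlra.
    by have [/(_ _ _ _ Ls)[_ _ _ nc] _ _ _ _] := adaptedW d22 aL.
  + by have [_ _ su _] := h1 _ _ _ Ls; move: su; rewrite ler_norml => /andP[? ?]; rlra.
  + by exists u, v; split => //; exact: box_sym.
  + have E := outer_unique gg ho ho'; subst v0'.
    by have := tmin _ _ _ Ls bx; rewrite leNgt hs.
Qed.

End TimeMatching.

(** * The time change *)

Section Assembly.
Variable R : realType.
Implicit Types (g h : R -> R) (u v w x eps delta : R) (Lam : R -> R -> R -> Prop).

(** In each box of a finite grid all cords are represented by the one with the largest left end,
    that is the one that appears first; hence finitely many times matter up to [eps]. *)
Lemma thresholds g eps : excursion g -> 0 < eps -> exists pts : seq R,
  [/\ 0 \in pts, 1 \in pts, forall p, p \in pts -> 0 <= p <= 1 &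
      forall u v, cord_of g u v -> exists p v', [/\ p \in pts, u <= p, cord_of g p v' & box u v eps p v']].
Proof.
move=> [cg _ _ _] e0; have e2 : 0 < eps / 2 by rewrite divr_gt0.
have [K hK] := natSinv_le e2; have {hK} hK := hK K (leqnn _).
pose r : R := K.+1%:R^-1.
have r0 : 0 < r by rewrite invr_gt0.
have /choice[f hf] : forall ij : 'I_K.+2 * 'I_K.+2, exists p : R, 0 <= p <= 1 /\
    ((exists u v, cord_of g u v /\ box (ij.1%:R / K.+1%:R) (ij.2%:R / K.+1%:R) r u v) ->
     exists v', [/\ cord_of g p v', box (ij.1%:R / K.+1%:R) (ij.2%:R / K.+1%:R) r p v' &
       forall u v, cord_of g u v -> box (ij.1%:R / K.+1%:R) (ij.2%:R / K.+1%:R) r u v -> u <= p]).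
  move=> ij; case: (pselect (exists u v, cord_of g u v /\ box (ij.1%:R / K.+1%:R) (ij.2%:R / K.+1%:R) r u v)) => [hx|hx].
    have [a [b [cab bab hm]]] := box_max cg r0 hx; exists a; split; last by move=> _; exists b.
    by have [a0 ab b1 _ _] := cab; rewrite a0 (le_trans ab).
  by exists 0; split; rewrite ?lexx ?ler01//.
exists [:: 0, 1 & [seq f ij | ij : 'I_K.+2 * 'I_K.+2]]; split.
- by rewrite inE eqxx.
- by rewrite !inE eqxx orbT.
- move=> p; rewrite !inE => /predU1P[->|/predU1P[->|/mapP[ij _ ->]]]; rewrite ?lexx ?ler01//.
  by have [] := hf ij.
- move=> u v c; have [u0 uv v1 _ _] := c.
  have cell (t : R) : 0 <= t <= 1 -> exists i : 'I_K.+2, `|t - i%:R / K.+1%:R| <= r.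
    move=> t01; have [iK i01 /andP[h1 h2]] := trunc_grid K t01.
    by exists (Ordinal (iK : (_ < K.+2)%N)) => /=; rewrite ger0_norm.
  have [i hi] := cell u ltac:(by rewrite u0 (le_trans uv)).
  have [j hj] := cell v ltac:(by rewrite v1 (le_trans u0)).
  have bx : box ((i, j).1%:R / K.+1%:R) ((i, j).2%:R / K.+1%:R) r u v by [].
  have [_ hp] := hf (i, j); have [|v' [c' b' hm]] := hp; first by exists u, v.
  exists (f (i, j)), v'; split => //; last first.
  - by apply: boxW (box_trans (box_sym bx) b'); rewrite -/r in hK; rlra.
  - exact: hm bx.
  - by rewrite !inE; apply/orP; right; apply/orP; right; apply: map_f; rewrite mem_enum.
Qed.

Lemma seq_min_pos (I : eqType) (s : seq I) (f : I -> R -> Prop) :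
  (forall i a b, f i a -> 0 < b -> b <= a -> f i b) ->
  (forall i, i \in s -> exists2 a : R, 0 < a & f i a) ->
  exists2 a : R, 0 < a & forall i, i \in s -> f i a.
Proof.
move=> fW; elim: s => [_|i s IHs h]; first by exists 1.
have [a a0 ha] := h i (mem_head _ _).
have [|b b0 hb] := IHs; first by move=> j js; apply: h; rewrite inE js orbT.
have m0 : 0 < Num.min a b by rewrite lt_min a0.
exists (Num.min a b) => // j; rewrite inE => /predU1P[->|/hb js].
  by apply: fW ha m0 _; rewrite ge_min lexx.
by apply: fW js m0 _; rewrite ge_min lexx orbT.
Qed.

Lemma seq_gap (s : seq R) : exists2 r : R, 0 < r & forall p q, p \in s -> q \in s -> p != q -> r <= `|p - q|.
Proof.
have [| |r r0 hr] := @seq_min_pos _ s (fun p r => forall q, q \in s -> p != q -> r <= `|p - q|).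
- by move=> p a b h b0 ba q qs pq; apply: le_trans ba (h q qs pq).
- move=> p ps; have [| |r r0 hr] := @seq_min_pos _ s (fun q r => p != q -> r <= `|p - q|).
  + by move=> q a b h b0 ba pq; apply: le_trans ba (h pq).
  + move=> q qs; have [->|pq] := eqVneq p q; first by exists 1.
    by exists `|p - q|; rewrite // normr_gt0 subr_eq0.
  + by exists r => // q qs; exact: hr.
- by exists r => // p q ps; exact: hr.
Qed.

Lemma seq_pred_max (s : seq R) (t : R) : (exists2 p, p \in s & p < t) ->
  exists q, [/\ q \in s, q < t & forall p, p \in s -> p < t -> p <= q].
Proof.
elim: s => [[]//|a s IHs] [p]; rewrite inE => hp pt.
case: (pselect (exists2 p, p \in s & p < t)) => [/IHs[q [qs qt hq]]|hn].
  have [ta|at_] := leP t a.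
    exists q; rewrite inE qs orbT; split => // p'; rewrite inE => /predU1P[->|]; last exact: hq.
    by rewrite ltNge ta.
  have [aq|qa] := leP a q.
    by exists q; rewrite inE qs orbT; split => // p'; rewrite inE => /predU1P[->//|]; exact: hq.
  exists a; rewrite mem_head; split => // p'; rewrite inE => /predU1P[->//|p's p't].
  by apply: le_trans (ltW qa); exact: hq.
have ap : p = a by case/predU1P: hp => // ps; case: hn; exists p.
exists a; rewrite mem_head -ap; split => // p'; rewrite inE => /predU1P[->|p's p't]; first by rewrite ap.
by case: hn; exists p'.
Qed.

Definition hat (x : R) : R := Num.max 0 (1 - `|x|).

Lemma hat_lip x y : `|hat x - hat y| <= `|x - y|.
Proof.
rewrite /hat; have h1 := lerB_dist x y; have h2 := lerB_dist y x; rewrite (distrC y x) in h2.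
have h0 := normr_ge0 (x - y); set a := `|x| in h1 h2 *; set b := `|y| in h1 h2 *.
set c := `|x - y| in h0 h1 h2 *.
by rewrite ler_norml; case: (leP 0 (1 - a)) => ha; case: (leP 0 (1 - b)) => hb; apply/andP; split; rlra.
Qed.

Lemma hat1 x : 1 <= `|x| -> hat x = 0.
Proof. by move=> x1; rewrite /hat max_l// subr_le0. Qed.

Lemma hat0 : hat 0 = 1.
Proof. by rewrite /hat normr0 subr0 max_r. Qed.

Lemma hat01 x : 0 <= hat x <= 1.
Proof. by rewrite /hat le_max lexx /= ge_max ler01 /= lerBlDr lerDl. Qed.

(* [phi] moves the finitely many times in [s] by [d] and is piecewise linear in between. *)
Lemma time_change_exists (s : seq R) (d : R -> R) (eps r : R) : 0 < r -> uniq s ->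
  0 \in s -> 1 \in s -> (forall p, p \in s -> 0 <= p <= 1) -> d 0 = 0 -> d 1 = 0 ->
  (forall p q, p \in s -> q \in s -> p != q -> r <= `|p - q|) ->
  (forall p, p \in s -> (size s)%:R * `|d p| <= r / 2 /\ (size s)%:R * `|d p| <= eps) ->
  exists phi, [/\ time_change phi, forall t, `|phi t - t| <= eps &
    forall p, p \in s -> phi p = p + d p].
Proof.
move=> r0 us s0 s1 s01 d0 d1 gap hd.
pose phi t := t + \sum_(p <- s) d p * hat ((t - p) / r).
have sz : 0 < (size s)%:R :> R by rewrite ltr0n; case: (s) s0.
have sum_le (c : R -> R) (b : R) : (forall p, p \in s -> (size s)%:R * `|c p| <= b) -> `|\sum_(p <- s) c p| <= b.
  move=> hc; apply: le_trans (ler_norm_sum _ _ _) _.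
  apply: (@le_trans _ _ (\sum_(p <- s) b / (size s)%:R)).
    by rewrite big_seq [leRHS]big_seq; apply: ler_sum => p /hc; rewrite ler_pdivlMr// mulrC.
  by rewrite big_const_seq count_predT iter_addr_0 -(mulr_natr (b / _)) divfK// lt0r_neq0.
have phip p : p \in s -> phi p = p + d p.
  move=> ps; rewrite /phi (bigD1_seq p)//= subrr mul0r hat0 mulr1 big_seq_cond big1 ?addr0// => q /andP[qs qp].
  rewrite hat1 ?mulr0// normrM (gtr0_norm (x := r^-1)) ?invr_gt0// ler_pdivlMr// mul1r.
  by apply: gap => //; rewrite eq_sym.
(* The perturbation of the identity is Lipschitz with constant 1/2, so [phi] is continuous and
   strictly increasing. *)
have philip t t' : `|(phi t - phi t') - (t - t')| <= `|t - t'| / 2.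
  have -> : (phi t - phi t') - (t - t') = \sum_(p <- s) d p * (hat ((t - p) / r) - hat ((t' - p) / r)).
    under eq_bigr do rewrite mulrBr; rewrite sumrB /phi; ring.
  apply: sum_le => p ps; rewrite normrM mulrA.
  apply: (@le_trans _ _ (r / 2 * (`|t - t'| / r))); last first.
    by rewrite le_eqVlt; apply/orP; left; apply/eqP; field; rewrite lt0r_neq0.
  have [hd1 _] := hd p ps; apply: ler_pM => //.
  apply: le_trans (hat_lip _ _) _; rewrite -mulrBl normrM (gtr0_norm (x := r^-1)) ?invr_gt0//.
  by rewrite (_ : t - p - (t' - p) = t - t')//; ring.
have philt t t' : t < t' -> phi t < phi t'.
  move=> tt; have := philip t' t; rewrite (gtr0_norm (x := t' - t)) ?subr_gt0// ler_norml => /andP[h _].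
  by move: h tt; clear; rlra.
have phile t t' : t <= t' -> phi t <= phi t'.
  by rewrite le_eqVlt => /predU1P[->//|/philt/ltW].
have phi0 : phi 0 = 0 by rewrite phip// d0 addr0.
have phi1 : phi 1 = 1 by rewrite phip// d1 addr0.
have phic : {within `[0, 1], continuous phi}.
  apply: continuous_subspaceT => t; apply/cvgrPdist_le => al al0; near=> t'.
  have := philip t t'; rewrite ler_norml => /andP[h1 h2].
  have h3 : `|t - t'| <= al / 2 by near: t'; apply: (@cvgr_dist_le _ _ _ _ _ id t) => //; rewrite divr_gt0.
  move: (h3); rewrite ler_norml => /andP[h4 h5].
  by rewrite ler_norml; apply/andP; split; rlra.
exists phi; split => //.
- split => //; first by move=> t t' _ _; exact: philt.
  split.
  + by move=> t /=; rewrite !in_itv/= => /andP[t0 t1]; rewrite -{1}phi0 -phi1 !phile.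
  + move=> t t' _ _ E; apply/eqP; rewrite eq_le !leNgt; apply/andP; split; apply/negP => /philt;
    by rewrite E ltxx.
  + move=> y /=; rewrite in_itv/= => y01.
    have [|||t tI <-] := @IVT R phi 0 1 y => //; last by exists t.
    by rewrite phi0 phi1 min_l// max_r.
- move=> t; rewrite /phi addrC addKr; apply: sum_le => p ps.
  rewrite normrM mulrA; apply: le_trans (_ : (size s)%:R * `|d p| * 1 <= _).
    rewrite ler_wpM2l//.
    by have /andP[h0 h1] := hat01 ((t - p) / r); rewrite ger0_norm.
  by rewrite mulr1; have [] := hd p ps.
Unshelve. all: by end_near. Qed.

(** Between consecutive thresholds the lamination of [g] hardly changes, so it suffices that the
    time change sends each threshold to its matched time. *)
Theorem cord_processes_close g eps : good_path g -> 0 < eps ->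
  exists2 delta : R, 0 < delta & forall Lam, adapted g delta Lam ->
    exists phi, [/\ time_change phi, forall t, `|phi t - t| <= eps &
      forall t : R, 0 <= t <= 1 ->
       (forall u v, cord_of g u v -> 1 - t <= u -> exists a b s, [/\ Lam a b s, s <= phi t & box u v eps a b]) /\
       (forall a b s, Lam a b s -> s <= phi t -> exists u v, [/\ cord_of g u v, 1 - t <= u & box u v eps a b])].
Proof.
move=> gg e0; have [eg _] := gg; have e2 : 0 < eps / 2 by rewrite divr_gt0.
have [pts0 [p0 p1 p01 hpts]] := thresholds eg e2.
pose pts := undup pts0.
have [r r0 gap] := seq_gap pts.
pose e1 := Num.min (eps / 2) (r / 2) / (size pts)%:R.
have sz : 0 < (size pts)%:R :> R.
  have : (0 : R) \in pts by rewrite mem_undup.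
  by rewrite ltr0n; case: (pts).
have sz1 : 1 <= (size pts)%:R :> R by move: sz; rewrite ltr0n ler1n.
have m0 : 0 < Num.min (eps / 2) (r / 2) by rewrite lt_min e2 divr_gt0.
have e10 : 0 < e1 by rewrite divr_gt0.
have e1e : e1 <= eps / 2.
  rewrite ler_pdivrMr// (le_trans (y := eps / 2)) ?ge_min ?lexx// ler_peMr// ltW//.
have [delta delta0 hdelta] : exists2 delta : R, 0 < delta & forall p, p \in pts ->
    forall Lam, adapted g delta Lam -> exists t', time_match g e1 Lam p t'.
  apply: (@seq_min_pos _ pts (fun p delta => forall Lam, adapted g delta Lam -> exists t', time_match g e1 Lam p t')).
    by move=> p a b h b0 ba Lam aL; apply: h; exact: adaptedW aL.
  by move=> p; rewrite mem_undup => /p01 pp; exact: time_match_exists.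
exists delta => // Lam aL.
have /choice[tau htau] : forall p, exists t', p \in pts -> time_match g e1 Lam p t'.
  by move=> p; case: (boolP (p \in pts)) => [/hdelta/(_ _ aL)[t' h]|]; [exists t'|exists 0].
pose s : seq R := [seq 1 - p | p <- pts].
have [||||||||phi [tc hphi phip]] := @time_change_exists s (fun t => tau (1 - t) - t) (eps / 2) r r0.
- by rewrite map_inj_uniq ?undup_uniq// => x y /addrI/oppr_inj.
- by apply/mapP; exists 1; rewrite ?mem_undup// subrr.
- by apply/mapP; exists 0; rewrite ?mem_undup// subr0.
- by move=> t /mapP[p]; rewrite mem_undup => /p01/andP[? ?] ->; apply/andP; split; rlra.
- by rewrite !subr0; have [_ _ [_ h] _ _] := htau 1 ltac:(by rewrite mem_undup); rewrite h.
- by rewrite subrr; have [_ _ [h _] _ _] := htau 0 ltac:(by rewrite mem_undup); rewrite h ?subrr.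
- move=> t t' /mapP[p pp ->] /mapP[q qq ->] ne.
  rewrite (_ : 1 - p - (1 - q) = q - p); last by ring.
  by apply: gap => //; apply: contra ne => /eqP ->.
- move=> t /mapP[p pp ->]; rewrite size_map (_ : 1 - (1 - p) = p); last by ring.
  have [_ h _ _ _] := htau p pp.
  have : (size pts)%:R * `|tau p - (1 - p)| <= Num.min (eps / 2) (r / 2).
    by rewrite mulrC -ler_pdivlMr.
  by rewrite le_min => /andP[].
have phiE p : p \in pts -> phi (1 - p) = tau p.
  move=> pp; rewrite phip; last by apply/mapP; exists p.
  by rewrite (_ : 1 - (1 - p) = p) ?subrKC//; ring.
have [_ philt _] := tc.
have e22 : eps / 2 + eps / 2 = eps by rewrite -splitr.
exists phi; split => //; first by move=> t; apply: le_trans (hphi t) _; rlra.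
move=> t /andP[t0 t1]; split.
  move=> u v c tu; have [p [v' [pp up c' bx]]] := hpts u v c.
  have pp' : p \in pts by rewrite mem_undup.
  have /andP[pp0 pp1] := p01 p pp.
  have [_ _ _ h _] := htau p pp'; have [a [b [s' [Ls bx' st]]]] := h p v' c' (lexx _).
  exists a, b, s'; split => //; last first.
    by rewrite -e22; apply: box_trans bx (boxW e1e bx').
  apply: le_trans st _; rewrite -phiE//.
  have : 1 - p <= t by rlra.
  rewrite le_eqVlt => /predU1P[->//|lt]; apply/ltW/philt => //; rewrite in_itv/=; apply/andP; split; rlra.
move=> a b s' Ls st; move: t1; rewrite le_eqVlt => /predU1P[tE|tlt].
  have pp' : 0 \in pts by rewrite mem_undup.
  have [_ _ _ _ h] := htau 0 pp'; have [|u [v [c u0 bx]]] := h a b s' Ls; first by right.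
  by exists u, v; split => //; [rewrite tE subrr ltW|apply: boxW bx; rlra].
(* [q] is the last threshold before [1 - t]: a cord starting after [q] has a representative starting
   at [1 - t] or later. *)
have [|q [qq qt hq]] := @seq_pred_max pts (1 - t).
  by exists 0; rewrite ?mem_undup// subr_gt0.
have /andP[q0 q1] := p01 q ltac:(by rewrite -mem_undup).
have sq : s' < tau q.
  apply: le_lt_trans st _; rewrite -phiE//; apply: philt; rewrite ?in_itv/=; try (apply/andP; split); rlra.
have [_ _ _ _ h] := htau q qq; have [|u [v [c uq bx]]] := h a b s' Ls; first by left.
have [p [v' [pp up c' bx']]] := hpts u v c.
exists p, v'; split => //.
  by rewrite leNgt; apply/negP => /hq; rewrite mem_undup pp => /(_ isT); rewrite leNgt (lt_le_trans uq).
by rewrite -e22; apply: box_trans (box_sym bx') (boxW e1e bx).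
Qed.

End Assembly.

(** * Laminations and the Skorokhod distance *)

Section Geometry.
Variable R : realType.
Implicit Types (g h : R -> R) (u v w x s t eps delta : R) (A B : set R[i]).

Local Open Scope complex_scope.

Lemma complex_norm_le (z : R[i]) eps : `|complex.Re z| + `|complex.Im z| <= eps -> `|z| <= eps%:C.
Proof.
move=> h; rewrite normc_def lecR; apply: le_trans h.
have s0 : 0 <= `|complex.Re z| + `|complex.Im z| by rewrite addr_ge0.
rewrite -[leRHS]ger0_norm// -sqrtr_sqr ler_sqrt ?exprn_ge0//.
rewrite sqrrD !real_normK ?num_real// -addrA lerD2l addrC lerDl mulrn_wge0// mulr_ge0//.
Qed.

Lemma complex_norm_sqr (z : R[i]) eps : 0 <= eps ->
  (`|z| <= eps%:C) = (complex.Re z ^+ 2 + complex.Im z ^+ 2 <= eps ^+ 2).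
Proof.
move=> e0; rewrite normc_def lecR -[X in _ <= X](ger0_norm e0) -sqrtr_sqr ler_sqrt ?exprn_ge0//.
Qed.

Lemma unit_diskE (z : R[i]) : unit_disk z = (complex.Re z ^+ 2 + complex.Im z ^+ 2 <= 1) :> Prop.
Proof. by have := complex_norm_sqr z ler01; rewrite expr1n => <-. Qed.

Lemma cordP u v (z : R[i]) : cord u v z <-> exists2 s, 0 <= s <= 1 &
  z = (s * cos (2 * pi * u) + (1 - s) * cos (2 * pi * v)) +i*
      (- (s * sin (2 * pi * u) + (1 - s) * sin (2 * pi * v))).
Proof.
have E s : s%:C * circle_point u + (1 - s)%:C * circle_point v =
    (s * cos (2 * pi * u) + (1 - s) * cos (2 * pi * v)) +i*
      (- (s * sin (2 * pi * u) + (1 - s) * sin (2 * pi * v))).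
  apply/eqP; rewrite eq_complex /circle_point /=; apply/andP; split; apply/eqP; ring.
by split=> -[s s01 ->]; exists s; rewrite // E.
Qed.

Lemma mvt_lip (f df : R -> R) : (forall x : R, is_derive x 1 f (df x)) -> (forall x, `|df x| <= 1) ->
  forall x y, `|f x - f y| <= `|x - y|.
Proof.
move=> fd df1 x y; wlog xy : x y / x <= y => [hw|].
  by case: (leP x y) => [/hw//|/ltW/hw]; rewrite distrC [leRHS]distrC.
have [c _ ->] : exists2 c, c \in `[x, y] & f x - f y = - (df c * (y - x)).
  have [|c cI E] := @MVT_segment R f df x y xy (fun z _ => fd z); last by exists c; rewrite // -E opprB.
  apply: continuous_subspaceT => z; apply: differentiable_continuous.
  by apply/derivable1_diffP; have [] := fd z.
by rewrite normrN normrM [leRHS]distrC ler_piMl.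
Qed.

Lemma cos_lip x y : `|cos x - cos y| <= `|x - y|.
Proof. by apply: (@mvt_lip _ (fun x => - sin x)) => z; rewrite normrN sin_max. Qed.

Lemma sin_lip x y : `|sin x - sin y| <= `|x - y|.
Proof. by apply: (@mvt_lip _ cos) => z; exact: cos_max. Qed.

Lemma cord_thickening u v u' v' eps : box u v eps u' v' ->
  cord u v `<=` thickening (4 * pi * eps) (cord u' v').
Proof.
move=> [h1 h2] z /cordP[s /andP[s0 s1] ->].
exists ((s * cos (2 * pi * u') + (1 - s) * cos (2 * pi * v')) +i*
      (- (s * sin (2 * pi * u') + (1 - s) * sin (2 * pi * v')))).
  by apply/cordP; exists s; rewrite ?s0.
have pi0 : 0 < 2 * pi :> R by rewrite mulr_gt0// pi_gt0.
have hh (f : R -> R) : (forall x y, `|f x - f y| <= `|x - y|) ->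
    `|s * (f (2 * pi * u) - f (2 * pi * u')) + (1 - s) * (f (2 * pi * v) - f (2 * pi * v'))| <= 2 * pi * eps.
  move=> fl; apply: le_trans (ler_normD _ _) _.
  have a1 : `|f (2 * pi * u) - f (2 * pi * u')| <= 2 * pi * eps.
    apply: le_trans (fl _ _) _; rewrite -mulrBr normrM (gtr0_norm pi0) ler_pM2l// distrC//.
  have a2 : `|f (2 * pi * v) - f (2 * pi * v')| <= 2 * pi * eps.
    apply: le_trans (fl _ _) _; rewrite -mulrBr normrM (gtr0_norm pi0) ler_pM2l// distrC//.
  have s1' : 0 <= 1 - s by rewrite subr_ge0.
  rewrite !normrM (ger0_norm s0) (ger0_norm s1').
  have -> : 2 * pi * eps = s * (2 * pi * eps) + (1 - s) * (2 * pi * eps) by ring.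
  by apply: lerD; rewrite ler_wpM2l.
apply: complex_norm_le.
have -> : 4 * pi * eps = 2 * pi * eps + 2 * pi * eps by ring.
apply: lerD.
  have := hh _ cos_lip; congr (`|_| <= _); rewrite /=; ring.
have := hh _ sin_lip; rewrite -normrN; congr (`|_| <= _); rewrite /=; ring.
Qed.

Lemma hausdorff_le A B eps : 0 <= eps -> A `<=` thickening eps B -> B `<=` thickening eps A ->
  hausdorff_dist A B <= eps.
Proof. by move=> e0 AB BA; apply: ge_inf; [exists 0 => e []|]. Qed.

Lemma hausdorff_ge0 A B : 0 <= hausdorff_dist A B.
Proof.
rewrite /hausdorff_dist; set E := [set eps | _].
have [[e Ee]|E0] := pselect (E !=set0).
  by apply: lb_le_inf; [exists e|move=> x []].
by rewrite (_ : E = set0) ?inf0//; apply/seteqP; split => // x Ex; apply: E0; exists x.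
Qed.

Lemma hausdorff_refl A : hausdorff_dist A A = 0.
Proof.
apply/eqP; rewrite eq_le hausdorff_ge0 andbT; apply: hausdorff_le => // z Az; exists z => //;
by rewrite subrr normr0 lexx.
Qed.

Definition cord_union (S : R -> R -> Prop) : set R[i] :=
  [set z | exists u v, S u v /\ cord u v z].

Lemma cord_union_thickening (S S' : R -> R -> Prop) eps :
  (forall u v, S u v -> exists u' v', S' u' v' /\ box u v eps u' v') ->
  cord_union S `<=` thickening (4 * pi * eps) (cord_union S').
Proof.
move=> h z [u [v [Suv zc]]]; have [u' [v' [S'uv bx]]] := h u v Suv.
have [w wc zw] := cord_thickening bx zc.
by exists w => //; exists u', v'.
Qed.

Lemma hausdorff_cord_union (S S' : R -> R -> Prop) eps : 0 <= eps ->
  (forall u v, S u v -> exists u' v', S' u' v' /\ box u v eps u' v') ->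
  (forall u v, S' u v -> exists u' v', S u' v' /\ box u v eps u' v') ->
  hausdorff_dist (cord_union S) (cord_union S') <= 4 * pi * eps.
Proof.
move=> e0 h1 h2; apply: hausdorff_le; [|exact: cord_union_thickening|exact: cord_union_thickening].
by rewrite !mulr_ge0// pi_ge0.
Qed.

Lemma lamination_ofE g t : lamination_of g t = cord_union (fun u v => cord_of g u v /\ 1 - t <= u).
Proof.
apply/seteqP; split => z.
  by move=> [[u v] /= [c tu] zc]; exists u, v.
by move=> [u [v [[c tu] zc]]]; exists (u, v).
Qed.

Definition limit_closed (S : R -> R -> Prop) : Prop :=
  forall a b, (forall eps, 0 < eps -> exists u v, S u v /\ box a b eps u v) -> S a b.

Definition noncrossing (S : R -> R -> Prop) : Prop :=
  forall u v u' v', S u v -> S u' v' ->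
    [\/ v <= u', v' <= u, u <= u' /\ v' <= v | u' <= u /\ v <= v'].

(** The normal form of the line through the points [u] and [v] of the circle. At a third point of
    the circle it is a product of sines, whose sign is read off the order of the three
    parameters. *)
Definition line u v (z : R[i]) : R :=
  cos (pi * (u + v)) * complex.Re z - sin (pi * (u + v)) * complex.Im z - cos (pi * (v - u)).

Lemma line_point u v w : line u v (circle_point w) = 2 * (sin (pi * (v - w)) * sin (pi * (w - u))).
Proof.
rewrite /line /circle_point /= mulrN opprK.
have -> : cos (pi * (u + v)) * cos (2 * pi * w) + sin (pi * (u + v)) * sin (2 * pi * w) =
    cos (pi * (v - w) - pi * (w - u)) by rewrite -cosB; congr cos; ring.
have -> : pi * (v - u) = pi * (v - w) + pi * (w - u) :> R by ring.
by rewrite cosB cosD; ring.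
Qed.

Lemma sin_pi_ge0 x : 0 <= x <= 1 -> 0 <= sin (pi * x).
Proof. by move=> /andP[x0 x1]; rewrite sin_ge0_pi// mulr_ge0 ?pi_ge0//= ler_piMr ?pi_ge0. Qed.

Lemma sin_pi_le0 x : -1 <= x <= 0 -> sin (pi * x) <= 0.
Proof.
move=> /andP[x0 x1]; rewrite -oppr_ge0 -sinN -mulrN sin_pi_ge0//; apply/andP; split; lra.
Qed.

Lemma sin_pi_eq0 x : -1 <= x <= 1 -> sin (pi * x) = 0 -> [\/ x = 0, x = 1 | x = -1].
Proof.
move=> /andP[x0 x1] sx.
have pos (y : R) : 0 < y < 1 -> 0 < sin (pi * y).
  by move=> /andP[y0 y1]; rewrite sin_gt0_pi// mulr_gt0 ?pi_gt0//= gtr_pMr ?pi_gt0.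
have [->|xn0] := eqVneq x 0; first exact: Or31.
have [->|xn1] := eqVneq x 1; first exact: Or32.
have [->|xnN1] := eqVneq x (-1); first exact: Or33.
have [xp|xn] := ltP 0 x.
  have := pos x; rewrite xp lt_def eq_sym xn1 x1 sx ltxx => /(_ isT).
  by [].
have := pos (- x); rewrite mulrN sinN sx oppr0 ltxx.
have h1 : 0 < - x by rewrite oppr_gt0 lt_def eq_sym xn0.
have h2 : - x < 1 by rewrite ltrNl lt_def xnN1.
by rewrite h1 h2 => /(_ isT).
Qed.

Lemma circle_point01 : circle_point 0 = circle_point 1 :> R[i].
Proof.
rewrite /circle_point !mulr0 mulr1 cos0 sin0.
by have -> : 2 * pi = pi *+ 2 :> R; [rewrite mulr_natl|rewrite cos2pi sin2pi].
Qed.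

Lemma line_eq0 u v w : 0 <= u <= 1 -> 0 <= v <= 1 -> 0 <= w <= 1 ->
  line u v (circle_point w) = 0 -> circle_point w = circle_point u \/ circle_point w = circle_point v.
Proof.
move=> u01 v01 w01; rewrite line_point => /eqP; rewrite mulf_eq0 pnatr_eq0 /= mulf_eq0.
have aux a : 0 <= a <= 1 -> (sin (pi * (a - w)) = 0 \/ sin (pi * (w - a)) = 0) ->
    circle_point w = circle_point a.
  move=> /andP[a0 a1] h; case/andP: (w01) => w0 w1.
  have hs : sin (pi * (w - a)) = 0 by case: h => // h; rewrite -opprB mulrN sinN h oppr0.
  have [||E|E] := sin_pi_eq0 _ hs; first by apply/andP; split; lra.
  - by move/eqP; rewrite subr_eq0 => /eqP ->.
  - have -> : w = 1 by lra.
    have -> : a = 0 by lra.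
    by rewrite circle_point01.
  - have -> : w = 0 by lra.
    have -> : a = 1 by lra.
    by rewrite circle_point01.
by case/orP => /eqP h; [right|left]; apply: aux => //; [left|right].
Qed.

Lemma line_cord u v z : cord u v z -> line u v z = 0.
Proof.
have l1 : line u v (circle_point u) = 0 by rewrite line_point subrr mulr0 sin0 !mulr0.
have l2 : line u v (circle_point v) = 0 by rewrite line_point subrr mulr0 sin0 mul0r mulr0.
move=> /cordP[s _ ->]; rewrite /line /=; move: l1 l2; rewrite /line /circle_point /=.
set a := cos (pi * (u + v)); set b := sin (pi * (u + v)); set c := cos (pi * (v - u)).
set p := cos (2 * pi * u); set q := sin (2 * pi * u); set p' := cos (2 * pi * v); set q' := sin (2 * pi * v) => l1 l2.
have -> : a * (s * p + (1 - s) * p') - b * - (s * q + (1 - s) * q') - c =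
   s * (a * p - b * - q - c) + (1 - s) * (a * p' - b * - q' - c) by ring.
by rewrite l1 l2 !mulr0 addr0.
Qed.

Lemma cord_sym u v : cord u v = cord v u :> set R[i].
Proof.
apply/seteqP; split => z /cordP[s /andP[s0 s1] ->]; apply/cordP; exists (1 - s);
  [by apply/andP; split; lra| |by apply/andP; split; lra|];
by apply/eqP; rewrite eq_complex /=; apply/andP; split; apply/eqP; ring.
Qed.

Definition inside (z : R[i]) : Prop := complex.Re z ^+ 2 + complex.Im z ^+ 2 < 1.

Lemma circle_point_norm u : complex.Re (circle_point u) ^+ 2 + complex.Im (circle_point u) ^+ 2 = 1.
Proof. by rewrite /circle_point /= sqrrN cos2Dsin2. Qed.

(** Both ends of the second cord lie weakly on one side of the first. A common point inside the disk
    is a strict convex combination of these ends, so both lie on the line and the cords coincide. *)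
Lemma cords_disjoint_nested u v u' v' z : 0 <= u <= 1 -> 0 <= v <= 1 -> 0 <= u' <= 1 -> 0 <= v' <= 1 ->
  (0 <= line u v (circle_point u') /\ 0 <= line u v (circle_point v')) \/
  (line u v (circle_point u') <= 0 /\ line u v (circle_point v') <= 0) ->
  inside z -> cord u v z -> cord u' v' z -> cord u v = cord u' v' :> set R[i].
Proof.
move=> u01 v01 u'01 v'01 sg iz zc zc'.
have lz := line_cord zc; have [s /andP[s0 s1] zE] := zc'.
have lE : line u v z = s * line u v (circle_point u') + (1 - s) * line u v (circle_point v').
  rewrite zE /line /=; ring.
have s1' : 0 <= 1 - s by rewrite subr_ge0.
have sn0 : s != 0.
  apply/eqP => sE; move: iz; rewrite zE sE /inside subr0 mul0r add0r mul1r.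
  by rewrite circle_point_norm ltxx.
have sn1 : 1 - s != 0.
  apply/eqP => sE; move: iz; rewrite zE sE /inside mul0r addr0.
  have -> : s = 1 by lra.
  by rewrite mul1r circle_point_norm ltxx.
have [l1 l2] : line u v (circle_point u') = 0 /\ line u v (circle_point v') = 0.
  move: lE; rewrite lz => /esym/eqP; case: sg => -[g1 g2].
    by rewrite paddr_eq0 ?mulr_ge0// !mulf_eq0 (negbTE sn0) (negbTE sn1) /= => /andP[/eqP ? /eqP ?].
  by rewrite naddr_eq0 ?mulr_ge0_le0// !mulf_eq0 (negbTE sn0) (negbTE sn1) /= => /andP[/eqP ? /eqP ?].
have h1 := line_eq0 u01 v01 u'01 l1; have h2 := line_eq0 u01 v01 v'01 l2.
have ne : circle_point u' <> circle_point v'.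
  move=> E; move: iz; rewrite zE E /inside.
  have -> : s%:C * circle_point v' + (1 - s)%:C * circle_point v' = circle_point v'.
    by apply/eqP; rewrite eq_complex /=; apply/andP; split; apply/eqP; ring.
  by rewrite circle_point_norm ltxx.
have ext a b : circle_point a = circle_point u' -> circle_point b = circle_point v' -> cord a b = cord u' v'.
  by move=> E1 E2; rewrite /cord E1 E2.
case: h1 => h1; case: h2 => h2.
- by case: ne; rewrite h1 h2.
- exact: ext.
- by rewrite cord_sym; exact: ext.
- by case: ne; rewrite h1 h2.
Qed.

Lemma line_ge0 u v w : 0 <= u -> u <= w -> w <= v -> v <= 1 -> 0 <= line u v (circle_point w).
Proof.
by move=> u0 uw wv v1; rewrite line_point mulr_ge0// mulr_ge0//; apply: sin_pi_ge0; apply/andP; split; lra.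
Qed.

Lemma line_le0 u v w : 0 <= u -> u <= v -> v <= 1 -> 0 <= w -> w <= 1 -> w <= u \/ v <= w ->
  line u v (circle_point w) <= 0.
Proof.
move=> u0 uv v1 w0 w1 h; rewrite line_point pmulr_rle0//; case: h => h.
  by rewrite mulr_ge0_le0// ?sin_pi_ge0 ?sin_pi_le0//; apply/andP; split; lra.
by rewrite mulr_le0_ge0// ?sin_pi_ge0 ?sin_pi_le0//; apply/andP; split; lra.
Qed.

Lemma cords_disjoint (S : R -> R -> Prop) u v u' v' z :
  (forall u v, S u v -> [/\ 0 <= u, u <= v & v <= 1]) -> noncrossing S ->
  S u v -> S u' v' -> inside z -> cord u v z -> cord u' v' z -> cord u v = cord u' v' :> set R[i].
Proof.
move=> S01 nS Suv Suv' iz zc zc'.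
have [u0 uv v1] := S01 _ _ Suv; have [u0' uv' v1'] := S01 _ _ Suv'.
have u01 : 0 <= u <= 1 by apply/andP; split; lra.
have v01 : 0 <= v <= 1 by apply/andP; split; lra.
have u01' : 0 <= u' <= 1 by apply/andP; split; lra.
have v01' : 0 <= v' <= 1 by apply/andP; split; lra.
case: (nS _ _ _ _ Suv Suv') => [h|h|[h1 h2]|[h1 h2]].
- apply: cords_disjoint_nested iz zc zc' => //; right.
  by split; apply: line_le0 => //; [lra|right; lra|lra|right; lra].
- apply: cords_disjoint_nested iz zc zc' => //; right.
  by split; apply: line_le0 => //; [lra|left; lra|lra|left; lra].
- apply: cords_disjoint_nested iz zc zc' => //; left.
  by split; apply: line_ge0 => //; lra.
- apply/esym; apply: cords_disjoint_nested iz zc' zc => //; left.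
  by split; apply: line_ge0 => //; lra.
Qed.

Lemma cord_unit_disk u v : cord u v `<=` @unit_disk R.
Proof.
move=> z /cordP[s /andP[s0 s1] ->]; rewrite unit_diskE /= sqrrN.
have h1 := cos2Dsin2 (2 * pi * u); have h2 := cos2Dsin2 (2 * pi * v).
set p := cos (2 * pi * u) in h1 *; set q := sin (2 * pi * u) in h1 *; set p' := cos (2 * pi * v) in h2 *; set q' := sin (2 * pi * v) in h2 *.
have s1' : 0 <= 1 - s by rewrite subr_ge0.
have h3 : 0 <= s * (1 - s) * ((p - p') ^+ 2 + (q - q') ^+ 2).
  by rewrite !mulr_ge0// addr_ge0// sqr_ge0.
have -> : (s * p + (1 - s) * p') ^+ 2 + (s * q + (1 - s) * q') ^+ 2 =
  s * (p ^+ 2 + q ^+ 2) + (1 - s) * (p' ^+ 2 + q' ^+ 2) - s * (1 - s) * ((p - p') ^+ 2 + (q - q') ^+ 2) by ring.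
by rewrite h1 h2 !mulr1 addrCA subrr addr0; lra.
Qed.

Lemma interior_inside (z : R[i]) : (@unit_disk R : set (R[i])^o)° z -> inside z.
Proof.
move=> /nbhs_ballP[e /= e0 hb].
have : unit_disk z by apply: hb; exact: ballxx.
rewrite unit_diskE /inside le_eqVlt => /predU1P[z1|//].
have eE : e = (complex.Re e)%:C.
  by move: e0; rewrite ltcE /= => /andP[/eqP ie _]; apply/eqP; rewrite eq_complex /= ie !eqxx.
have e0' : 0 < complex.Re e by move: e0; rewrite ltcE => /andP[].
pose eta := complex.Re e / 2; have eta0 : 0 < eta by rewrite divr_gt0.
have : unit_disk ((1 + eta)%:C * z).
  apply: hb; rewrite /ball /= (_ : z - (1 + eta)%:C * z = - (eta%:C * z)).
    rewrite normrN normrM.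
    have -> : `|z| = 1 by rewrite normc_def z1 sqrtr1.
    rewrite mulr1 normc_def /= expr0n /= addr0 sqrtr_sqr gtr0_norm// eE ltcR /eta.
    by rewrite ltr_pdivrMr// ltr_pMr// ltr1n.
  by rewrite rmorphD /= mulrDl mul1r opprD addrA subrr add0r.
rewrite unit_diskE.
case: z z1 {hb} => a b /= z1.
have -> : ((1 + eta) * a - 0 * b) ^+ 2 + ((1 + eta) * b + 0 * a) ^+ 2 = (1 + eta) ^+ 2 * (a ^+ 2 + b ^+ 2) by ring.
rewrite z1 mulr1 => h; exfalso; move: h eta0; clear; nra.
Qed.

Lemma continuous_complex (X : topologicalType) (f : X -> R[i]) :
  continuous (fun x : X => complex.Re (f x) : R) -> continuous (fun x : X => complex.Im (f x) : R) ->
  continuous (f : X -> (R[i])^o).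
Proof.
move=> cr ci x; apply/cvgrPdist_le => e e0.
have eE : e = (complex.Re e)%:C.
  by move: e0; rewrite ltcE /= => /andP[/eqP ie _]; apply/eqP; rewrite eq_complex /= ie !eqxx.
have e0' : 0 < complex.Re e / 2 by rewrite divr_gt0//; move: e0; rewrite ltcE => /andP[].
have /cvgrPdist_le/(_ _ e0') h1 := cr x; have /cvgrPdist_le/(_ _ e0') h2 := ci x.
near=> y; rewrite eE; apply: complex_norm_le; rewrite (splitr (complex.Re e)); apply: lerD.
  by rewrite raddfB; near: y.
by rewrite raddfB; near: y.
Unshelve. all: by end_near. Qed.

Lemma cord_union_lamination (S : R -> R -> Prop) :
  (exists u v, S u v) -> (forall u v, S u v -> [/\ 0 <= u, u <= v & v <= 1]) ->
  limit_closed S -> noncrossing S -> is_lamination (cord_union S).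
Proof.
move=> [u1 [v1 S1]] S01 cS nS; split.
- exists (circle_point u1), u1, v1; split => //; exists 1; rewrite ?ler01 ?lexx//.
  by rewrite subrr mul1r mul0r addr0.
- pose K : set (R * (R * R)) := `[0, 1] `*` [set p | S p.1 p.2].
  pose f (x : R * (R * R)) : R[i] := (x.1 * cos (2 * pi * x.2.1) + (1 - x.1) * cos (2 * pi * x.2.2)) +i*
      (- (x.1 * sin (2 * pi * x.2.1) + (1 - x.1) * sin (2 * pi * x.2.2))).
  have -> : cord_union S = (f : _ -> (R[i])^o) @` K.
    apply/seteqP; split => z.
      by move=> [u [v [Suv /cordP[s s01 ->]]]]; exists (s, (u, v)) => //; split => //=; rewrite in_itv.
    move=> [[s [u v]] [/= sI Suv] <-]; exists u, v; split => //; apply/cordP; exists s => //.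
  apply: continuous_compact.
    apply: continuous_subspaceT.
    have c1 : continuous (fun x : R * (R * R) => x.1) by move=> x; exact: cvg_fst.
    have c2 : continuous (fun x : R * (R * R) => x.2.1).
      by move=> x; apply: (@cvg_comp _ _ _ (fun x : R * (R * R) => x.2) fst _ (nbhs x.2)); [exact: cvg_snd|exact: cvg_fst].
    have c3 : continuous (fun x : R * (R * R) => x.2.2).
      by move=> x; apply: (@cvg_comp _ _ _ (fun x : R * (R * R) => x.2) snd _ (nbhs x.2)); [exact: cvg_snd|exact: cvg_snd].
    have aux (h : R -> R) : continuous h ->
       continuous (fun x : R * (R * R) => x.1 * h (2 * pi * x.2.1) + (1 - x.1) * h (2 * pi * x.2.2)).
      move=> ch x; apply: cvgD; apply: cvgM.
      - exact: c1.
      - apply: (@cvg_comp _ _ _ (fun x : R * (R * R) => 2 * pi * x.2.1) h _ (nbhs (2 * pi * x.2.1))); last exact: ch.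
        by apply: cvgM; [exact: cvg_cst|exact: c2].
      - by apply: cvgB; [exact: cvg_cst|exact: c1].
      - apply: (@cvg_comp _ _ _ (fun x : R * (R * R) => 2 * pi * x.2.2) h _ (nbhs (2 * pi * x.2.2))); last exact: ch.
        by apply: cvgM; [exact: cvg_cst|exact: c3].
    apply: continuous_complex.
      exact: (aux _ (@continuous_cos R)).
    by move=> x; apply: cvgN; exact: (aux _ (@continuous_sin R)).
  apply: compact_setX; first exact: segment_compact.
  apply: (@subclosed_compact (R * R)%type _ (`[0, 1]%classic `*` `[0, 1]%classic)).
  + move=> [a b] cl; apply: cS => e e0.
    have [[u v] [Suv [/= ba bb]]] := cl _ (nbhsx_ballx (a, b) e e0).
    exists u, v; split => //; move: ba bb; rewrite /ball /= => ba bb.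
    by split; rewrite distrC ltW.
  + by apply: compact_setX; exact: segment_compact.
  + move=> [u v] /= /S01[u0 uv v1']; split; rewrite /= in_itv/=; apply/andP; split; lra.
- by move=> z [u [v [_ /cord_unit_disk]]].
- exists [set c | exists u v, S u v /\ c = cord u v]; split.
  + move=> c [u [v [Suv ->]]]; have [u0 uv v1'] := S01 _ _ Suv.
    by exists u, v.
  + move=> c c' [u [v [Suv ->]]] [u' [v' [Suv' ->]]] [z [[zc iz] [zc' _]]].
    exact: (cords_disjoint S01 nS Suv Suv' (interior_inside iz) zc zc').
  + apply/seteqP; split => z.
      by move=> [u [v [Suv zc]]]; exists (cord u v) => //; exists u, v.
    by move=> [c [u [v [Suv ->]]] zc]; exists u, v.
Qed.

End Geometry.

(** * Regularity and comparison of lamination processes *)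

Section Processes.
Variable R : realType.
Implicit Types (g h : R -> R) (u v w x s t eps delta : R) (A B C : set R[i]) (Lam : R -> R -> R -> Prop).

Lemma sup_nonneg (E : set R) : (forall x, E x -> 0 <= x) -> 0 <= sup E.
Proof.
move=> h; case: (pselect (has_sup E)) => [sE|/sup_out -> //].
have [[x Ex] bE] := sE; apply: le_trans (h x Ex) _; exact: ub_le_sup.
Qed.

Lemma skorokhod_le (f h : R -> set R[i]) (phi : R -> R) eps : time_change phi ->
  (forall t, 0 <= t <= 1 -> `|phi t - t| <= eps) ->
  (forall t, 0 <= t <= 1 -> hausdorff_dist (f t) (h (phi t)) <= eps) ->
  skorokhod_dist f h <= eps.
Proof.
move=> tc h1 h2; apply: (@le_trans _ _ (Num.max (sup [set `|phi t - t| | t in `[0, 1]])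
         (sup [set hausdorff_dist (f t) (h (phi t)) | t in `[0, 1]]))).
  apply: ge_inf; last by exists phi.
  exists 0 => _ [psi _ <-]; rewrite le_max; apply/orP; left.
  by apply: sup_nonneg => _ [t _ <-].
rewrite ge_max; apply/andP; split; apply: sup_image_le; try exact: set01_neq0.
  by move=> t /mem01; exact: h1.
by move=> t /mem01; exact: h2.
Qed.

Lemma thickening_trans A B C (a b : R) : A `<=` thickening a B -> B `<=` thickening b C ->
  A `<=` thickening (a + b) C.
Proof.
move=> AB BC z /AB[w /BC[y Cy wy] zw]; exists y => //.
have -> : z - y = (z - w) + (w - y) by ring.
by rewrite (le_trans (ler_normD _ _))// rmorphD lerD.
Qed.

Lemma thickeningW A B (a b : R) : a <= b -> A `<=` thickening a B -> A `<=` thickening b B.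
Proof. by move=> ab AB z /AB[w Bw zw]; exists w => //; apply: le_trans zw _; rewrite lecR. Qed.

Definition timed_union Lam t : set R[i] := cord_union (fun u v => exists2 s, s <= t & Lam u v s).

(** [X] may be slightly smaller than [timed_union]: every adapted family contains the point cord at
    1 from time 0 on, which the discrete lamination need not contain later. *)
Theorem adapted_skorokhod g eps : good_path g -> 0 < eps ->
  exists2 delta : R, 0 < delta & forall Lam, adapted g delta Lam -> forall X : R -> set R[i],
    (forall t, 0 <= t <= 1 -> X t `<=` timed_union Lam t /\
       timed_union Lam t `<=` thickening (eps / 2) (X t)) ->
    skorokhod_dist (lamination_of g) X <= eps.
Proof.
move=> gg e0; have pi0 : 0 < pi :> R := pi_gt0 R.
(* Cords whose parameters differ by at most [e] are at Hausdorff distance at most [4 * pi * e],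
   hence at most [eps / 2]. *)
pose e := Num.min eps (eps / (8 * pi)).
have p8 : 0 < 8 * pi :> R by rewrite mulr_gt0.
have ee0 : 0 < e by rewrite lt_min e0 divr_gt0.
have ee1 : e <= eps by rewrite ge_min lexx.
have ee2 : 4 * pi * e <= eps / 2.
  have aux (p : R) : 0 < p -> eps / 2 = 4 * p * (eps / (8 * p)).
    by move=> /lt0r_neq0 pn; field.
  rewrite (aux pi)//.
  by rewrite ler_pM2l ?mulr_gt0// ge_min lexx orbT.
have [del del0 hd] := cord_processes_close gg ee0.
exists del => // Lam /hd[phi [tc hphi hL]] X hX.
apply: (skorokhod_le tc) => t t01; first exact: le_trans (hphi t) ee1.
have [h1 h2] := hL t t01.
have phi01 : 0 <= phi t <= 1.
  by have [_ _ [hm _ _]] := tc; have := hm t; rewrite /= !in_itv/=; apply.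
have [X1 X2] := hX _ phi01.
apply: hausdorff_le; first exact: ltW.
  rewrite lamination_ofE (splitr eps); apply: thickening_trans X2.
  apply: thickeningW ee2 _; apply: cord_union_thickening => u v [c tu].
  by have [a [b [s [Ls st bx]]]] := h1 u v c tu; exists a, b; split => //; exists s.
rewrite lamination_ofE => z /X1; apply: (@thickeningW _ _ (4 * pi * e)); first by lra.
apply: cord_union_thickening => a b [s st Ls].
by have [u [v [c tu bx]]] := h2 a b s Ls st; exists u, v; split => //; exact: box_sym.
Qed.

(** Crossing cords lie at the same height; the end of each that falls inside the other is then a
    local minimum, and the two values agree. *)
Lemma cord_of_noncrossing g : good_path g -> noncrossing (cord_of g).
Proof.
move=> gg u v u' v' c c'.
have key a b a' b' : cord_of g a b -> cord_of g a' b' -> a < a' -> a' < b -> b < b' -> False.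
  move=> k k' h1 h2 h3; have [_ _ _ e1 m1] := k; have [_ _ _ e2 m2] := k'.
  have E : g a' = g a.
    apply/eqP; rewrite eq_le; apply/andP; split.
      by rewrite e1; apply: m2; apply/andP; split; lra.
    by apply: m1; apply/andP; split; lra.
  apply: (@interior_min_unique R g a b a' a' b' b gg k _ E k') => //.
  - by rewrite h1.
  - by rewrite h2.
  - by rewrite -e1.
have [h1|h1] := leP v u'; first exact: Or41.
have [h2|h2] := leP v' u; first exact: Or42.
have [h3|h3] := leP u u'; have [h4|h4] := leP v' v.
- exact: Or43.
- move: h3; rewrite le_eqVlt => /predU1P[E|h3]; first by apply: Or44; rewrite E lexx ltW.
  by case: (key _ _ _ _ c c' h3 h1 h4).
- move: h4; rewrite le_eqVlt => /predU1P[E|h4]; first by apply: Or44; rewrite -E lexx ltW.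
  by case: (key _ _ _ _ c' c h3 h2 h4).
- by apply: Or44; rewrite !ltW.
Qed.

Lemma cord_of_limit_closed g : cont01 g -> limit_closed (cord_of g).
Proof.
move=> cg a b h.
have /choice[f hf] : forall n : nat, exists p : R * R, cord_of g p.1 p.2 /\ box a b n.+1%:R^-1 p.1 p.2.
  by move=> n; have [|u [v [c bx]]] := h n.+1%:R^-1; [rewrite invr_gt0|exists (u, v)].
have [|a' [b' [c cl]]] := @near_cord_cluster _ g (fun n => (f n).1) (fun n => (f n).2) cg.
  by move=> n; have [k _] := hf n; apply: cord_near => //; rewrite invr_ge0.
have E eps : 0 < eps -> box a b (eps + eps) a' b'.
  move=> e0; have [N hN] := natSinv_le e0; have [n /hN hn bx] := cl _ e0 N.
  by have [_ bx'] := hf n; apply: box_trans (boxW hn bx') (box_sym bx).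
have eq0 (p q : R) : (forall eps, 0 < eps -> `|p - q| <= eps + eps) -> p = q.
  move=> hh; apply/eqP; rewrite -subr_eq0 -normr_le0; apply/ler_addgt0Pr => eps e0.
  by rewrite add0r (splitr eps) hh// divr_gt0.
have <- : a' = a by apply: eq0 => eps /E[].
by have <- : b' = b by apply: eq0 => eps /E[].
Qed.

Lemma cord_of01 g u v : cord_of g u v -> [/\ 0 <= u, u <= v & v <= 1].
Proof. by case. Qed.

Lemma cord_of11 g : cord_of g 1 1.
Proof.
split => //; rewrite ?ler01// => s /andP[s0 s1].
by rewrite (_ : s = 1)//; apply/eqP; rewrite eq_le s1.
Qed.

Lemma noncrossingW (S S' : R -> R -> Prop) : (forall u v, S u v -> S' u v) -> noncrossing S' -> noncrossing S.
Proof. by move=> SS h u v u' v' /SS s /SS s'; exact: h. Qed.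

Lemma lamination_of_lamination g t : good_path g -> 0 <= t -> is_lamination (lamination_of g t).
Proof.
move=> gg t0; have [[cg _ _ _] _] := gg; rewrite lamination_ofE; apply: cord_union_lamination.
- by exists 1, 1; split; [exact: cord_of11|lra].
- by move=> u v [/cord_of01].
- move=> a b h; split.
    by apply: cord_of_limit_closed => // eps /h[u [v [[c _] bx]]]; exists u, v.
  apply/ler_addgt0Pr => eps /h[u [v [[_ tu] [+ _]]]].
  by rewrite ler_norml => /andP[_]; lra.
- by apply: noncrossingW (cord_of_noncrossing gg) => u v [].
Qed.

Lemma hausdorff_cvg0 (F : set_system R) (f : R -> set R[i]) B : Filter F ->
  (forall eps, 0 < eps -> \forall s \near F, hausdorff_dist (f s) B <= eps) ->
  hausdorff_dist (f s) B @[s --> F] --> 0.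
Proof.
move=> FF h; apply/cvgrPdist_le => eps e0; near=> s.
rewrite sub0r normrN ger0_norm ?hausdorff_ge0//; near: s; exact: h.
Unshelve. all: by end_near. Qed.

(** Finitely many thresholds leave a gap on both sides of [x]; this yields right continuity and left
    limits. *)
Lemma thresholds_gap g eps x : excursion g -> 0 < eps -> exists2 r : R, 0 < r &
  forall u v, cord_of g u v -> (x - r < u -> exists p v', [/\ x <= p, cord_of g p v' & box u v eps p v']) /\
    (x < u -> exists p v', [/\ x + r <= p, cord_of g p v' & box u v eps p v']).
Proof.
move=> eg e0; have [pts [_ _ _ hp]] := thresholds eg e0.
have [r r0 hr] := seq_gap (x :: pts).
exists r => // u v c; have [p [v' [pp up c' bx]]] := hp u v c.
have pin : p \in x :: pts by rewrite inE pp orbT.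
split=> xu; exists p, v'; split => //.
- rewrite leNgt; apply/negP => px; have := hr x p (mem_head _ _) pin.
  by rewrite gt_eqF// => /(_ isT); rewrite gtr0_norm ?subr_gt0//; lra.
- have px : x < p by lra.
  have := hr p x pin (mem_head _ _); rewrite gt_eqF// => /(_ isT).
  by rewrite gtr0_norm ?subr_gt0//; lra.
Qed.

Lemma lamination_of_cadlag g : good_path g -> is_cadlag (lamination_of g).
Proof.
move=> gg; have [eg _] := gg; have [cg _ _ _] := eg.
have pi0 : 0 < pi :> R := pi_gt0 R.
have bd eps : 0 < eps -> 0 < eps / (4 * pi) /\ 4 * pi * (eps / (4 * pi)) = eps.
  move=> e0; split; first by rewrite divr_gt0// mulr_gt0.
  have aux (p : R) : 0 < p -> 4 * p * (eps / (4 * p)) = eps.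
    by move=> /lt0r_neq0 pn; field.
  exact: aux.
split.
- by move=> t /andP[t0 _]; exact: lamination_of_lamination.
- move=> t /andP[t0 t1]; apply: hausdorff_cvg0 => eps e0.
  have [e1 <-] := bd _ e0; set e := eps / _ in e1 *.
  have [r r0 hr] := thresholds_gap (1 - t) eg e1.
  near=> s; rewrite !lamination_ofE; apply: hausdorff_cord_union; first exact: ltW.
    move=> u v [c su]; have [hr1 _] := hr u v c.
    have [|p [v' [xp c' bx]]] := hr1; last by exists p, v'.
    have : s < t + r by near: s; apply: nbhs_right_lt; rewrite ltrDl.
    by lra.
  move=> u v [c tu]; exists u, v; split; last by split; rewrite subrr normr0 ltW.
  split => //; have : t < s by near: s; exact: nbhs_right_gt.
  by lra.
- move=> t /andP[t0 t1].
  (* The left limit at [t] consists of the cords that are limits of cords appearing strictly before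
     [t]. *)
  pose S u v := cord_of g u v /\ forall eps, 0 < eps -> exists a b,
    [/\ cord_of g a b, 1 - t < a & box u v eps a b].
  exists (cord_union S).
    apply: cord_union_lamination.
    + exists 1, 1; split; first exact: cord_of11.
      move=> eps e0; exists 1, 1; split; [exact: cord_of11|lra|].
      by split; rewrite subrr normr0 ltW.
    + by move=> u v [/cord_of01].
    + move=> a b h; split.
        by apply: cord_of_limit_closed => // eps /h[u [v [[c _] bx]]]; exists u, v.
      move=> eps e0; have e2 : 0 < eps / 2 by rewrite divr_gt0.
      have [u [v [[_ h'] bx]]] := h _ e2; have [a' [b' [c' ta bx']]] := h' _ e2.
      exists a', b'; split => //; rewrite (splitr eps); exact: box_trans bx bx'.
    + by apply: noncrossingW (cord_of_noncrossing gg) => u v [].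
  apply: hausdorff_cvg0 => eps e0.
  have [e1 <-] := bd _ e0; set e := eps / _ in e1 *.
  have e2 : 0 < e / 2 by rewrite divr_gt0.
  have [r r0 hr] := thresholds_gap (1 - t) eg e2.
  near=> s; rewrite lamination_ofE; apply: hausdorff_cord_union; first exact: ltW.
    move=> u v [c su]; exists u, v; split; last by split; rewrite subrr normr0 ltW.
    split => // e' e'0; exists u, v; split => //; last by split; rewrite subrr normr0 ltW.
    have : s < t by near: s; exact: nbhs_left_lt.
    by lra.
  move=> u v [c h]; have [a [b [cab ta bx]]] := h _ e2.
  have [_ hr2] := hr a b cab; have [p [v' [xp c' bx']]] := hr2 ta.
  exists p, v'; split; last by rewrite (splitr e); exact: box_trans bx bx'.
  split => //; have : t - r < s by near: s; apply: nbhs_left_gt; rewrite ltrBlDr ltrDl.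
  by lra.
Unshelve. all: by end_near. Qed.

End Processes.

(** * Dyck words and decreasing factorisations *)

Definition swap (a b y : nat) : nat := if y == a then b else if y == b then a else y.

Definition act (l : seq (nat * nat)) (x : nat) : nat := foldl (fun y c => swap c.1 c.2 y) x l.

Lemma act_rcons l c x : act (rcons l c) x = swap c.1 c.2 (act l x).
Proof. by rewrite /act -cats1 foldl_cat. Qed.

Lemma swapK a b : involutive (swap a b).
Proof.
move=> y; rewrite /swap; case: (eqVneq y a) => [ya|ya].
  by rewrite ya; case: eqVneq => // _; rewrite eqxx.
case: (eqVneq y b) => [yb|yb]; first by rewrite eqxx yb.
by rewrite (negbTE ya) (negbTE yb).
Qed.

Lemma subseq_skip (p : seq nat) a b q : subseq (p ++ a :: q) (p ++ [:: a, b & q]) .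
Proof.
apply: cat_subseq => //.
exact: (@cat_subseq _ [:: a] q [:: a] (b :: q) (subseq_refl _) (subseq_cons q b)).
Qed.

(** Deleting [b] from a cycle amounts to splitting off the transposition of the consecutive entries
    [a] and [b]. *)
Lemma next_swap p a b q x : uniq (p ++ [:: a, b & q]) ->
  next (p ++ [:: a, b & q]) x = next (p ++ a :: q) (swap a b x).
Proof.
move=> us.
have us' : uniq (p ++ a :: q).
  exact: subseq_uniq (subseq_skip _ _ _ _) us.
rewrite -(next_rot (size p) us) -(next_rot (size p) us') !rot_size_cat.
have : uniq ([:: a, b & q] ++ p) by rewrite uniq_catC.
move: us us' => _ _; rewrite !cat_cons.
move: (q ++ p) => t; rewrite [uniq _]/= !inE negb_or => /and3P[/andP[ab at_] bt ut].
rewrite !next_nth !inE /swap /= .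
case: (eqVneq x a) => [->|xa].
  by rewrite /= [b == a]eq_sym (negbTE ab) (negbTE bt).
case: (eqVneq x b) => [->|xb].
  by rewrite !eqxx /= nth0.
by rewrite [a == x]eq_sym (negbTE xa) /=.
Qed.

(** * Orbits under a decreasing sequence of transpositions *)

Section Track.
Implicit Types (l : seq (nat * nat)) (s : seq nat).

Definition decreasing l : bool := pairwise geq (map fst l) && all (fun c => c.1 < c.2)%N l.

Lemma act_ge l m y : all (fun c => (m <= c.1) && (c.1 < c.2))%N l -> (m <= act l y)%N -> (m <= y)%N.
Proof.
elim: l y => //= -[a b] l IHl y /= /andP[/andP[ma ab] ml] /(IHl _ ml).
by rewrite /swap; case: eqVneq => [->//|_]; case: eqVneq => [->|//] _; rewrite (leq_trans ma)// ltnW.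
Qed.

(* Followed backwards in time, a label that never is the larger entry of a
   transposition can only move to larger labels. *)
Lemma act_track l x y : decreasing l -> x \notin map snd l -> act l y = x -> (x <= y)%N.
Proof.
elim/last_ind: l x y => [x y _ _|l [a b] IHl x y]; first by rewrite /act /= => ->.
rewrite /decreasing !map_rcons pairwise_rcons all_rcons /= mem_rcons inE negb_or act_rcons /=.
move=> /andP[/andP[la pl] /andP[ab al]] /andP[xb xl].
have dl : decreasing l by rewrite /decreasing pl.
rewrite {1}/swap; case: eqVneq => [_ E|_]; first by rewrite E eqxx in xb.
case: eqVneq => [E <-|_]; last exact: IHl.
apply: (@act_ge l); last by rewrite E ltnW.
apply/allP => c cl; rewrite (allP al c cl) andbT.
by move/allP: la => /(_ c.1); apply; exact: map_f.
Qed.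

(** A label [z] other than the least one is the image of a smaller label, so by [act_track] it must
    be the larger entry of some transposition. There are as many transpositions as such labels. *)
Lemma larger_entries l s : sorted ltn s -> decreasing l -> size l = (size s).-1 ->
  (forall x, act l x = next s x) -> uniq (map snd l).
Proof.
move=> ss dl sl h; have us : uniq s := sorted_uniq ltn_trans ltnn ss.
case: s ss sl h us => [|x0 s] ss sl h us.
  by rewrite (size0nil sl).
apply: (@leq_size_uniq _ s); first by case/andP: us.
  move=> z zs; apply: contraT => zb.
  have iz : (index z s < size s)%N by rewrite index_mem.
  pose y := nth x0 (x0 :: s) (index z s).
  have ys : y \in x0 :: s by rewrite mem_nth//= ltnS ltnW.
  have E : next (x0 :: s) y = z.
    by rewrite next_nth ys /y index_uniq//= ?ltnS ?(ltnW iz)// nth_index.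
  have := act_track dl zb (etrans (h y) E); rewrite leqNgt => /negP[].
  have -> : z = nth x0 (x0 :: s) (index z s).+1 by rewrite /= nth_index.
  by rewrite /y; apply: (sorted_ltn_nth ltn_trans x0 ss); rewrite ?inE//= ltnS// ltnW.
by rewrite size_map sl.
Qed.

(** Once [a] has moved to [b] it stays there: [b] is not a larger entry again, and the later smaller
    entries are at most [a < b]. *)
Lemma first_entry a b l s : sorted ltn s -> decreasing ((a, b) :: l) -> (size l).+1 = (size s).-1 ->
  (forall x, act ((a, b) :: l) x = next s x) -> next s a = b.
Proof.
move=> ss dl sl h; have := larger_entries ss dl sl h; rewrite -h /= => /andP[bl _].
rewrite /act /= /swap eqxx -/(act l b).
case/andP: dl => /= /andP[la _] /andP[ab _].
elim: l b bl la ab {sl h} => //= -[a' b'] l IHl b; rewrite inE negb_or => /andP[bb bl] /andP[a'a la] ab.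
rewrite {1}/swap (negbTE bb) (_ : (b == a') = false); first exact: IHl.
by apply/negbTE; rewrite neq_ltn (leq_ltn_trans a'a ab) orbT.
Qed.

Lemma decreasing_behead c l : decreasing (c :: l) -> decreasing l.
Proof. by rewrite /decreasing /= => /andP[/andP[_ ->] /andP[_ ->]]. Qed.

End Track.

(** * The stack algorithm *)

Section Machine.
Implicit Types (l : seq (nat * nat)) (st : seq nat) (r w : seq bool).

(* [r] is the reversed word, [d] the current label, and [st] the labels met so
   far and not yet absorbed. *)
Fixpoint run (d : nat) st r : seq (nat * nat) :=
  match r with
  | [::] => [::]
  | false :: r => run d.-1 (d :: st) r
  | true :: r => (d, head 0%N st) :: run d (behead st) r
  end.

Fixpoint valid (d k : nat) r : bool :=
  match r with
  | [::] => (d == 0%N) && (k == 0%N)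
  | false :: r => (0 < d)%N && valid d.-1 k.+1 r
  | true :: r => (0 < k)%N && valid d k.-1 r
  end.

Fact labels_key : unit. Proof. by []. Qed.
(** The cycle still to be factored: the labels up to the current one, then the stack. *)
Definition labels (d : nat) st : seq nat := locked_with labels_key (iota 0 d.+1 ++ st).

Lemma labels_iota d st : labels d st = iota 0 d.+1 ++ st.
Proof. by rewrite /labels unlock. Qed.

Lemma labels_pop d st : (0 < d)%N -> labels d st = labels d.-1 (d :: st).
Proof. by case: d => // d _; rewrite !labels_iota -[d.+2]addn1 iotaD -catA. Qed.

Lemma labelsE d st : labels d st = iota 0 d ++ d :: st.
Proof. by rewrite labels_iota -[d.+1]addn1 iotaD -catA. Qed.

Lemma run_act d st r x : uniq (labels d st) -> valid d (size st) r ->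
  act (run d st r) x = next (labels d st) x.
Proof.
elim: r d st x => [|[] r IHr] d st x us /=.
- move=> /andP[/eqP -> /nilP ->]; rewrite labelsE next_nth inE.
  by case: eqVneq => // ->.
- case: st us => [|b st] //= us v; rewrite /act /= -/(act _ _).
  rewrite labelsE in us *; rewrite next_swap// -labelsE IHr// labelsE.
  exact: subseq_uniq (subseq_skip _ _ _ _) us.
- move=> /andP[d0 v]; rewrite (labels_pop _ d0) IHr//.
  by rewrite -(labels_pop _ d0).
Qed.

Lemma run_le d st r c : c \in run d st r -> (c.1 <= d)%N.
Proof.
elim: r d st => [|[] r IHr] d st //=.
  by rewrite inE => /predU1P[->//|/IHr].
by move=> /IHr h; apply: leq_trans h (leq_pred _).
Qed.

Lemma size_run d st r : valid d (size st) r -> size (run d st r) = (d + size st)%N.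
Proof.
elim: r d st => [|[] r IHr] d st /=.
- by move=> /andP[/eqP -> /eqP ->].
- by case: st => //= b st /IHr ->; rewrite addnS.
- by move=> /andP[d0 v]; rewrite IHr//= addnS -addSn prednK.
Qed.

Lemma run_decreasing d st r : sorted ltn (labels d st) -> valid d (size st) r ->
  decreasing (run d st r).
Proof.
elim: r d st => [|[] r IHr] d st //=.
- case: st => //= b st ss v; rewrite labelsE in ss.
  have ss' : sorted ltn (labels d st).
    rewrite labelsE; apply: subseq_sorted ss; first exact: ltn_trans.
    exact: subseq_skip.
  have /andP[p1 p2] := IHr d st ss' v; rewrite /decreasing /= p1 p2 !andbT; apply/andP; split.
    by apply/allP => a /mapP[c cr ->]; exact: run_le cr.
  by move: ss => /cat_sorted2[_] /= /andP[].
- by move=> ss /andP[d0 v]; apply: IHr => //; rewrite -labels_pop.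
Qed.

(** The first transposition has smaller entry [d] exactly when the letter read is an up step; after
    a down step all smaller entries are below [d]. *)
Lemma run_inj d st r r' : valid d (size st) r -> valid d (size st) r' -> run d st r = run d st r' -> r = r'.
Proof.
elim: r d st r' => [|x r IHr] d st [|x' r'] //.
- by move=> /= /andP[/eqP -> /nilP ->]; case: x'.
- by case: x => /= + /andP[/eqP d0 /nilP s0]; rewrite d0 s0.
- case: x; case: x' => /=.
  + case: st => //= b st v v' [] /(IHr _ _ _ v v') -> //.
  + move=> v /andP[d0 v'] E; have := @run_le d.-1 (d :: st) r' (d, head 0%N st).
    by rewrite -E mem_head => /(_ isT) /=; rewrite leqNgt ltn_predL d0.
  + move=> /andP[d0 v] v' E; have := @run_le d.-1 (d :: st) r (d, head 0%N st).
    by rewrite E mem_head => /(_ isT) /=; rewrite leqNgt ltn_predL d0.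
  + by move=> /andP[_ v] /andP[_ v'] /(IHr _ (d :: st) _ v v') ->.
Qed.

(** By [first_entry] the first transposition joins [a] to its successor in the cycle. If [a = d]
    this successor is the top of the stack and the letter is an up step; otherwise no smaller entry
    equals [d], which can be pushed. *)
Lemma run_surj d st l : sorted ltn (labels d st) -> decreasing l -> size l = (d + size st)%N ->
  all (fun c => c.1 <= d)%N l -> (forall x, act l x = next (labels d st) x) ->
  exists r, valid d (size st) r /\ run d st r = l.
Proof.
have [n] := ubnP (d + size l); elim: n d st l => // n IHn d st l.
case: l => [|[a b] l].
  move=> _ _ _ /= /esym/eqP; rewrite addn_eq0 => /andP[/eqP -> s0] _ _.
  by exists [::]; rewrite /= s0.
move=> dn ss dl sl al h.
have ls : size (labels d st) = (d + size st).+1 by rewrite labels_iota size_cat size_iota addSn.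
have nb : next (labels d st) a = b by apply: (first_entry ss dl) => //; rewrite ls.
have /= /andP[ad al'] := al.
have /andP[_ /= /andP[ab _]] := dl.
have us : uniq (labels d st) := sorted_uniq ltn_trans ltnn ss.
have [da|] := eqVneq a d; last first.
  move=> ad'; have d0 : (0 < d)%N by case: d ad ad' {dn ss sl al h ls nb us al'} => //; rewrite leqn0 => ->.
  have lt_ad : (a <= d.-1)%N by rewrite -ltnS prednK// ltn_neqAle ad' ad.
  have [||||||r [vr rr]] := IHn d.-1 (d :: st) ((a, b) :: l).
  - by rewrite -ltnS (leq_trans _ dn)// ltnS -addSn prednK.
  - by rewrite -labels_pop.
  - exact: dl.
  - by rewrite sl /= addnS -addSn prednK.
  - apply/allP => c /=; rewrite inE => /predU1P[->//|cl]; apply: leq_trans lt_ad.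
    by case/andP: dl => /= /andP[/allP la _] _; apply: la; exact: map_f.
  - by move=> x; rewrite -labels_pop.
  by exists (false :: r); rewrite /= d0.
subst a.
case: st ss sl h ls nb us => [|b' st] ss sl h ls nb us.
  move: nb; rewrite labelsE next_nth mem_cat mem_head orbT index_cat mem_iota add0n ltnn size_iota /= eqxx addn0.
  case: d {dn ss sl h ls us dl al ad al'} ab => [|d] db; first by move=> E; rewrite -E ltnn in db.
  rewrite /= nth_default ?size_cat ?size_iota ?addn1// => E.
  by rewrite -E in db.
have bb : b' = b.
  move: nb; rewrite labelsE next_nth mem_cat mem_head orbT index_cat mem_iota add0n ltnn size_iota /= eqxx addn0.
  case: (d) => [|d'] //=; rewrite nth_cat size_iota ltnNge leqnSn /=.
  by rewrite subSnn.
subst b'.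
have [||||||r [vr rr]] := IHn d st l.
- by rewrite -ltnS (leq_trans _ dn)// ltnS addnS.
- rewrite labelsE; rewrite labelsE in ss; apply: subseq_sorted ss; first exact: ltn_trans.
  exact: subseq_skip.
- exact: decreasing_behead dl.
- by move: sl; rewrite /= addnS => -[].
- exact: al'.
- move=> x; have := h (swap d b x); rewrite /act /= swapK -/(act l x) => ->.
  by rewrite labelsE in us *; rewrite next_swap// swapK labelsE.
by exists (true :: r); rewrite /= rr.
Qed.

(** The same algorithm by recursion on the unreversed word: the suffix is processed first and hands
    back the stack and the output. [d] counts the down steps to the left. *)
Fixpoint proc (d : nat) w : seq nat * seq (nat * nat) :=
  match w with
  | [::] => ([::], [::])
  | false :: v => (d.+1 :: (proc d.+1 v).1, (proc d.+1 v).2)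
  | true :: v => (behead (proc d v).1, rcons (proc d v).2 (d, head 0%N (proc d v).1))
  end.

Lemma proc_run d u v :
  (proc d (u ++ v)).2 = (proc (d + count negb u) v).2 ++
     run (d + count negb u) (proc (d + count negb u) v).1 (rev u).
Proof.
elim/last_ind: u v => [|u x IHu] v; first by rewrite addn0 cats0.
rewrite cat_rcons IHu rev_rcons -cats1 count_cat /=; case: x => /=.
  by rewrite !addn0 cat_rcons.
by rewrite addn0 addn1 addnS.
Qed.

Definition first_passage (k : nat) w (q : nat) : Prop :=
  [/\ (q <= size w)%N, height (take q w) = - (k.+1)%:Z &
      forall j, (j < q)%N -> - (k.+1)%:Z < height (take j w)].

(** Read from the top, the stack holds the labels of the successive first passages of the suffix to
    the levels -1, -2 and so on. *)
Lemma proc_stack d v k q : first_passage k v q ->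
  (k < size (proc d v).1)%N /\ nth 0%N (proc d v).1 k = (d + count negb (take q v))%N.
Proof.
elim: v d k q => [|x v IHv] d k q [qv hq hj]; first by rewrite take_oversize// in hq.
case: q qv hq hj => [|q] qv hq hj; first by rewrite take0 in hq.
case: x qv hq hj => /= qv hq hj.
  have [h1 h2] : (k.+1 < size (proc d v).1)%N /\ nth 0%N (proc d v).1 k.+1 = (d + count negb (take q v))%N.
    apply: IHv; split => //; first by move: hq; rewrite /step; lia.
    by move=> j jq; have := hj j.+1 jq; rewrite /= /step; lia.
  by rewrite size_behead nth_behead add0n; split => //; rewrite ltn_predRL.
case: k hq hj => [|k] hq hj.
  split => //; case: q qv hq hj => [|q] qv hq hj; first by rewrite take0 /= addn1.
  by have := hj 1%N isT; rewrite /= take0 /step.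
have [h1 h2] : (k < size (proc d.+1 v).1)%N /\ nth 0%N (proc d.+1 v).1 k = (d.+1 + count negb (take q v))%N.
  apply: IHv; split => //; first by move: hq; rewrite /step; lia.
  by move=> j jq; have := hj j.+1 jq; rewrite /= /step; lia.
by split => //=; rewrite h2 addSn addnS.
Qed.

Lemma size_proc d v : size (proc d v).2 = count id v.
Proof.
elim: v d => [|[] v IHv] d //=; first by rewrite size_rcons IHv.
Qed.

Lemma proc_nth d v p q : (p < size v)%N -> nth false v p -> first_passage 0 (drop p.+1 v) q ->
  nth (0%N, 0%N) (proc d v).2 (count id (drop p.+1 v)) =
  (d + count negb (take p v), d + count negb (take (p.+1 + q) v))%N.
Proof.
elim: v d p => [|x v IHv] d [|p] //=.
  move=> _ xt; rewrite drop0 xt => fp /=; have [h1 h2] := proc_stack d fp.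
  by rewrite nth_rcons size_proc ltnn eqxx addn0 add0n -nth0 h2.
rewrite ltnS => pv np fp; case: x => /=.
  have [pc] : (count id (drop p.+1 v) < count id v)%N.
    rewrite -{2}(cat_take_drop p v) count_cat (drop_nth false pv) /= np.
    by rewrite addnCA add1n ltnS leq_addl.
  by rewrite nth_rcons size_proc pc (IHv _ _ pv np fp) !add0n.
by rewrite (IHv _ _ pv np fp) !add1n !addnS !addSn.
Qed.

Lemma count_drop_surj v i : (i < count id v)%N -> exists p, [/\ (p < size v)%N, nth false v p &
  count id (drop p.+1 v) = i].
Proof.
elim: v => //= x v IHv; rewrite leq_eqVlt => /predU1P[E|iv].
  case: x E => /= [[->]|E]; first by exists 0%N; rewrite drop0.
  have [|p [h1 h2 h3]] := IHv; first by rewrite E.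
  by exists p.+1.
have [|p [h1 h2 h3]] := IHv; last by exists p.+1.
by case: x iv => /=; clear; lia.
Qed.

End Machine.

(** * The bijection between Dyck words and decreasing factorisations *)

Section Factorisations.
Variable N : nat.

Lemma valid_nonneg d k r : valid d k r =
  [&& count negb r == d, nonneg_from k%:Z (map negb r) & k%:Z + height (map negb r) == 0].
Proof.
elim: r d k => [|b r IHr] d k.
  by rewrite nonneg_from_nil addr0 [count _ _ == d]eq_sym /=; case: k.
rewrite [map _ _]/= nonneg_from_cons [height _]/= [count _ _]/= addrA; case: b => /=.
  case: k => [|k]; rewrite ?IHr.
    by rewrite [in RHS](_ : nonneg_from _ _ = false) ?andbF//; apply/negbTE/negP => /nonneg_from_ge0.
  have -> : k.+1%:Z + step false = k%:Z by rewrite /step; lia.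
  by rewrite add0n.
case: d => [|d]; first by [].
have -> : k%:Z + step true = k.+1%:Z by rewrite /step; lia.
by rewrite IHr.
Qed.

Lemma height_negb w : height (map negb w) = - height w.
Proof.
by elim: w => //= b w ->; rewrite opprD; congr (_ + _); case: b.
Qed.

Lemma height_rev w : height (rev w) = height w.
Proof. by rewrite !heightE !count_rev. Qed.

Lemma count_dyck w n : height w = 0 -> size w = n.*2 -> count negb w = n /\ count id w = n.
Proof.
rewrite heightE => h sw; have := count_predC id w; rewrite sw -[count (predC id) w]/(count negb w).
by lia.
Qed.

Lemma dyck_valid w : size w = N.*2 -> dyck w = valid N 0 (rev w).
Proof.
move=> sw; rewrite valid_nonneg /dyck add0r height_negb height_rev oppr_eq0.
have cr : count negb (rev w) = count negb w by rewrite count_rev.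
case: eqP => [h0|]; last by rewrite !andbF.
have [c0 _] := count_dyck h0 sw; rewrite cr c0 eqxx !andbT /=.
have E j : height (take j (map negb (rev w))) = height (take (size w - j) w).
  rewrite -map_take height_negb take_rev height_rev; apply/eqP.
  have := height_cat (take (size w - j) w) (drop (size w - j) w).
  by rewrite cat_take_drop h0; lia.
apply/nonneg_fromP/nonneg_fromP => h j; rewrite add0r.
  by rewrite E; have := h (size w - j)%N; rewrite add0r.
have [jw|jw] := leqP j (size w); last by rewrite take_oversize ?h0// ltnW.
by have := h (size w - j)%N; rewrite add0r E subKn.
Qed.

Definition transpositions w : seq (nat * nat) := run N [::] (rev w).

Lemma transpositions_proc w : size w = N.*2 -> dyck w -> transpositions w = (proc 0 w).2.
Proof.
move=> sw /andP[_ /eqP h0]; have [c0 _] := count_dyck h0 sw.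
by have := proc_run 0 w [::]; rewrite cats0 add0n c0 => ->.
Qed.

Definition nat_pairs n (tau : seq ('I_n * 'I_n)) : seq (nat * nat) :=
  [seq (nat_of_ord c.1, nat_of_ord c.2) | c <- tau].

Lemma prod_tperm_act n (tau : seq ('I_n * 'I_n)) (i : 'I_n) :
  (\prod_(c <- tau) tperm c.1 c.2)%g i = act (nat_pairs tau) i :> nat.
Proof.
elim: tau i => [|[a b] tau IH] i; first by rewrite big_nil perm1.
rewrite big_cons permM IH /=; congr (act _ _).
rewrite /swap; case: tpermP => [->|->|/eqP ia /eqP ib] /=; rewrite ?eqxx//.
  by case: eqVneq => // /val_inj ->.
by rewrite -!val_eqE in ia ib; rewrite (negbTE ia) (negbTE ib).
Qed.

Lemma next_iota n i : (i < n)%N -> next (iota 0 n) i = (i.+1 %% n)%N.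
Proof.
move=> iN; rewrite next_nth mem_iota /= add0n iN.
case: n iN => // n iN /=; case: i iN => [|i] iN /=.
  by case: n {iN} => [|n]; rewrite ?modnn//= modn_small.
have -> : index i.+1 (iota 1 n) = i.
  have {1}-> : i.+1 = nth 0%N (iota 1 n) i by rewrite nth_iota.
  by rewrite index_uniq ?iota_uniq ?size_iota.
have [E|ne] := eqVneq i.+1 n.
  by rewrite nth_default ?size_iota ?E// modnn.
have lt : (i.+1 < n)%N by rewrite ltn_neqAle ne -ltnS.
by rewrite nth_iota// modn_small.
Qed.

Lemma act_fixed n (l : seq (nat * nat)) x : all (fun c => (c.1 < n) && (c.2 < n))%N l -> (n <= x)%N -> act l x = x.
Proof.
move=> + nx; elim: l => //= -[a b] l IHl /= /andP[/andP[an bn] al].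
rewrite /swap !gtn_eqF ?IHl//; exact: leq_trans nx.
Qed.

Lemma minimalE (tau : (N.+1.-1).-tuple ('I_N.+1 * 'I_N.+1)) :
  decreasing_factorisation tau <->
  decreasing (nat_pairs tau) /\ forall x, act (nat_pairs tau) x = next (labels N [::]) x.
Proof.
have lt : all (fun c => (c.1 < N.+1) && (c.2 < N.+1))%N (nat_pairs tau).
  by apply/allP => c /mapP[[a b] _ ->] /=; rewrite !ltn_ord.
have pw : pairwise geq [seq c.1 | c <- nat_pairs tau] = sorted geq [seq nat_of_ord c.1 | c <- tau].
  by rewrite sorted_pairwise -?map_comp// => x y z /= h1 h2; exact: leq_trans h2 h1.
have al : all (fun c => c.1 < c.2)%N (nat_pairs tau) = all (fun c : 'I_N.+1 * 'I_N.+1 => (c.1 < c.2)%N) tau.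
  by rewrite all_map.
rewrite /decreasing_factorisation /minimal_factorisation /decreasing pw al labels_iota cats0.
split.
  move=> /andP[/andP[-> /eqP h] ->]; split => // x.
  have [xN|xN] := leqP x N; last by rewrite (act_fixed lt xN) next_nth mem_iota /= add0n ltnNge xN.
  have := congr1 (fun s : {perm 'I_N.+1} => nat_of_ord (s (Ordinal (xN : (x < N.+1)%N)))) h.
  rewrite prod_tperm_act permE => E.
  by rewrite -[LHS]/(act (nat_pairs tau) (Ordinal (xN : (x < N.+1)%N))) E next_iota.
move=> [/andP[-> ->] h]; rewrite andbT /=; apply/eqP/permP => i; apply: val_inj.
have E := prod_tperm_act tau i; rewrite h next_iota// in E.
by apply: (etrans E); rewrite permE.
Qed.

Definition factorisation_of w : (N.+1.-1).-tuple ('I_N.+1 * 'I_N.+1) :=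
  [tuple (inord (nth (0, 0)%N (transpositions w) i).1, inord (nth (0, 0)%N (transpositions w) i).2) | i < N.+1.-1].

Lemma sorted_labels : sorted ltn (labels N [::]).
Proof. by rewrite labels_iota cats0 iota_ltn_sorted. Qed.

Section Word.
Variable w : seq bool.
Hypotheses (sw : size w = N.*2) (dw : dyck w).

Lemma size_transpositions : size (transpositions w) = N.
Proof. by rewrite size_run ?addn0// -dyck_valid. Qed.

Lemma transpositions_decreasing : decreasing (transpositions w).
Proof. by apply: run_decreasing; [exact: sorted_labels|rewrite -dyck_valid]. Qed.

Lemma transpositions_act x : act (transpositions w) x = next (labels N [::]) x.
Proof.
apply: run_act; last by rewrite -dyck_valid.
exact: (sorted_uniq ltn_trans ltnn sorted_labels).
Qed.

(** Every label from 1 to [N] is the larger entry of one of the [N] transpositions, by [act_track];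
    this leaves no room for a label above [N]. *)
Lemma transpositions_lt c : c \in transpositions w -> (c.1 < N.+1)%N /\ (c.2 < N.+1)%N.
Proof.
move=> cw; split; first by rewrite ltnS; exact: run_le cw.
have /andP[_ /allP al] := transpositions_decreasing.
rewrite ltnNge; apply/negP => h.
have sb : {subset c.2 :: behead (labels N [::]) <= map snd (transpositions w)}.
  move=> z; rewrite inE => /predU1P[->|]; first exact: map_f.
  rewrite labels_iota cats0 /= mem_iota add1n => /andP[z0 zN]; apply: contraT => zb.
  have := @act_track _ z z.-1 transpositions_decreasing zb.
  rewrite transpositions_act labels_iota cats0 next_iota; last by rewrite prednK// ltnW.
  rewrite prednK// modn_small// => /(_ erefl); rewrite leqNgt ltn_predL z0.
  by [].
have usb : uniq (c.2 :: behead (labels N [::])).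
  rewrite labels_iota cats0 /= iota_uniq andbT mem_iota add1n ltnS.
  by apply/negP => /andP[_]; rewrite leqNgt h.
have := uniq_leq_size usb sb; rewrite size_map size_transpositions /= size_behead labels_iota cats0 size_iota /=.
by rewrite ltnn.
Qed.

Lemma nat_pairs_factorisation : nat_pairs (factorisation_of w) = transpositions w.
Proof.
apply: (@eq_from_nth _ (0, 0)%N); rewrite size_map size_tuple ?size_transpositions// => i iN.
rewrite (nth_map (ord0, ord0)) ?size_tuple// -[X in nth _ _ X]/(nat_of_ord (Ordinal (iN : (i < N.+1.-1)%N))) nth_mktuple /=.
have /transpositions_lt[h1 h2] : nth (0, 0)%N (transpositions w) i \in transpositions w.
  by rewrite mem_nth// size_transpositions.
by rewrite !inordK//; case: (nth _ _ _).
Qed.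

Lemma factorisation_of_decreasing : decreasing_factorisation (factorisation_of w).
Proof.
apply/minimalE; rewrite nat_pairs_factorisation.
by split; [exact: transpositions_decreasing|exact: transpositions_act].
Qed.

End Word.

Lemma factorisation_of_inj w w' : size w = N.*2 -> size w' = N.*2 -> dyck w -> dyck w' ->
  factorisation_of w = factorisation_of w' -> w = w'.
Proof.
move=> sw sw' dw dw' E.
have : transpositions w = transpositions w' by rewrite -!nat_pairs_factorisation// E.
move/run_inj; rewrite -!dyck_valid// => /(_ dw dw') h.
by rewrite -(revK w) h revK.
Qed.

Lemma factorisation_of_surj tau : decreasing_factorisation tau ->
  exists w, [/\ size w = N.*2, dyck w & factorisation_of w = tau].
Proof.
move/minimalE => [dl h].
have [||r [vr rr]] := run_surj sorted_labels dl _ _ h.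
- by rewrite size_map size_tuple addn0.
- by apply/allP => c /mapP[x _ ->] /=; rewrite -ltnS.
have sr : size (rev r) = N.*2.
  move: (vr); rewrite valid_nonneg => /and3P[/eqP cr _]; rewrite add0r height_negb oppr_eq0 => /eqP h0.
  move: h0; rewrite heightE cr size_rev -(count_predC id) -[count (predC id) r]/(count negb r) cr; lia.
have dr : dyck (rev r) by rewrite dyck_valid// revK.
exists (rev r); split => //; apply/val_inj.
have inj : injective (fun c : 'I_N.+1 * 'I_N.+1 => (nat_of_ord c.1, nat_of_ord c.2)).
  by move=> [a b] [a' b'] [/val_inj -> /val_inj ->].
apply: (inj_map inj); rewrite -/(nat_pairs _) nat_pairs_factorisation//.
by rewrite /transpositions revK rr.
Qed.

Lemma dyck_average (R : realType) (F : (N.+1.-1).-tuple ('I_N.+1 * 'I_N.+1) -> R) :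
  (\sum_(tau | decreasing_factorisation tau) F tau) / #|@decreasing_factorisation N.+1|%:R =
  dyck_mean N (fun w => F (factorisation_of w)) / mean N.*2 (fun w => (dyck w)%:R).
Proof.
pose s := [seq factorisation_of w | w <- words N.*2 & dyck w].
have us : uniq s.
  rewrite map_inj_in_uniq ?filter_uniq ?uniq_words// => w w'.
  rewrite !mem_filter !size_words => /andP[dw /eqP sw] /andP[dw' /eqP sw'].
  exact: factorisation_of_inj.
have ps : perm_eq s (enum (@decreasing_factorisation N.+1)).
  apply: uniq_perm => //; first exact: enum_uniq.
  move=> tau; rewrite mem_enum; apply/mapP/idP.
    move=> [w]; rewrite mem_filter size_words => /andP[dw /eqP sw] ->.
    exact: factorisation_of_decreasing.
  move=> /factorisation_of_surj[w [sw dw <-]]; exists w => //.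
  by rewrite mem_filter size_words sw eqxx dw.
have S (G : (N.+1.-1).-tuple ('I_N.+1 * 'I_N.+1) -> R) :
    \sum_(tau | decreasing_factorisation tau) G tau =
    \sum_(w <- words N.*2) (dyck w)%:R * G (factorisation_of w).
  rewrite -big_enum /= -(perm_big _ ps) big_map big_filter big_mkcond.
  by apply: eq_bigr => w _; case: (dyck w); rewrite ?mul1r ?mul0r.
have C : #|@decreasing_factorisation N.+1|%:R = \sum_(w <- words N.*2) (dyck w)%:R :> R.
  rewrite -sum1_card natr_sum S; apply: eq_bigr => w _.
  by rewrite mulr1.
have p0 : 2 ^+ N.*2 != 0 :> R by rewrite expf_neq0// pnatr_eq0.
by rewrite S C /dyck_mean /mean invfM invrK mulrACA mulVf// mulr1.
Qed.

End Factorisations.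

(** * The cords of a Dyck word *)

Lemma last_level w (k P : nat) : k%:Z < height (take P w) ->
  exists p, [/\ (p < P)%N, height (take p w) = k%:Z, nth false w p &
    forall j, (p < j <= P)%N -> k%:Z < height (take j w)].
Proof.
elim: P => [|P IHP]; first by rewrite take0.
move=> kP; have [h|h] := ltP k%:Z (height (take P w)).
  have [p [pP hp np hj]] := IHP h; exists p; split => //; first exact: ltnW.
  move=> j /andP[pj]; rewrite leq_eqVlt => /predU1P[->//|]; rewrite ltnS => jP.
  by apply: hj; rewrite pj.
have [PW|PW] := ltnP P (size w); last by move: kP; rewrite take_oversize ?(leq_trans PW)// -(take_oversize PW) ltNge h.
move: kP; rewrite (take_nth false PW) -cats1 height_cat /= addr0 => kP.
have np : nth false w P by move: kP; rewrite /step; case: (nth false w P) => //; lia.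
rewrite np /step in kP.
exists P; split => //; first by lia.
move=> j /andP[Pj jP]; have -> : j = P.+1 by apply/eqP; rewrite eqn_leq jP.
by rewrite (take_nth false PW) -cats1 height_cat /= np /step addr0.
Qed.

Lemma first_passage_exists v : height v < 0 -> exists q, first_passage 0 v q.
Proof.
move=> hv.
have ex : exists j, height (take j v) < 0 by exists (size v); rewrite take_size.
case: (ex_minnP ex) => q hq qmin; exists q.
have qv : (q <= size v)%N by apply: qmin; rewrite take_size.
have lo j : (j < q)%N -> 0 <= height (take j v).
  by move=> jq; rewrite leNgt; apply/negP => /qmin; rewrite leqNgt jq.
split => //.
case: q hq qv lo {qmin} => [|q] hq qv lo; first by rewrite take0 in hq.
have := lo q (ltnSn q); move: hq; rewrite (take_nth false qv) -cats1 height_cat /= addr0 /step.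
by case: (nth false v q); lia.
Qed.

Lemma height_nseq b n : height (nseq n b) = step b * n%:Z.
Proof. by elim: n => [|n IHn]; rewrite ?mulr0//= IHn; lia. Qed.

Lemma sorted_implb v : sorted implb v -> exists2 i, (i <= size v)%N & v = nseq i false ++ nseq (size v - i) true.
Proof.
elim: v => [|x v IHv] /= pv; first by exists 0%N.
case: x pv => pv.
  exists 0%N => //=; congr (_ :: _); apply/all_pred1P.
  have tr : transitive implb by move=> y x z; case: x; case: y; case: z.
  by apply: sub_all (order_path_min tr pv) => y /=; case: y.
have [i iv vE] := IHv (path_sorted pv).
by exists i.+1 => //=; rewrite subSS {1}vE.
Qed.

(** A word without a peak is a run of down steps followed by a run of up steps, and each run is at
    most as long as the oscillation [b]. *)
Lemma peak_exists v (b : nat) : (b.*2 < size v)%N ->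
  (forall i j, (i <= j <= size v)%N -> `|height (take j v) - height (take i v)| <= b%:Z) ->
  exists p, [/\ (p.+1 < size v)%N, nth false v p & ~~ nth false v p.+1].
Proof.
move=> bv hb; case: (boolP (sorted implb v)) => [|ns].
  move=> /sorted_implb[i iv vE]; exfalso.
  have h1 := hb 0%N i; have h2 := hb i (size v); rewrite take_size take0 in h1 h2.
  have ti : take i v = nseq i false by rewrite vE take_size_cat// size_nseq.
  have hv : height v = height (nseq i false) + height (nseq (size v - i) true) by rewrite {1}vE height_cat.
  rewrite ti !height_nseq /step in h1 h2 hv; rewrite hv in h2.
  have {}h1 := h1 iv; have {}h2 := h2 ltac:(by rewrite iv leqnn).
  rewrite -[height [::]]/(0 : int) in h1.
  by move: h1 h2 bv iv; clear; rewrite -muln2; lia.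
apply: contrapT => hn; case/negP: ns; apply/(sortedP false) => i iv.
apply/implyP => vi; apply: contraT => nvi; case: hn; exists i; split => //.
Qed.

(** * Positions, times and heights of the cords of one word *)

Section WordCords.
Variables (R : realType) (N : nat) (w : seq bool).
Implicit Types (u v s x y eps : R).
Hypotheses (N0 : (0 < N)%N) (sw : size w = N.*2) (dw : dyck w).

Definition label_pos (j : nat) : R := (count negb (take j w)).+1%:R / N.+1%:R.

(** The cord of an up step appears when its transposition is applied, at its rank divided by
    [N + 1]. The second alternative is the point from which the process starts, as the last clause
    of [adapted] requires. *)
Definition word_cords u v s : Prop :=
  (exists p q, [/\ (p < N.*2)%N, nth false w p, first_passage 0 (drop p.+1 w) q &
     [/\ u = label_pos p, v = label_pos (p.+1 + q) & s = (count id (drop p.+1 w)).+1%:R / N.+1%:R]]) \/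
  [/\ u = 1, v = 1 & s = 0].

Let H (j : nat) : int := height (take j w).

Lemma take_counts j : (j <= N.*2)%N ->
  (count negb (take j w))%:Z *+ 2 = j%:Z - H j /\ (count id (take j w))%:Z *+ 2 = j%:Z + H j.
Proof.
move=> jN; rewrite /H heightE; have := count_predC id (take j w).
rewrite -[count (predC id) _]/(count negb (take j w)) size_takel ?sw//.
by rewrite !mulr2n; lia.
Qed.

Lemma word_height_ge0 j : 0 <= H j.
Proof. by have /andP[/nonneg_fromP h _] := dw; have := h j; rewrite add0r. Qed.

Lemma count_word : count negb w = N /\ count id w = N.
Proof. by have /andP[_ /eqP h] := dw; exact: count_dyck h sw. Qed.

Lemma label_pos01 j : 0 <= label_pos j <= 1.
Proof.
rewrite divr_ge0//= ler_pdivrMr// mul1r ler_nat ltnS; have [c _] := count_word.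
by rewrite -[leqRHS]c -{2}(cat_take_drop j w) count_cat leq_addr.
Qed.

Lemma label_pos_le i j : (i <= j)%N -> label_pos i <= label_pos j.
Proof.
move=> ij; rewrite ler_pM2r ?invr_gt0// ler_nat ltnS -(subnKC ij) takeD count_cat leq_addr//.
Qed.

Lemma passage_height p q : (p < N.*2)%N -> nth false w p -> first_passage 0 (drop p.+1 w) q ->
  [/\ (p.+1 + q <= N.*2)%N, H (p.+1 + q) = H p & forall j, (p <= j <= p.+1 + q)%N -> H p <= H j].
Proof.
move=> pN np [qs hq hj].
have HS : H p.+1 = H p + 1.
  by rewrite /H (take_nth false) ?sw// -cats1 height_cat /= np addr0.
have HD j : H (p.+1 + j) = H p + 1 + height (take j (drop p.+1 w)).
  by rewrite /H takeD height_cat -/(H p.+1) HS.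
split.
- by move: qs; rewrite size_drop sw; move: pN; clear; lia.
- by rewrite HD hq; lia.
- move=> j /andP[pj jq]; move: pj; rewrite leq_eqVlt => /predU1P[->//|pj].
  rewrite -(subnKC pj) HD.
  have : (j - p.+1 <= q)%N by rewrite leq_subLR.
  rewrite leq_eqVlt => /predU1P[->|/hj]; first by rewrite hq; lia.
  by move: (height _) => z; lia.
Qed.

Variables (s0 : R) (B eps : R).
Hypotheses (s00 : 0 < s0) (s0E : s0 ^+ 2 = N.*2%:R) (s01 : 1 <= s0).
Hypotheses (eps0 : 0 < eps) (B0 : 0 <= B) (hB : forall j, (H j)%:~R <= B * s0).
(** The bound on the heights enters through [4 * B]; the constant 17 leaves room for rounding. *)
Hypothesis (large : (4 * B + 17) <= eps * s0).

Let N2 : N.*2%:R = 2 * N%:R :> R. Proof. by rewrite -mul2n natrM. Qed.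

(** The number of down steps among [j] letters is [(j - H j) / 2], and heights are of the order of
    the square root of [N]. *)
Lemma label_pos_close j : (j <= N.*2)%N -> `|label_pos j - j%:R / N.*2%:R| <= eps.
Proof.
move=> jN; have [c2 _] := take_counts jN.
have h0 : 0 <= (H j)%:~R :> R by rewrite ler0z word_height_ge0.
have cR : 2 * (count negb (take j w))%:R = j%:R - (H j)%:~R :> R.
  by move/eqP: c2; rewrite -(eqr_int R) mulr2n intrB intrD -!pmulrn => /eqP <-; ring.
have n0 : 0 < N%:R :> R by rewrite ltr0n.
have jR : j%:R <= 2 * N%:R :> R by rewrite -N2 ler_nat.
have n1 : 0 < N.+1%:R :> R by [].
have nE : N.+1%:R = N%:R + 1 :> R by rewrite natr1.
have -> : label_pos j - j%:R / N.*2%:R = (2 * N%:R - j%:R - (H j)%:~R * N%:R) / (N.*2%:R * N.+1%:R).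
  rewrite /label_pos -[(count _ _).+1%:R]natr1.
  have -> : (count negb (take j w))%:R = (j%:R - (H j)%:~R) / 2 :> R by rewrite -cR; field.
  by rewrite N2 nE; field; rewrite !lt0r_neq0//; rlra.
have M0 : 0 < N.*2%:R * N.+1%:R :> R by rewrite mulr_gt0// N2 mulr_gt0.
rewrite normrM [X in _ * X]gtr0_norm ?invr_gt0// ler_pdivrMr//.
apply: (@le_trans _ _ (N.*2%:R * (B * s0 + 1))).
  have hBj := hB j; have j0 : 0 <= j%:R :> R by [].
  have : (H j)%:~R * N%:R <= B * s0 * N%:R by rewrite ler_wpM2r// ltW.
  have : 0 <= (H j)%:~R * N%:R :> R by rewrite mulr_ge0// ltW.
  have : 0 <= B * s0 * N%:R by rewrite !mulr_ge0// ltW.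
  rewrite N2 ler_norml => *; apply/andP; split; rlra.
rewrite mulrCA ler_pM2l ?N2 ?mulr_gt0//.
have : eps * s0 * s0 <= eps * (2 * N.+1%:R).
  by rewrite -mulrA ler_pM2l// -expr2 s0E N2 ler_pM2l// ler_nat.
have : (4 * B + 17) * s0 <= eps * s0 * s0 by rewrite ler_pM2r.
have : 0 <= B * s0 by rewrite mulr_ge0// ltW.
by move: s01; rlra.
Qed.

(** Time counts up steps from [p] on and position counts down steps before [p]; the difference is
    exactly [H p / (N + 1)]. *)
Lemma label_time_close p : (p < N.*2)%N -> nth false w p ->
  `|(count id (drop p.+1 w)).+1%:R / N.+1%:R - (1 - label_pos p)| <= eps.
Proof.
move=> pN np; have [c1 c2] := take_counts (ltnW pN); have [cn ci] := count_word.
have E : ((count id (drop p.+1 w)).+1 + count id (take p w))%N = N.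
  have pw : (p < size w)%N by rewrite sw.
  by rewrite -[RHS]ci -[in RHS](cat_take_drop p w) count_cat (drop_nth false pw) /= np addnC.
have h0 : 0 <= (H p)%:~R :> R by rewrite ler0z word_height_ge0.
have ER : (count id (drop p.+1 w)).+1%:R = N%:R - (count id (take p w))%:R :> R.
  by rewrite -[in RHS]E natrD addrK.
have cR : (count id (take p w))%:R = (count negb (take p w))%:R + (H p)%:~R :> R.
  have : (count id (take p w))%:Z = (count negb (take p w))%:Z + H p by move: c1 c2; rewrite !mulr2n; lia.
  by move/eqP; rewrite -(eqr_int R) intrD -!pmulrn => /eqP.
have n1 : 0 < N.+1%:R :> R by [].
have -> : (count id (drop p.+1 w)).+1%:R / N.+1%:R - (1 - label_pos p) = - (H p)%:~R / N.+1%:R :> R.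
  rewrite ER cR /label_pos -[(count negb _).+1%:R]natr1 -[N.+1%:R]natr1; field.
  by rewrite natr1 lt0r_neq0.
rewrite mulNr normrN ger0_norm ?divr_ge0// ler_pdivrMr//.
apply: le_trans (hB p) _.
have : eps * s0 * s0 <= eps * (2 * N.+1%:R).
  by rewrite -mulrA ler_pM2l// -expr2 s0E N2 ler_pM2l// ler_nat.
have : (4 * B + 17) * s0 <= eps * s0 * s0 by rewrite ler_pM2r.
have : 0 <= B * s0 by rewrite mulr_ge0// ltW.
by move: s01; rlra.
Qed.

Lemma wpath_grid j : (j <= N.*2)%N -> wpath w (j%:R / N.*2%:R) = (H j)%:~R / s0 :> R.
Proof.
move=> jN; have n0 : N.*2%:R != 0 :> R by rewrite pnatr_eq0 double_eq0 -lt0n.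
have E : N.*2%:R * (j%:R / N.*2%:R) = j%:R :> R by rewrite mulrC divfK.
by rewrite /wpath sw E natrK -s0E sqrtr_sqr gtr0_norm.
Qed.

Variables (g : R -> R) (kap : R).
Hypothesis gclose : forall x y, 0 <= x <= 1 -> 0 <= y <= 1 -> `|x - y| <= eps -> `|g x - g y| <= kap.
Hypothesis gw : sup_close g (wpath w) kap.

Let grid01 j : (j <= N.*2)%N -> 0 <= (j%:R / N.*2%:R : R) <= 1.
Proof. by move=> jN; rewrite divr_ge0//= ler_pdivrMr ?ltr0n ?double_gt0// mul1r ler_nat. Qed.

Lemma near_height x j : (j <= N.*2)%N -> 0 <= x <= 1 -> `|x - j%:R / N.*2%:R| <= eps ->
  `|g x - (H j)%:~R / s0| <= kap + kap.
Proof.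
move=> jN x01 xj; have j01 := grid01 jN.
have -> : g x - (H j)%:~R / s0 = (g x - g (j%:R / N.*2%:R)) + (g (j%:R / N.*2%:R) - (H j)%:~R / s0) by ring.
rewrite (le_trans (ler_normD _ _))// lerD//; first exact: gclose.
by rewrite -wpath_grid//; exact: gw.
Qed.

Lemma near_height_pos j : (j <= N.*2)%N -> `|g (label_pos j) - (H j)%:~R / s0| <= kap + kap.
Proof. by move=> jN; apply: near_height; rewrite ?label_pos01// label_pos_close. Qed.

Lemma word_cord_near p q : (p < N.*2)%N -> nth false w p -> first_passage 0 (drop p.+1 w) q ->
  near_cord g (4 * kap) (label_pos p) (label_pos (p.+1 + q)).
Proof.
move=> pN np fp; have [qN hq hj] := passage_height pN np fp.
have pq : (p <= p.+1 + q)%N by rewrite addSn ltnW// ltnS leq_addr.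
have hp := near_height_pos (ltnW pN); have hq' := near_height_pos qN; rewrite hq in hq'.
have /andP[p0 _] := label_pos01 p; have /andP[_ q1] := label_pos01 (p.+1 + q).
split => //; first exact: label_pos_le.
  by move: hp hq'; rewrite !ler_norml => /andP[? ?] /andP[? ?]; apply/andP; split; rlra.
move=> x /andP[px xq].
have x01 : 0 <= x <= 1 by apply/andP; split; rlra.
have [j [jp jq xj]] : exists j, [/\ (p <= j)%N, (j <= p.+1 + q)%N & `|x - j%:R / N.*2%:R| <= eps].
  have n0 : 0 < N.*2%:R :> R by rewrite ltr0n double_gt0.
  have /andP[x0 x1] := x01.
  have nx0 : 0 <= N.*2%:R * x by rewrite mulr_ge0// ltW.
  have /andP[a1 a2] := truncn_itv nx0; set a := Num.truncn _ in a1 a2.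
  have ax : a%:R / N.*2%:R <= x by rewrite ler_pdivrMr// mulrC.
  have xa : x <= a.+1%:R / N.*2%:R by rewrite ler_pdivlMr// mulrC ltW.
  have cp := label_pos_close (ltnW pN); have cq := label_pos_close qN.
  move: cp cq; rewrite !ler_norml => /andP[? ?] /andP[? ?].
  have [ap|pa] := ltnP a p.
    exists p; split => //; rewrite ler_norml; apply/andP; split; first by rlra.
    have : a.+1%:R / N.*2%:R <= p%:R / N.*2%:R :> R by rewrite ler_pM2r ?invr_gt0// ler_nat.
    by rlra.
  have [aq|qa] := leqP a (p.+1 + q).
    exists a; split => //; rewrite ler_norml; apply/andP; split; first by rlra.
    have : a.+1%:R / N.*2%:R <= a%:R / N.*2%:R + eps :> R.
      rewrite -natr1 mulrDl lerD2l mul1r -(ler_pM2r n0) mulVf ?lt0r_neq0// -s0E expr2 mulrA.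
      have : 1 * s0 <= eps * s0 * s0 by rewrite ler_pM2r//; move: large B0; rlra.
      by move: s01; rlra.
    by move: xa; rlra.
  exists (p.+1 + q)%N; split => //; rewrite ler_norml; apply/andP; split; last by rlra.
  have : (p.+1 + q)%:R / N.*2%:R <= a%:R / N.*2%:R :> R by rewrite ler_pM2r ?invr_gt0// ler_nat ltnW.
  by move: ax => *; rlra.
have := near_height (leq_trans jq qN) x01 xj.
have : (H p)%:~R / s0 <= (H j)%:~R / s0 by rewrite ler_pM2r ?invr_gt0// ler_int hj// jp.
by move: hp; rewrite !ler_norml => /andP[? ?] ? /andP[? ?]; rlra.
Qed.

End WordCords.

(** * The cords of a Dyck word close to a path form an adapted family *)

Section WordAdapted.
Variable R : realType.

Lemma word_cords_adapted (g : R -> R) (delta : R) : excursion g -> 0 < delta ->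
  exists2 d0 : R, 0 < d0 & exists N0 : nat, forall N w, (N0 <= N)%N -> size w = N.*2 -> dyck w ->
    sup_close g (wpath w) d0 -> adapted g delta (@word_cords R N w).
Proof.
move=> eg delta0; have [cg g0 g1 gp] := eg.
pose kap : R := Num.min 1 (delta / 8).
have kap0 : 0 < kap by rewrite lt_min ltr01 divr_gt0.
have kd : kap <= delta / 8 by rewrite ge_min lexx orbT.
have k1 : kap <= 1 by rewrite ge_min lexx.
have [mo mo0 hmo] := cont01_unif cg kap0.
have [B' hB'] := cont01_bounded cg.
pose B : R := `|B'| + 1; have B0 : 0 <= B by rewrite addr_ge0.
pose eps : R := Num.min mo (Num.min 1 (delta / 8)).
have eps0 : 0 < eps by rewrite !lt_min mo0 ltr01 divr_gt0.
have ed : eps <= delta / 8 by rewrite /eps !ge_min lexx !orbT.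
have eps1 : eps <= 1 by rewrite /eps !ge_min lexx !orbT.
have em : eps <= mo by rewrite ge_min lexx.
have [N1 hN1] := large_sqrt (Num.max 1 (Num.max ((4 * B + 17) / eps) (8 / delta))).
exists kap => //; exists (maxn 1 N1) => N w; rewrite geq_max => /andP[N0 N1N] sw dw gw.
have NN : (N <= N.*2)%N by rewrite -addnn leq_addr.
pose s0 : R := Num.sqrt N.*2%:R.
have := hN1 _ (leq_trans N1N NN); rewrite -/s0.
rewrite !ge_max => /and3P[s01 sB sd].
have s00 : 0 < s0 by apply: lt_le_trans s01.
have s0E : s0 ^+ 2 = N.*2%:R by rewrite sqr_sqrtr.
have large : 4 * B + 17 <= eps * s0 by rewrite [eps * s0]mulrC -ler_pdivrMr.
have n0 : 0 < N.*2%:R :> R by rewrite ltr0n double_gt0.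
have x01 j : (j <= N.*2)%N -> 0 <= (j%:R / N.*2%:R : R) <= 1.
  by move=> jN; rewrite divr_ge0//= ler_pdivrMr// mul1r ler_nat.
have hB j : (height (take j w))%:~R <= B * s0.
  have main i : (i <= N.*2)%N -> (height (take i w))%:~R <= B * s0.
    move=> iN; rewrite -ler_pdivrMr//; rewrite -(wpath_grid N0 sw s00 s0E iN).
    have := gw _ (x01 i iN); have := hB' _ (x01 i iN).
    have := ler_norm (g (i%:R / N.*2%:R)); have := ler_norm B'.
    by rewrite /B [`|_ - _|]distrC => h1 h2 h3 /(le_trans (ler_norm _)) h4; rlra.
  have [jN|jN] := leqP j N.*2; first exact: main.
  by rewrite take_oversize ?sw ?(ltnW jN)// -(take_size w) sw main.
have gclose : forall x y : R, 0 <= x <= 1 -> 0 <= y <= 1 -> `|x - y| <= eps -> `|g x - g y| <= kap.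
  by move=> x y x' y' xy; apply: hmo => //; exact: le_trans em.
clearbody kap eps s0 B; clear mo mo0 hmo em B' hB' hN1 N1 N1N NN cg g0 g1 gp.
have LC j := @label_pos_close R N w N0 sw dw s0 B eps s00 s0E s01 eps0 B0 hB large j.
have TC p := @label_time_close R N w N0 sw dw s0 B eps s00 s0E s01 eps0 B0 hB large p.
have NH x j := @near_height R N w N0 sw s0 eps s00 s0E g kap gclose gw x j.
have NP j := @near_height_pos R N w N0 sw dw s0 B eps s00 s0E s01 eps0 B0 hB large g kap gclose gw j.
have WN p q := @word_cord_near R N w N0 sw dw s0 B eps s00 s0E s01 eps0 B0 hB large g kap gclose gw p q.
have PH p q := @passage_height N w N0 sw dw p q.
have hp0 j : 0 <= height (take j w) by exact: word_height_ge0.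
have LP j := @label_pos01 R N w sw dw j.
have step1 j : j.+1%:R / N.*2%:R <= j%:R / N.*2%:R + eps :> R.
  rewrite -natr1 mulrDl lerD2l mul1r -(ler_pM2r n0) mulVf ?lt0r_neq0// -s0E expr2 mulrA.
  have : 1 * s0 <= eps * s0 * s0 by rewrite ler_pM2r//; move: large B0; rlra.
  by move: s01; rlra.
have c11 : cord_of g 1 1.
  by split => //; rewrite ?ler01// => s /andP[h1 h2]; rewrite (_ : s = 1)//; apply/eqP; rewrite eq_le h1 h2.
split.
- move=> u v s [[p [q [pN np fp [-> -> ->]]]]|[-> -> ->]]; last first.
    split; rewrite ?ler01//; first by rewrite subrr subr0 normr0 ltW.
    by apply: cord_near => //; exact: ltW.
  have k4 : 4 * kap <= delta by rlra.
  split.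
  + by rewrite divr_ge0.
  + rewrite ler_pdivrMr// mul1r ler_nat ltnS; have [_ <-] := count_word sw dw.
    by rewrite -{2}(cat_take_drop p.+1 w) count_cat leq_addl.
  + by apply: le_trans (TC p pN np) _; rlra.
  + have [h1 h2 h3 h4 h5] := WN p q pN np fp; split => //; first exact: le_trans k4.
    by move=> x /h5; rlra.
(* Second clause of [adapted]: with [P] the letter index at time [m] and [k] the integer part of
   [c * s0], the last up step from level [k] before [P] opens an excursion that is still under way
   at [P]. *)
- move=> m c m01 dc cm; have /andP[m0 m1] := m01.
  have nm0 : 0 <= N.*2%:R * m by rewrite mulr_ge0// ltW.
  have /andP[a1 a2] := truncn_itv nm0; set P := Num.truncn _ in a1 a2.
  have Pm : P%:R / N.*2%:R <= m by rewrite ler_pdivrMr// mulrC.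
  have mP : m <= P.+1%:R / N.*2%:R by rewrite ler_pdivlMr// mulrC ltW.
  have PN : (P <= N.*2)%N by rewrite -(ler_nat R); apply: le_trans a1 _; rewrite ler_piMr// ltW.
  have hP := NH m P PN m01 ltac:(by rewrite ger0_norm ?subr_ge0//; have := step1 P; rlra).
  have cs0 : 0 <= c * s0 by rewrite mulr_ge0// ltW//; rlra.
  have /andP[b1 b2] := truncn_itv cs0; set k := Num.truncn _ in b1 b2.
  have kP : k%:Z < height (take P w).
    rewrite -(ltr_int R) -pmulrn; apply: le_lt_trans b1 _; rewrite -ltr_pdivlMr//.
    by move: hP; rewrite ler_norml => /andP[_]; clear -cm kd kap0 delta0; rlra.
  have [p [pP hp np hj]] := last_level kP.
  have pN : (p < N.*2)%N by rewrite (leq_trans pP).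
  have pw : (p < size w)%N by rewrite sw.
  have [q fp] : exists q, first_passage 0 (drop p.+1 w) q.
    apply: first_passage_exists; have /andP[_ /eqP hw] := dw.
    have := height_cat (take p.+1 w) (drop p.+1 w); rewrite cat_take_drop hw.
    rewrite (take_nth false pw) -cats1 height_cat hp /= np /step addr0.
    by move: (height _) => z; clear; lia.
  have [qN hq hjq] := PH p q pN np fp.
  have Pq : (P < p.+1 + q)%N.
    rewrite ltnNge; apply/negP => qP; have := hj (p.+1 + q)%N.
    by rewrite qP addSn ltnS leq_addr hq hp ltxx => /(_ isT).
  exists (label_pos R N w p), (label_pos R N w (p.+1 + q)), ((count id (drop p.+1 w)).+1%:R / N.+1%:R); split.
  + by left; exists p, q; split.
  + have := LC p (ltnW pN); rewrite ler_norml => /andP[_].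
    have : p%:R / N.*2%:R <= P%:R / N.*2%:R :> R by rewrite ler_pM2r ?invr_gt0// ler_nat ltnW.
    by clear -Pm ed delta0; rlra.
  + have := LC (p.+1 + q)%N qN; rewrite ler_norml => /andP[+ _].
    have : P.+1%:R / N.*2%:R <= (p.+1 + q)%:R / N.*2%:R :> R by rewrite ler_pM2r ?invr_gt0// ler_nat.
    by clear -mP ed delta0; rlra.
  + have := NP p (ltnW pN); rewrite hp -[(k%:Z)%:~R]/(k%:R).
    have kc : k%:R / s0 <= c by rewrite ler_pdivrMr.
    have ck : c <= k%:R / s0 + delta / 8.
      have : 1 <= delta / 8 * s0.
        by move: sd; rewrite ler_pdivrMr//; clear; rlra.
      rewrite -ler_pdivrMr// div1r => s8.
      have : c <= (k%:R + 1) / s0 by rewrite ler_pdivlMr// natr1 ltW.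
      by rewrite mulrDl mul1r; clear -s8; rlra.
    by rewrite !ler_norml => /andP[h1 h2]; clear -h1 h2 kc ck kd delta0; apply/andP; split; rlra.
(* Third clause: heights are at most [b], so [2 * b + 1] consecutive letters near [x] contain a
   peak, whose cord is short. *)
- move=> x x01'; have /andP[x0 x1] := x01'.
  have Bs0 : 0 <= B * s0 by rewrite mulr_ge0// ltW.
  have /andP[b1 b2] := truncn_itv Bs0; set b := (Num.truncn _).+1 in b2.
  have b1' : b%:R <= B * s0 + 1 by rewrite /b -natr1 lerD2r.
  pose l := b.*2.+1.
  have lR : l%:R = 2 * b%:R + 1 :> R by rewrite /l -natr1 -mul2n natrM.
  have lN : l%:R <= N.*2%:R * (eps / 2) - 4 :> R.
    rewrite lR -s0E; have : (4 * B + 17) * s0 <= eps * s0 * s0 by rewrite ler_pM2r.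
    by move: b1' s01 Bs0; clear; rlra.
  have lN' : (l <= N.*2)%N.
    by rewrite -(ler_nat R); apply: le_trans lN _; have : N.*2%:R * (eps / 2) <= N.*2%:R * 1 by [rewrite ler_pM2l//; clear -eps0 eps1; rlra]; clear; rlra.
  have nx0 : 0 <= N.*2%:R * x by rewrite mulr_ge0// ltW.
  have /andP[a1 a2] := truncn_itv nx0; set a := Num.truncn _ in a1 a2.
  (* Near the right end the stretch of [l] letters is moved to the left so that it fits into the
     word. *)
  pose J := minn a (N.*2 - l).
  have JN : (J + l <= N.*2)%N by rewrite -(subnK lN') leq_add2r geq_minr.
  have [p [pv np nq]] : exists p, [/\ (p.+1 < size (take l (drop J w)))%N,
      nth false (take l (drop J w)) p & ~~ nth false (take l (drop J w)) p.+1].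
    have sv : size (take l (drop J w)) = l.
      by rewrite size_takel// size_drop sw leq_subRL ?(leq_trans (leq_addr _ _) JN)// addnC.
    apply: (@peak_exists _ b); first by rewrite sv.
    move=> i j /andP[ij jv]; rewrite sv in jv.
    have E i' : (i' <= l)%N -> height (take i' (take l (drop J w))) = height (take (J + i') w) - height (take J w).
      by move=> i'l; rewrite take_takel// takeD height_cat addrC addKr.
    rewrite !E ?(leq_trans ij)//.
    have h1 := hp0 (J + j)%N; have h2 := hp0 (J + i)%N; have h3 := hB (J + j)%N; have h4 := hB (J + i)%N.
    have up z : z%:~R <= B * s0 -> z <= b%:Z.
      by move=> zB; rewrite -(ler_int R) -pmulrn; apply: le_trans zB (ltW b2).
    by move: h1 h2 (up _ h3) (up _ h4); clear; lia.
  have sv : size (take l (drop J w)) = l.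
    by rewrite size_takel// size_drop sw leq_subRL ?(leq_trans (leq_addr _ _) JN)// addnC.
  rewrite sv in pv; rewrite !nth_take ?(ltnW pv)// !nth_drop addnS in np nq.
  have pN : (J + p < N.*2)%N by rewrite (leq_trans _ JN)// ltn_add2l ltnW.
  have pN1 : ((J + p).+1 < N.*2)%N by rewrite -addnS (leq_trans _ JN)// ltn_add2l.
  have fp : first_passage 0 (drop (J + p).+1 w) 1.
    rewrite (drop_nth false) ?sw// (negbTE nq); split => //=; first by rewrite take0.
    by case=> // _; rewrite take0.
  exists (label_pos R N w (J + p)), (label_pos R N w ((J + p).+1 + 1)), ((count id (drop (J + p).+1 w)).+1%:R / N.+1%:R).
  have pos i : (J <= i)%N -> (i <= J + l)%N -> `|label_pos R N w i - x| <= delta.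
    move=> Ji iJ; have iN : (i <= N.*2)%N by rewrite (leq_trans iJ).
    have h1 := LC i iN.
    have h2 : i%:R <= a%:R + l%:R :> R.
      by rewrite -natrD ler_nat (leq_trans iJ)// leq_add2r geq_minl.
    have h3 : N.*2%:R * x <= i%:R + l%:R + 1.
      have a2' : N.*2%:R * x < a%:R + 1 by rewrite natr1.
      have l0 : 0 <= l%:R :> R by [].
      have [ai|ia] := leqP a i.
        have : a%:R <= i%:R :> R by rewrite ler_nat.
        by move: a2' l0; clear; rlra.
      have : (N.*2 <= i + l)%N.
        move: Ji; rewrite /J /minn; case: ltnP => al; first by rewrite leqNgt ia.
        by rewrite leq_subLR addnC.
      rewrite -(ler_nat R) natrD => ?; have : N.*2%:R * x <= N.*2%:R by rewrite ler_piMr// ltW.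
      by rlra.
    have h4 : `|i%:R / N.*2%:R - x| <= eps.
      have -> : i%:R / N.*2%:R - x = (i%:R - N.*2%:R * x) / N.*2%:R by field; rewrite lt0r_neq0.
      rewrite normrM [X in _ * X]gtr0_norm ?invr_gt0// ler_pdivrMr//.
      have : 0 <= N.*2%:R * eps by rewrite mulr_ge0// ltW.
      by rewrite ler_norml => Ne; clear -Ne a1 h2 h3 lN; apply/andP; split; rlra.
    have -> : label_pos R N w i - x = (label_pos R N w i - i%:R / N.*2%:R) + (i%:R / N.*2%:R - x) by ring.
    by rewrite (le_trans (ler_normD _ _))// (le_trans (lerD h1 h4))//; clear -ed delta0; rlra.
  split; first by left; exists (J + p)%N, 1%N; split.
  split; apply: pos; rewrite ?leq_addr//.
  + by rewrite leq_add2l ltnW// ltnW.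
  + by rewrite addn1 ltnW// ltnS ltnW// ltnS leq_addr.
  + by rewrite addn1 -!addnS leq_add2l.
(* Fourth clause: the times are multiples of [1 / (N + 1)], so a first one exists. *)
- move=> x y e u v s Ls bx.
  have ex : exists c : nat, `[< exists u v, word_cords N w u v (c%:R / N.+1%:R) /\ box x y e u v >].
    case: (Ls) => [[p [q [_ _ _ [_ _ sE]]]]|[_ _ sE]].
      by exists (count id (drop p.+1 w)).+1; apply/asboolP; exists u, v; rewrite -sE.
    by exists 0%N; apply/asboolP; exists u, v; rewrite mul0r -sE.
  case: (ex_minnP ex) => c /asboolP[u' [v' [L' b']]] cmin.
  exists u', v', (c%:R / N.+1%:R); split => // u2 v2 s2 L2 b2.
  have [c2 sE2] : exists c2 : nat, s2 = c2%:R / N.+1%:R.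
    case: (L2) => [[p [q [_ _ _ [_ _ sE]]]]|[_ _ sE]]; first by exists (count id (drop p.+1 w)).+1.
    by exists 0%N; rewrite mul0r.
  rewrite sE2 in L2 *; rewrite ler_pM2r ?invr_gt0// ler_nat; apply: cmin; apply/asboolP.
  by exists u2, v2.
- by right.
Qed.

End WordAdapted.

(** * Distinct minima of the excursion *)

Section DistinctMinima.
Variable R : realType.
Implicit Types (g : R -> R) (w u v : seq bool).

(** The walk started at [a] has minimum exactly 0; for [a] the current height minus [x] this says
    that the next stretch has minimum [x]. *)
Definition tight (a : int) w : bool := nonneg_from a w && ~~ nonneg_from (a - 1) w.

Lemma tight_exists w : exists k : nat, tight k%:Z w.
Proof.
have ex : exists k : nat, nonneg_from k%:Z w.
  exists (size w); apply/nonneg_fromP => j; have := height_bound (take j w).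
  have : (size (take j w) <= size w)%N by rewrite size_take_min geq_minr.
  by move: (size (take j w)) (height (take j w)) => a' b'; lia.
case: (ex_minnP ex) => k hk kmin; exists k; rewrite /tight hk; apply/negP.
case: k hk kmin => [|k] hk kmin; first by move/nonneg_from_ge0.
by rewrite (_ : k.+1%:Z - 1 = k%:Z); [move/kmin; rewrite ltnn|lia].
Qed.

Lemma tightP (a : int) w : tight a w ->
  (forall j, 0 <= a + height (take j w)) /\ exists2 j, (j <= size w)%N & a + height (take j w) = 0.
Proof.
move=> /andP[/nonneg_fromP h /negP nh]; split => //; apply: contrapT => hn; apply: nh.
apply/nonneg_fromP => j.
have key i : (i <= size w)%N -> 0 < a + height (take i w).
  move=> iw; rewrite lt_neqAle h andbT eq_sym; apply/eqP => E; apply: hn; exists i => //.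
have [jw|jw] := leqP j (size w); first by have := key j jw; lia.
by have := key (size w) (leqnn _); rewrite take_size take_oversize ?(ltnW jw)//; lia.
Qed.

(** In [mean_nonneg_from] the windows for [a] and [a - 1] differ by the two heights [- a] and
    [a + 1], each of probability at most [1 / s]. *)
Lemma mean_tight (s : R) l (a : int) : 0 < s -> s ^+ 2 = l%:R ->
  mean l (fun w => (tight a w)%:R) <= 2 / s.
Proof.
move=> s0 sl; have [a0|a0] := leP 0 a; last first.
  rewrite (eq_mean (G := fun=> 0)); first by rewrite mean_cst divr_ge0// ltW.
  move=> w _; rewrite /tight; case: (boolP (nonneg_from a w)) => // /nonneg_from_ge0.
  by rewrite leNgt a0.
have E : mean l (fun w => (tight a w)%:R) + mean l (fun w => (nonneg_from (a - 1) w)%:R) =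
    mean l (fun w => (nonneg_from a w)%:R) :> R.
  rewrite -meanD; apply: eq_mean => w _; rewrite /tight.
  case: (boolP (nonneg_from (a - 1) w)) => [/nonneg_fromP h|_]; last by rewrite andbT addr0.
  have -> : nonneg_from a w by apply/nonneg_fromP => j; have := h j; lia.
  by rewrite add0r.
have {}E : mean l (fun w => (tight a w)%:R) = mean l (fun w => (nonneg_from a w)%:R) -
   mean l (fun w => (nonneg_from (a - 1) w)%:R) :> R by rewrite -E addrK.
rewrite E !mean_nonneg_from; [|lia|lia].
rewrite lerBlDr mulr_natl mulr2n.
apply: (@le_trans _ _ (local_prob l (- a) + local_prob l (a + 1) +
    mean l (fun w => (- (a - 1) <= height w <= a - 1 + 1)%R%:R))).
  rewrite -!meanD; apply: le_mean => w _.
  rewrite -!natrD ler_nat; move: (height w) => h.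
  case: (boolP (- a <= h <= a + 1)) => //= /andP[h1 h2].
  case: (eqVneq h (- a)) => //= n1; case: (eqVneq h (a + 1)) => //= n2.
  by rewrite (_ : _ <= h <= _)//; move: h1 h2 n1 n2; clear; lia.
by rewrite lerD2r; apply: lerD; exact: sqr_le_local_prob_ub.
Qed.

(** After time reversal the walk starts at 0: positivity is kept over the first [l1] steps, at cost
    [2 / s1], and the last [l2] steps have to hit one height, at cost [1 / s2]. *)
Lemma mean_nonneg_end (s1 s2 : R) l1 l2 (y : int) : 0 < s1 -> 0 < s2 ->
  s1 ^+ 2 = l1%:R -> s2 ^+ 2 = l2%:R -> 0 <= y ->
  mean (l1 + l2) (fun w => (nonneg_from y w && (y + height w == 0))%:R) <= 2 / s1 * s2^-1.
Proof.
move=> s10 s20 s1l s2l y0; rewrite -/(ballot_prob (l1 + l2) y 0) ballot_prob_sym// /ballot_prob mean_cat.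
apply: (@le_trans _ _ (mean l1 (fun u => s2^-1 * (nonneg_from 0 u)%:R))).
  apply: le_mean => u _.
  apply: (@le_trans _ _ (mean l2 (fun v => (nonneg_from 0 u)%:R * (height v == y - height u)%:R))).
    apply: le_mean => v _; rewrite nonneg_from_cat height_cat -natrM mulnb ler_nat.
    case: (nonneg_from 0 u) => //=; case: (nonneg_from _ v) => //=.
    by rewrite add0r [_ == y - _]eq_sym subr_eq eq_sym addrC.
  rewrite meanZ mulrC ler_wpM2r//; exact: sqr_le_local_prob_ub.
rewrite meanZ mulrC ler_wpM2r ?invr_ge0 ?(ltW s20)//; exact: mean_nonneg_from0_ub.
Qed.

(** Positivity on [l1], a prescribed minimum on [l2] and another on [l4] cost [1 / s] each, and the
    return to 0 over [l5 + l6] costs [1 / s ^+ 2], up to constants. With order [s] values of [x] and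
    [delta * s] values of [y] near [x], this is [delta] times the mass of Dyck words. *)
Lemma two_minima_bound (l1 l2 l3 l4 l5 l6 : nat) (s c : R) (x y : int) : 0 < s -> 0 < c ->
  (forall l : nat, l \in [:: l1; l2; l4; l5; l6] -> (c * s) ^+ 2 <= l%:R) ->
  mean (l1 + (l2 + (l3 + (l4 + (l5 + l6))))) (fun w => (dyck w &&
     (tight (height (take l1 w) - x) (take l2 (drop l1 w)) &&
      tight (height (take (l1 + l2 + l3) w) - y) (take l4 (drop (l1 + l2 + l3) w))))%:R) <=
  16 / (c * s) ^+ 5.
Proof.
move=> s0 c0 hl; have cs0 : 0 < c * s by rewrite mulr_gt0.
have ub l : l \in [:: l1; l2; l4; l5; l6] -> exists t : R, [/\ 0 < t, t ^+ 2 = l%:R & t^-1 <= (c * s)^-1].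
  move=> /hl h; have l0 : 0 < l%:R :> R by apply: lt_le_trans h; rewrite exprn_gt0.
  exists (Num.sqrt l%:R); rewrite sqrtr_gt0 l0 sqr_sqrtr ?(ltW l0)//; split => //.
  rewrite lef_pV2 ?posrE ?sqrtr_gt0//.
  by rewrite -(ler_pXn2r (n := 2)) ?nnegrE ?sqrtr_ge0 ?(ltW cs0)// sqr_sqrtr// ltW.
have [t1 [t10 t1l t1c]] := ub l1 ltac:(by rewrite !inE eqxx).
have [t2 [t20 t2l t2c]] := ub l2 ltac:(by rewrite !inE eqxx ?orbT).
have [t4 [t40 t4l t4c]] := ub l4 ltac:(by rewrite !inE eqxx ?orbT).
have [t5 [t50 t5l t5c]] := ub l5 ltac:(by rewrite !inE eqxx ?orbT).
have [t6 [t60 t6l t6c]] := ub l6 ltac:(by rewrite !inE eqxx ?orbT).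
have g2 : 0 <= 2 / t2 by rewrite divr_ge0// ltW.
have g4 : 0 <= 2 / t4 by rewrite divr_ge0// ltW.
pose K5 := 2 / t5 * t6^-1.
have K50 : 0 <= K5 by rewrite mulr_ge0 ?divr_ge0 ?invr_ge0// ltW.
apply: (@le_trans _ _ (2 / t1 * (2 / t2 * (2 / t4 * K5)))); last first.
  have i0 : 0 <= (c * s)^-1 by rewrite invr_ge0 ltW.
  have m2 (z : R) : z^-1 <= (c * s)^-1 -> 2 / z <= 2 / (c * s) by move=> h; rewrite ler_pM2l.
  have p2 (z : R) : 0 < z -> 0 <= 2 / z by move=> z0; rewrite divr_ge0// ltW.
  apply: (@le_trans _ _ (2 / (c * s) * (2 / (c * s) * (2 / (c * s) * (2 / (c * s) * (c * s)^-1))))).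
    have q1 : 0 <= 2 / t4 * K5 by rewrite mulr_ge0// p2.
    have q2 : 0 <= 2 / t2 * (2 / t4 * K5) by rewrite mulr_ge0// p2.
    have q3 : 0 <= t6^-1 by rewrite invr_ge0 ltW.
    exact: (ler_pM (p2 _ t10) q2 (m2 _ t1c) (ler_pM (p2 _ t20) q1 (m2 _ t2c)
      (ler_pM (p2 _ t40) K50 (m2 _ t4c) (ler_pM (p2 _ t50) q3 (m2 _ t5c) t6c)))).
  rewrite le_eqVlt; apply/orP; left; apply/eqP; field.
  by rewrite !lt0r_neq0.
rewrite mean_cat.
apply: (@le_trans _ _ (mean l1 (fun u1 => (2 / t2 * (2 / t4 * K5)) * (nonneg_from 0 u1)%:R))); last first.
  rewrite meanZ [leRHS]mulrC; apply: ler_wpM2l; first exact: mulr_ge0 g2 (mulr_ge0 g4 K50).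
  exact: mean_nonneg_from0_ub.
apply: le_mean => u1 su1; rewrite mean_cat.
apply: (@le_trans _ _ (mean l2 (fun u2 => ((2 / t4 * K5) * (nonneg_from 0 u1)%:R) * (tight (height u1 - x) u2)%:R))); last first.
  rewrite meanZ.
  have -> : 2 / t2 * (2 / t4 * K5) * (nonneg_from 0 u1)%:R = (2 / t4 * K5) * (nonneg_from 0 u1)%:R * (2 / t2) by ring.
  apply: ler_wpM2l; first exact: mulr_ge0 (mulr_ge0 g4 K50) (ler0n _ _).
  exact: mean_tight.
apply: le_mean => u2 su2; rewrite mean_cat.
rewrite -(mean_cst l3 (2 / t4 * K5 * (nonneg_from 0 u1)%:R * (tight (height u1 - x) u2)%:R)).
apply: le_mean => u3 su3; rewrite mean_cat.
apply: (@le_trans _ _ (mean l4 (fun u4 => (K5 * (nonneg_from 0 u1)%:R * (tight (height u1 - x) u2)%:R) *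
   (tight (height (u1 ++ u2 ++ u3) - y) u4)%:R))); last first.
  rewrite meanZ.
  have -> : 2 / t4 * K5 * (nonneg_from 0 u1)%:R * (tight (height u1 - x) u2)%:R =
     K5 * (nonneg_from 0 u1)%:R * (tight (height u1 - x) u2)%:R * (2 / t4) by ring.
  by apply: ler_wpM2l; [do 2 (apply: mulr_ge0 => //)|exact: mean_tight].
apply: le_mean => u4 su4.
pose z := height (u1 ++ u2 ++ u3 ++ u4).
apply: (@le_trans _ _ (mean (l5 + l6) (fun u5 => ((nonneg_from 0 u1)%:R * (tight (height u1 - x) u2)%:R *
   (tight (height (u1 ++ u2 ++ u3) - y) u4)%:R) * ((0 <= z)%R && (nonneg_from z u5 && (z + height u5 == 0)))%:R))).
  apply: le_mean => u5 su5.
  rewrite take_size_cat// drop_size_cat// take_size_cat//.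
  have -> : u1 ++ u2 ++ u3 ++ u4 ++ u5 = (u1 ++ u2 ++ u3) ++ (u4 ++ u5) by rewrite -!catA.
  have s123 : size (u1 ++ u2 ++ u3) = (l1 + l2 + l3)%N by rewrite !size_cat su1 su2 su3 addnA.
  rewrite take_size_cat// drop_size_cat// take_size_cat// -!natrM !mulnb ler_nat.
  have -> : (u1 ++ u2 ++ u3) ++ (u4 ++ u5) = u1 ++ ((u2 ++ u3 ++ u4) ++ u5) by rewrite -!catA.
  case: (boolP (dyck _)) => //= /andP[]; rewrite nonneg_from_cat => /andP[-> n2] h0 /=.
  rewrite nonneg_from_cat add0r in n2; move/andP: n2 => [n2 n3].
  have zE : height u1 + height (u2 ++ u3 ++ u4) = z by rewrite /z (height_cat u1).
  rewrite zE in n3; rewrite n3 (nonneg_from_ge0 n3) /=.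
  have -> : z + height u5 == 0 by move: h0; rewrite (height_cat u1) (height_cat (u2 ++ _)) addrA zE.
  by rewrite andbT.
rewrite meanZ.
have -> : K5 * (nonneg_from 0 u1)%:R * (tight (height u1 - x) u2)%:R * (tight (height (u1 ++ u2 ++ u3) - y) u4)%:R =
  (nonneg_from 0 u1)%:R * (tight (height u1 - x) u2)%:R * (tight (height (u1 ++ u2 ++ u3) - y) u4)%:R * K5 by ring.
apply: ler_wpM2l; first by rewrite !mulr_ge0.
have [z0|z0] := leP 0 z; last by rewrite (eq_mean (G := fun=> 0)) ?mean_cst.
by apply: mean_nonneg_end.
Qed.

Definition min_level (p q b : R) g : R := 1 - sup [set 1 - clamp (g t / b) | t in `[p, q]].

Lemma min_level_le p q b g t : p <= t <= q -> min_level p q b g <= clamp (g t / b).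
Proof.
move=> tpq; rewrite /min_level lerBlDr -lerBlDl.
apply: (@sup_image_ub _ _ _ (fun t => 1 - clamp (g t / b))); first by rewrite /= in_itv.
by move=> u _; rewrite lerBlDr lerDl clamp_ge0.
Qed.

Lemma min_level_ge p q b g c : p <= q -> (forall t, p <= t <= q -> c <= clamp (g t / b)) -> c <= min_level p q b g.
Proof.
move=> pq h; rewrite /min_level lerBrDr -lerBrDl; apply: sup_image_le.
  by exists p; rewrite /= in_itv/= lexx.
by move=> t; rewrite /= in_itv/= => /h; lra.
Qed.

Lemma min_level_lip p q b : 0 <= p -> p <= q -> q <= 1 -> 0 < b -> lip b^-1 (min_level p q b).
Proof.
move=> p0 pq q1 b0.
have aux f g c : sup_close f g c -> min_level p q b f <= min_level p q b g + b^-1 * c.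
  move=> fg; rewrite -lerBlDr; apply: min_level_ge => // t tpq.
  have := min_level_le b f tpq; have := clamp_lip (f t / b) (g t / b).
  have : `|f t / b - g t / b| <= b^-1 * c.
    rewrite -mulrBl normrM (gtr0_norm (x := b^-1)) ?invr_gt0// mulrC ler_pM2l ?invr_gt0//.
    by apply: fg; case/andP: tpq => ? ?; apply/andP; split; lra.
  by move=> h1 /le_trans/(_ h1); rewrite ler_norml => /andP[_]; lra.
move=> f g c fg; have gf : sup_close g f c by move=> t t01; rewrite distrC fg.
by have := aux _ _ _ fg; have := aux _ _ _ gf; rewrite ler_norml => h1 h2; apply/andP; split; lra.
Qed.

Lemma min_level_wpath (p q b s : R) M w i l (x : int) : 0 <= p -> p <= q -> 0 < b -> 0 < s ->
  s = Num.sqrt M%:R -> size w = M -> i = Num.truncn (M%:R * p) -> (i + l)%N = Num.truncn (M%:R * q) ->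
  (0 < M)%N -> tight (height (take i w) - x) (take l (drop i w)) -> (i + l <= M)%N ->
  min_level p q b (wpath w) = clamp (x%:~R / (s * b)).
Proof.
move=> p0 pq b0 s0 sE sw iE lE M0 /tightP[hx [j jl hj]] ilM.
have HD k : (k <= l)%N -> height (take (i + k) w) = height (take i w) + height (take k (take l (drop i w))).
  by move=> kl; rewrite take_takel// takeD height_cat.
have M0R : 0 < M%:R :> R by rewrite ltr0n.
have wE t : wpath w t / b = (height (take (Num.truncn (M%:R * t)) w))%:~R / (s * b).
  by rewrite /wpath sw -sE invfM mulrA.
have sb0 : 0 < (s * b)^-1 by rewrite invr_gt0 mulr_gt0.
have {}jl : (j <= l)%N.
  by apply: leq_trans jl _; rewrite size_take_min geq_minl.
apply/eqP; rewrite eq_le; apply/andP; split.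
  (* The minimum may be attained at letter [i], whose grid time can precede [p]; hence the
     maximum. *)
  pose t := Num.max p ((i + j)%:R / M%:R).
  have q0 : 0 <= M%:R * q by rewrite mulr_ge0//; lra.
  have Mp0 : 0 <= M%:R * p by rewrite mulr_ge0.
  have /andP[a1 a2] := truncn_itv Mp0; have /andP[c1 c2] := truncn_itv q0.
  rewrite -iE in a1 a2; rewrite -lE in c1 c2.
  have tt : p <= t <= q.
    rewrite /t le_max lexx /= ge_max pq /= ler_pdivrMr// mulrC; apply: le_trans c1.
    by rewrite ler_nat leq_add2l.
  have -> : x = height (take (Num.truncn (M%:R * t)) w).
    have -> : Num.truncn (M%:R * t) = (i + j)%N.
      rewrite /t maxr_pMr ?ler0n// mulrCA divff ?lt0r_neq0// mulr1.
      apply: truncn_def; rewrite le_max lexx orbT /= gt_max ltr_nat ltnSn andbT.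
      by apply: lt_le_trans a2 _; rewrite ler_nat ltnS leq_addr.
    by rewrite HD//; move: hj; move: (height _) (height _) => y z; clear; lia.
  by rewrite -wE; exact: min_level_le.
apply: min_level_ge => // t /andP[t0 t1]; rewrite wE; apply: clamp_homo; rewrite ler_pM2r// ler_int.
set k := Num.truncn _.
have ik : (i <= k)%N by rewrite iE le_truncn// ler_pM2l.
have kl : (k <= i + l)%N by rewrite lE le_truncn// ler_pM2l.
rewrite -(subnKC ik) HD; last by rewrite leq_subLR.
by have := hx (k - i)%N; move: (height _) (height _) => y z; clear; lia.
Qed.

End DistinctMinima.

Lemma window_min_exists w i l : (forall j, 0 <= height (take j w)) ->
  exists x : nat, tight (height (take i w) - x%:Z) (take l (drop i w)).
Proof.
move=> h0; have [k hk] := tight_exists (take l (drop i w)).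
have [_ [j _ jE]] := tightP hk.
have E : height (take i w) - k%:Z = height (take (i + minn j l) w).
  rewrite takeD height_cat take_min.
  by move: jE; move: (height _) (height _) => y z; lia.
have z0 := h0 (i + minn j l)%N; rewrite -E in z0.
exists `|height (take i w) - k%:Z|%N; rewrite gez0_abs//.
by rewrite (_ : _ - (_ - _) = k%:Z)//; lia.
Qed.

Lemma centred_window (x y D : nat) : `|x%:Z - y%:Z| < D%:Z ->
  (y + D - x < D.*2)%N /\ x%:Z + (y + D - x)%N%:Z - D%:Z = y%:Z.
Proof. by rewrite ltr_norml => /andP[h1 h2]; split; lia. Qed.

Lemma half_bounds l : (l <= 2 * l./2 + 1)%N /\ (l./2 <= l - l./2)%N.
Proof. by split; lia. Qed.

Lemma gaps_sum i1 i2 i3 i4 l5 M : (i1 <= i2)%N -> (i2 <= i3)%N -> (i3 <= i4)%N -> (i4 <= M)%N ->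
  (l5 <= M - i4)%N -> (i1 + ((i2 - i1) + ((i3 - i2) + ((i4 - i3) + (l5 + (M - i4 - l5))))))%N = M.
Proof. by lia. Qed.

(** * Dyck words with two almost equal minima *)

Section Ties.
Variable R : realType.
Implicit Types (g : R -> R).

Lemma clamp_lt1 (x : R) : 0 <= x -> clamp x < 1 -> clamp x = x.
Proof.
move=> x0 h; apply: clamp_id; rewrite x0 /= leNgt; apply/negP => /ltW x1.
by move: h; rewrite clamp1// ltxx.
Qed.

Lemma lip_clamp (L : R) F : lip L F -> lip L (fun g => clamp (F g)).
Proof. by move=> LF f g c fg; exact: le_trans (clamp_lip _ _) (LF _ _ _ fg). Qed.

(* Detects two nearly equal minima over [p, q] and [r, s], at a level below
   three quarters of [b]. *)
Definition tie (p q r s b delta : R) g : R :=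
  clamp (1 - `|min_level p q b g - min_level r s b g| / delta) * clamp (3 - 4 * min_level p q b g).

Lemma tie_lip (p q r s b delta : R) : 0 <= p -> p <= q -> q <= 1 -> 0 <= r -> r <= s -> s <= 1 ->
  0 < b -> 0 < delta -> lip (2 * b^-1 / delta + 4 * b^-1) (tie p q r s b delta).
Proof.
move=> p0 pq q1 r0 rs s1 b0 d0; apply: lipM.
- apply: lip_clamp => f g c fg.
  have h1 := min_level_lip p0 pq q1 b0 fg; have h2 := min_level_lip r0 rs s1 b0 fg.
  set m1 := min_level p q b f in h1 *; set m2 := min_level p q b g in h1 *.
  set m3 := min_level r s b f in h2 *; set m4 := min_level r s b g in h2 *.
  have -> : 1 - `|m1 - m3| / delta - (1 - `|m2 - m4| / delta) = (`|m2 - m4| - `|m1 - m3|) / delta by ring.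
  rewrite normrM (gtr0_norm (x := delta^-1)) ?invr_gt0// mulrAC ler_pM2r ?invr_gt0//.
  apply: le_trans (ler_dist_dist _ _) _.
  rewrite (_ : m2 - m4 - (m1 - m3) = - (m1 - m2) + (m3 - m4)); last by ring.
  by rewrite (le_trans (ler_normD _ _))// normrN; rlra.
- apply: lip_clamp => f g c fg.
  have h1 := min_level_lip p0 pq q1 b0 fg.
  rewrite (_ : 3 - _ - _ = - 4 * (min_level p q b f - min_level p q b g)); last by ring.
  by rewrite mulNr normrN normrM ger0_norm// -[_ / b * c]mulrA ler_wpM2l.
- by move=> f; rewrite clamp_ge0 clamp_le1.
- by move=> f; rewrite clamp_ge0 clamp_le1.
Qed.

Lemma tie_unit (p q r s b delta : R) : unit_valued (tie p q r s b delta).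
Proof. by apply: unit_valuedM => f; rewrite clamp_ge0 clamp_le1. Qed.

Lemma window_length (x y ga M : R) : 0 <= x -> 0 <= M -> ga <= y - x -> 4 <= M * ga ->
  M * (ga / 2) <= (Num.truncn (M * y) - Num.truncn (M * x))%:R.
Proof.
move=> x0 M0 gxy Mg; have M0' : 0 <= M * (y - x - ga) by rewrite mulr_ge0//; rlra.
have Mx0 : 0 <= M * x by rewrite mulr_ge0.
have My0 : 0 <= M * y by move: M0'; rewrite !mulrBr; rlra.
have /andP[a1 a2] := truncn_itv Mx0; have /andP[b1 b2] := truncn_itv My0.
rewrite natrB; last by apply: le_truncn; move: M0'; rewrite !mulrBr; rlra.
by move: a1 b2 M0'; rewrite -natr1 !mulrBr; rlra.
Qed.

Section Word.
Variables (N : nat) (w : seq bool) (p q r s b delta S : R).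
Hypothesis sw : size w = N.*2.
Hypothesis dw : dyck w.
Hypothesis N0 : (0 < N)%N.
Hypothesis SE : S = Num.sqrt N.*2%:R.
Hypotheses (p0 : 0 <= p) (pq : p <= q) (qr : q <= r) (rs : r <= s) (s1 : s <= 1) (b0 : 0 < b).
Hypotheses (d0 : 0 < delta) (d8 : delta <= 1 / 8).

Let i1 := Num.truncn (N.*2%:R * p).
Let i2 := Num.truncn (N.*2%:R * q).
Let i3 := Num.truncn (N.*2%:R * r).
Let i4 := Num.truncn (N.*2%:R * s).

Lemma tie_wpath_le : tie p q r s b delta (wpath w) <=
  \sum_(x < (Num.truncn (S * b)).+1) \sum_(j < (Num.truncn (delta * S * b)).+1.*2)
    (tight (height (take i1 w) - x%:Z) (take (i2 - i1) (drop i1 w)) &&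
     tight (height (take i3 w) - (x%:Z + j%:Z - (Num.truncn (delta * S * b)).+1%:Z))
       (take (i4 - i3) (drop i3 w)))%:R.
Proof.
have H0 j : 0 <= height (take j w) by have /andP[/nonneg_fromP h _] := dw; have := h j; rewrite add0r.
have M0 : (0 < N.*2)%N by rewrite double_gt0.
have S0 : 0 < S by rewrite SE sqrtr_gt0 ltr0n.
have tr (x y : R) : x <= y -> (Num.truncn (N.*2%:R * x) <= Num.truncn (N.*2%:R * y))%N.
  by move=> xy; apply: le_truncn; rewrite ler_wpM2l.
have tM (y : R) : y <= 1 -> (Num.truncn (N.*2%:R * y) <= N.*2)%N.
  by move=> y1; rewrite -{2}(@natrK R N.*2); apply: le_truncn; rewrite ler_piMr.
have [x hx] := @window_min_exists w i1 (i2 - i1) H0.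
have [y hy] := @window_min_exists w i3 (i4 - i3) H0.
have m1 : min_level p q b (wpath w) = clamp (x%:R / (S * b)).
  rewrite (@min_level_wpath R p q b S N.*2 w i1 (i2 - i1) x)// ?subnKC ?tr ?tM//.
  by apply: le_trans s1; apply: le_trans rs; apply: le_trans qr.
have r0 : 0 <= r by apply: le_trans qr; apply: le_trans pq.
have m2 : min_level r s b (wpath w) = clamp (y%:R / (S * b)).
  by rewrite (@min_level_wpath R r s b S N.*2 w i3 (i4 - i3) y)// ?subnKC ?tr ?tM.
have S1 : 0 < S * b by rewrite mulr_gt0.
have S2 : 0 <= S * b by rewrite ltW.
have S3 : 0 <= delta * S * b by rewrite -mulrA mulr_ge0// ltW.
have nn A (F : 'I_A -> bool) : 0 <= \sum_(j < A) (F j)%:R :> R by apply: sumr_ge0 => j _.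
set rhs := leRHS; have rhs0 : 0 <= rhs by apply: sumr_ge0 => i _; apply: nn.
rewrite /tie m1 m2; set z1 := x%:R / _; set z2 := y%:R / _.
have z10 : 0 <= z1 by rewrite divr_ge0.
have z20 : 0 <= z2 by rewrite divr_ge0.
have [h|h] := leP (1 - `|clamp z1 - clamp z2| / delta) 0; first by rewrite (clamp0 h) mul0r.
have [h'|h'] := leP (3 - 4 * clamp z1) 0; first by rewrite (clamp0 h') mulr0.
apply: (@le_trans _ _ 1).
  by rewrite -(mulr1 1); apply: ler_pM; rewrite ?clamp_ge0 ?clamp_le1.
have {}h : `|clamp z1 - clamp z2| < delta.
  by move: h; rewrite subr_gt0 ltr_pdivrMr// mul1r.
(* A first level below 3/4 and a gap below [delta <= 1 / 8] keep both minima below 1, where clamping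
   has no effect. *)
have c1 : clamp z1 < 1 by rlra.
have c2 : clamp z2 < 1 by move: h h' d8; rewrite ltr_norml => /andP[+ _]; move: (clamp z1) (clamp z2) => a1 a2 *; rlra.
have E1 := clamp_lt1 z10 c1; have E2 := clamp_lt1 z20 c2.
rewrite E1 E2 in h; rewrite E1 in c1.
have xX : (x < (Num.truncn (S * b)).+1)%N.
  rewrite -(ltr_nat R); apply: lt_trans (truncnS_gt _).
  by move: c1; rewrite /z1 ltr_pdivrMr// mul1r.
set D := (Num.truncn (delta * S * b)).+1 in rhs rhs0 *.
have DE : delta * S * b < D%:R by exact: truncnS_gt.
have xy : `|x%:Z - y%:Z| < D%:Z.
  rewrite -(ltr_int R) intr_norm intrB; apply: lt_trans DE.
  move: h; rewrite /z1 /z2 -mulrBl normrM (gtr0_norm (x := _^-1)) ?invr_gt0//.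
  by rewrite ltr_pdivrMr// mulrA.
have [jD jE] := centred_window xy.
rewrite /rhs (bigD1 (Ordinal xX))//= (bigD1 (Ordinal jD))//= hx /=.
rewrite jE hy /= -addrA lerDl addr_ge0//; first by apply: sumr_ge0.
by apply: sumr_ge0 => i _; apply: sumr_ge0.
Qed.

End Word.

Lemma tie_dyck_bound (p q r s b : R) : 0 < p -> p < q -> q < r -> r < s -> s < 1 -> 0 < b ->
  exists2 C : R, 0 < C & forall delta : R, 0 < delta -> delta <= 1 / 8 ->
    exists N0 : nat, forall N, (N0 <= N)%N ->
      dyck_mean N (fun w => tie p q r s b delta (wpath w)) <=
      C * delta * mean N.*2 (fun w => (dyck w)%:R).
Proof.
move=> p0 pq qr rs s1 b0.
pose ga : R := Num.min p (Num.min (q - p) (Num.min (s - r) ((1 - s) / 2))).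
have ga0 : 0 < ga by rewrite !lt_min p0 !subr_gt0 pq rs divr_gt0// subr_gt0.
have gp : ga <= p by rewrite ge_min lexx.
have gq : ga <= q - p by rewrite /ga !ge_min lexx !orbT.
have gs : ga <= s - r by rewrite /ga !ge_min lexx !orbT.
have gl : ga <= (1 - s) / 2 by rewrite /ga !ge_min lexx !orbT.
clearbody ga; pose c : R := ga / 2; have c0 : 0 < c by rewrite divr_gt0.
have cc : c ^+ 2 <= ga / 2.
  by rewrite expr2 -/c ger_pMl// /c; rlra.
have n320 : 0 < 320 :> R by rewrite ltr0n.
have C0 : 0 < 320 * b ^+ 2 / c ^+ 5 := divr_gt0 (mulr_gt0 n320 (exprn_gt0 2 b0)) (exprn_gt0 5 c0).
(* At most [2 * S * b] levels and [4 * delta * S * b] offsets at [16 / (c * S) ^+ 5] each make the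
   factor 128; the Dyck mass is at least [S ^- 3 / 2], so 256 would already do. *)
exists (320 * b ^+ 2 / c ^+ 5) => //.
move=> delta d0 d8.
have db0 : 0 < delta * b by rewrite mulr_gt0.
have [N1 hN1] := large_sqrt (Num.max 1 (Num.max (4 / ga) (Num.max b^-1 (delta * b)^-1))).
exists (maxn 1 N1) => N; rewrite geq_max => /andP[N0 N1N].
have NN : (N <= N.*2)%N by rewrite -addnn leq_addr.
pose S : R := Num.sqrt N.*2%:R.
have := hN1 _ (leq_trans N1N NN); rewrite -/S !ge_max => /and4P[S1 Sg Sb Sd].
have S0 : 0 < S by apply: lt_le_trans S1.
have SE : S ^+ 2 = N.*2%:R by rewrite sqr_sqrtr.
have Sb1 : 1 <= S * b by rewrite -ler_pdivrMr// div1r.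
have Sd1 : 1 <= delta * S * b by rewrite -mulrA (mulrC S) mulrA mulrC -ler_pdivrMr// div1r.
have Mg : 4 <= N.*2%:R * ga.
  move: Sg; rewrite ler_pdivrMr// => Sg; rewrite -SE expr2 -mulrA.
  apply: le_trans (Sg) _; by rewrite ler_pMl// (lt_le_trans _ Sg).
have tr (x y : R) : x <= y -> (Num.truncn (N.*2%:R * x) <= Num.truncn (N.*2%:R * y))%N.
  by move=> xy; apply: le_truncn; rewrite ler_wpM2l.
pose i1 := Num.truncn (N.*2%:R * p).
pose i2 := Num.truncn (N.*2%:R * q).
pose i3 := Num.truncn (N.*2%:R * r).
pose i4 := Num.truncn (N.*2%:R * s).
have i12 : (i1 <= i2)%N by rewrite tr// ltW.
have i23 : (i2 <= i3)%N by rewrite tr// ltW.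
have i34 : (i3 <= i4)%N by rewrite tr// ltW.
have Ms0 : 0 <= N.*2%:R * s by rewrite mulr_ge0//; rlra.
have i4s : i4%:R <= N.*2%:R * s by have /andP[] := truncn_itv Ms0.
have i4M : (i4 <= N.*2)%N.
  by rewrite -(ler_nat R); apply: le_trans i4s _; rewrite ler_piMr// ltW.
pose l := (N.*2 - i4)%N; pose l5 := l./2; pose l6 := (l - l5)%N.
have l5l : (l5 <= l)%N by rewrite /l5 -divn2 leq_div.
have lo k : N.*2%:R * (ga / 2) <= k%:R -> (c * S) ^+ 2 <= k%:R :> R.
  move=> h; rewrite exprMn SE; apply: le_trans h; rewrite mulrC ler_wpM2l//.
have Mga : N.*2%:R * ga <= N.*2%:R * ((1 - s) / 2) by rewrite ler_wpM2l.
have lR : N.*2%:R * (1 - s) <= l%:R.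
  by rewrite /l natrB// mulrBr mulr1 lerB.
have l5R : N.*2%:R * (ga / 2) <= l5%:R.
  have : l%:R <= 2 * l5%:R + 1 :> R by rewrite -natrM natr1 ler_nat -addn1; have [] := half_bounds l.
  by move: Mga Mg lR; rlra.
have l6R : N.*2%:R * (ga / 2) <= l6%:R.
  by apply: le_trans l5R _; rewrite ler_nat; have [] := half_bounds l.
have sum6 : (i1 + ((i2 - i1) + ((i3 - i2) + ((i4 - i3) + (l5 + l6)))))%N = N.*2.
  exact: gaps_sum.
have hl : forall k, k \in [:: i1; (i2 - i1)%N; (i4 - i3)%N; l5; l6] -> (c * S) ^+ 2 <= k%:R :> R.
  move=> k; rewrite !inE => /or4P[/eqP->|/eqP->|/eqP->|/orP[/eqP->|/eqP->]]; apply: lo => //.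
  - have := @window_length 0 p ga N.*2%:R (lexx _) ltac:(by []) ltac:(by rewrite subr0) Mg.
    by rewrite mulr0 truncn0 subn0.
  - by apply: window_length => //; rewrite ltW.
  - by apply: window_length => //; rlra.
pose K : R := 16 / (c * S) ^+ 5.
have K0 : 0 <= K by rewrite divr_ge0// exprn_ge0// mulr_ge0// ltW.
pose X := (Num.truncn (S * b)).+1; pose D := (Num.truncn (delta * S * b)).+1.
have bound : dyck_mean N (fun w => tie p q r s b delta (wpath w)) <= \sum_(x < X) \sum_(j < D.*2) K.
  pose G (x j : nat) w : bool := tight (height (take i1 w) - x%:Z) (take (i2 - i1) (drop i1 w)) &&
     tight (height (take i3 w) - (x%:Z + j%:Z - D%:Z)) (take (i4 - i3) (drop i3 w)).
  apply: (@le_trans _ _ (mean N.*2 (fun w => \sum_(x < X) \sum_(j < D.*2) (dyck w && G x j w)%:R))).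
    apply: le_mean => w sw.
    case: (boolP (dyck w)) => dw; last by rewrite mul0r; apply: sumr_ge0 => x _; apply: sumr_ge0.
    by rewrite mul1r; apply: tie_wpath_le => //; exact: ltW.
  rewrite mean_sum; apply: ler_sum => x _; rewrite mean_sum; apply: ler_sum => j _.
  have := @two_minima_bound R i1 (i2 - i1) (i3 - i2) (i4 - i3) l5 l6 S c x%:Z (x%:Z + j%:Z - D%:Z) S0 c0 hl.
  by rewrite sum6 !subnKC//; apply: le_trans; apply: le_mean => w _.
apply: le_trans bound _; rewrite !sumr_const !card_ord -mulrnA -[K *+ _]mulr_natl.
have XR : X%:R <= 2 * (S * b).
  have /andP[h _] := @truncn_itv R (S * b) (le_trans ler01 Sb1).
  by rewrite /X -natr1; clear -h Sb1; rlra.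
have DR : D.*2%:R <= 4 * (delta * S * b).
  have /andP[h _] := @truncn_itv R (delta * S * b) (le_trans ler01 Sd1).
  by rewrite -mul2n natrM /D -natr1; clear -h Sd1; rlra.
have lb := @dyck_lb R N S N0 S0 SE.
apply: (@le_trans _ _ (320 * b ^+ 2 / c ^+ 5 * delta * (S ^- 3 / 2))); last first.
  exact: (ler_wpM2l (ltW (mulr_gt0 C0 d0)) lb).
apply: (@le_trans _ _ (4 * (delta * S * b) * (2 * (S * b)) * K)).
  by rewrite ler_wpM2r// natrM; apply: ler_pM.
rewrite le_eqVlt; apply/orP; right; rewrite /K.
have -> : 4 * (delta * S * b) * (2 * (S * b)) * (16 / (c * S) ^+ 5) =
   128 * (delta * b ^+ 2 / c ^+ 5 * S ^- 3) by field; rewrite !lt0r_neq0.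
have -> : 320 * b ^+ 2 / c ^+ 5 * delta * (S ^- 3 / 2) = 160 * (delta * b ^+ 2 / c ^+ 5 * S ^- 3).
  by field; rewrite !lt0r_neq0.
by rewrite ltr_pM2r ?mulr_gt0 ?invr_gt0 ?exprn_gt0// ltr_nat.
Qed.

End Ties.

Lemma ratr_lt1 (R : realType) (x : rat) : (ratr x < 1 :> R) = (x < 1).
Proof. by have {1}<- : ratr 1 = 1 :> R; [exact: rmorph1|exact: ltr_rat]. Qed.

(** * Almost every excursion is a good path *)

Section GoodExcursion.
Context (d : measure_display) (T : measurableType d) (R : realType) (P : probability T R).
Variable e : T -> R -> R.
Hypothesis he : brownian_excursion P e.

Let tied (p q r s b : R) : set T :=
  [set w | min_level p q b (e w) - min_level r s b (e w) = 0] `&`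
  [set w | min_level p q b (e w) <= 1 / 2].

Lemma measurable_tied (p q r s b : R) : 0 <= p -> p <= q -> q <= 1 -> 0 <= r -> r <= s -> s <= 1 -> 0 < b ->
  measurable (tied p q r s b).
Proof.
move=> p0 pq q1 r0 rs s1 b0.
have m1 := measurable_excursion he (min_level_lip p0 pq q1 b0).
have m2 := measurable_excursion he (min_level_lip r0 rs s1 b0).
apply: measurableI.
  have m3 : measurable_fun setT (fun w => min_level p q b (e w) - min_level r s b (e w)) by exact: measurable_funB.
  by have := m3 measurableT [set 0] (measurable_set1 _); rewrite setTI.
have := m1 measurableT `]-oo, (1 / 2)]%classic (measurable_itv _); rewrite setTI.
by congr (measurable _); apply/seteqP; split => w /=; rewrite in_itv.
Qed.

(** On this event [tie] equals 1 whatever [delta] is, and [excursion_liminf] carries the bound for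
    Dyck words over to [e]: the probability is at most [C * delta]. *)
Lemma tied_null (p q r s b : R) : 0 < p -> p < q -> q < r -> r < s -> s < 1 -> 0 < b ->
  P (tied p q r s b) = 0%E.
Proof.
move=> p0 pq qr rs s1 b0; have [C C0 hC] := tie_dyck_bound p0 pq qr rs s1 b0.
have mA : measurable (tied p q r s b) by apply: measurable_tied => //; rlra.
have key (delta : R) : 0 < delta -> delta <= 1 / 8 -> pr P (tied p q r s b) <= C * delta.
  move=> d0 d8; have [N1 hN1] := hC _ d0 d8.
  have lt : lip (2 * b^-1 / delta + 4 * b^-1) (tie p q r s b delta) by apply: tie_lip => //; rlra.
  have ut := @tie_unit R p q r s b delta.
  apply: (@le_trans _ _ (ex P (fun w => tie p q r s b delta (e w)))).
    rewrite -ex_indic//; apply: le_ex; [apply: bm_indic => //|exact: (bm_excursion he lt ut)|move=> w].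
    rewrite indicE; case: (boolP (w \in _)) => [|_]; last by have /andP[] := ut (e w).
    rewrite inE => -[/= h1 h2]; rewrite /tie h1 normr0 mul0r subr0 !clamp1 ?mulr1//.
    by rlra.
  apply/ler_addgt0Pr => eps e0; have [N0 hN0] := excursion_liminf he lt ut e0.
  pose N := maxn 1 (maxn N0 N1).
  have := le_trans (hN0 N ltac:(by rewrite /N !leq_max leqnn !orbT)) (hN1 N ltac:(by rewrite /N !leq_max leqnn !orbT)).
  have N00 : (0 < N)%N by rewrite /N leq_max.
  have n0 : 0 < N.*2%:R :> R by rewrite ltr0n double_gt0.
  have S0 : 0 < Num.sqrt N.*2%:R :> R by rewrite sqrtr_gt0.
  have lb := @dyck_lb R N _ N00 S0 (sqr_sqrtr (ltW n0)).
  rewrite ler_pM2r; first by rewrite lerBlDr.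
  by apply: lt_le_trans lb; rewrite divr_gt0// invr_gt0 exprn_gt0.
have z : pr P (tied p q r s b) = 0.
  apply/eqP; rewrite eq_le; apply/andP; split; last by rewrite /pr fine_ge0.
  rewrite leNgt; apply/negP => h; pose dl : R := Num.min (1 / 8) (pr P (tied p q r s b) / (2 * C)).
  have d0 : 0 < dl by rewrite lt_min !divr_gt0// mulr_gt0.
  have := key dl d0 ltac:(by rewrite ge_min lexx).
  have : C * dl <= C * (pr P (tied p q r s b) / (2 * C)) by rewrite ler_pM2l// ge_min lexx orbT.
  have -> : C * (pr P (tied p q r s b) / (2 * C)) = pr P (tied p q r s b) / 2 by field; rewrite lt0r_neq0.
  by rlra.
by rewrite -[LHS]fineK ?fin_num_measure// -/(pr P _) z.
Qed.

Lemma min_level_at (g : R -> R) (p q b a : R) : p <= a <= q -> 0 < b ->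
  (forall t, p <= t <= q -> g a <= g t) -> min_level p q b g = clamp (g a / b).
Proof.
move=> apq b0 h; have pq : p <= q by case/andP: apq => h1 h2; exact: le_trans h2.
apply/eqP; rewrite eq_le min_level_le//=; apply: min_level_ge => // t tpq.
by apply: clamp_homo; rewrite ler_pM2r ?invr_gt0// h.
Qed.

Lemma excursion_good : exists G : set T,
  [/\ measurable G, P G = 1%E & forall w, G w -> good_path (e w)].
Proof.
(* Rational windows and integer scales make the exceptional set a countable union of null events. *)
pose ok (z : rat * rat * (rat * rat) * nat) : bool :=
  [&& 0 < z.1.1.1, z.1.1.1 < z.1.1.2, z.1.1.2 < z.1.2.1, z.1.2.1 < z.1.2.2, z.1.2.2 < 1 & (0 < z.2)%N].
pose F (z : rat * rat * (rat * rat) * nat) : set T := if ok z then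
  tied (ratr z.1.1.1) (ratr z.1.1.2) (ratr z.1.2.1) (ratr z.1.2.2) z.2%:R else set0.
pose A (k : nat) : set T := if unpickle k is Some z then F z else set0.
have hF z : measurable (F z) /\ P (F z) = 0%E.
  rewrite /F; case: ifPn => [/and5P[h1 h2 h3 h4 /andP[h5 h6]]|_]; last by split => //; rewrite measure0.
  have h1' : 0 < ratr z.1.1.1 :> R by rewrite ltr0q.
  have h5' : ratr z.1.2.2 < 1 :> R by rewrite ratr_lt1.
  have h2' : ratr z.1.1.1 < ratr z.1.1.2 :> R by rewrite ltr_rat.
  have h3' : ratr z.1.1.2 < ratr z.1.2.1 :> R by rewrite ltr_rat.
  have h4' : ratr z.1.2.1 < ratr z.1.2.2 :> R by rewrite ltr_rat.
  have h6' : 0 < z.2%:R :> R by rewrite ltr0n.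
  split; last exact: tied_null.
  exact: (measurable_tied (ltW h1') (ltW h2') (ltW (lt_trans h3' (lt_trans h4' h5')))
    (ltW (lt_trans h1' (lt_trans h2' h3'))) (ltW h4') (ltW h5') h6').
have hA k : measurable (A k) /\ P (A k) = 0%E.
  by rewrite /A; case: unpickle => [z|]; [exact: hF|split => //; rewrite measure0].
have FA z w : F z w -> (\bigcup_k A k) w.
  by move=> Fz; exists (pickle z); [exact: I|rewrite /A pickleK].
clearbody A; have mU : measurable (\bigcup_k A k) by apply: bigcup_measurable => k _; have [] := hA k.
have PU : P (\bigcup_k A k) = 0%E.
  apply: measure_negligible => //; apply: negligible_bigcup => k.
  by have [m0 p0] := hA k; exists (A k); split.
exists (~` \bigcup_k A k); split; first exact: measurableC.
  by rewrite probability_setC// PU sube0.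
have eg w : excursion (e w).
  have [e0 e1] := excursion_ends he w; split => //; first exact: excursion_cont01 he w.
  by have [h _ _] := he; have [_ _ _ ?] := h w.
move=> w Gw; split => // a b r r0 ar ab br ga gb gab.
have [p /itvP p1] := @rat_in_itvoo R (a - r) a ltac:(rlra).
have [q /itvP q1] := @rat_in_itvoo R a (a + r) ltac:(rlra).
have [p' /itvP p2] := @rat_in_itvoo R (b - r) b ltac:(rlra).
have [q' /itvP q2] := @rat_in_itvoo R b (b + r) ltac:(rlra).
have pu : ratr p < a by rewrite p1.
have ql : a < ratr q by rewrite q1. have qu : ratr q < a + r by rewrite q1.
have pl' : b - r < ratr p' by rewrite p2. have pu' : ratr p' < b by rewrite p2.
have ql' : b < ratr q' by rewrite q2. have qu' : ratr q' < b + r by rewrite q2.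
have {}pl : a - r < ratr p by rewrite p1.
have [_ _ _ ep] := eg w.
have v0 : 0 < e w a by apply: ep; apply/andP; split; rlra.
(* Larger than twice the common value, so that the rescaled minimum is below 1/2 and is not
   clamped. *)
pose B := (Num.truncn (2 * e w a)).+1.
have B0 : 0 < B%:R :> R by rewrite ltr0n.
have vB : 2 * e w a < B%:R by exact: truncnS_gt.
have m1 : min_level (ratr p) (ratr q) B%:R (e w) = clamp (e w a / B%:R).
  apply: min_level_at => //; first by apply/andP; split; rlra.
  by move=> t /andP[t1 t2]; apply: ga; rewrite ler_norml; apply/andP; split; rlra.
have m2 : min_level (ratr p') (ratr q') B%:R (e w) = clamp (e w a / B%:R).
  rewrite gab; apply: min_level_at => //; first by apply/andP; split; rlra.
  by move=> t /andP[t1 t2]; apply: gb; rewrite ler_norml; apply/andP; split; rlra.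
apply: Gw; apply: (FA (p, q, (p', q'), B)); rewrite /F.
have -> /= : ok (p, q, (p', q'), B).
  rewrite /ok /= -(ltr0q R) -(ratr_lt1 R) -!(ltr_rat R).
  by apply/and5P; split; [rlra|rlra|rlra|rlra|apply/andP; split => //; rlra].
split; rewrite /= ?m1 ?m2 ?subrr//.
rewrite clamp_id; first by rewrite ler_pdivrMr//; rlra.
by rewrite divr_ge0 ?(ltW v0)//= ler_pdivrMr//; rlra.
Qed.

End GoodExcursion.

(** * The discrete process *)

Lemma cords_of_seq_limit_closed (R : realType) (s : seq (R * R)) :
  limit_closed (fun u v : R => (u, v) \in s).
Proof.
move=> a b h; apply: contrapT => /negP ns.
have [| |r r0 hr] := @seq_min_pos R _ s (fun p r => ~ box a b (r / 2) p.1 p.2).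
- move=> p x y hx y0 yx bx; apply: hx; case: bx => h1 h2.
  by split; [apply: le_trans h1 _|apply: le_trans h2 _]; rewrite ler_pM2r.
- move=> [u v] ps; exists (Num.max `|u - a| `|v - b|).
    rewrite lt_max !normr_gt0 !subr_eq0; apply: contraT; rewrite negb_or !negbK => /andP[/eqP ua /eqP vb].
    by rewrite -ua -vb ps in ns.
  move=> [/= h1 h2]; have pos (x : R) : x <= x / 2 -> 0 <= x -> x = 0 by move=> ? ?; lra.
  have u0 : `|u - a| <= Num.max `|u - a| `|v - b| by rewrite le_max lexx.
  have v0 : `|v - b| <= Num.max `|u - a| `|v - b| by rewrite le_max lexx orbT.
  have m0 : Num.max `|u - a| `|v - b| = 0.
    by apply: pos; [rewrite ge_max h1 h2|apply: le_trans u0].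
  move: u0 v0; rewrite m0 !normr_le0 !subr_eq0 => /eqP ua /eqP vb.
  by rewrite -ua -vb ps in ns.
- have [|u [v [uvs bx]]] := h (r / 2); first by rewrite divr_gt0.
  exact: hr uvs bx.
Qed.

(** * The lamination process of a Dyck word *)

Section WordProcess.
Variables (R : realType) (N : nat) (w : seq bool).
Hypotheses (N0 : (0 < N)%N) (sw : size w = N.*2) (dw : dyck w).
Implicit Types (u v s t eps : R).
Notation tau := (factorisation_of N w).
Notation pos := (label_pos R N w).

Lemma passage_exists p : (p < N.*2)%N -> nth false w p -> exists q, first_passage 0 (drop p.+1 w) q.
Proof.
move=> pN np; apply: first_passage_exists; have /andP[_ /eqP hw] := dw.
have pw : (p < size w)%N by rewrite sw.
have := height_cat (take p.+1 w) (drop p.+1 w); rewrite cat_take_drop hw.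
rewrite (take_nth false pw) -cats1 height_cat /= np /step addr0.
have := word_height_ge0 dw p.
by move: (height _) (height _) => y z; lia.
Qed.

Lemma chord_labels p q (i : 'I_N.+1.-1) : (p < N.*2)%N -> nth false w p ->
  first_passage 0 (drop p.+1 w) q -> count id (drop p.+1 w) = i ->
  nat_of_ord (tnth tau i).1 = count negb (take p w) /\
  nat_of_ord (tnth tau i).2 = count negb (take (p.+1 + q) w).
Proof.
move=> pN np fp iE; have pw : (p < size w)%N by rewrite sw.
have E := proc_nth 0 pw np fp; rewrite -(transpositions_proc sw dw) -(nat_pairs_factorisation sw dw) iE in E.
rewrite (nth_map (ord0, ord0)) ?size_tuple ?ltn_ord// -(tnth_nth) !add0n in E.
by case: E.
Qed.

Lemma count_drop_lt p : (p < N.*2)%N -> nth false w p -> (count id (drop p.+1 w) < N.+1.-1)%N.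
Proof.
move=> pN np; have pw : (p < size w)%N by rewrite sw.
have [_ cN] := count_word sw dw; rewrite /= -[ltnRHS]cN -{2}(cat_take_drop p w) count_cat (drop_nth false pw) /= np.
by rewrite addnA addn1 addSn ltnS leq_addl.
Qed.

Definition word_cords_until (k : nat) u v : Prop := exists p q,
  [/\ (p < N.*2)%N, nth false w p, first_passage 0 (drop p.+1 w) q &
     [/\ u = pos p, v = pos (p.+1 + q) & (count id (drop p.+1 w) < k)%N]].

Lemma word_cords_untilE k u v : word_cords_until k u v <-> exists2 i : 'I_N.+1.-1, (i < k)%N &
  u = (tnth tau i).1.+1%:R / N.+1%:R /\ v = (tnth tau i).2.+1%:R / N.+1%:R.
Proof.
split.
  move=> [p [q [pN np fp [-> -> pk]]]]; exists (Ordinal (count_drop_lt pN np)) => //.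
  by have [-> ->] := @chord_labels p q (Ordinal (count_drop_lt pN np)) pN np fp erefl.
move=> [i ik [-> ->]]; have [_ cN] := count_word sw dw.
have [|p [pw np iE]] := @count_drop_surj w i; first by rewrite cN; case: i {ik}.
have pN : (p < N.*2)%N by rewrite -sw.
have [q fp] := passage_exists pN np.
have [-> ->] := chord_labels pN np fp iE.
by exists p, q; split; rewrite // iE.
Qed.

Lemma factorisation_laminationE k : (0 < k)%N ->
  @factorisation_lamination R N.+1 tau k = cord_union (word_cords_until k).
Proof.
case: k => // k _; apply/seteqP; split => z.
  move=> [i /= ik zc]; exists ((tnth tau i).1.+1%:R / N.+1%:R), ((tnth tau i).2.+1%:R / N.+1%:R).
  by split => //; apply/word_cords_untilE; exists i.
by move=> [u [v [/word_cords_untilE[i ik [-> ->]] zc]]]; exists i.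
Qed.

Lemma word_cords_noncrossing k : noncrossing (word_cords_until k).
Proof.
have nest p q p' q' : (p < N.*2)%N -> nth false w p -> first_passage 0 (drop p.+1 w) q ->
    (p' < N.*2)%N -> nth false w p' -> first_passage 0 (drop p'.+1 w) q' -> (p <= p')%N ->
    (p.+1 + q <= p')%N \/ (p'.+1 + q' <= p.+1 + q)%N.
  move=> pN np fp pN' np' fp' pp.
  have [h|h] := leqP (p.+1 + q) p'; [by left|right].
  have [_ hq hj] := passage_height N0 sw dw pN np fp.
  have hpp : height (take p w) <= height (take p' w) by apply: hj; rewrite pp ltnW.
  rewrite leqNgt; apply/negP => lt; case: fp' => _ _ hj'.
  have := hj' (p.+1 + q - p'.+1)%N; rewrite ltn_subLR// => /(_ lt).
  have := height_cat (take p'.+1 w) (take (p.+1 + q - p'.+1) (drop p'.+1 w)).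
  rewrite -takeD subnKC// hq => E; move: E hpp.
  rewrite [take p'.+1 w](take_nth false) ?sw// -cats1 height_cat np' /= /step addr0.
  by move: (height _) (height _) (height _) => x y z; lia.
move=> u v u' v' [p [q [pN np fp [-> -> _]]]] [p' [q' [pN' np' fp' [-> -> _]]]].
have [pp|/ltnW pp] := leqP p p'.
  have [h|h] := nest _ _ _ _ pN np fp pN' np' fp' pp; first by apply: Or41; exact: label_pos_le.
  by apply: Or43; split; exact: label_pos_le.
have [h|h] := nest _ _ _ _ pN' np' fp' pN np fp pp; first by apply: Or42; exact: label_pos_le.
by apply: Or44; split; exact: label_pos_le.
Qed.

Lemma factorisation_lamination_lamination k : is_lamination (@factorisation_lamination R N.+1 tau k).
Proof.
case: k => [|k].
  have -> : @factorisation_lamination R N.+1 tau 0 = cord_union (fun u v => (u, v) \in [:: (0, 0)]).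
    apply/seteqP; split => z; first by move=> zc; exists 0, 0; rewrite inE.
    by move=> [u [v []]]; rewrite inE => /eqP[-> ->].
  apply: cord_union_lamination; [by exists 0, 0; rewrite inE| |exact: cords_of_seq_limit_closed|].
    by move=> u v; rewrite inE => /eqP[-> ->]; split => //; exact: ler01.
  by move=> u v u' v'; rewrite !inE => /eqP[-> ->] /eqP[-> ->]; apply: Or41.
rewrite factorisation_laminationE//; apply: cord_union_lamination.
- have iN : (0 < N.+1.-1)%N by [].
  exists ((tnth tau (Ordinal iN)).1.+1%:R / N.+1%:R), ((tnth tau (Ordinal iN)).2.+1%:R / N.+1%:R).
  by apply/word_cords_untilE; exists (Ordinal iN).
- move=> u v [p [q [pN np fp [-> -> _]]]].
  have /andP[h1 _] := label_pos01 R sw dw p; have /andP[_ h2] := label_pos01 R sw dw (p.+1 + q).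
  by split => //; apply: label_pos_le; rewrite addSnnS leq_addr.
- have -> : word_cords_until k.+1 = (fun u v => (u, v) \in
      [seq ((tnth tau i).1.+1%:R / N.+1%:R, (tnth tau i).2.+1%:R / N.+1%:R) | i <- [seq i : 'I_N.+1.-1 <- enum 'I_N.+1.-1 | (i < k.+1)%N]]).
    apply/funext => u; apply/funext => v; apply/propext; rewrite word_cords_untilE; split.
      by move=> [i ik [-> ->]]; apply/mapP; exists i => //; rewrite mem_filter ik mem_enum.
    by case/mapP => i; rewrite mem_filter => /andP[ik _] [-> ->]; exists i.
  exact: cords_of_seq_limit_closed.
- exact: word_cords_noncrossing.
Qed.

Lemma factorisation_process_cadlag : is_cadlag (@factorisation_process R N.+1 tau).
Proof.
have n0 : 0 < N.+1%:R :> R by [].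
split.
- by move=> t _; exact: factorisation_lamination_lamination.
- move=> t /andP[t0 t1]; apply: hausdorff_cvg0 => eps e0.
  have nt0 : 0 <= N.+1%:R * t by rewrite mulr_ge0.
  have /andP[a1 a2] := truncn_itv nt0; set k := Num.truncn _ in a1 a2.
  near=> s; rewrite /factorisation_process (_ : Num.truncn (N.+1%:R * s) = k) ?hausdorff_refl ?(ltW e0)//.
  have ts : t < s by near: s; exact: nbhs_right_gt.
  apply: truncn_def; apply/andP; split; first by apply: le_trans a1 _; rewrite ler_pM2l// ltW.
  rewrite mulrC -ltr_pdivlMr//; near: s; apply: nbhs_right_lt.
  by rewrite ltr_pdivlMr// mulrC.
- move=> t /andP[t0 t1].
  have nt0 : 0 < N.+1%:R * t by rewrite mulr_gt0.
  (* The index of the left limit at [t]; it is one less than the truncation when [(N + 1) * t] is an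
     integer. *)
  have [m /andP[a1 a2]] : exists m : nat, m%:R < N.+1%:R * t <= m.+1%:R.
    have /andP[a1 a2] := truncn_itv (ltW nt0); move: a1; rewrite le_eqVlt => /predU1P[E|lt].
      case: (Num.truncn _) E a2 => [E|m E _]; first by rewrite -E ltxx in nt0.
      by exists m; rewrite E lexx -E ltr_nat ltnSn.
    by exists (Num.truncn (N.+1%:R * t)); rewrite lt ltW.
  exists (@factorisation_lamination R N.+1 tau m); first exact: factorisation_lamination_lamination.
  apply: hausdorff_cvg0 => eps e0.
  near=> s; rewrite /factorisation_process (_ : Num.truncn (N.+1%:R * s) = m) ?hausdorff_refl ?(ltW e0)//.
  have st : s < t by near: s; exact: nbhs_left_lt.
  apply: truncn_def; apply/andP; split; last by apply: lt_le_trans a2; rewrite ltr_pM2l.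
  apply: ltW; rewrite [ltRHS]mulrC -ltr_pdivrMr//; near: s; apply: nbhs_left_gt.
  by rewrite ltr_pdivrMr// mulrC.
Unshelve. all: by end_near. Qed.

Lemma factorisation_process_close g delta t : adapted g delta (@word_cords R N w) -> 0 <= t <= 1 ->
  @factorisation_process R N.+1 tau t `<=` timed_union (@word_cords R N w) t /\
  timed_union (@word_cords R N w) t `<=`
    thickening (4 * pi * (delta + N.+1%:R^-1)) (@factorisation_process R N.+1 tau t).
Proof.
move=> [ad1 _ _ _ _] /andP[t0 t1]; have n0 : 0 < N.+1%:R :> R by [].
have nt0 : 0 <= N.+1%:R * t by rewrite mulr_ge0.
have timeE p : ((count id (drop p.+1 w)).+1%:R / N.+1%:R <= t) =
    (count id (drop p.+1 w) < Num.truncn (N.+1%:R * t))%N.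
  by rewrite ler_pdivrMr// mulrC -truncn_ge_nat.
have d0 : 0 <= delta.
  have [|_ _ h _] := ad1 1 1 0; [by right|exact: le_trans (normr_ge0 _) h].
have dn0 : 0 <= delta + N.+1%:R^-1 by rewrite addr_ge0.
rewrite /factorisation_process; case kE: (Num.truncn (N.+1%:R * t)) timeE => [|k] timeE.
  (* The parameters 0 and 1 denote the same point of the circle. *)
  have c01 : @factorisation_lamination R N.+1 tau 0 = cord 1 1 by rewrite /= /cord circle_point01.
  rewrite c01; split => z.
    by move=> zc; exists 1, 1; split => //; exists 0 => //; right.
  move=> [u [v [[s st [[p [q [_ _ _ [_ _ sE]]]]|[-> -> _]]] zc]]].
    by have := timeE p; rewrite -sE st.
  by exists z => //; rewrite subrr normr0 lecR !mulr_ge0// pi_ge0.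
rewrite factorisation_laminationE//; split.
  move=> z [u [v [[p [q [pN np fp [uE vE ck]]]] zc]]]; exists u, v; split => //.
  exists ((count id (drop p.+1 w)).+1%:R / N.+1%:R); first by rewrite timeE.
  by left; exists p, q.
apply: cord_union_thickening => u v [s st [[p [q [pN np fp [uE vE sE]]]]|[-> -> _]]].
  exists u, v; split; last by split; rewrite subrr normr0.
  by exists p, q; split => //; split => //; rewrite -timeE -sE.
(* The point cord at 1 is approximated by the cord of the first transposition: it appears at time
   [1 / (N + 1)], so by the first clause of [adapted] its left end is close to 1. *)
have [_ cN] := count_word sw dw.
have [|p [pw np iE]] := @count_drop_surj w 0; first by rewrite cN.
have pN : (p < N.*2)%N by rewrite -sw.
have [q fp] := passage_exists pN np.
exists (pos p), (pos (p.+1 + q)); split; first by exists p, q; split; rewrite // iE.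
have Lp : word_cords N w (pos p) (pos (p.+1 + q)) (1%:R / N.+1%:R).
  by left; exists p, q; rewrite iE; split.
have [_ _ su [_ uv v1 _ _]] := ad1 _ _ _ Lp.
move: su; rewrite div1r ler_norml => /andP[h _].
move: h uv v1 dn0; move: (pos p) (pos _) (N.+1%:R^-1) => a b c h uv v1 dn0.
by split; rewrite ler_norml; apply/andP; split; lra.
Qed.

End WordProcess.

(** * Convergence in distribution *)

Section PathFunctionals.
Variable R : realType.
Implicit Types (g h : R -> R) (H : (R -> R) -> R) (E : set ((R -> R) -> R)).

(* The cap keeps the supremum meaningful for unbounded [g], on which
   functionals are total. *)
Definition capped_dist h g : R := sup [set Num.min 1 `|g t - h t| | t in `[0, 1]].

Let zero01 : (`[0, 1]%classic : set R) 0. Proof. by rewrite /= in_itv /= lexx ler01. Qed.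

Lemma capped_dist_ub h g t : 0 <= t <= 1 -> Num.min 1 `|g t - h t| <= capped_dist h g.
Proof.
move=> t01; apply: (@sup_image_ub _ _ _ (fun t => Num.min 1 `|g t - h t|)).
  by rewrite /= in_itv.
by move=> i _; rewrite ge_min lexx.
Qed.

Lemma capped_dist_unit h : unit_valued (capped_dist h).
Proof.
move=> g; apply/andP; split.
  apply: le_trans (capped_dist_ub h g (t := 0) _); last by rewrite lexx ler01.
  by rewrite le_min ler01 normr_ge0.
by apply: sup_image_le => [|t _]; [by exists 0|rewrite ge_min lexx].
Qed.

Lemma capped_dist_lip h : lip 1 (capped_dist h).
Proof.
move=> f g c fg; rewrite mul1r.
have aux f' g' : sup_close f' g' c -> capped_dist h f' <= capped_dist h g' + c.
  move=> fg'; have c0 : 0 <= c by apply: le_trans (fg' 0 _); rewrite ?normr_ge0 ?lexx ?ler01.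
  apply: le_sup_image; [by exists 0|by move=> t _; rewrite ge_min lexx|].
  move=> t; rewrite /= in_itv/= => /fg' ht.
  have k : `|f' t - h t| <= `|g' t - h t| + c.
    have -> : f' t - h t = (g' t - h t) + (f' t - g' t) by ring.
    by rewrite (le_trans (ler_normD _ _))// lerD2l.
  by rewrite addr_minl le_min !ge_min; apply/andP; split; apply/orP; [left; rewrite lerDl|right].
have gf : sup_close g f c by move=> t t01; rewrite distrC fg.
by have h1 := aux _ _ fg; have h2 := aux _ _ gf; rewrite ler_norml; apply/andP; split; lra.
Qed.

Lemma capped_distxx g : capped_dist g g = 0.
Proof.
apply/eqP; rewrite eq_le; have /andP[-> _] := capped_dist_unit g g; rewrite andbT.
by apply: sup_image_le => [|t _]; [by exists 0|rewrite subrr normr0 ge_min lexx orbT].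
Qed.

Lemma capped_dist_close h g d : capped_dist h g < Num.min 1 d -> sup_close g h d.
Proof.
move=> lt t t01; have := le_lt_trans (capped_dist_ub h g t01) lt.
by rewrite lt_min !gt_min ltxx /= => /andP[h1 /orP[h2|]]; [lra|exact: ltW].
Qed.

(** The value 1 keeps the set nonempty when [E] is empty. *)
Definition inf_functional E g : R := inf [set x | x = 1 \/ exists2 a, E a & x = a g].

Section Inf.
Variables (L : R) (E : set ((R -> R) -> R)).
Hypothesis L0 : 0 <= L.
Hypothesis EL : forall a, E a -> lip L a.
Hypothesis E1 : forall a, E a -> unit_valued a.

Let lb0 g : lbound [set x | x = 1 \/ exists2 a, E a & x = a g] 0.
Proof. by move=> x [->|[a Ea ->]]; [exact: ler01|have /andP[] := E1 Ea g]. Qed.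

Lemma inf_functional_le1 g : inf_functional E g <= 1.
Proof. by apply: ge_inf; [exists 0; exact: lb0|left]. Qed.

Lemma inf_functional_le a g : E a -> inf_functional E g <= a g.
Proof. by move=> Ea; apply: ge_inf; [exists 0; exact: lb0|right; exists a]. Qed.

Lemma inf_functional_ge c g : c <= 1 -> (forall a, E a -> c <= a g) -> c <= inf_functional E g.
Proof.
move=> c1 h; apply: lb_le_inf; first by exists 1; left.
by move=> x [->//|[a /h ca ->]].
Qed.

Lemma inf_functional_unit : unit_valued (inf_functional E).
Proof.
move=> g; rewrite inf_functional_le1 andbT.
by apply: inf_functional_ge => // a Ea; have /andP[] := E1 Ea g.
Qed.

Lemma inf_functional_lip : lip L (inf_functional E).
Proof.
move=> f g c fg.
have aux f' g' : sup_close f' g' c -> inf_functional E f' - L * c <= inf_functional E g'.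
  move=> fg'; have c0 : 0 <= c by apply: le_trans (fg' 0 _); rewrite ?normr_ge0 ?lexx ?ler01.
  have Lc : 0 <= L * c by rewrite mulr_ge0.
  apply: inf_functional_ge; first by have := inf_functional_le1 f'; lra.
  move=> a Ea; have := inf_functional_le f' Ea; have := EL Ea fg'.
  by rewrite ler_norml => /andP[_]; lra.
have gf : sup_close g f c by move=> t t01; rewrite distrC fg.
by have h1 := aux _ _ fg; have h2 := aux _ _ gf; rewrite ler_norml; apply/andP; split; lra.
Qed.

End Inf.

Lemma cords_timed_union g t : timed_union (cords g) t = lamination_of g t.
Proof.
rewrite lamination_ofE; apply/seteqP; split => z [u [v [h zc]]]; exists u, v; split => //.
  by case: h => s st [c sE]; split => //; lra.
by case: h => c tu; exists (1 - u); [lra|split].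
Qed.

Lemma thickening_refl (A : set R[i]%C) (eps : R) : 0 <= eps -> A `<=` thickening eps A.
Proof. by move=> e0 z Az; exists z => //; rewrite subrr normr0 lecR. Qed.

Lemma lamination_continuous g eps : good_path g -> 0 < eps -> exists2 d : R, 0 < d &
  forall h, excursion h -> sup_close g h d -> skorokhod_dist (lamination_of g) (lamination_of h) <= eps.
Proof.
move=> gg e0; have [eg _] := gg; have [delta d0 hd] := adapted_skorokhod gg e0.
exists (delta / 2) => [|h eh gh]; first by rewrite divr_gt0.
apply: (hd (cords h)); first exact: adapted_close.
by move=> t _; rewrite cords_timed_union; split => //; apply: thickening_refl; rewrite divr_ge0// ltW.
Qed.

End PathFunctionals.

(** * Measurability of the random lamination process *)

Section RandomLamination.
Variable R : realType.
Notation path := (R -> set R[i]%C).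

Lemma cst_cadlag (A : set R[i]%C) : is_lamination A -> is_cadlag (fun=> A).
Proof.
move=> lA; split => // t _; last exists A => //.
  by apply: hausdorff_cvg0 => eps e0; apply: nearW => s; rewrite hausdorff_refl ltW.
by apply: hausdorff_cvg0 => eps e0; apply: nearW => s; rewrite hausdorff_refl ltW.
Qed.

Lemma point_lamination : is_lamination (cord 0 0 : set R[i]%C).
Proof.
have := @factorisation_lamination_lamination R 1 [:: true; false] isT erefl _ 0; apply.
by rewrite /dyck; apply/andP; split => //; apply/nonneg_fromP => -[|[|[|j]]].
Qed.

Lemma random_element_open (d : measure_display) (T : measurableType d) (U : Type) (S : set U)
  (dist : U -> U -> R) (Y : T -> U) : (forall w, S (Y w)) ->
  (forall V, metric_open S dist V -> measurable (Y @^-1` V)) -> random_element S dist Y.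
Proof.
move=> SY oY; split => // V; apply: (@smallest_sub _ (sigma_algebra S) _ [set V | measurable (Y @^-1` V)]) => //.
split => /=.
- by rewrite preimage_set0.
- move=> A mA; rewrite (_ : _ @^-1` _ = ~` (Y @^-1` A)); first exact: measurableC.
  by apply/seteqP; split => w /=; [case|split].
- by move=> A mA; rewrite preimage_bigcup; apply: bigcup_measurable.
Qed.

Lemma bounded_continuous_measurable (d : measure_display) (T : measurableType d) (U : Type) (S : set U)
  (dist : U -> U -> R) (Y : T -> U) F : random_element S dist Y -> bounded_continuous S dist F ->
  bounded_measurable (fun w => F (Y w)).
Proof.
move=> [SY mY] [[M FM] cF]; split; last by exists M => w; exact: FM.
apply: (measurability _ (RGenOInfty.measurableE R)) => _ [_ [x ->] <-]; rewrite setTI.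
rewrite (_ : _ @^-1` _ = Y @^-1` [set y | S y /\ x < F y]).
  apply: mY; apply: sub_gen_smallest; split; first by move=> y [].
  move=> y [Sy xy]; have [delta d0 hd] := cF y Sy (F y - x) ltac:(by rewrite subr_gt0).
  exists delta => // z Sz yz; split => //.
  by have := hd z Sz yz; rewrite ltr_norml => /andP[_]; lra.
apply/seteqP; split => w /=; rewrite in_itv/= andbT; first by split.
by case.
Qed.

Section Excursion.
Context (d : measure_display) (T : measurableType d) (P : probability T R).
Variable e : T -> R -> R.
Hypothesis he : brownian_excursion P e.
Variable G : set T.
Hypotheses (mG : measurable G) (PG : P G = 1%E) (GG : forall w, G w -> good_path (e w)).

(** Regularity of [lamination_of (e w)] is known on the almost sure event [G]; elsewhere a constant
    path is substituted. *)
Definition regular_lamination w : path :=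
  if `[< G w >] then lamination_of (e w) else fun=> cord 0 0.

Lemma regular_lamination_cadlag w : is_cadlag (regular_lamination w).
Proof.
rewrite /regular_lamination; case: asboolP => [/GG gw|_]; first exact: lamination_of_cadlag.
exact: cst_cadlag point_lamination.
Qed.

(** Within [G] the preimage of [V] is the event that [e w] has positive distance to the good paths
    that are sent outside [V]. This infimum over an uncountable family is Lipschitz in the path,
    hence measurable. *)
Lemma regular_lamination_open V : metric_open (@is_cadlag R) (@skorokhod_dist R) V ->
  measurable (regular_lamination @^-1` V).
Proof.
move=> [VS oV].
pose E : set ((R -> R) -> R) := [set a | exists h, [/\ good_path h, ~ V (lamination_of h) & a = capped_dist h]].
have EL a : E a -> lip 1 a by move=> [h [_ _ ->]]; exact: capped_dist_lip.
have E1 a : E a -> unit_valued a by move=> [h [_ _ ->]]; exact: capped_dist_unit.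
have mH := measurable_excursion he (inf_functional_lip ler01 EL E1).
have -> : regular_lamination @^-1` V = (G `&` [set w | 0 < inf_functional E (e w)]) `|`
    (~` G `&` [set w | V (fun=> cord 0 0)]).
  apply/seteqP; split => w; rewrite /regular_lamination /=.
    case: asboolP => [Gw|nG] Vw; [left|by right]; split => //.
    have gw := GG Gw; have [delta d0 hd] := oV _ Vw.
    have [d1 d10 hd1] := lamination_continuous gw (eps := delta / 2) ltac:(by rewrite divr_gt0).
    apply: (@lt_le_trans _ _ (Num.min 1 d1)); first by rewrite lt_min ltr01.
    apply: inf_functional_ge; first by rewrite ge_min lexx.
    move=> a [h [gh nV ->]]; rewrite leNgt; apply/negP => /capped_dist_close cl.
    apply: nV; apply: hd; first exact: lamination_of_cadlag.
    by apply: le_lt_trans (hd1 h _ cl) _; [case: gh|rewrite ltr_pdivrMr// ltr_pMr// ltr1n].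
  move=> [[Gw lt]|[nG Vc]]; case: asboolP => // _; apply: contrapT => nV.
  have Ea : E (capped_dist (e w)) by exists (e w); split => //; exact: GG.
  by have := inf_functional_le E1 (e w) Ea; rewrite capped_distxx leNgt lt.
apply: measurableU; apply: measurableI => //.
- have := mH measurableT `]0, +oo[%classic (measurable_itv _); rewrite setTI.
  by congr (measurable _); apply/seteqP; split => w /=; rewrite in_itv /= andbT.
- exact: measurableC.
- by have [Vc|nV] := pselect (V (fun=> cord 0 0));
    [rewrite (_ : [set _ | _] = setT)//|rewrite (_ : [set _ | _] = set0)//]; apply/seteqP; split.
Qed.

Lemma regular_lamination_version : ae_version (@is_cadlag R) (@skorokhod_dist R) P
  (fun w => lamination_of (e w)) regular_lamination.
Proof.
split.
  by apply: random_element_open; [exact: regular_lamination_cadlag|exact: regular_lamination_open].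
exists (~` G); split; first exact: measurableC.
  by rewrite probability_setC// PG subee.
move=> w /= h Gw; apply: h; rewrite /regular_lamination; by case: asboolP.
Qed.

End Excursion.
End RandomLamination.

(** * Uniform random variables on a finite set *)

Section UniformVariable.
Context (d : measure_display) (T : measurableType d) (R : realType) (P : probability T R).
Variables (U : finType) (A : pred U) (X : T -> U).
Hypothesis hX : uniform_on P A X.

Lemma uniform_measurable (E : set U) : measurable (X @^-1` E).
Proof.
rewrite (_ : X @^-1` E = \bigcup_(x in E) (X @^-1` [set x])).
  by apply: fin_bigcup_measurable => [|x _]; [exact: finite_finset|have [] := hX x].
by apply/seteqP; split => w /= => [Ew|[x Ex /= ->]] //; exists (X w).
Qed.

Lemma uniform_null (E : set U) : (forall x, A x -> ~ E x) -> P (X @^-1` E) = 0%E.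
Proof.
move=> AE; apply: measure_negligible; first exact: uniform_measurable.
have -> : X @^-1` E = \bigcup_k (if unpickle k is Some x then if `[< E x >] then X @^-1` [set x] else set0 else set0).
  apply/seteqP; split => w /=.
    by move=> Ew; exists (pickle (X w)) => //; rewrite pickleK; case: asboolP.
  by move=> [k _]; case: unpickle => [x|//]; case: asboolP => // Ex /= ->.
apply: negligible_bigcup => k; case: unpickle => [x|]; last exact: negligible_set0.
case: asboolP => [Ex|_]; last exact: negligible_set0.
have [mx px] := hX x; exists (X @^-1` [set x]); split => //.
rewrite [LHS]px; have -> : A x = false by apply/negbTE/negP => Ax; exact: (AE x).
by rewrite mul0r.
Qed.

Lemma uniform_ae : {ae P, forall w, A (X w)}.
Proof.
exists (X @^-1` [set x | ~ A x]); split => //; first exact: uniform_measurable.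
by apply: uniform_null => x Ax nA; exact: nA.
Qed.

Lemma uniform_expectation (f : U -> R) :
  ('E_P[f \o X] = ((\sum_(x | A x) f x) / #|A|%:R)%:E)%E.
Proof.
have bI x : bounded_measurable (\1_(X @^-1` [set x]) : T -> R).
  by apply: bm_indic; exact: uniform_measurable.
have fE : f \o X = fun w => \sum_(x <- enum U) f x * \1_(X @^-1` [set x]) w.
  apply/funext => w; rewrite big_enum /= (bigD1 (X w))//= indicE mem_set// mulr1 big1 ?addr0//.
  by move=> x xw; rewrite indicE memNset ?mulr0// => /= E; rewrite E eqxx in xw.
have bf : bounded_measurable (f \o X) by rewrite fE; apply: bm_sum => x; exact: bmZ.
rewrite unlock exE//; congr EFin; rewrite fE ex_sum; last by move=> x; exact: bmZ.
rewrite big_enum /= mulr_suml [RHS]big_mkcond /=; apply: eq_bigr => x _.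
rewrite exZ// ex_indic; last exact: uniform_measurable.
rewrite /pr (hX x).2 /=; case: (A x); first by rewrite mul1r.
by rewrite mul0r mulr0.
Qed.

End UniformVariable.

(** * Lower limits for functionals of the lamination process *)

Section WordLimit.
Variable R : realType.
Notation path := (R -> set R[i]%C).

Definition word_process (N : nat) (w : seq bool) : path :=
  @factorisation_process R N.+1 (factorisation_of N w).

Lemma word_process_close g eps : good_path g -> 0 < eps ->
  exists2 d0 : R, 0 < d0 & exists N0 : nat, forall N w, (N0 <= N)%N -> size w = N.*2 -> dyck w ->
    sup_close g (wpath w) d0 -> skorokhod_dist (lamination_of g) (word_process N w) <= eps.
Proof.
move=> gg e0; have [eg _] := gg; have [delta1 d10 hd1] := adapted_skorokhod gg e0.
have pi0 : 0 < pi :> R := pi_gt0 R.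
pose x : R := eps / (16 * pi); have x0 : 0 < x by rewrite divr_gt0// mulr_gt0.
have xE : 4 * pi * (x + x) <= eps / 2.
  rewrite le_eqVlt; apply/orP; left; apply/eqP; rewrite /x.
  have aux (p : R) : p != 0 -> 4 * p * (eps / (16 * p) + eps / (16 * p)) = eps / 2 by move=> pn; field.
  by rewrite aux// lt0r_neq0.
clearbody x; pose delta : R := Num.min delta1 x.
have d0 : 0 < delta by rewrite lt_min d10.
have dx : delta <= x by rewrite ge_min lexx orbT.
have dd : delta <= delta1 by rewrite ge_min lexx.
have [d2 d20 [N1 hN1]] := word_cords_adapted eg d0.
have [N2 hN2] := natSinv_le x0.
exists d2 => //; exists (maxn 1 (maxn N1 N2)) => N w; rewrite !geq_max => /and3P[N0 N1N N2N] sw dw cl.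
have ad := hN1 N w N1N sw dw cl.
apply: (hd1 (@word_cords R N w)); first exact: adaptedW dd ad.
move=> t t01; have [h1 h2] := factorisation_process_close N0 sw dw ad t01; split => //.
apply: thickeningW h2; apply: le_trans xE.
by rewrite ler_pM2l ?mulr_gt0//; apply: lerD => //; exact: hN2.
Qed.

Context (d : measure_display) (T : measurableType d) (P : probability T R).
Variable e : T -> R -> R.
Hypothesis he : brownian_excursion P e.
Variable G : set T.
Hypotheses (mG : measurable G) (PG : P G = 1%E) (GG : forall w, G w -> good_path (e w)).

Let Y := regular_lamination e G.

Section Functional.
Variable F : path -> R.
Hypothesis cF : bounded_continuous (@is_cadlag R) (@skorokhod_dist R) F.
Hypothesis F01 : forall y, is_cadlag y -> 0 <= F y <= 1.

(** The infimum of these is a Pasch-Hausdorff envelope of [F], sampled only at discrete laminations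
    of index at least [N]: moving away from the path of the word costs [N] per unit of capped
    distance. *)
Let penalised (N : nat) : set ((R -> R) -> R) := [set a | exists n w,
  [/\ (N <= n)%N, (0 < n)%N, size w = n.*2, dyck w &
      a = fun g => Num.min 1 (F (word_process n w) + N%:R * capped_dist (wpath w) g)]].

Let word_process01 n w : (0 < n)%N -> size w = n.*2 -> dyck w -> 0 <= F (word_process n w) <= 1.
Proof. by move=> n0 sw dw; apply: F01; exact: factorisation_process_cadlag. Qed.

Let penalised_lip N a : penalised N a -> lip N%:R a.
Proof.
move=> [n [w [_ n0 sw dw ->]]] f g c fg.
have := capped_dist_lip (wpath w) fg; rewrite mul1r.
set x := capped_dist _ f; set y := capped_dist _ g; set z := F _ => h.
have c0 : 0 <= c by exact: le_trans h.
have k : `|N%:R * x - N%:R * y| <= N%:R * c by rewrite -mulrBr normrM ger0_norm// ler_wpM2l.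
have Nc : 0 <= N%:R * c by rewrite mulr_ge0.
move: k Nc; move: (N%:R * x) (N%:R * y) (N%:R * c) => p q r.
rewrite !ler_norml => /andP[k1 k2] r0.
have aux (p' q' : R) : p' <= q' + r -> Num.min 1 (z + p') <= Num.min 1 (z + q') + r.
  by move=> pq; rewrite addr_minl le_min !ge_min; apply/andP; split; apply/orP; [left|right]; lra.
by have h1 := aux p q ltac:(lra); have h2 := aux q p ltac:(lra); apply/andP; split; lra.
Qed.

Let penalised_unit N a : penalised N a -> unit_valued a.
Proof.
move=> [n [w [_ n0 sw dw ->]]] g; rewrite ge_min lexx /= andbT le_min ler01 /=.
have /andP[h _] := word_process01 n0 sw dw.
by rewrite addr_ge0// mulr_ge0//; have /andP[] := capped_dist_unit (wpath w) g.
Qed.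

(* [lower N] is [N]-Lipschitz in the path, at most [F] on long Dyck words, and
   in the limit at least [F] of the lamination at every good path: it replaces
   [F], which is only continuous at good paths. *)
Let lower N := inf_functional (penalised N).

Let lower_lip N : lip N%:R (lower N).
Proof. exact: (inf_functional_lip (ler0n R N) (@penalised_lip N) (@penalised_unit N)). Qed.

Let lower_unit N : unit_valued (lower N).
Proof. exact: (inf_functional_unit (@penalised_unit N)). Qed.

Let lower_le N n w : (N <= n)%N -> (0 < n)%N -> size w = n.*2 -> dyck w ->
  lower N (wpath w) <= F (word_process n w).
Proof.
move=> Nn n0 sw dw.
apply: le_trans (inf_functional_le (@penalised_unit N) (wpath w) _) _.
  by exists n, w; split.
by rewrite /= capped_distxx mulr0 addr0 ge_min lexx orbT.
Qed.

(** Words whose path is close to [g] have a lamination process close to that of [g], hence nearly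
    the same value of [F]; for the others the penalty alone reaches 1 once [N] is large. *)
Let lower_ge g eps : good_path g -> 0 < eps ->
  exists N0 : nat, forall N, (N0 <= N)%N -> F (lamination_of g) - eps <= lower N g.
Proof.
move=> gg e0; have Lg := lamination_of_cadlag gg; have /andP[Fg0 Fg1] := F01 Lg.
have [delta d0 hd] := cF.2 _ Lg eps e0.
have [d1 d10 [N1 hN1]] := word_process_close gg (eps := delta / 2) ltac:(by rewrite divr_gt0).
have m0 : 0 < Num.min 1 d1 by rewrite lt_min ltr01.
exists (maxn N1 (Num.truncn (Num.min 1 d1)^-1).+1) => N; rewrite geq_max => /andP[N1N NN].
apply: inf_functional_ge; first by lra.
move=> a [n [w [Nn n0 sw dw ->]]]; rewrite le_min; apply/andP; split; first by lra.
have /andP[f0 f1] := word_process01 n0 sw dw.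
have /andP[c0 c1] := capped_dist_unit (wpath w) g.
have [lt|ge] := ltP (capped_dist (wpath w) g) (Num.min 1 d1).
  have cl := capped_dist_close lt.
  have sk := hN1 n w (leq_trans N1N Nn) sw dw cl.
  have := hd (word_process n w) (factorisation_process_cadlag R n0 sw dw) ltac:(by apply: le_lt_trans sk _; rewrite ltr_pdivrMr// ltr_pMr// ltr1n).
  have : 0 <= N%:R * capped_dist (wpath w) g by rewrite mulr_ge0.
  by rewrite ltr_norml => k /andP[_]; lra.
have : 1 <= N%:R * capped_dist (wpath w) g.
  apply: (@le_trans _ _ (N%:R * Num.min 1 d1)); last by rewrite ler_wpM2l.
  rewrite -ler_pdivrMr// div1r; apply: (@le_trans _ _ (Num.truncn (Num.min 1 d1)^-1).+1%:R).
    exact/ltW/truncnS_gt.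
  by rewrite ler_nat.
by lra.
Qed.

Lemma lamination_liminf eps : 0 < eps -> exists N0 : nat, forall N, (N0 <= N)%N ->
  ex P (fun w => F (Y w)) - eps <=
  dyck_mean N (fun w => F (word_process N w)) / mean N.*2 (fun w => (dyck w)%:R).
Proof.
move=> e0; have e2 : 0 < eps / 2 by rewrite divr_gt0.
have bF : bounded_measurable (fun w => F (Y w)).
  by apply: (bounded_continuous_measurable (regular_lamination_version he mG PG GG).1 cF).
have FY w : 0 <= F (Y w) <= 1 by apply: F01; exact: regular_lamination_cadlag.
have bL N := bm_excursion he (@lower_lip N) (@lower_unit N).
pose Z (N : nat) w : R := \1_G w * Num.max 0 (F (Y w) - lower N (e w)).
have Z01 N w : 0 <= Z N w <= 1.
  have /andP[a0 a1] := FY w; have /andP[b0 b1] := lower_unit N (e w).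
  rewrite /Z indicE; case: (w \in G); rewrite ?mul1r ?mul0r ?lexx ?ler01//.
  by rewrite le_max lexx ge_max ler01 /=; lra.
have bZ N : bounded_measurable (Z N).
  split; last by exists 1 => w; rewrite ger0_norm; have /andP[] := Z01 N w.
  apply: measurable_funM; first exact: measurable_indic.
  apply: measurable_maxr; first exact: measurable_cst.
  by apply: measurable_funB; [exact: bF.1|exact: (bL N).1].
have [] := @ex_cvg0 _ _ _ P Z 1 (fun N => (bZ N).1) _ _ (eps / 2) e2.
- move=> w eps' e'0; rewrite /Z indicE; case: (boolP (w \in G)) => [|_]; last first.
    by exists 0%N => n _; rewrite mul0r normr0 ltW.
  rewrite inE => Gw; have [N0 hN0] := lower_ge (GG Gw) e'0; exists N0 => N /hN0.
  rewrite /Y /regular_lamination; case: asboolP => // _ h.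
  by rewrite mul1r ger0_norm ?le_max ?lexx// ge_max (ltW e'0) /=; lra.
- by move=> N w; rewrite ger0_norm; have /andP[] := Z01 N w.
move=> N1 hN1; have [N2 hN2] := excursion_liminf he (@lower_lip N1) (@lower_unit N1) e2.
exists (maxn 1 (maxn N1 N2)) => N; rewrite !geq_max => /and3P[N0 N1N N2N].
have n0 : 0 < N.*2%:R :> R by rewrite ltr0n double_gt0.
have s0 : 0 < Num.sqrt N.*2%:R :> R by rewrite sqrtr_gt0.
have lb := @dyck_lb R N _ N0 s0 (sqr_sqrtr (ltW n0)).
have m0 : 0 < mean N.*2 (fun w => (dyck w)%:R) :> R.
  by apply: lt_le_trans lb; rewrite divr_gt0// invr_gt0 exprn_gt0.
rewrite ler_pdivlMr//.
apply: (@le_trans _ _ ((ex P (fun w => lower N1 (e w)) - eps / 2) * mean N.*2 (fun w => (dyck w)%:R))).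
  rewrite ler_pM2r// lerBlDr.
  have bC : bounded_measurable (\1_(~` G) : T -> R) by apply: bm_indic; exact: measurableC.
  have -> : ex P (fun w => lower N1 (e w)) - eps / 2 + eps = ex P (fun w => lower N1 (e w)) + eps / 2 by lra.
  apply: (@le_trans _ _ (ex P (fun w => (lower N1 (e w) + Z N1 w) + \1_(~` G) w))).
    apply: le_ex => //; first by apply: bmD => //; apply: bmD.
    move=> w; have /andP[a0 a1] := FY w; have /andP[b0 b1] := lower_unit N1 (e w).
    rewrite /Z !indicE in_setC; case: (w \in G); rewrite ?mul1r ?mul0r /=.
      by have : F (Y w) - lower N1 (e w) <= Num.max 0 (F (Y w) - lower N1 (e w)) by [rewrite le_max lexx orbT]; lra.
    by lra.
  rewrite exD//; last exact: bmD.
  rewrite exD// ex_indic; last exact: measurableC.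
  rewrite /pr probability_setC// PG subee// /= addr0 lerD2l.
  by apply: le_trans (hN1 N1 (leqnn _)); exact: ler_norm.
apply: le_trans (hN2 N N2N) _; apply: le_mean => w sw.
case: (boolP (dyck w)) => dw; last by rewrite !mul0r.
by rewrite !mul1r; exact: lower_le.
Qed.

End Functional.
End WordLimit.

(** * Convergence of the expectations *)

Section Convergence.
Variable R : realType.
Notation path := (R -> set R[i]%C).
Context (d : measure_display) (T : measurableType d) (P : probability T R).
Variable e : T -> R -> R.
Hypothesis he : brownian_excursion P e.
Variable G : set T.
Hypotheses (mG : measurable G) (PG : P G = 1%E) (GG : forall w, G w -> good_path (e w)).
Variable F : path -> R.
Hypothesis cF : bounded_continuous (@is_cadlag R) (@skorokhod_dist R) F.

Let mass (N : nat) : R := mean N.*2 (fun w => (dyck w)%:R).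
Let average (N : nat) : R := dyck_mean N (fun w => F (word_process N w)) / mass N.

Let mass_gt0 N : (0 < N)%N -> 0 < mass N.
Proof.
move=> N0; have n0 : 0 < N.*2%:R :> R by rewrite ltr0n double_gt0.
have s0 : 0 < Num.sqrt N.*2%:R :> R by rewrite sqrtr_gt0.
apply: lt_le_trans (dyck_lb N0 s0 (sqr_sqrtr (ltW n0))).
by rewrite divr_gt0// invr_gt0 exprn_gt0.
Qed.

(** The functional [c * F + 1 / 2] takes values in [[0, 1]]; both signs of [c] together turn the
    lower bound into a limit. *)
Lemma scaled_liminf (c eps : R) : (forall y, is_cadlag y -> `|c * F y| <= 1 / 2) -> 0 < eps ->
  exists N0 : nat, forall N, (N0 <= N)%N ->
    c * (ex P (fun w => F (regular_lamination e G w)) - average N) <= eps.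
Proof.
move=> hc e0; pose F' y := c * F y + 1 / 2.
have F'01 y : is_cadlag y -> 0 <= F' y <= 1.
  by move=> /hc; rewrite ler_norml /F' => /andP[h1 h2]; apply/andP; split; lra.
have cF' : bounded_continuous (@is_cadlag R) (@skorokhod_dist R) F'.
  split; first by exists 1 => y /F'01/andP[h1 h2]; rewrite ger0_norm.
  move=> x Sx eps' e'0; have c1 : 0 < `|c| + 1 by rewrite ltr_wpDl.
  have [delta d0 hd] := cF.2 x Sx (eps' / (`|c| + 1)) ltac:(by rewrite divr_gt0).
  exists delta => // y Sy xy; have := hd y Sy xy; rewrite ltr_pdivlMr// => h.
  have -> : F' x - F' y = c * (F x - F y) by rewrite /F'; ring.
  rewrite normrM; apply: le_lt_trans h; rewrite mulrDr mulr1 mulrC lerDl.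
  exact: normr_ge0.
have bF : bounded_measurable (fun w => F (regular_lamination e G w)).
  by apply: (bounded_continuous_measurable (regular_lamination_version he mG PG GG).1 cF).
have [N0 hN0] := lamination_liminf he mG PG GG cF' F'01 e0.
exists (maxn 1 N0) => N; rewrite geq_max => /andP[N1 NN]; have := hN0 N NN.
rewrite /F' exD; [|exact: bmZ|exact: bm_cst]; rewrite exZ// ex_cst.
have -> : dyck_mean N (fun w => c * F (word_process N w) + 1 / 2) =
    c * dyck_mean N (fun w => F (word_process N w)) + 1 / 2 * mass N.
  by rewrite /dyck_mean /mass -!meanZ -meanD; apply: eq_mean => w _; ring.
rewrite mulrDl mulfK ?lt0r_neq0 ?mass_gt0// -mulrA -/(average N) mulrBr.
by lra.
Qed.

Lemma average_cvg : average N.+1 @[N --> \oo] --> ex P (fun w => F (regular_lamination e G w)).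
Proof.
have [M hM] := cF.1; pose K : R := `|M| + 1; have K0 : 0 < K by rewrite ltr_wpDl.
have bound c y : `|c| = (2 * K)^-1 -> is_cadlag y -> `|c * F y| <= 1 / 2.
  move=> cE /hM FM; rewrite normrM cE ler_pdivrMl ?mulr_gt0//.
  have -> : 2 * K * (1 / 2) = K by field.
  by apply: le_trans FM _; apply: le_trans (ler_norm M) _; rewrite lerDl.
have i0 : 0 < (2 * K)^-1 by rewrite invr_gt0 mulr_gt0.
apply/cvgrPdist_le => eps e0; pose eps' : R := (2 * K)^-1 * eps.
have e'0 : 0 < eps' by rewrite mulr_gt0.
have [N1 hN1] := scaled_liminf (fun y => bound (2 * K)^-1 y (gtr0_norm i0)) e'0.
have [N2 hN2] := scaled_liminf (fun y => bound (- (2 * K)^-1) y (etrans (normrN _) (gtr0_norm i0))) e'0.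
exists (maxn N1 N2) => // N /=; rewrite geq_max => /andP[h1 h2].
have := hN1 N.+1 (leqW h1); have := hN2 N.+1 (leqW h2).
rewrite mulNr -mulrN /eps' !ler_pM2l// => k2 k1.
by rewrite ler_norml; apply/andP; split; lra.
Qed.

End Convergence.

(** * The uniform factorisation as a random element *)

Section FactorisationVersion.
Context (d : measure_display) (T : measurableType d) (R : realType) (P : probability T R).
Variables (n : nat) (tau : T -> (n.+1).-tuple ('I_n.+2 * 'I_n.+2)).
Hypothesis htau : uniform_on P (@decreasing_factorisation n.+2) tau.

Definition regular_process (t : (n.+1).-tuple ('I_n.+2 * 'I_n.+2)) : R -> set R[i]%C :=
  if @decreasing_factorisation n.+2 t then @factorisation_process R n.+2 t else fun=> cord 0 0.

Lemma regular_process_version : ae_version (@is_cadlag R) (@skorokhod_dist R) P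
  (fun w => @factorisation_process R n.+2 (tau w)) (fun w => regular_process (tau w)).
Proof.
split.
  apply: random_element_open.
    move=> w; rewrite /regular_process; case: ifPn => [dt|_]; last exact: cst_cadlag (point_lamination R).
    have [v [sv dv <-]] := factorisation_of_surj dt.
    exact: factorisation_process_cadlag.
  by move=> V _; exact: (uniform_measurable htau [set t | V (regular_process t)]).
by apply: filterS (uniform_ae htau) => w dw; rewrite /regular_process dw.
Qed.

Lemma regular_process_expectation (F : (R -> set R[i]%C) -> R) :
  ('E_P[F \o (fun w => regular_process (tau w))] =
   (dyck_mean n.+1 (fun w => F (word_process n.+1 w)) / mean n.+1.*2 (fun w => (dyck w)%:R))%:E)%E.
Proof.
have := uniform_expectation htau (fun t => F (regular_process t)) => E.
rewrite -[LHS]/('E_P[(fun t => F (regular_process t)) \o tau])%E E; congr EFin.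
rewrite -(dyck_average (fun t => F (@factorisation_process R n.+2 t))); congr (_ / _).
by apply: eq_bigr => t dt; rewrite /regular_process dt.
Qed.

End FactorisationVersion.

Theorem theorem4 (R : realType)
  (d_ : nat -> measure_display) (T_ : forall n : nat, measurableType (d_ n))
  (P_ : forall n : nat, probability (T_ n) R)
  (tau : forall n : nat, T_ n -> (n.+1).-tuple ('I_n.+2 * 'I_n.+2))
  (htau : forall n : nat,
     uniform_on (P_ n) (@decreasing_factorisation n.+2) (tau n))
  (d : measure_display) (T : measurableType d) (P : probability T R)
  (e : T -> R -> R) (he : brownian_excursion P e) :
  cvg_in_distribution (@is_cadlag R) (@skorokhod_dist R)
    P_ (fun n w => @factorisation_process R n.+2 (tau n w))
    P (fun w => lamination_of (e w)).
Proof.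
have [G [mG PG GG]] := excursion_good he.
exists (fun n w => @regular_process R n (tau n w)), (regular_lamination e G); split.
- by move=> n; exact: regular_process_version.
- exact: regular_lamination_version.
move=> F cF; have := average_cvg he mG PG GG cF.
have bF := bounded_continuous_measurable (regular_lamination_version he mG PG GG).1 cF.
rewrite [X in _ -> _ --> X](_ : _ = (ex P (fun w => F (regular_lamination e G w)))%:E); last first.
  by rewrite unlock -exE.
move=> h; apply: cvg_EFin; first by apply: nearW => n; rewrite regular_process_expectation.
apply: cvg_trans h; apply: near_eq_cvg; apply: nearW => n.
by rewrite [RHS]/= regular_process_expectation.
Qed.
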